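(* Fix $\omega\in(0,1)$ and assume the setting and hypotheses described in the context. Let $\lambda_1\ge\dots\ge\lambda_K$ be the nontrivial eigenvalues of $X^*X$ and let $\gamma_1\ge\dots\ge\gamma_K$ be the classical locations defined by $\int_{\gamma_\alpha}^\infty\varrho_\phi(\mathrm dx)=\alpha/N$. Then $$|\lambda_\alpha-\gamma_\alpha|\prec\alpha^{-1/3}K^{-2/3}$$ uniformly for $\alpha\in\{1,\dots,\lfloor(1-\omega)K\rfloor\}$. If in addition $|\phi-1|\ge c$ for some constant $c>0$, then $$|\lambda_\alpha-\gamma_\alpha|\prec(K+1-\alpha)^{-1/3}K^{-2/3}$$ uniformly for $\alpha\in\{\lfloor K/2\rfloor,\dots,K\}$.
   Context: Let $N\in\mathbb N$ and let $M=M_N$ satisfy $N^{1/C}\le M\le N^{C}$ for a fixed constant $C>0$. Let $X$ be an $M\times N$ random matrix whose entries $X_{i\mu}$ are independent complex random variables with $\mathbb E X_{i\mu}=0$, $\mathbb E|X_{i\mu}|^2=(NM)^{-1/2}$, and such that for every $p\in\mathbb N$ there is a constant $C_p$ with $\mathbb E|(NM)^{1/4}X_{i\mu}|^p\le C_p$ for all $N,i,\mu$. Set $\phi=M/N$, $K=\min\{M,N\}$ and $\gamma_\pm=\sqrt\phi+1/\sqrt\phi\pm2$. The Marchenko–Pastur law is $\varrho_\phi(\mathrm dx)=\frac{\sqrt\phi}{2\pi}\frac{\sqrt{[(x-\gamma_-)(\gamma_+-x)]_+}}{x}\,\mathrm dx+(1-\phi)_+\delta_0(\mathrm dx)$. Stochastic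 domination: for families of nonnegative random variables $\xi=(\xi^{(N)}(u))$, $\zeta=(\zeta^{(N)}(u))$, we write $\xi\prec\zeta$ (uniformly in $u$) if for every $\varepsilon>0$, $D>0$, $\sup_u\mathbb P[\xi^{(N)}(u)>N^\varepsilon\zeta^{(N)}(u)]\le N^{-D}$ for $N\ge N_0(\varepsilon,D)$, with $N_0$ depending only on the constants in the hypotheses (including $\omega,c$). *)

(* Defs.v *)
From HB Require Import structures.
From mathcomp Require Import all_boot all_order all_algebra.
From mathcomp Require Import all_classical all_reals all_analysis.
From mathcomp Require Import complex.
Set Implicit Arguments. Unset Strict Implicit. Unset Printing Implicit Defensive.
Import Order.TTheory GRing.Theory Num.Theory.
Import numFieldNormedType.Exports.
Local Open Scope classical_set_scope.
Local Open Scope ring_scope.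

Definition mp_gamma_plus (R : realType) (phi : R) : R :=
  Num.sqrt phi + (Num.sqrt phi)^-1 + 2.
Definition mp_gamma_minus (R : realType) (phi : R) : R :=
  Num.sqrt phi + (Num.sqrt phi)^-1 - 2.

Definition mp_density (R : realType) (phi : R) (x : R) : R :=
  Num.sqrt phi / (2 * pi) *
  (Num.sqrt (Num.max 0 ((x - mp_gamma_minus phi) * (mp_gamma_plus phi - x))) / x).

(* rho_phi([t, +oo)) : absolutely continuous part plus the atom
   (1 - phi)_+ delta_0 *)
Definition mp_tail (R : realType) (phi : R) (t : R) : R :=
  Rintegral lebesgue_measure `[t, +oo[%classic (mp_density phi)
  + (if t <= 0 then Num.max 0 (1 - phi) else 0).

(* classical location gamma_alpha, defined by
   int_{gamma_alpha}^oo rho_phi(dx) = alpha / N; we take the largest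
   such point (the supremum of {t | rho_phi([t,oo)) >= alpha/N}), which
   is the unique solution except in degenerate endpoint cases. *)
Definition classical_location (R : realType) (N : nat) (phi : R) (alpha : nat) : R :=
  sup [set t : R | alpha%:R / N%:R <= mp_tail phi t].

(* lam 1 >= ... >= lam K are the K nontrivial eigenvalues of the N x N
   matrix A, whose remaining N - K eigenvalues are 0: the characteristic
   polynomial factors as X^(N-K) * prod_{a=1}^K (X - lam a). *)
Definition nontrivial_spectrum (R : realType) (N K : nat) (A : 'M[R[i]]_N)
    (lam : nat -> R) : Prop :=
  char_poly A = 'X^(N - K) * \prod_(1 <= a < K.+1) ('X - ((lam a)%:C)%C%:P)
  /\ (forall a b : nat, (1 <= a)%N -> (a <= b)%N -> (b <= K)%N -> lam b <= lam a).

Definition cmatrix (R : realType) (T : Type) (M N : nat)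
    (Xre Xim : 'I_M -> 'I_N -> T -> R) (x : T) : 'M[R[i]]_(M, N) :=
  \matrix_(i < M, j < N) ((Xre i j x) +i* (Xim i j x))%C.

Definition gram (R : realType) (M N : nat) (A : 'M[R[i]]_(M, N)) : 'M[R[i]]_N :=
  (map_mx (@conjc R) A)^T *m A.

(* mutual independence of a finite family of R^2-valued random variables
   (a complex random variable is encoded by its real and imaginary parts) *)
Definition mutually_independent (R : realType) (d : measure_display)
    (T : measurableType d) (P : probability T R) (I : finType)
    (Y : I -> T -> (R * R)%type) : Prop :=
  forall (J : {set I}) (B : I -> set (R * R)%type),
    (forall i, measurable (B i)) ->
    P (\bigcap_(i in [set j | j \in J]) (Y i @^-1` B i)) =
    (\prod_(i in J) P (Y i @^-1` B i))%E.

Definition entry_hypotheses (R : realType) (Cp : nat -> R) (M N : nat)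
    (d : measure_display) (T : measurableType d) (P : probability T R)
    (Xre Xim : 'I_M -> 'I_N -> T -> R) : Prop :=
  [/\ (forall i j, measurable_fun setT (Xre i j) /\ measurable_fun setT (Xim i j)),
      mutually_independent P
        (fun ij : 'I_M * 'I_N => fun x => (Xre ij.1 ij.2 x, Xim ij.1 ij.2 x)),
      (forall i j, (\int[P]_x (Xre i j x)%:E = 0)%E /\ (\int[P]_x (Xim i j x)%:E = 0)%E),
      (forall i j, (\int[P]_x ((Xre i j x) ^+ 2 + (Xim i j x) ^+ 2)%:E
                    = ((Num.sqrt (N%:R * M%:R))^-1)%:E)%E)
    &
      (forall (p : nat) i j,
        (\int[P]_x ((Num.sqrt (Num.sqrt (N%:R * M%:R))
                     * Num.sqrt ((Xre i j x) ^+ 2 + (Xim i j x) ^+ 2)) ^+ p)%:E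
          <= (Cp p)%:E)%E)].

(* Main.v *)
Require Import Defs.
From HB Require Import structures.
From mathcomp Require Import all_boot all_order all_algebra.
From mathcomp Require Import all_classical all_reals all_analysis.
From mathcomp Require Import complex measurable_realfun.
From mathcomp Require Import ring lra zify.
Import Order.TTheory GRing.Theory Num.Theory.
Import numFieldNormedType.Exports.
Set Implicit Arguments. Unset Strict Implicit. Unset Printing Implicit Defensive.
Local Open Scope classical_set_scope.
Local Open Scope ring_scope.

(* Let s be the square root of the aspect ratio and recentre the eigenvalues by s + 1/s, so that the
   limiting spectrum is [-2, 2].  With u the Stieltjes transform of the semicircle law, m = u / (1 - s u)
   is the Stieltjes transform of the recentred limit law and a root of
   P(v) = 1 + (w + 2 s) v + a v^2, where a = 1 + s w + s^2.

   Removing one column at a time by the Sherman-Morrison formula writes P(m_N) as an average of centred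
   quadratic forms divided by quantities that do not depend on the removed column, plus a small error.
   High moments of P(m_N), cut off to the event |m_N - m| <= l, satisfy a recursion: the expectation in
   one column vanishes as soon as the other factors are replaced by their versions without that column,
   and the replacement costs a factor 1/(N eta).  Since P(m_N) = Lam (a Lam + rho) with Lam = m_N - m,
   descending along a vertical line from large Im w propagates the smallness of Lam.

   Outside [-2, 2] the bound on Im m_N beats 1/(N eta), so that there is no eigenvalue.  Inside,
   integrating Re m_N along the vertical line compares a sum of arctangents, hence the eigenvalue counting
   function, with the explicit distribution function of the limit law up to an error N^eps / N.  The
   square-root behaviour of its density at a soft edge turns this into the rigidity of the eigenvalues.

   The argument is run for entries taking finitely many values.  A general matrix is the pointwise limit
   of rounded, centred and rescaled ones, whose eigenvalues converge by Weyl's inequality.  If M < N, the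
   matrix is transposed.  The number G plays the role of N^eps throughout. *)

(** Write rho for the square root of w^2 - 4. Since Im m is at most a constant times |rho|, the
    moment bound on P(m_N) is of order |rho| / (N eta); dividing by |rho| in the factorization of P
    then loses nothing, and the bound on Lam stays of order 1/(N eta) up to the edge. Outside the
    spectrum Im m is of order eta / |rho|, and the same bound gives an error far below 1/(N eta).
    The division is legitimate only while the distance to the edge dominates a power of G times
    (1/(N eta))^2; the window left over near an edge is narrower than the error allowed there. All
    bounds have to be uniform in an aspect ratio that may be polynomially large. Hence the
    recentring, the weight L = 1 + |w| recording the decay for large spectral parameters, and the
    parameter tt, which keeps away either from the hard edge or from aspect ratio 1. Finite value
    sets turn independence into a rearrangement of finite sums, so that measurability plays no part
    in the moment argument. The powers of G are chosen with room to spare. *)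

Notation nrm := Normc.normc.

(** * Real parts, imaginary parts and moduli of complex numbers *)

Section ComplexModulus.
Variable R : realType.
Implicit Types (x y z : R[i]) (a b : R).
Local Open Scope complex_scope.

Lemma cReD x y : complex.Re (x + y) = complex.Re x + complex.Re y.
Proof. by case: x y => [a b] [c d]. Qed.
Lemma cImD x y : complex.Im (x + y) = complex.Im x + complex.Im y.
Proof. by case: x y => [a b] [c d]. Qed.
Lemma cReN x : complex.Re (- x) = - complex.Re x.
Proof. by case: x. Qed.
Lemma cImN x : complex.Im (- x) = - complex.Im x.
Proof. by case: x. Qed.
Lemma cReB x y : complex.Re (x - y) = complex.Re x - complex.Re y.
Proof. by rewrite cReD cReN. Qed.
Lemma cImB x y : complex.Im (x - y) = complex.Im x - complex.Im y.
Proof. by rewrite cImD cImN. Qed.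
Lemma cReM x y : complex.Re (x * y) =
  complex.Re x * complex.Re y - complex.Im x * complex.Im y.
Proof. by case: x y => [a b] [c d]. Qed.
Lemma cImM x y : complex.Im (x * y) =
  complex.Re x * complex.Im y + complex.Im x * complex.Re y.
Proof. by case: x y => [a b] [c d]. Qed.
Lemma cReR a : complex.Re a%:C = a. Proof. by []. Qed.
Lemma cImR a : complex.Im a%:C = 0. Proof. by []. Qed.
Lemma cReJ x : complex.Re (x^*) = complex.Re x. Proof. by case: x. Qed.
Lemma cImJ x : complex.Im (x^*) = - complex.Im x. Proof. by case: x. Qed.
Lemma cRe_sum (I : Type) (r : seq I) (P : pred I) (F : I -> R[i]) :
  complex.Re (\sum_(i <- r | P i) F i) = \sum_(i <- r | P i) complex.Re (F i).
Proof. by elim/big_rec2: _ => // i y1 y2 _ <-; rewrite cReD. Qed.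
Lemma cIm_sum (I : Type) (r : seq I) (P : pred I) (F : I -> R[i]) :
  complex.Im (\sum_(i <- r | P i) F i) = \sum_(i <- r | P i) complex.Im (F i).
Proof. by elim/big_rec2: _ => // i y1 y2 _ <-; rewrite cImD. Qed.
Lemma cReZ a x : complex.Re (a%:C * x) = a * complex.Re x.
Proof. by rewrite cReM /= mul0r subr0. Qed.
Lemma cImZ a x : complex.Im (a%:C * x) = a * complex.Im x.
Proof. by rewrite cImM /= mul0r addr0. Qed.

Lemma nrmE x : nrm x = Num.sqrt (complex.Re x ^+ 2 + complex.Im x ^+ 2).
Proof. by case: x. Qed.
Lemma nrm_ge0 x : 0 <= nrm x.
Proof. by rewrite nrmE sqrtr_ge0. Qed.
Lemma nrm_sqr x : nrm x ^+ 2 = complex.Re x ^+ 2 + complex.Im x ^+ 2.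
Proof. by rewrite nrmE sqr_sqrtr // addr_ge0 // sqr_ge0. Qed.
Lemma nrmD x y : nrm (x + y) <= nrm x + nrm y.
Proof. exact: le_normcD. Qed.
Lemma nrmN x : nrm (- x) = nrm x.
Proof. exact: normcN. Qed.
Lemma nrmB x y : nrm (x - y) <= nrm x + nrm y.
Proof. by rewrite -(nrmN y) nrmD. Qed.
Lemma nrmBC x y : nrm (x - y) = nrm (y - x).
Proof. by rewrite -nrmN opprB. Qed.
Lemma nrmM x y : nrm (x * y) = nrm x * nrm y.
Proof. exact: Normc.normcM. Qed.
Lemma nrmV x : nrm x^-1 = (nrm x)^-1.
Proof. exact: Normc.normcV. Qed.
Lemma nrm0 : nrm (0 : R[i]) = 0. Proof. exact: Normc.normc0. Qed.
Lemma nrm1 : nrm (1 : R[i]) = 1. Proof. exact: Normc.normc1. Qed.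
Lemma nrmX x n : nrm (x ^+ n) = nrm x ^+ n.
Proof. by elim: n => [|n IH]; rewrite ?expr0 ?nrm1 // !exprS nrmM IH. Qed.
Lemma nrm_eq0 x : (nrm x == 0) = (x == 0).
Proof. by apply/eqP/eqP => [/Normc.eq0_normc|->]; rewrite ?nrm0. Qed.
Lemma nrm_gt0 x : (0 < nrm x) = (x != 0).
Proof. by rewrite lt0r nrm_ge0 andbT nrm_eq0. Qed.
Lemma nrmR a : nrm (a%:C) = `|a|.
Proof. by rewrite nrmE /= expr0n addr0 sqrtr_sqr. Qed.
Lemma nrmJ x : nrm (x^*) = nrm x.
Proof. by rewrite !nrmE cReJ cImJ sqrrN. Qed.
Lemma nrm_sum (I : Type) (r : seq I) (P : pred I) (F : I -> R[i]) :
  nrm (\sum_(i <- r | P i) F i) <= \sum_(i <- r | P i) nrm (F i).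
Proof.
elim/big_rec2: _ => [|i y1 y2 _ H]; first by rewrite nrm0.
by apply: (le_trans (nrmD _ _)); rewrite lerD2l.
Qed.
Lemma le_Re_nrm x : `|complex.Re x| <= nrm x.
Proof.
by rewrite nrmE -sqrtr_sqr ler_wsqrtr // lerDl sqr_ge0.
Qed.
Lemma le_Im_nrm x : `|complex.Im x| <= nrm x.
Proof.
by rewrite nrmE -sqrtr_sqr ler_wsqrtr // lerDr sqr_ge0.
Qed.
Lemma Re_le_nrm x : complex.Re x <= nrm x.
Proof. exact: le_trans (ler_norm _) (le_Re_nrm x). Qed.
Lemma Im_le_nrm x : complex.Im x <= nrm x.
Proof. exact: le_trans (ler_norm _) (le_Im_nrm x). Qed.
Lemma nrm_le_ReIm x : nrm x <= `|complex.Re x| + `|complex.Im x|.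
Proof.
rewrite -(ler_pXn2r (n := 2)) // ?nnegrE ?nrm_ge0 ?addr_ge0 // nrm_sqr sqrrD.
by rewrite !real_normK ?num_real // lerD2r lerDl mulrn_wge0 // mulr_ge0.
Qed.
Lemma mulJ x : x^* * x = (nrm x ^+ 2)%:C.
Proof.
by case: x => a b; rewrite nrm_sqr /=; apply/eqP; rewrite eq_complex /=; apply/andP; split;
  apply/eqP; ring.
Qed.
Lemma mulcJE x : x * x^* = (nrm x ^+ 2)%:C.
Proof. by rewrite mulrC mulJ. Qed.
Lemma nrmD_ge x y : nrm x - nrm y <= nrm (x + y).
Proof. by rewrite lerBlDr; have := nrmB (x + y) y; rewrite addrK. Qed.
Lemma nrmB_ge x y : nrm x - nrm y <= nrm (x - y).
Proof. by rewrite -(nrmN y) nrmD_ge. Qed.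
Lemma cIm_inv x : complex.Im x^-1 = - complex.Im x / nrm x ^+ 2.
Proof. by rewrite nrm_sqr; case: x => a b /=; rewrite mulNr. Qed.
Lemma cRe_inv x : complex.Re x^-1 = complex.Re x / nrm x ^+ 2.
Proof. by rewrite nrm_sqr; case: x => a b /=. Qed.
Lemma cplx_eq x y : complex.Re x = complex.Re y -> complex.Im x = complex.Im y -> x = y.
Proof. by case: x y => [a b] [c d] /= -> ->. Qed.
Lemma nrm_nat n : nrm (n%:R : R[i]) = n%:R.
Proof.
have -> : (n%:R : R[i]) = (n%:R : R)%:C by rewrite rmorph_nat.
by rewrite nrmR normr_nat.
Qed.
End ComplexModulus.

(** * Finite probability spaces and quadratic forms *)

Section FiniteExpectation.
Variables (R : realType) (T : finType) (w : T -> R).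
Hypothesis w_ge0 : forall t, 0 <= w t.
Implicit Types f g : T -> R.

Definition fE f : R := \sum_t w t * f t.

Lemma fE_ext f g : f =1 g -> fE f = fE g.
Proof. by move=> fg; apply: eq_bigr => t _; rewrite fg. Qed.
Lemma fE_le f g : (forall t, f t <= g t) -> fE f <= fE g.
Proof. by move=> fg; apply: ler_sum => t _; rewrite ler_wpM2l. Qed.
Lemma fE_ge0 f : (forall t, 0 <= f t) -> 0 <= fE f.
Proof. by move=> f0; apply: sumr_ge0 => t _; rewrite mulr_ge0. Qed.
Lemma fED f g : fE (fun t => f t + g t) = fE f + fE g.
Proof. by rewrite /fE -big_split; apply: eq_bigr => t _; rewrite mulrDr. Qed.
Lemma fEZ a f : fE (fun t => a * f t) = a * fE f.
Proof. by rewrite /fE mulr_sumr; apply: eq_bigr => t _; rewrite mulrCA. Qed.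
Lemma fEZr a f : fE (fun t => f t * a) = fE f * a.
Proof. by rewrite /fE mulr_suml; apply: eq_bigr => t _; rewrite mulrA. Qed.
Lemma fE_sum (I : Type) (r : seq I) (P : pred I) (F : I -> T -> R) :
  fE (fun t => \sum_(i <- r | P i) F i t) = \sum_(i <- r | P i) fE (F i).
Proof.
rewrite /fE exchange_big; apply: eq_bigr => t _; rewrite mulr_sumr.
exact: eq_bigr.
Qed.

Definition fP (A : pred T) : R := fE (fun t => (A t)%:R).

Lemma fP_ge0 A : 0 <= fP A.
Proof. by apply: fE_ge0 => t; rewrite ler0n. Qed.
Lemma fP_le (A B : pred T) : (forall t, A t -> B t) -> fP A <= fP B.
Proof.
move=> AB; apply: fE_le => t; case At : (A t); last by rewrite ler0n.
by rewrite (AB _ At).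
Qed.
Lemma fPU (A B : pred T) : fP (fun t => A t || B t) <= fP A + fP B.
Proof.
rewrite -fED; apply: fE_le => t.
by case: (A t); case: (B t) => /=; lra.
Qed.
Lemma fP_has (I : Type) (r : seq I) (F : I -> pred T) :
  fP (fun t => has (F^~ t) r) <= \sum_(i <- r) fP (F i).
Proof.
elim: r => [|i r IH]; first by rewrite big_nil /fP /fE big1 // => t _; rewrite mulr0.
rewrite big_cons; apply: (le_trans (fPU (F i) (fun t => has (F^~ t) r))).
by rewrite lerD2l.
Qed.
Lemma fP_exists (I : finType) (F : I -> pred T) :
  fP (fun t => [exists i, F i t]) <= \sum_i fP (F i).
Proof.
rewrite -fE_sum; apply: fE_le => t.
case: existsP => [[i Fi]|_]; last by rewrite sumr_ge0 // => i _; rewrite ler0n.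
by rewrite (bigD1 i) //= Fi lerDl sumr_ge0 // => j _; rewrite ler0n.
Qed.
Lemma markov_fin f a : 0 < a -> (forall t, 0 <= f t) ->
  fP (fun t => a < f t) <= fE f / a.
Proof.
move=> a0 f0; rewrite ler_pdivlMr // -fEZr; apply: fE_le => t.
by case: ltP => [/ltW|]; rewrite ?mul1r ?mul0r.
Qed.
Lemma fE_const a : \sum_t w t = 1 -> fE (fun _ => a) = a.
Proof. by move=> w1; rewrite /fE -mulr_suml w1 mul1r. Qed.
End FiniteExpectation.

Section ProductSpace.
Variables (R : realType) (I V : finType) (p : I -> V -> R).

Definition pw (o : {ffun I -> V}) : R := \prod_i p i (o i).
Definition upd (o : {ffun I -> V}) i v : {ffun I -> V} :=
  [ffun j => if j == i then v else o j].

Lemma upd_eq o i v : upd o i v i = v.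
Proof. by rewrite ffunE eqxx. Qed.
Lemma upd_neq o i v j : j != i -> upd o i v j = o j.
Proof. by rewrite ffunE => /negbTE ->. Qed.
Lemma upd_id o i : upd o i (o i) = o.
Proof. by apply/ffunP => j; rewrite ffunE; case: eqP => // ->. Qed.
Lemma upd_upd o i v v' : upd (upd o i v) i v' = upd o i v'.
Proof. by apply/ffunP => j; rewrite !ffunE; case: eqP. Qed.

Hypothesis p_ge0 : forall i v, 0 <= p i v.
Hypothesis p_sum1 : forall i, \sum_v p i v = 1.

Lemma pw_ge0 o : 0 <= pw o.
Proof. exact: prodr_ge0. Qed.

Lemma pw_sum1 : \sum_o pw o = 1.
Proof.
rewrite -(bigA_distr_bigA (fun i v => p i v)).
by rewrite big1.
Qed.

(* The swap (o, v) |-> (upd o i v, o i) is a weight-preserving involution. *)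
Lemma fE_fubini i (f : {ffun I -> V} -> R) :
  fE pw f = fE pw (fun o => \sum_v p i v * f (upd o i v)).
Proof.
transitivity (\sum_(x : {ffun I -> V} * V) pw x.1 * p i x.2 * f x.1).
  rewrite -(pair_bigA _ (fun o v => pw o * p i v * f o)) /=.
  apply: eq_bigr => o _; rewrite -mulr_suml -mulr_sumr p_sum1 mulr1 //.
pose sw (x : {ffun I -> V} * V) := (upd x.1 i x.2, x.1 i).
have swK : involutive sw.
  by case=> o v; rewrite /sw /= upd_eq upd_upd upd_id.
rewrite (reindex_inj (inv_inj swK)) /=.
transitivity (\sum_(x : {ffun I -> V} * V) pw x.1 * (p i x.2 * f (upd x.1 i x.2))).
  apply: eq_bigr => x _; case: x => o v /=; rewrite mulrA; congr (_ * _).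
  rewrite /pw (bigD1 i) //= [in RHS](bigD1 i) //= upd_eq.
  rewrite [LHS]mulrC mulrA [LHS]mulrAC; congr (_ * _ * _).
    by apply: eq_bigr => j ji; rewrite upd_neq.
rewrite -(pair_bigA _ (fun o v => pw o * (p i v * f (upd o i v)))) /=.
by apply: eq_bigr => o _; rewrite mulr_sumr.
Qed.

End ProductSpace.

(** * Even moments of complex martingales *)

Section MartingaleMoments.
Variable R : realType.

(** The recursion adds up the error terms in the induction step of [mart_pow_step]: 4 and 1 times
    [k.+1] from the products containing c, 2 from multiplying the previous error, 1 from the leading
    power. *)
Fixpoint mart_const (k : nat) : R :=
  if k is k'.+1 then 1 + 5 * k%:R + 2 * mart_const k' else 1.

Lemma mart_constS k : mart_const k.+1 = 1 + 5 * k.+1%:R + 2 * mart_const k.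
Proof. by []. Qed.

Lemma mart_const_ge1 k : 1 <= mart_const k.
Proof.
elim: k => [|k IH]; first by rewrite /=.
rewrite mart_constS.
have x0 : 0 <= k.+1%:R :> R by rewrite ler0n.
by move: (k.+1%:R : R) (mart_const k) x0 IH => x y; lra.
Qed.

(** With A = |S|^2, B = |D|^2 and c the real part of conj(S) D, the base is |S + D|^2. The term
    linear in c is kept exactly because its expectation vanishes for a martingale; [c ^+ 2 <= A * B]
    turns every further occurrence of c into a multiple of B (A + B)^k. *)
Lemma mart_pow_step (k : nat) (A B c : R) : 0 <= A -> 0 <= B -> c ^+ 2 <= A * B ->
  (A + 2 * c + B) ^+ k.+1 <=
  A ^+ k.+1 + 2 * k.+1%:R * A ^+ k * c + mart_const k * B * (A + B) ^+ k.
Proof.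
move=> A0 B0 cAB.
have : `|2 * c| <= A + B.
  rewrite -(ler_pXn2r (n := 2)) // ?nnegrE ?addr_ge0 // real_normK ?num_real //.
  by have := sqr_ge0 (A - B); nra.
rewrite ler_norml => /andP[c2 c1].
have pos : 0 <= A + 2 * c + B by lra.
elim: k => [|k IH]; first by rewrite (_ : mart_const 0 = 1) // !expr1 !expr0; lra.
rewrite exprS; apply: (le_trans (ler_wpM2l pos IH)).
have AB0 : 0 <= A + B by lra.
have h0 : 0 <= A ^+ k by rewrite exprn_ge0.
have h1 : A ^+ k <= (A + B) ^+ k by rewrite lerXn2r ?nnegrE //; lra.
rewrite mart_constS.
have n0 : 0 <= k.+1%:R :> R by rewrite ler0n.
have -> : (k.+2%:R : R) = k.+1%:R + 1 by rewrite -[k.+2]addn1 natrD.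
have K1 := mart_const_ge1 k.
rewrite !exprS.
move: (A ^+ k) ((A + B) ^+ k) (mart_const k) (k.+1%:R) h0 h1 n0 K1 {IH} => X Y K n h0 h1 n0 K1.
have Y0 : 0 <= Y by lra.
have e1 : 4 * n * X * c ^+ 2 <= 4 * n * Y * ((A + B) * B).
  apply: (@le_trans _ _ (4 * n * X * ((A + B) * B))).
    by apply: ler_wpM2l; [rewrite !mulr_ge0 //; lra | nra].
  by apply: ler_wpM2r; [nra | rewrite ler_wpM2l //; lra].
have e2 : 2 * n * X * c * B <= n * Y * (A + B) * B.
  apply: ler_wpM2r => //.
  have : X * (2 * c) <= Y * (A + B).
    apply: (@le_trans _ _ (X * (A + B))); first by rewrite ler_wpM2l.
    by rewrite ler_wpM2r.
  by move=> h; nra.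
have e3 : (A + 2 * c + B) * (K * B * Y) <= 2 * (A + B) * (K * B * Y).
  by apply: ler_wpM2r; [rewrite !mulr_ge0 //; lra | lra].
have e4 : B * (A * X) <= B * ((A + B) * Y).
  rewrite ler_wpM2l //.
  apply: (@le_trans _ _ (A * Y)); first by rewrite ler_wpM2l.
  by rewrite ler_wpM2r //; lra.
lra.
Qed.

Lemma pow_sum_le (k : nat) (A B : R) : 0 <= A -> 0 <= B ->
  (A + B) ^+ k <= 2 ^+ k * (A ^+ k + B ^+ k).
Proof.
move=> A0 B0; have [AB|BA] := leP A B.
  apply: (@le_trans _ _ ((2 * B) ^+ k)).
    by rewrite lerXn2r ?nnegrE; lra.
  by rewrite exprMn ler_wpM2l ?exprn_ge0 // lerDr exprn_ge0.
apply: (@le_trans _ _ ((2 * A) ^+ k)).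
  by rewrite lerXn2r ?nnegrE; lra.
by rewrite exprMn ler_wpM2l ?exprn_ge0 // lerDl exprn_ge0.
Qed.

(** Young's inequality with free scales: the larger of A / a and B / b dominates the product. The
    scales will be moment bounds, which makes both expectations on the right at most 1. *)
Lemma pow_young (k : nat) (A B a b : R) : 0 <= A -> 0 <= B -> 0 < a -> 0 < b ->
  A ^+ k * B <= a ^+ k * b * ((A / a) ^+ k.+1 + (B / b) ^+ k.+1).
Proof.
move=> A0 B0 a0 b0.
have -> : A ^+ k * B = a ^+ k * b * ((A / a) ^+ k * (B / b)).
  rewrite expr_div_n; field.
  by rewrite (gt_eqF b0) expf_neq0 // gt_eqF.
rewrite ler_pM2l ?mulr_gt0 ?exprn_gt0 //.
have x0 : 0 <= A / a by rewrite divr_ge0 // ltW.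
have y0 : 0 <= B / b by rewrite divr_ge0 // ltW.
move: (A / a) (B / b) x0 y0 => x y x0 y0.
have [xy|yx] := leP x y.
  apply: (@le_trans _ _ (y ^+ k.+1)); last by rewrite lerDr exprn_ge0.
  by rewrite exprSr ler_wpM2r // lerXn2r ?nnegrE.
apply: (@le_trans _ _ (x ^+ k.+1)); last by rewrite lerDl exprn_ge0.
by rewrite exprSr ler_wpM2l ?exprn_ge0 // ltW.
Qed.

Definition mart_K (k : nat) : R := 4 * (mart_const k * 2 ^+ k) + 4.

Lemma mart_K_ge1 k : 1 <= mart_K k.
Proof.
rewrite /mart_K; have := mart_const_ge1 k; have : 0 < (2 : R) ^+ k by rewrite exprn_gt0.
nra.
Qed.

(** An increment of size s enlarges the base a by only [mart_K k * s], so that over all steps the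
    bases, and not their powers, add up. *)
Lemma mart_close (k : nat) (a s : R) : 0 <= a -> 0 <= s ->
  a ^+ k.+1 + mart_const k * 2 ^+ k * (2 * (a ^+ k * s) + s ^+ k.+1)
   <= (a + mart_K k * s) ^+ k.+1.
Proof.
move=> a0 s0; have K1 := mart_K_ge1 k.
have t0 : 0 <= mart_K k * s by rewrite mulr_ge0 //; lra.
have u0 : 0 <= mart_const k * 2 ^+ k.
  by rewrite mulr_ge0 ?exprn_ge0 //; have := mart_const_ge1 k; lra.
have ak0 : 0 <= a ^+ k by rewrite exprn_ge0.
have sk0 : 0 <= s ^+ k by rewrite exprn_ge0.
have h1 : a ^+ k <= (a + mart_K k * s) ^+ k by rewrite lerXn2r ?nnegrE //; lra.
have h2 : s ^+ k <= (a + mart_K k * s) ^+ k.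
  by rewrite lerXn2r ?nnegrE //; [lra | nra].
rewrite !exprSr mulrDr.
have h3 : a ^+ k * a <= (a + mart_K k * s) ^+ k * a by rewrite ler_wpM2r.
have h4 : (2 * (a ^+ k) + s ^+ k) <= 3 * (a + mart_K k * s) ^+ k by lra.
have h5 : mart_const k * 2 ^+ k * (2 * (a ^+ k * s) + s ^+ k * s) <=
   (a + mart_K k * s) ^+ k * (mart_K k * s).
  have -> : 2 * (a ^+ k * s) + s ^+ k * s = (2 * a ^+ k + s ^+ k) * s by ring.
  apply: (@le_trans _ _ (mart_const k * 2 ^+ k * (3 * (a + mart_K k * s) ^+ k * s))).
    by rewrite ler_wpM2l // ler_wpM2r.
  have W0 : 0 <= (a + mart_K k * s) ^+ k by lra.
  move: ((a + mart_K k * s) ^+ k) W0 => W W0.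
  have Ws : 0 <= W * s by rewrite mulr_ge0.
  rewrite /mart_K; nra.
lra.
Qed.

Variables (T : finType) (w : T -> R).
Hypothesis w_ge0 : forall t, 0 <= w t.

(** A Burkholder-type bound by induction on time. The martingale property enters only as the
    vanishing of the first-order term weighted by |S|^(2k), so no filtration is introduced. *)
Lemma mart_moment (k n : nat) (S : nat -> T -> R[i]) (sg : nat -> R) (V : R) :
  (forall t, S 0%N t = 0) -> 0 < V ->
  (forall j, (j < n)%N -> 0 <= sg j) ->
  \sum_(j < n) sg j <= V ->
  (forall j, (j < n)%N ->
    fE w (fun t => nrm (S j t) ^+ 2 ^+ k *
      complex.Re ((S j t)^*%C * (S j.+1 t - S j t))) = 0) ->
  (forall j, (j < n)%N ->
    fE w (fun t => nrm (S j.+1 t - S j t) ^+ 2 ^+ k.+1) <= sg j ^+ k.+1) ->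
  fE w (fun t => nrm (S n t) ^+ 2 ^+ k.+1) <= (2 * mart_K k * V) ^+ k.+1.
Proof.
move=> S0 V0 sg0 sgV orth bnd.
(* A positive amount e is added to each variance because [pow_young] divides by the scales; the n +
   1 copies add up to V, whence the factor 2 in the conclusion. *)
pose e := V / n.+1%:R.
have n1 : 0 < n.+1%:R :> R by rewrite ltr0n.
have e0 : 0 < e by rewrite divr_gt0.
have K1 := mart_K_ge1 k.
suff H m : (m <= n)%N -> fE w (fun t => nrm (S m t) ^+ 2 ^+ k.+1) <=
   (mart_K k * (e + \sum_(j < m) (sg j + e))) ^+ k.+1.
  apply: (le_trans (H n (leqnn n))).
  have hs : 0 <= \sum_(j < n) sg j by rewrite sumr_ge0 // => j _; exact: sg0.
  have he : e + \sum_(j < n) e = V.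
    rewrite sumr_const card_ord -mulrS -mulr_natl /e.
    by field; rewrite gt_eqF.
  rewrite big_split /=.
  have he' : 0 <= \sum_(j < n) e by rewrite sumr_ge0 // => j _; exact: ltW.
  move: (\sum_(j < n) sg j) (\sum_(j < n) e) hs he he' sgV => x y hs he he' xV.
  by apply: lerXn2r; rewrite ?nnegrE; nra.
elim: m => [_|m IH mn].
  rewrite /fE big1 => [|t _]; last by rewrite S0 nrm0 expr0n /= expr0n /= mulr0.
  by rewrite exprn_ge0 // mulr_ge0 //; [lra | rewrite big_ord0 addr0 ltW].
have {}IH := IH (ltnW mn).
have hs : 0 <= \sum_(j < m) (sg j + e).
  rewrite sumr_ge0 // => j _; have := sg0 j (ltn_trans (ltn_ord j) mn); lra.
set a := mart_K k * (e + \sum_(j < m) (sg j + e)) in IH *.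
have a0 : 0 < a by rewrite /a mulr_gt0 //; lra.
set s := sg m + e.
have s0 : 0 < s by rewrite /s; have := sg0 m mn; lra.
have -> : mart_K k * (e + \sum_(j < m.+1) (sg j + e)) = a + mart_K k * s.
  by rewrite big_ord_recr /= /a /s; ring.
have bm := bnd m mn.
have bm' : fE w (fun t => nrm (S m.+1 t - S m t) ^+ 2 ^+ k.+1) <= s ^+ k.+1.
  apply: (le_trans bm); rewrite lerXn2r ?nnegrE // /s ?sg0 //; try lra.
  have := sg0 m mn; lra.
set D := fun t => S m.+1 t - S m t in bm'.
apply: le_trans (mart_close k (ltW a0) (ltW s0)).
set c := mart_const k * 2 ^+ k.
have c0 : 0 <= c.
  by rewrite /c mulr_ge0 ?exprn_ge0 //; have := mart_const_ge1 k; lra.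
pose A t := nrm (S m t) ^+ 2; pose B t := nrm (D t) ^+ 2.
apply: (@le_trans _ _ (fE w (fun t => A t ^+ k.+1 +
   (2 * k.+1%:R) * (A t ^+ k * complex.Re ((S m t)^*%C * D t)) +
   c * (A t ^+ k * B t + B t ^+ k.+1)))).
  apply: fE_le => // t.
  have A0 : 0 <= A t by rewrite /A exprn_ge0 // nrm_ge0.
  have B0 : 0 <= B t by rewrite /B exprn_ge0 // nrm_ge0.
  have -> : nrm (S m.+1 t) ^+ 2 = A t + 2 * complex.Re ((S m t)^*%C * D t) + B t.
    have -> : S m.+1 t = S m t + D t by rewrite /D addrC subrK.
    rewrite /A /B !nrm_sqr cReM cReJ cImJ cReD cImD; ring.
  have hc : complex.Re ((S m t)^*%C * D t) ^+ 2 <= A t * B t.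
    rewrite /A /B -exprMn -(nrmJ (S m t)) -nrmM.
    rewrite -[leLHS]real_normK ?num_real // lerXn2r ?nnegrE ?nrm_ge0 //.
    exact: le_Re_nrm.
  apply: (le_trans (mart_pow_step k A0 B0 hc)).
  rewrite -[_ * A t ^+ k * _]mulrA lerD2l /c.
  move: (A t) (B t) A0 B0 => x y x0 y0.
  rewrite -!mulrA; apply: ler_wpM2l; first by have := mart_const_ge1 k; lra.
  apply: (le_trans (ler_wpM2l y0 (pow_sum_le k x0 y0))).
  by rewrite mulrCA ler_wpM2l ?exprn_ge0 // mulrDr [y * x ^+ k]mulrC -exprS.
rewrite !fED !fEZ orth // mulr0 addr0 fED.
apply: lerD; first exact: IH.
rewrite ler_wpM2l //.
apply: lerD => //.
have a0' := a0; have s0' := s0.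
have ka : 0 < a ^+ k * s by rewrite mulr_gt0 ?exprn_gt0.
apply: (@le_trans _ _ (fE w (fun t => a ^+ k * s * ((A t / a) ^+ k.+1 + (B t / s) ^+ k.+1)))).
  apply: fE_le => // t; apply: pow_young => //; exact: exprn_ge0 (nrm_ge0 _).
rewrite fEZ mulrC ler_pM2r // fED.
have div1 x : 0 < x -> forall F, fE w (fun t => (F t) ^+ k.+1) <= x ^+ k.+1 ->
   fE w (fun t => (F t / x) ^+ k.+1) <= 1.
  move=> x0 F HF.
  rewrite (_ : fE _ _ = fE w (fun t => F t ^+ k.+1) / x ^+ k.+1); last first.
    by rewrite -fEZr; apply: fE_ext => t; rewrite expr_div_n.
  by rewrite ler_pdivrMr ?exprn_gt0 // mul1r.
by apply: (@le_trans _ _ (1 + 1)); [apply: lerD; apply: div1 | lra].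
Qed.

End MartingaleMoments.

(** * Moments of linear and quadratic forms in one random column *)

Section ColumnModel.
Variables (R : realType) (M : nat) (V : finType).
Variables (p : 'I_M -> V -> R) (xv : 'I_M -> V -> R[i]) (s : R) (c : nat -> R).

(** Here s is the variance of an entry and c bounds the moments of |x|^2 / s, so that the constants
    do not see the scaling of the matrix. *)
Record column_model : Prop := ColumnModel {
  cm_ge0 : forall i v, 0 <= p i v;
  cm_sum1 : forall i, \sum_v p i v = 1;
  cm_s_gt0 : 0 < s;
  cm_c_ge0 : forall k, 0 <= c k;
  cm_mean : forall i, \sum_v (p i v)%:C%C * xv i v = 0;
  cm_var : forall i, \sum_v p i v * nrm (xv i v) ^+ 2 = s;
  cm_mom : forall i k, \sum_v p i v * (nrm (xv i v) ^+ 2) ^+ k <= c k * s ^+ k }.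

Hypothesis H : column_model.

Lemma sum_Re_factor (i : 'I_M) (X : R) (d : R[i]) (D : V -> R[i]) :
  \sum_v p i v * (X * complex.Re (d * D v)) =
  X * complex.Re (d * \sum_v (p i v)%:C%C * D v).
Proof.
rewrite mulr_sumr cRe_sum mulr_sumr; apply: eq_bigr => v _.
by rewrite (mulrCA d) cReZ mulrCA.
Qed.

Let x (o : {ffun 'I_M -> V}) i := xv i (o i).

(** Partial sums form a martingale in n, since each coordinate is centred and independent of the
    earlier ones. *)
Definition linS (b : 'I_M -> R[i]) (n : nat) (o : {ffun 'I_M -> V}) : R[i] :=
  \sum_(j < M | (j < n)%N) b j * x o j.

Lemma sum_ltS (Z : zmodType) (F : 'I_M -> Z) n (nM : (n < M)%N) :
  \sum_(j < M | (j < n.+1)%N) F j = \sum_(j < M | (j < n)%N) F j + F (Ordinal nM).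
Proof.
rewrite (bigD1 (Ordinal nM)) //= addrC; congr (_ + _).
by apply: eq_bigl => j; rewrite ltnS -val_eqE /= ltn_neqAle andbC.
Qed.

Lemma linS_S b n o (nM : (n < M)%N) :
  linS b n.+1 o = linS b n o + b (Ordinal nM) * x o (Ordinal nM).
Proof. exact: sum_ltS. Qed.

Lemma linS_upd b n o (nM : (n < M)%N) v :
  linS b n (upd o (Ordinal nM) v) = linS b n o.
Proof.
apply: eq_bigr => j jn; rewrite /x upd_neq //.
by rewrite -val_eqE /= neq_ltn jn.
Qed.

Lemma lin_moment k (b : 'I_M -> R[i]) n (W : R) : (n <= M)%N ->
  0 < W -> \sum_j nrm (b j) ^+ 2 <= W ->
  fE (pw p) (fun o => nrm (linS b n o) ^+ 2 ^+ k.+1) <=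
  (2 * mart_K R k * ((1 + c k.+1) * s * W)) ^+ k.+1.
Proof.
move=> nM W0 bW.
have s0 := cm_s_gt0 H.
pose sg j := (1 + c k.+1) * s * (if insub j is Some i then nrm (b i) ^+ 2 else 0).
have sgE j (jM : (j < M)%N) : sg j = (1 + c k.+1) * s * nrm (b (Ordinal jM)) ^+ 2.
  by rewrite /sg insubT.
have c0 := cm_c_ge0 H k.+1.
apply: (mart_moment (pw_ge0 (cm_ge0 H)) (S := fun n => linS b n) (sg := sg)).
- by move=> o; rewrite /linS big1.
- by rewrite !mulr_gt0 //; lra.
- move=> j jn; rewrite (sgE _ (leq_trans jn nM)).
  by rewrite !mulr_ge0 ?exprn_ge0 ?nrm_ge0 //; lra.
- apply: (@le_trans _ _ ((1 + c k.+1) * s * \sum_j nrm (b j) ^+ 2)).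
    rewrite (big_ord_widen M (fun j => sg j)) // mulr_sumr big_mkcond /=.
    apply: ler_sum => j _; rewrite (sgE _ (ltn_ord j)) (_ : Ordinal _ = j); last exact: val_inj.
    by case: ifP => // _; rewrite !mulr_ge0 ?exprn_ge0 ?nrm_ge0 //; lra.
  by rewrite ler_wpM2l // mulr_ge0 //; lra.
- move=> j jn; have jM := leq_trans jn nM.
  rewrite (fE_fubini (cm_sum1 H) (Ordinal jM)).
  rewrite /fE big1 // => o _; apply/eqP; rewrite mulf_eq0; apply/orP; right; apply/eqP.
  under eq_bigr => v _ do rewrite (linS_S b _ jM) linS_upd addrC addKr /x upd_eq.
  rewrite sum_Re_factor.
  rewrite (_ : \sum_v _ = 0) ?mulr0 //=; last first.
    transitivity (b (Ordinal jM) * \sum_v (p (Ordinal jM) v)%:C%C * xv (Ordinal jM) v).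
      by rewrite mulr_sumr; apply: eq_bigr => v _; rewrite mulrCA.
    by rewrite (cm_mean H) mulr0.
- move=> j jn; have jM := leq_trans jn nM.
  rewrite (fE_fubini (cm_sum1 H) (Ordinal jM)).
  rewrite (sgE _ jM).
  apply: (@le_trans _ _ (fE (pw p) (fun _ => (nrm (b (Ordinal jM)) ^+ 2) ^+ k.+1 * (c k.+1 * s ^+ k.+1)))).
    apply: fE_le; first exact: pw_ge0 (cm_ge0 H).
    move=> o; rewrite (eq_bigr (fun v => (nrm (b (Ordinal jM)) ^+ 2) ^+ k.+1 *
       (p (Ordinal jM) v * (nrm (xv (Ordinal jM) v) ^+ 2) ^+ k.+1))); last first.
      move=> v _; rewrite (linS_S b _ jM) linS_upd addrC addKr /x upd_eq nrmM.
      rewrite [(_ * _) ^+ 2]exprMn [(_ * _) ^+ k.+1]exprMn; ring.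
    rewrite -mulr_sumr ler_wpM2l ?exprn_ge0 ?nrm_ge0 //; exact: cm_mom.
  rewrite fE_const; last exact: pw_sum1 (cm_sum1 H).
  have : 0 <= nrm (b (Ordinal jM)) ^+ 2 by rewrite exprn_ge0 ?nrm_ge0.
  move: (nrm (b (Ordinal jM)) ^+ 2) => y y0.
  rewrite mulrC !exprMn ler_wpM2r ?exprn_ge0 // ler_wpM2r ?exprn_ge0 //; first exact: ltW.
  rewrite exprS; apply: (@le_trans _ _ ((1 + c k.+1) * 1)); first by lra.
  by rewrite ler_wpM2l ?exprn_ege1 //; lra.
Qed.

(** The centred form x* B x - s tr B restricted to the leading minor of size n, again a martingale
    in n. Revealing one more coordinate adds [quadD]: two linear forms in the earlier coordinates
    and the fluctuation of the new squared modulus. *)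
Definition quadS (B : 'M[R[i]]_M) (n : nat) (o : {ffun 'I_M -> V}) : R[i] :=
  \sum_(i < M | (i < n)%N) (x o i)^*%C * linS (B i) n o
  - s%:C%C * \sum_(i < M | (i < n)%N) B i i.

Definition quadD (B : 'M[R[i]]_M) n o (k : 'I_M) v : R[i] :=
  (xv k v)^*%C * linS (B k) n o + (linS (fun i => (B i k)^*%C) n o)^*%C * xv k v
  + B k k * ((nrm (xv k v) ^+ 2)%:C%C - s%:C%C).

Lemma quadS_S B n o (nM : (n < M)%N) :
  quadS B n.+1 o = quadS B n o + quadD B n o (Ordinal nM) (o (Ordinal nM)).
Proof.
rewrite /quadS !sum_ltS (linS_S _ _ nM).
rewrite (eq_bigr (fun i => (x o i)^*%C * linS (B i) n o + (x o i)^*%C * B i (Ordinal nM) * x o (Ordinal nM))); last first.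
  by move=> i _; rewrite (linS_S _ _ nM) mulrDr mulrA.
rewrite big_split /= -mulr_suml /quadD -/(x o (Ordinal nM)).
have -> : (linS (fun i => (B i (Ordinal nM))^*%C) n o)^*%C =
    \sum_(i < M | (i < n)%N) (x o i)^*%C * B i (Ordinal nM).
  rewrite /linS rmorph_sum; apply: eq_bigr => i _.
  by rewrite rmorphM /= conjcK mulrC.
rewrite -mulJ.
move: (\sum_(i < M | _) _ * linS _ _ _) (\sum_(i < M | _) _ * B _ _) (\sum_(i < M | _) B _ _)
 => a b d.
ring.
Qed.

Lemma quadS_upd B n o (nM : (n < M)%N) v :
  quadS B n (upd o (Ordinal nM) v) = quadS B n o.
Proof.
congr (_ - _); apply: eq_bigr => i lin; rewrite linS_upd /x upd_neq //.
by rewrite -val_eqE /= neq_ltn lin.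
Qed.

Lemma quadD_upd B n o (nM : (n < M)%N) v v' :
  quadD B n (upd o (Ordinal nM) v) (Ordinal nM) v' = quadD B n o (Ordinal nM) v'.
Proof. by rewrite /quadD !linS_upd. Qed.

Lemma cm_meanJ i : \sum_v (p i v)%:C%C * (xv i v)^*%C = 0.
Proof.
transitivity (\sum_v (p i v)%:C%C * xv i v)^*%C; last by rewrite (cm_mean H) rmorph0.
by rewrite rmorph_sum; apply: eq_bigr => v _; rewrite rmorphM; congr (_ * _); exact/esym/conjc_real.
Qed.

Lemma quadD_mean B n o k : \sum_v (p k v)%:C%C * quadD B n o k v = 0.
Proof.
rewrite (eq_bigr (fun v => (p k v)%:C%C * (xv k v)^*%C * linS (B k) n o +
   (p k v)%:C%C * xv k v * (linS (fun i => (B i k)^*%C) n o)^*%C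
  + ((p k v * nrm (xv k v) ^+ 2)%:C%C - (p k v)%:C%C * s%:C%C) * B k k)); last first.
  by move=> v _; rewrite /quadD rmorphM /=; ring.
rewrite !big_split /= -!mulr_suml cm_meanJ (cm_mean H) !mul0r !add0r.
rewrite big_split /= sumrN -mulr_suml -!rmorph_sum /= (cm_var H) (cm_sum1 H) mul1r.
by rewrite subrr mul0r.
Qed.

Definition lin_const k : R := 2 * mart_K R k * (1 + c k.+1).
Definition quad_kappa k : R := 2 + 2 * c k.+1 * lin_const k ^+ k.+1 + c (2 * k.+1)%N.
Definition quad_const k : R := 72 * mart_K R k * quad_kappa k.

Lemma lin_const_ge0 k : 0 <= lin_const k.
Proof.
rewrite /lin_const; have := mart_K_ge1 R k; have := cm_c_ge0 H k.+1.
by move: (mart_K R k) (c k.+1) => a b; nra.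
Qed.

Lemma quad_kappa_ge1 k : 1 <= quad_kappa k.
Proof.
rewrite /quad_kappa; have := cm_c_ge0 H (2 * k.+1).
have : 0 <= 2 * c k.+1 * lin_const k ^+ k.+1.
  by rewrite !mulr_ge0 ?(cm_c_ge0 H) ?exprn_ge0 ?lin_const_ge0.
by move: (2 * c k.+1 * _) (c (2 * k.+1)%N) => a b; lra.
Qed.

Lemma quadD_bound k (X l1 l2 b : R) : 0 <= X -> 0 <= l1 -> 0 <= l2 -> 0 <= b -> 0 < s ->
  (3 * (X * (l1 + l2) + b * (X ^+ 2 + s ^+ 2))) ^+ k <=
  12 ^+ k * (X ^+ k * (l1 ^+ k + l2 ^+ k) + b ^+ k * (X ^+ (2 * k) + s ^+ (2 * k))).
Proof.
move=> X0 l10 l20 b0 s0.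
have -> : 12 = 3 * (2 * 2) :> R by ring.
rewrite !exprMn -!mulrA; apply: ler_wpM2l; first by rewrite exprn_ge0.
have h2 : 0 <= 2 ^+ k :> R by rewrite exprn_ge0.
apply: (le_trans (pow_sum_le k _ _)).
- by rewrite mulr_ge0 // addr_ge0.
- by rewrite mulr_ge0 // addr_ge0 // exprn_ge0 // ltW.
rewrite !exprMn; apply: ler_wpM2l => //.
rewrite mulrDr; apply: lerD.
  rewrite mulrCA; apply: ler_wpM2l; first by rewrite exprn_ge0.
  exact: pow_sum_le.
rewrite mulrCA; apply: ler_wpM2l; first by rewrite exprn_ge0.
by rewrite !exprM; apply: pow_sum_le; rewrite exprn_ge0 // ltW.
Qed.

Lemma nrm_sqr_sum3 (x1 x2 x3 : R[i]) :
  nrm (x1 + x2 + x3) ^+ 2 <= 3 * (nrm x1 ^+ 2 + nrm x2 ^+ 2 + nrm x3 ^+ 2).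
Proof.
apply: (@le_trans _ _ ((nrm x1 + nrm x2 + nrm x3) ^+ 2)).
  rewrite lerXn2r ?nnegrE ?nrm_ge0 ?addr_ge0 ?nrm_ge0 //.
  by apply: (le_trans (nrmD _ _)); rewrite lerD2r nrmD.
move: (nrm x1) (nrm x2) (nrm x3) => a b d.
have := sqr_ge0 (a - b); have := sqr_ge0 (a - d); have := sqr_ge0 (b - d); nra.
Qed.

(** The increments are controlled by [lin_moment] for a row and a column of B, and the martingale
    bound is applied a second time. The row and column norms add up to the squared Frobenius norm,
    so the form fluctuates on the scale s times the Frobenius norm of B. *)
Lemma quad_moment k (B : 'M[R[i]]_M) (W : R) : 0 < W ->
  \sum_i \sum_j nrm (B i j) ^+ 2 <= W ->
  fE (pw p) (fun o => nrm (quadS B M o) ^+ 2 ^+ k.+1) <=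
  (quad_const k * s ^+ 2 * W) ^+ k.+1.
Proof.
move=> W0 BW.
have s0 := cm_s_gt0 H; have kap1 := quad_kappa_ge1 k.
(* The summand d makes every row weight positive, as [lin_moment] requires. Rows, columns and the
   copies of d contribute at most W each, hence 36 = 12 * 3 below. *)
pose d := W / M.+1%:R.
have d0 : 0 < d by rewrite divr_gt0 // ltr0n.
pose Wn (i : 'I_M) := \sum_j nrm (B i j) ^+ 2 + \sum_j nrm (B j i) ^+ 2 + d.
have Wn0 i : 0 < Wn i.
  rewrite ltr_pwDr // addr_ge0 // sumr_ge0 // => j _; exact: exprn_ge0 (nrm_ge0 _).
have S1 i : 0 <= \sum_j nrm (B i j) ^+ 2.
  by rewrite sumr_ge0 // => j _; exact: exprn_ge0 (nrm_ge0 _).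
have S2 i : 0 <= \sum_j nrm (B j i) ^+ 2.
  by rewrite sumr_ge0 // => j _; exact: exprn_ge0 (nrm_ge0 _).
pose sg j := 12 * quad_kappa k * s ^+ 2 * (if insub j is Some i then Wn i else 0).
have sgE j (jM : (j < M)%N) : sg j = 12 * quad_kappa k * s ^+ 2 * Wn (Ordinal jM).
  by rewrite /sg insubT.
have ks0 : 0 <= 12 * quad_kappa k * s ^+ 2 by rewrite !mulr_ge0 ?exprn_ge0 //; lra.
have -> : quad_const k * s ^+ 2 * W = 2 * mart_K R k * (36 * quad_kappa k * s ^+ 2 * W).
  by rewrite /quad_const; ring.
apply: (mart_moment (pw_ge0 (cm_ge0 H)) (S := fun n => quadS B n) (sg := sg)).
- by move=> o; rewrite /quadS !big1 // mulr0 subr0.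
- by rewrite !mulr_gt0 ?exprn_gt0 //; lra.
- move=> j jn; rewrite (sgE _ jn) mulr_ge0 // ltW //.
- rewrite (eq_bigr (fun j : 'I_M => 12 * quad_kappa k * s ^+ 2 * Wn j)); last first.
    by move=> j _; rewrite (sgE _ (ltn_ord j)); congr (_ * Wn _); exact: val_inj.
  rewrite -mulr_sumr !big_split /= sumr_const card_ord.
  have -> : \sum_(i < M) \sum_j nrm (B j i) ^+ 2 = \sum_(i < M) \sum_j nrm (B i j) ^+ 2.
    exact: exchange_big.
  have : d *+ M <= W.
    rewrite -mulr_natr /d mulrAC ler_pdivrMr ?ltr0n // ler_wpM2l ?ler_nat //.
    exact: ltW.
  move: (d *+ M) (\sum_i _) BW => dM y BW xW.
  have -> : 36 * quad_kappa k * s ^+ 2 * W = 12 * quad_kappa k * s ^+ 2 * (3 * W) by ring.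
  by rewrite ler_wpM2l //; lra.
- move=> j jn.
  rewrite (fE_fubini (cm_sum1 H) (Ordinal jn)).
  rewrite /fE big1 // => o _; apply/eqP; rewrite mulf_eq0; apply/orP; right; apply/eqP.
  under eq_bigr => v _ do rewrite (quadS_S B _ jn) addrC addKr quadS_upd quadD_upd upd_eq.
  by rewrite sum_Re_factor quadD_mean ?mulr0 //= mulr0.
- move=> j jn; set i := Ordinal jn.
  rewrite (fE_fubini (cm_sum1 H) i) (sgE _ jn) -/i.
  pose l1 o := nrm (linS (B i) j o) ^+ 2.
  pose l2 o := nrm (linS (fun i' => (B i' i)^*%C) j o) ^+ 2.
  set b := nrm (B i i) ^+ 2.
  have b0 : 0 <= b by rewrite exprn_ge0 // nrm_ge0.
  set K := k.+1.
  have l10 o : 0 <= l1 o by rewrite exprn_ge0 // nrm_ge0.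
  have l20 o : 0 <= l2 o by rewrite exprn_ge0 // nrm_ge0.
  apply: (@le_trans _ _ (fE (pw p) (fun o => 12 ^+ K *
      (c K * s ^+ K * (l1 o ^+ K + l2 o ^+ K) + b ^+ K * ((c (2 * K)%N + 1) * s ^+ (2 * K)))))).
    apply: fE_le; first exact: pw_ge0 (cm_ge0 H).
    move=> o.
    apply: (@le_trans _ _ (\sum_v p i v * (12 ^+ K * ((nrm (xv i v) ^+ 2) ^+ K * (l1 o ^+ K + l2 o ^+ K) +
       b ^+ K * ((nrm (xv i v) ^+ 2) ^+ (2 * K) + s ^+ (2 * K)))))).
      apply: ler_sum => v _; apply: ler_wpM2l; first exact: (cm_ge0 H).
      rewrite (quadS_S B _ jn) addrC addKr quadD_upd upd_eq.
      have X0 : 0 <= nrm (xv i v) ^+ 2 by rewrite exprn_ge0 // nrm_ge0.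
      apply: le_trans (quadD_bound K X0 (l10 o) (l20 o) b0 s0).
      rewrite lerXn2r ?nnegrE ?exprn_ge0 ?nrm_ge0 //.
        by rewrite mulr_ge0 // addr_ge0 // mulr_ge0 // addr_ge0 // exprn_ge0 // ltW.
      apply: (le_trans (nrm_sqr_sum3 _ _ _)); rewrite ler_wpM2l //.
      rewrite !nrmM !nrmJ !exprMn -/(l1 o) -/(l2 o) -/b.
      rewrite [l2 o * _]mulrC -mulrDr lerD2l ler_wpM2l //.
      have -> : forall a b' : R, nrm (a%:C%C - b'%:C%C) = `|a - b'|.
        by move=> a b'; rewrite -nrmR rmorphB.
      rewrite real_normK ?num_real //.
      move: (nrm _ ^+ 2) X0 => X X0; have := ltW s0; nra.
    rewrite (eq_bigr (fun v => 12 ^+ K * (((p i v * (nrm (xv i v) ^+ 2) ^+ K) * (l1 o ^+ K + l2 o ^+ K) +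
       (p i v * (nrm (xv i v) ^+ 2) ^+ (2 * K)) * b ^+ K) + p i v * (b ^+ K * s ^+ (2 * K))))); last first.
      move=> v _.
      move: (p i v) (_ ^+ K) (_ ^+ (2 * K)) (l1 o ^+ K + l2 o ^+ K) => *; ring.
    rewrite -mulr_sumr ler_wpM2l ?exprn_ge0 // !big_split /= -!mulr_suml (cm_sum1 H) mul1r.
    have h1 := cm_mom H i K; have h2 := cm_mom H i (2 * K).
    have bK : 0 <= b ^+ K by rewrite exprn_ge0.
    have -> : b ^+ K * ((c (2 * K)%N + 1) * s ^+ (2 * K)) =
      (c (2 * K)%N * s ^+ (2 * K)) * b ^+ K + b ^+ K * s ^+ (2 * K) by ring.
    rewrite addrA lerD2r; apply: lerD; apply: ler_wpM2r => //.
    by rewrite addr_ge0 // exprn_ge0.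
  rewrite fEZ fED fEZ fED fE_const; last exact: pw_sum1 (cm_sum1 H).
  have Wi0 := Wn0 i.
  have e1 : fE (pw p) (fun o => l1 o ^+ K) <= (lin_const k * s * Wn i) ^+ K.
    have := @lin_moment k (B i) j (Wn i) (ltnW jn) Wi0.
    rewrite (_ : 2 * mart_K R k * _ = lin_const k * s * Wn i); last by rewrite /lin_const; ring.
    by apply; rewrite /Wn -addrA lerDl addr_ge0 // ltW.
  have e2 : fE (pw p) (fun o => l2 o ^+ K) <= (lin_const k * s * Wn i) ^+ K.
    have := @lin_moment k (fun i' => (B i' i)^*%C) j (Wn i) (ltnW jn) Wi0.
    rewrite (_ : 2 * mart_K R k * _ = lin_const k * s * Wn i); last by rewrite /lin_const; ring.
    apply; rewrite (eq_bigr (fun i' => nrm (B i' i) ^+ 2)); last by move=> i' _; rewrite nrmJ.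
    by rewrite /Wn [X in _ <= X + _]addrC -addrA lerDl addr_ge0 // ltW.
  have bW : b ^+ K <= Wn i ^+ K.
    apply: lerXn2r; rewrite ?nnegrE //; first exact: ltW.
    rewrite /Wn (bigD1 i) //= -/b.
    rewrite -!addrA lerDl; apply: addr_ge0.
      by apply: sumr_ge0 => j' _; exact: exprn_ge0 (nrm_ge0 _).
    by apply: addr_ge0; [exact: S2 | exact: ltW].
  apply: (@le_trans _ _ (12 ^+ K * (c K * s ^+ K * (2 * (lin_const k * s * Wn i) ^+ K)
     + Wn i ^+ K * ((c (2 * K)%N + 1) * s ^+ (2 * K))))).
    have cK := cm_c_ge0 H K; have c2K := cm_c_ge0 H (2 * K).
    rewrite ler_wpM2l ?exprn_ge0 //; apply: lerD.
      by rewrite ler_wpM2l ?mulr_ge0 ?exprn_ge0 //; [exact: ltW | lra].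
    rewrite ler_wpM2r // mulr_ge0 ?exprn_ge0 //; [lra | exact: ltW].
  have -> : 12 ^+ K * (c K * s ^+ K * (2 * (lin_const k * s * Wn i) ^+ K)
     + Wn i ^+ K * ((c (2 * K)%N + 1) * s ^+ (2 * K))) =
     (quad_kappa k - 1) * (12 * s ^+ 2 * Wn i) ^+ K.
    rewrite /quad_kappa -/K (mulnC 2 K) (exprM s) !exprMn; ring.
  have -> : 12 * quad_kappa k * s ^+ 2 * Wn i = quad_kappa k * (12 * s ^+ 2 * Wn i) by ring.
  rewrite [leRHS]exprMn; apply: ler_wpM2r.
    by rewrite exprn_ge0 // !mulr_ge0 ?exprn_ge0 //; exact: ltW.
  apply: (@le_trans _ _ (quad_kappa k)); first by rewrite gerBl.
  rewrite /K exprS; apply: ler_peMr; first by lra.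
  by rewrite exprn_ege1.
Qed.

Lemma quad_mean B n : (n <= M)%N ->
  \sum_o (pw p o)%:C%C * quadS B n o = 0.
Proof.
elim: n => [|n IH] nM.
  by rewrite big1 // => o _; rewrite /quadS !big1 // mulr0 subr0 mulr0.
pose D := fun o => quadD B n o (Ordinal nM) (o (Ordinal nM)).
(* Real and imaginary parts are treated at once: f stands for either of them. *)
have split_re (f : R[i] -> R) (F : {ffun 'I_M -> V} -> R[i]) :
    (forall a x, f (a%:C%C * x) = a * f x) -> (forall x y, f (x + y) = f x + f y) -> f 0 = 0 ->
    f (\sum_o (pw p o)%:C%C * F o) = fE (pw p) (fun o => f (F o)).
  move=> fZ fD f0; rewrite (big_morph f fD f0); apply: eq_bigr => o _; exact: fZ.
have z0 (f : R[i] -> R) : (forall a x, f (a%:C%C * x) = a * f x) ->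
    (forall x y, f (x + y) = f x + f y) -> f 0 = 0 -> f (\sum_o (pw p o)%:C%C * D o) = 0.
  move=> fZ fD f0; rewrite split_re //.
  rewrite (fE_fubini (cm_sum1 H) (Ordinal nM)) /fE big1 // => o _.
  rewrite (_ : \sum_v _ = f (\sum_v (p (Ordinal nM) v)%:C%C * quadD B n o (Ordinal nM) v)).
    by rewrite quadD_mean f0 mulr0.
  rewrite (big_morph f fD f0); apply: eq_bigr => v _.
  by rewrite fZ /D quadD_upd upd_eq.
have D0 : \sum_o (pw p o)%:C%C * D o = 0.
  apply: cplx_eq; first exact: (z0 (@complex.Re R) (@cReZ R) (@cReD R) erefl).
  exact: (z0 (@complex.Im R) (@cImZ R) (@cImD R) erefl).
rewrite (eq_bigr (fun o => (pw p o)%:C%C * quadS B n o + (pw p o)%:C%C * D o)).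
  by rewrite big_split /= D0 addr0; apply: IH; exact: ltnW.
by move=> o _; rewrite (quadS_S B o nM) mulrDr.
Qed.

End ColumnModel.

(** * Resolvents of sample covariance matrices *)

Section HermitianResolvent.
Variable R : realType.
Local Notation C := R[i].
Local Open Scope complex_scope.

Definition adjm m n (A : 'M[C]_(m, n)) : 'M[C]_(n, m) := (map_mx (@conjc R) A)^T.

Lemma scalemxE m n (a : C) (A : 'M[C]_(m, n)) i j : (a *: A) i j = a * A i j.
Proof. by rewrite mxE. Qed.
Lemma submxE m n (A B : 'M[C]_(m, n)) i j : (A - B) i j = A i j - B i j.
Proof. by rewrite !mxE. Qed.
Lemma adjmE m n (A : 'M[C]_(m, n)) i j : adjm A i j = (A j i)^*.
Proof. by rewrite !mxE. Qed.
Lemma adjmK m n (A : 'M[C]_(m, n)) : adjm (adjm A) = A.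
Proof. by apply/matrixP => i j; rewrite !adjmE conjcK. Qed.
Lemma adjmM m n k (A : 'M[C]_(m, n)) (B : 'M[C]_(n, k)) :
  adjm (A *m B) = adjm B *m adjm A.
Proof. by rewrite /adjm map_mxM trmx_mul. Qed.
Lemma adjmB m n (A B : 'M[C]_(m, n)) : adjm (A - B) = adjm A - adjm B.
Proof. by apply/matrixP => i j; rewrite !(adjmE, mxE) rmorphB. Qed.
Lemma adjmD m n (A B : 'M[C]_(m, n)) : adjm (A + B) = adjm A + adjm B.
Proof. by apply/matrixP => i j; rewrite !(adjmE, mxE) rmorphD. Qed.
Lemma adjm0 m n : adjm (0 : 'M[C]_(m, n)) = 0.
Proof. by apply/matrixP => i j; rewrite !(adjmE, mxE) rmorph0. Qed.
Lemma adjm_scalar n z : adjm (z%:M : 'M[C]_n) = (z^*)%:M.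
Proof. by apply/matrixP => i j; rewrite !(adjmE, mxE) eq_sym rmorphMn. Qed.
Lemma adjm_sum m n (I : finType) (P : pred I) (F : I -> 'M[C]_(m, n)) :
  adjm (\sum_(i | P i) F i) = \sum_(i | P i) adjm (F i).
Proof. by apply: (big_morph (@adjm m n) (@adjmD m n) (adjm0 m n)). Qed.
Lemma mxtrace_adjm n (A : 'M[C]_n) : \tr (adjm A) = (\tr A)^*.
Proof. by rewrite /mxtrace rmorph_sum; apply: eq_bigr => i _; rewrite adjmE. Qed.
Lemma adjm_inv n (A : 'M[C]_n) : adjm (invmx A) = invmx (adjm A).
Proof. by rewrite /adjm map_invmx trmx_inv. Qed.

Definition frob2 m n (A : 'M[C]_(m, n)) : R := \sum_i \sum_j nrm (A i j) ^+ 2.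
Lemma frob2_ge0 m n (A : 'M[C]_(m, n)) : 0 <= frob2 A.
Proof. by do 2!(apply: sumr_ge0 => ? _); exact: exprn_ge0 (nrm_ge0 _). Qed.
Lemma frob2_adj m n (A : 'M[C]_(m, n)) : frob2 (adjm A) = frob2 A.
Proof.
rewrite /frob2 exchange_big /=; apply: eq_bigr => i _; apply: eq_bigr => j _.
by rewrite adjmE nrmJ.
Qed.
Lemma tr_mul_adj m n (A : 'M[C]_(m, n)) : \tr (A *m adjm A) = (frob2 A)%:C.
Proof.
rewrite /mxtrace /frob2 rmorph_sum; apply: eq_bigr => i _.
rewrite mxE rmorph_sum; apply: eq_bigr => j _.
by rewrite adjmE mulcJE.
Qed.
Lemma frob2_cols m n k (A : 'M[C]_(m, n)) (B : 'M[C]_(n, k)) :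
  frob2 (A *m B) = \sum_j frob2 (A *m col j B).
Proof.
rewrite /frob2 exchange_big /=; apply: eq_bigr => j _; apply: eq_bigr => i _.
by rewrite big_ord1 colE mulmxA -colE [in RHS]mxE.
Qed.
Lemma frob2_col m n (A : 'M[C]_(m, n)) : frob2 A = \sum_j frob2 (col j A).
Proof.
rewrite /frob2 exchange_big /=; apply: eq_bigr => j _; apply: eq_bigr => i _.
by rewrite big_ord1 mxE.
Qed.

Definition qf n (A : 'M[C]_n) (x y : 'cV[C]_n) : C := (adjm x *m A *m y) 0 0.

Lemma qfE n (A : 'M[C]_n) x y : qf A x y = \sum_i \sum_j (x i 0)^* * A i j * y j 0.
Proof.
rewrite /qf mxE exchange_big /=; apply: eq_bigr => j _.
by rewrite mxE big_distrl /=; apply: eq_bigr => i _; rewrite adjmE.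
Qed.

Lemma frob2_cv n (x : 'cV[C]_n) : (frob2 x)%:C = (adjm x *m x) 0 0.
Proof.
rewrite mxE /frob2 rmorph_sum; apply: eq_bigr => i _.
by rewrite big_ord1 adjmE mulJ.
Qed.

(** The free weight e lets the two norms be balanced without square roots. *)
Lemma nrm_dot_le n (x y : 'cV[C]_n) (e : R) : 0 < e ->
  nrm ((adjm x *m y) 0 0) <= (e * frob2 x + e^-1 * frob2 y) / 2.
Proof.
move=> e0; rewrite mxE; apply: (le_trans (nrm_sum _ _ _)).
rewrite ler_pdivlMr // mulr_suml /frob2 !mulr_sumr -big_split /=.
apply: ler_sum => i _; rewrite !big_ord1 adjmE nrmM nrmJ.
move: (nrm (x i 0)) (nrm (y i 0)) => a b.
have -> : e * a ^+ 2 + e^-1 * b ^+ 2 = a * b * 2 + e^-1 * (e * a - b) ^+ 2.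
  by field; rewrite gt_eqF.
by rewrite lerDl mulr_ge0 ?sqr_ge0 // invr_ge0 ltW.
Qed.

Definition hermit n (A : 'M[C]_n) := adjm A = A.
Definition psd n (A : 'M[C]_n) := forall x, 0 <= complex.Re (qf A x x).

Lemma qf_hermit_real n (A : 'M[C]_n) x : hermit A -> complex.Im (qf A x x) = 0.
Proof.
move=> hA; have : (qf A x x)^* = qf A x x.
  rewrite /qf -(adjmE (adjm x *m A *m x) 0 0) !adjmM adjmK.
  by rewrite [adjm A]hA mulmxA.
by case: (qf A x x) => a b [] /= => h; have := h; lra.
Qed.

Variables (n : nat) (A : 'M[C]_n) (z : C).
Hypothesis hA : hermit A.
Hypothesis Imz : 0 < complex.Im z.
Local Notation eta := (complex.Im z).

(** For a left null vector a real quadratic form would equal z times a squared norm, which forces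
    the vector to vanish because Im z > 0. *)
Lemma resolvent_unit : (A - z%:M) \in unitmx.
Proof.
rewrite -row_free_unit -kermx_eq0; apply/negPn/negP => k0.
have /rowV0Pn[v vk v0] := k0.
have {vk} : v *m (A - z%:M) = 0 by apply/sub_kermxP.
rewrite mulmxBr mul_mx_scalar => /eqP; rewrite subr_eq0 => /eqP vA.
have e1 : qf A (adjm v) (adjm v) = z * (frob2 (adjm v))%:C.
  by rewrite /qf adjmK vA -scalemxAl mxE frob2_cv adjmK.
have := qf_hermit_real (adjm v) hA.
rewrite e1 cImM /= mulr0 add0r => /eqP; rewrite mulf_eq0 gt_eqF //= frob2_adj => /eqP f0.
case/eqP: v0; apply/rowP => j; rewrite mxE; apply: Normc.eq0_normc.
have := f0; rewrite /frob2 big_ord1 => /eqP.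
rewrite psumr_eq0 => [|i _]; last exact: exprn_ge0 (nrm_ge0 _).
by move=> /allP /(_ j (mem_index_enum _)) /=; rewrite sqrf_eq0 => /eqP.
Qed.

Definition resolvent : 'M[C]_n := invmx (A - z%:M).
Local Notation G := resolvent.

Lemma adj_shift_unit : (A - (z^*)%:M) \in unitmx.
Proof.
rewrite -[A]hA -adjm_scalar -adjmB.
by rewrite /adjm unitmx_tr map_unitmx resolvent_unit.
Qed.

Lemma adj_resolvent : adjm G = invmx (A - (z^*)%:M).
Proof. by rewrite /resolvent adjm_inv adjmB adjm_scalar [adjm A]hA. Qed.

Lemma ImC2 (x : C) : x - x^* = (2 * complex.Im x)%:C * 'i.
Proof. by case: x => a b; apply: cplx_eq => /=; ring. Qed.

Lemma shift_sub : (A - (z^*)%:M) - (A - z%:M) = ((2 * eta)%:C * 'i)%:M :> 'M[C]_n.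
Proof.
apply/matrixP => i j; rewrite -ImC2 !mxE.
by case: (i == j); rewrite ?mulr1n ?mulr0n; ring.
Qed.

(** The resolvent identity between z and its conjugate. Its trace and its quadratic forms are the
    Ward identities, expressing squared norms of G through imaginary parts. *)
Lemma resolvent_sub_adj : G - adjm G = ((2 * eta)%:C * 'i) *: (G *m adjm G).
Proof.
have e1 : G = G *m (A - (z^*)%:M) *m adjm G.
  by rewrite adj_resolvent mulmxK // adj_shift_unit.
have e2 : adjm G = G *m (A - z%:M) *m adjm G.
  by rewrite /resolvent mulVmx ?resolvent_unit // mul1mx.
rewrite [X in X - _]e1 [X in _ - X]e2 -mulmxBl -mulmxBr shift_sub.
by rewrite mul_mx_scalar -scalemxAl.
Qed.

Lemma resolvent_sub_adj' : G - adjm G = ((2 * eta)%:C * 'i) *: (adjm G *m G).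
Proof.
have e1 : G = adjm G *m (A - (z^*)%:M) *m G.
  by rewrite adj_resolvent mulVmx ?adj_shift_unit // mul1mx.
have e2 : adjm G = adjm G *m (A - z%:M) *m G.
  by rewrite /resolvent mulmxK // resolvent_unit.
rewrite [X in X - _]e1 [X in _ - X]e2 -mulmxBl -mulmxBr shift_sub.
by rewrite mul_mx_scalar -scalemxAl.
Qed.

Lemma resolvent_normal : G *m adjm G = adjm G *m G.
Proof.
have /eqP := resolvent_sub_adj'; rewrite resolvent_sub_adj => /eqP.
apply: scalerI; rewrite mulf_neq0 //; last by rewrite eq_complex /= oner_eq0 andbF.
by rewrite eq_complex /= eqxx andbT gt_eqF // mulr_gt0.
Qed.

Lemma Im_trace_resolvent : complex.Im (\tr G) = eta * frob2 G.
Proof.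
have := congr1 (@mxtrace _ _) resolvent_sub_adj.
rewrite linearB /= mxtrace_adjm linearZ /= tr_mul_adj ImC2 => /(congr1 (@complex.Im R)).
by rewrite !(cImM, cReM) /=; lra.
Qed.

Lemma Im_qf_resolvent x : complex.Im (qf G x x) = eta * frob2 (G *m x).
Proof.
have := congr1 (fun B => qf B x x) resolvent_sub_adj'.
rewrite /qf mulmxBr mulmxBl submxE.
have -> : (adjm x *m adjm G *m x) 0 0 = ((adjm x *m G *m x) 0 0)^*.
  by rewrite -(adjmE (adjm x *m G *m x)) !adjmM adjmK mulmxA.
have e3 : adjm x *m (adjm G *m G) *m x = adjm (G *m x) *m (G *m x).
  by rewrite adjmM !mulmxA.
rewrite ImC2 -scalemxAr -scalemxAl e3 scalemxE -frob2_cv.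
by move=> /(congr1 (@complex.Im R)); rewrite !(cImM, cReM) /=; lra.
Qed.

Lemma frob2_adj_resolvent (x : 'cV[C]_n) : frob2 (adjm G *m x) = frob2 (G *m x).
Proof.
apply: (@complexI R); rewrite !frob2_cv !adjmM adjmK.
by rewrite !mulmxA -(mulmxA (adjm x)) resolvent_normal mulmxA.
Qed.

Lemma qf_resolvent_sqr_le (x : 'cV[C]_n) : nrm (qf (G *m G) x x) <= complex.Im (qf G x x) / eta.
Proof.
have -> : qf (G *m G) x x = (adjm (adjm G *m x) *m (G *m x)) 0 0.
  by rewrite /qf adjmM adjmK !mulmxA.
apply: (le_trans (nrm_dot_le _ _ (@ltr01 R))).
rewrite frob2_adj_resolvent Im_qf_resolvent mulrAC divff ?gt_eqF // invr1 !mul1r.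
lra.
Qed.

Lemma resolvent_contract (x : 'cV[C]_n) : frob2 (G *m x) <= frob2 x / eta ^+ 2.
Proof.
have h : eta * frob2 (G *m x) <= (eta^-1 * frob2 x + eta * frob2 (G *m x)) / 2.
  rewrite -[leLHS]Im_qf_resolvent; apply: (le_trans (Im_le_nrm _)).
  have -> : qf G x x = (adjm x *m (G *m x)) 0 0 by rewrite /qf mulmxA.
  have h0 : 0 < eta^-1 by rewrite invr_gt0.
  by have := nrm_dot_le x (G *m x) h0; rewrite invrK.
rewrite ler_pdivlMr ?exprn_gt0 //.
have h2 : eta * frob2 (G *m x) <= eta^-1 * frob2 x by lra.
have := ler_wpM2l (ltW Imz) h2; rewrite [leRHS]mulrA mulfV ?gt_eqF // mul1r; lra.
Qed.

Lemma frob2_resolvent_sqr : frob2 (G *m G) <= frob2 G / eta ^+ 2.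
Proof.
rewrite frob2_cols [frob2 G]frob2_col mulr_suml.
by apply: ler_sum => j _; exact: resolvent_contract.
Qed.

Lemma nrm_trace_sqr_le : nrm (\tr (G *m G)) <= frob2 G.
Proof.
rewrite /mxtrace; apply: (le_trans (nrm_sum _ _ _)).
apply: (@le_trans _ _ (\sum_i \sum_j (nrm (G i j) ^+ 2 + nrm (G j i) ^+ 2) / 2)).
  apply: ler_sum => i _; rewrite mxE; apply: (le_trans (nrm_sum _ _ _)).
  apply: ler_sum => j _; rewrite nrmM ler_pdivlMr //.
  by have := sqr_ge0 (nrm (G i j) - nrm (G j i)); nra.
under eq_bigr => i _ do rewrite -mulr_suml big_split /=.
rewrite -mulr_suml big_split /= [X in _ + X]exchange_big /=.
by rewrite -/(frob2 G) ler_pdivrMr //; lra.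
Qed.

Hypothesis pA : psd A.

(** Writing x = (A - z) u, the imaginary part is Im z times the quadratic form of A at u. This keeps
    z (1 + r) at distance at least Im z from 0 in the rank-one formulas. *)
Lemma Im_z_qf_ge0 x : 0 <= complex.Im (z * qf G x x).
Proof.
pose u := G *m x.
have xu : x = (A - z%:M) *m u by rewrite /u mulmxA mulmxV ?resolvent_unit // mul1mx.
have -> : qf G x x = qf A u u - z^* * (frob2 u)%:C.
  have -> : qf G x x = (adjm x *m u) 0 0 by rewrite /qf /u mulmxA.
  rewrite {1}xu adjmM adjmB adjm_scalar [adjm A]hA mulmxBr mulmxBl.
  by rewrite mul_mx_scalar -scalemxAl submxE scalemxE frob2_cv.
have := pA u; have := qf_hermit_real u hA.
rewrite mulrBr cImB mulrA mulcJE cImM [X in _ - X]cImM /= => -> h.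
rewrite !mulr0 !mul0r add0r addr0 subr0 mulr_ge0 // ltW //.
Qed.

Lemma Im_z_trace_ge0 : 0 <= complex.Im (z * \tr G).
Proof.
rewrite /mxtrace mulr_sumr cIm_sum sumr_ge0 // => i _.
have := Im_z_qf_ge0 (delta_mx i 0).
suff -> : qf G (delta_mx i 0) (delta_mx i 0) = G i i by [].
have e : adjm (delta_mx i 0 : 'cV[C]_n) = delta_mx 0 i.
  by apply/matrixP => j k; rewrite adjmE !mxE andbC; case: (_ && _); apply: cplx_eq; rewrite /= ?oppr0.
by rewrite /qf e -rowE -colE !mxE.
Qed.

End HermitianResolvent.

(** * Rank-one perturbations of a resolvent *)

Section RankOne.
Variable R : realType.
Local Notation C := R[i].
Local Open Scope complex_scope.

Lemma cIm1 : complex.Im (1 : C) = 0. Proof. by []. Qed.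
Lemma cRe1 : complex.Re (1 : C) = 1. Proof. by []. Qed.

Lemma qf_real_scalar n (G : 'M[C]_n) (x : 'cV[C]_n) : adjm x *m G *m x = (qf G x x)%:M.
Proof. by apply/matrixP => i j; rewrite !ord1 [RHS]mxE mulr1n. Qed.

Variables (n : nat) (A : 'M[C]_n) (z : C) (x : 'cV[C]_n).
Hypotheses (hA : hermit A) (pA : psd A) (Imz : 0 < complex.Im z).
Local Notation eta := (complex.Im z).
Local Notation G := (resolvent A z).
Local Notation A' := (A + x *m adjm x).
Local Notation G' := (resolvent A' z).
Local Notation r := (qf G x x).

Lemma Im_z1r_ge : eta <= complex.Im (z * (1 + r)).
Proof. by rewrite mulrDr mulr1 cImD lerDl Im_z_qf_ge0. Qed.

Lemma nrm_z1r_ge : eta <= nrm (z * (1 + r)).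
Proof. exact: le_trans Im_z1r_ge (Im_le_nrm _). Qed.

Lemma z_neq0 : z != 0.
Proof. by apply: contraTneq Imz => ->; rewrite ltxx. Qed.

Lemma r1_neq0 : 1 + r != 0.
Proof.
apply/negP => /eqP r0; have := nrm_z1r_ge; rewrite r0 mulr0 nrm0.
by rewrite leNgt Imz.
Qed.

Lemma hermit_rank1 : hermit A'.
Proof. by rewrite /hermit adjmD adjmM adjmK [adjm A]hA. Qed.

Lemma sherman_morrison : G' = G - (1 + r)^-1 *: (G *m x *m adjm x *m G).
Proof.
set B := RHS.
have e : (A' - z%:M) *m B = 1%:M.
  set Y := x *m adjm x *m G.
  have e1 : (A' - z%:M) *m G = 1%:M + Y.
    by rewrite addrAC mulmxDl mulmxV // resolvent_unit.
  have e2 : G *m x *m adjm x *m G = G *m Y by rewrite /Y !mulmxA.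
  have e3 : Y *m Y = r *: Y.
    have -> : Y *m Y = x *m (adjm x *m G *m x) *m (adjm x *m G) by rewrite /Y !mulmxA.
    by rewrite qf_real_scalar mul_mx_scalar -scalemxAl mulmxA.
  rewrite /B e2 mulmxBr -scalemxAr mulmxA e1 mulmxDl mul1mx e3.
  rewrite -[X in _ *: (X + _)]scale1r -scalerDl scalerA mulVf ?r1_neq0 // scale1r.
  by rewrite addrK.
have u := resolvent_unit hermit_rank1 Imz.
by rewrite -[B](mulKmx u) e mulmx1.
Qed.

Lemma trace_rank1 : \tr G' = \tr G - qf (G *m G) x x / (1 + r).
Proof.
rewrite sherman_morrison linearB linearZ /= [\tr (G *m x *m adjm x *m G)](_ : _ = qf (G *m G) x x).
  by rewrite mulrC.
rewrite -mulmxA mxtrace_mulC mulmxA -(mulmxA (adjm x)) qf_real_scalar.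
by rewrite mxtrace_scalar mulr1n.
Qed.

Lemma qf_rank1 : qf G' x x = r / (1 + r).
Proof.
rewrite {1}/qf sherman_morrison mulmxBr mulmxBl submxE -scalemxAr -scalemxAl scalemxE.
rewrite !mulmxA qf_real_scalar -(mulmxA _ G x) -mulmxA (mulmxA (adjm x)) qf_real_scalar.
rewrite -scalar_mxM !mxE /= !mulr1n.
by field; exact: r1_neq0.
Qed.

(** The Ward identity bounds the numerator by Im r / Im z, hence by |1 + r| / Im z: removing a
    column moves the trace by at most 1 / Im z, however long the column is. *)
Lemma nrm_qf_sqr_div_le : nrm (qf (G *m G) x x / (1 + r)) <= eta^-1.
Proof.
have d0 : 0 < nrm (1 + r) by rewrite nrm_gt0 r1_neq0.
rewrite nrmM nrmV ler_pdivrMr //.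
apply: (le_trans (qf_resolvent_sqr_le hA Imz x)).
rewrite mulrC ler_wpM2l ?invr_ge0 ?(ltW Imz) //.
by have := Im_le_nrm (1 + r); rewrite cImD cIm1 add0r.
Qed.

(** The numerator is at most Im r / Im z, and Im(-1 / (1 + r)) = Im r / |1 + r|^2. Averaged over the
    columns, the right side becomes Im(z m_N) / Im z by [Im_zm]. *)
Lemma nrm_qf_sqr_div2_le : nrm (qf (G *m G) x x / (1 + r) ^+ 2) <= complex.Im (- (1 + r)^-1) / eta.
Proof.
have d0 : 0 < nrm (1 + r) by rewrite nrm_gt0 r1_neq0.
rewrite cImN cIm_inv cImD cIm1 add0r nrmM nrmV nrmX.
rewrite -mulNr opprK mulrAC ler_wpM2r ?invr_ge0 ?exprn_ge0 ?nrm_ge0 //.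
exact: qf_resolvent_sqr_le.
Qed.

End RankOne.

(** * Sample covariance matrices with one column removed *)

Section SampleCovariance.
Variable R : realType.
Local Notation C := R[i].
Local Open Scope complex_scope.
Variables (M N : nat) (X : 'M[C]_(M, N)).

Definition scov (P : pred 'I_N) : 'M[C]_M := \sum_(mu | P mu) col mu X *m adjm (col mu X).

Lemma hermit_scov P : hermit (scov P).
Proof.
rewrite /hermit /scov adjm_sum; apply: eq_bigr => mu _.
by rewrite adjmM adjmK.
Qed.

Lemma psd_scov P : psd (scov P).
Proof.
move=> x; rewrite /qf /scov mulmx_sumr mulmx_suml summxE cRe_sum.
apply: sumr_ge0 => mu _.
have -> : adjm x *m (col mu X *m adjm (col mu X)) *m x =
   adjm (adjm (col mu X) *m x) *m (adjm (col mu X) *m x).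
  by rewrite adjmM adjmK !mulmxA.
by rewrite -frob2_cv /= frob2_ge0.
Qed.

Variable z : C.
Hypothesis Imz : 0 < complex.Im z.
Local Notation eta := (complex.Im z).

Definition Gfull := resolvent (scov xpredT) z.
Definition Gmin mu := resolvent (scov (predC1 mu)) z.
Definition rmin mu := qf (Gmin mu) (col mu X) (col mu X).
Definition r2min mu := qf (Gmin mu *m Gmin mu) (col mu X) (col mu X).

Lemma scov_full mu : scov xpredT = scov (predC1 mu) + col mu X *m adjm (col mu X).
Proof. by rewrite /scov (bigD1 mu) //= addrC. Qed.

Lemma rmin1_neq0 mu : 1 + rmin mu != 0.
Proof. by apply: r1_neq0 => //; [exact: hermit_scov | exact: psd_scov]. Qed.

Lemma trace_full mu : \tr Gfull = \tr (Gmin mu) - r2min mu / (1 + rmin mu).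
Proof.
rewrite /Gfull (scov_full mu); apply: trace_rank1 => //; [exact: hermit_scov | exact: psd_scov].
Qed.

(** Both sides are the trace of the covariance matrix times its resolvent: summed over the columns,
    Sherman-Morrison gives r / (1 + r) = 1 - 1 / (1 + r) for each. *)
Lemma scov_trace_identity :
  M%:R + z * \tr Gfull = N%:R - \sum_mu (1 + rmin mu)^-1.
Proof.
have -> : M%:R + z * \tr Gfull = \tr (scov xpredT *m Gfull).
  have u := resolvent_unit (hermit_scov xpredT) Imz.
  have -> : scov xpredT *m Gfull = 1%:M + z *: Gfull.
    transitivity ((scov xpredT - z%:M) *m Gfull + z%:M *m Gfull).
      by rewrite -mulmxDl subrK.
    by rewrite mulmxV // mul_scalar_mx.
  by rewrite linearD linearZ /= mxtrace1.
rewrite /scov mulmx_suml linear_sum /=.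
have -> : N%:R = \sum_(mu : 'I_N) (1 : C) by rewrite sumr_const card_ord.
rewrite -sumrB; apply: eq_bigr => mu _.
rewrite -mulmxA mxtrace_mulC qf_real_scalar mxtrace_scalar mulr1n /Gfull (scov_full mu).
rewrite (qf_rank1 _ (hermit_scov _) (psd_scov _) Imz).
rewrite -/(rmin mu); field; exact: rmin1_neq0.
Qed.

End SampleCovariance.

(** * The self-consistent equation *)

Section SelfConsistent.
Variable R : realType.
Local Notation C := R[i].
Local Open Scope complex_scope.
Variables (M N : nat) (s : R) (w : C).
Hypotheses (N0 : (0 < N)%N) (NM : (N <= M)%N) (s0 : 0 < s) (sMN : s ^+ 2 * M%:R = N%:R).
Local Notation eta := (complex.Im w).
Hypothesis eta0 : 0 < eta.

(* The spectral parameter is centred: the edges of the spectrum sit at w = -2 and w = 2. *)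
Definition zpar : C := (s^-1 + s)%:C + w.
Definition apar : C := 1 + (s ^+ 2)%:C + s%:C * w.
(* The variance (N M)^(-1/2) of an entry. *)
Definition spar : R := s / N%:R.
Definition qpar : R := (N%:R * eta)^-1.
Local Notation z := zpar.
Local Notation a := apar.
Local Notation sp := spar.
Local Notation q := qpar.

Definition scpoly (v : C) : C := 1 + (w + (2 * s)%:C) * v + a * v ^+ 2.

Lemma Nr0 : 0 < N%:R :> R. Proof. by rewrite ltr0n. Qed.
Lemma Im_zpar : complex.Im z = eta.
Proof. by rewrite /z cImD cImR add0r. Qed.
Lemma Im_zpar_gt0 : 0 < complex.Im z. Proof. by rewrite Im_zpar. Qed.
Lemma apar_z : a = s%:C * z.
Proof.
rewrite /a /z mulrDr -rmorphM /= mulrDr mulfV ?gt_eqF // -expr2 rmorphD /= rmorph1.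
by [].
Qed.
Lemma sp_gt0 : 0 < sp. Proof. by rewrite divr_gt0 // Nr0. Qed.
Lemma q_gt0 : 0 < q. Proof. by rewrite invr_gt0 mulr_gt0 // Nr0. Qed.
Lemma nrm_z_sp : nrm z * sp = nrm a / N%:R.
Proof. by rewrite apar_z nrmM nrmR gtr0_norm // /sp mulrCA mulrA. Qed.
Lemma z_neq : z != 0. Proof. exact: (z_neq0 Im_zpar_gt0). Qed.
Lemma s_le1 : s <= 1.
Proof.
have h : (N%:R : R) <= M%:R by rewrite ler_nat.
have : s ^+ 2 * M%:R <= 1 * M%:R by rewrite sMN mul1r.
rewrite ler_pM2r; last by apply: lt_le_trans h; exact: Nr0.
by rewrite expr_le1 // ltW.
Qed.

Variable X : 'M[C]_(M, N).
Local Notation t := (\tr (Gfull X z)).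
Local Notation tau mu := (\tr (Gmin X z mu)).
Local Notation rm mu := (rmin X z mu).
(** The conditional mean of 1 + r given the other columns. [Zmin] is the corresponding fluctuation,
    and [T2min], [Z2min] split the form of the squared resolvent in the same way. *)
Definition Dmin mu : C := 1 + sp%:C * tau mu.
Definition Zmin mu : C := rm mu - sp%:C * tau mu.
Definition T2min mu : C := \tr (Gmin X z mu *m Gmin X z mu).
Definition Z2min mu : C := r2min X z mu - sp%:C * T2min mu.
(** The trace of the M by M resolvent is corrected by the M - N zero eigenvalues, so this is the
    Stieltjes transform of the N by N Gram matrix ([mstj_stj]). *)
Definition mstj : C := (t + (M - N)%:R / z) / N%:R.
(** A version of m_N that does not see column mu. The removed term r2 / (1 + r) is replaced by its
    leading part instead of being dropped; the difference with m_N is then 1/(N eta) times a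
    fluctuation. *)
Definition mhat mu : C := (tau mu - sp%:C * T2min mu / Dmin mu + (M - N)%:R / z) / N%:R.
Local Notation Fm mu := (frob2 (Gmin X z mu)).

Lemma Nc0 : (N%:R : C) != 0.
Proof. by rewrite pnatr_eq0 -lt0n. Qed.

Lemma subMN : ((M - N)%:R : C) = M%:R - N%:R. Proof. by rewrite natrB. Qed.

Lemma mstj_avg : z * mstj = - (\sum_mu (1 + rm mu)^-1) / N%:R.
Proof.
have h := scov_trace_identity X Im_zpar_gt0.
have -> : - (\sum_mu (1 + rm mu)^-1) = M%:R + z * t - N%:R.
  by rewrite h; ring.
rewrite /mstj subMN; field.
by rewrite Nc0 z_neq.
Qed.

Lemma sMNc : (s%:C) ^+ 2 * M%:R = N%:R :> C.
Proof.
have -> : (M%:R : C) = (M%:R : R)%:C by rewrite rmorph_nat.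
by rewrite -rmorphXn -rmorphM sMN rmorph_nat.
Qed.
Lemma sc0 : s%:C != 0 :> C. Proof. by rewrite (inj_eq (@complexI R)) gt_eqF. Qed.
Lemma spC : sp%:C = s%:C / N%:R :> C.
Proof. by rewrite /sp rmorphM fmorphV rmorph_nat. Qed.

Lemma scpoly_mstj : scpoly mstj = 1 + z * mstj * (1 + sp%:C * t).
Proof.
have -> : t = N%:R * mstj - (M - N)%:R / z.
  by rewrite /mstj; field; rewrite Nc0 z_neq.
rewrite /scpoly apar_z spC subMN.
have -> : w = z - (s^-1 + s)%:C by rewrite /z addrAC subrr add0r.
have -> : (s^-1 + s)%:C = (s%:C)^-1 + s%:C :> C by rewrite rmorphD fmorphV.
have -> : (2 * s)%:C = 2 * s%:C :> C by rewrite rmorphM rmorph_nat.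
have e : M%:R = N%:R / (s%:C) ^+ 2 :> C by rewrite -sMNc mulrAC divff ?mul1r // expf_neq0 // sc0.
rewrite e; field.
by rewrite Nc0 z_neq sc0.
Qed.

Lemma rm1 mu : 1 + rm mu = Dmin mu + Zmin mu.
Proof. by rewrite /Dmin /Zmin addrAC addrA subrK. Qed.

Lemma zD_ge mu : eta <= nrm (z * Dmin mu).
Proof.
apply: le_trans (Im_le_nrm _).
rewrite /Dmin mulrDr mulr1 cImD Im_zpar lerDl mulrCA cImZ mulr_ge0 ?(ltW sp_gt0) //.
exact: Im_z_trace_ge0 (hermit_scov _ _) Im_zpar_gt0 (psd_scov _ _).
Qed.

Lemma Dmin_neq0 mu : Dmin mu != 0.
Proof.
apply/negP => /eqP D0; have := zD_ge mu; rewrite D0 mulr0 nrm0.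
by rewrite leNgt eta0.
Qed.

Lemma rm1_neq0 mu : 1 + rm mu != 0.
Proof. exact: rmin1_neq0 Im_zpar_gt0 mu. Qed.

Lemma Im_tau mu : complex.Im (tau mu) = eta * Fm mu.
Proof. by rewrite (Im_trace_resolvent (hermit_scov _ _) Im_zpar_gt0) Im_zpar. Qed.

Lemma spT2_le mu : nrm (sp%:C * T2min mu / Dmin mu) <= eta^-1.
Proof.
have d0 : 0 < nrm (Dmin mu) by rewrite nrm_gt0 Dmin_neq0.
rewrite nrmM nrmV ler_pdivrMr // nrmM nrmR gtr0_norm ?sp_gt0 //.
have h1 : nrm (T2min mu) <= Fm mu.
  exact: nrm_trace_sqr_le.
have h2 : complex.Im (Dmin mu) <= nrm (Dmin mu) := Im_le_nrm _.
rewrite /Dmin cImD cIm1 add0r cImZ Im_tau in h2.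
rewrite [leRHS]mulrC ler_pdivlMr //.
apply: le_trans h2; rewrite -mulrA ler_pM2l ?sp_gt0 // mulrC ler_pM2l //.
Qed.

Lemma trace_diff mu : t - tau mu = - (r2min X z mu / (1 + rm mu)).
Proof. by rewrite (trace_full X Im_zpar_gt0 mu) addrAC subrr add0r. Qed.

Lemma trace_diff_le mu : nrm (t - tau mu) <= eta^-1.
Proof.
rewrite trace_diff nrmN -[X in _ <= X^-1]Im_zpar.
exact: nrm_qf_sqr_div_le (hermit_scov _ _) (psd_scov _ _) Im_zpar_gt0.
Qed.

Lemma mstj_mhat mu : mstj - mhat mu =
  (sp%:C * T2min mu / Dmin mu * (Zmin mu / (1 + rm mu)) - Z2min mu / (1 + rm mu)) / N%:R.
Proof.
have -> : mstj - mhat mu = (t - tau mu + sp%:C * T2min mu / Dmin mu) / N%:R.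
  by rewrite /mstj /mhat; ring.
rewrite trace_diff; congr (_ / _).
have -> : r2min X z mu = Z2min mu + sp%:C * T2min mu by rewrite /Z2min subrK.
have rn := rm1_neq0 mu; rewrite rm1 in rn *.
by field; rewrite rn Dmin_neq0.
Qed.

Lemma mstj_mhat_crude mu : nrm (mstj - mhat mu) <= 2 * q.
Proof.
have -> : mstj - mhat mu = (t - tau mu + sp%:C * T2min mu / Dmin mu) / N%:R.
  by rewrite /mstj /mhat; ring.
have -> : 2 * q = 2 * eta^-1 / N%:R by rewrite /q invfM; ring.
rewrite nrmM nrmV nrm_nat ler_pM2r ?invr_gt0 ?Nr0 //.
apply: (le_trans (nrmD _ _)); rewrite mulr_natl mulr2n.
by apply: lerD; [exact: trace_diff_le | exact: spT2_le].
Qed.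

Lemma mstj_mhat_fine mu (y : R) : nrm (Zmin mu) <= y -> nrm (Z2min mu) <= y / eta ->
  nrm (mstj - mhat mu) <= 2 * q * y / nrm (1 + rm mu).
Proof.
move=> Zy Z2y; have y0 : 0 <= y := le_trans (nrm_ge0 _) Zy.
have d0 : 0 < nrm (1 + rm mu) by rewrite nrm_gt0 rm1_neq0.
rewrite mstj_mhat nrmM nrmV nrm_nat.
have -> : 2 * q * y / nrm (1 + rm mu) = (2 * (y / eta / nrm (1 + rm mu))) / N%:R.
  rewrite /q; field; rewrite ?gt_eqF //; exact: Nr0.
rewrite ler_pM2r ?invr_gt0 ?Nr0 //.
apply: (le_trans (nrmB _ _)); rewrite mulr_natl mulr2n.
apply: lerD; last first.
  by rewrite nrmM nrmV ler_wpM2r // invr_ge0 nrm_ge0.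
rewrite nrmM [nrm (Zmin _ / _)]nrmM nrmV mulrA ler_wpM2r ?invr_ge0 ?nrm_ge0 //.
rewrite mulrC; apply: ler_pM; rewrite ?nrm_ge0 //; exact: spT2_le.
Qed.

(** The part linear in the fluctuations. Each coefficient 1 / D is independent of its own column, so
    each summand averages to zero against any function of the other columns. *)
Definition sc_main : C := (\sum_mu Zmin mu / Dmin mu) / N%:R.
Definition sc_err : C := scpoly mstj - sc_main.

(** P(m_N) is the average of 1 - (1 + sp t) / (1 + r), where t = tau - r2 / (1 + r) and 1 + r = D +
    Z. Expanding Z / (D + Z) to first order in Z leaves exactly these two terms. *)
Lemma sc_errE : sc_err =
  (- (\sum_mu Zmin mu ^+ 2 / (Dmin mu * (1 + rm mu))) +
  sp%:C * \sum_mu r2min X z mu / (1 + rm mu) ^+ 2) / N%:R.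
Proof.
have eP : scpoly mstj = (\sum_mu (1 - (1 + sp%:C * t) / (1 + rm mu))) / N%:R.
  rewrite scpoly_mstj mstj_avg sumrB sumr_const card_ord -mulr_sumr.
  by field; exact: Nc0.
rewrite /sc_err eP /sc_main -mulrBl; congr (_ / _).
rewrite mulr_sumr -sumrB -sumrN -big_split; apply: eq_bigr => mu _ /=.
have -> : t = tau mu - r2min X z mu / (1 + rm mu) by rewrite -trace_diff addrC subrK.
have rn := rm1_neq0 mu; have Dn := Dmin_neq0 mu.
have tE : sp%:C * tau mu = Dmin mu - 1 by rewrite /Dmin addrC addKr.
rewrite mulrBr tE; have -> : Zmin mu = 1 + rm mu - Dmin mu by rewrite rm1 addrC addKr.
field; by rewrite rn Dn.
Qed.

Lemma Im_zm : complex.Im (z * mstj) = (\sum_mu complex.Im (- (1 + rm mu)^-1)) / N%:R.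
Proof.
rewrite mstj_avg.
have -> : - (\sum_mu (1 + rm mu)^-1) / N%:R = (N%:R^-1)%:C * \sum_mu (- (1 + rm mu)^-1) :> C.
  by rewrite sumrN mulrC fmorphV rmorph_nat.
by rewrite cImZ cIm_sum mulrC.
Qed.

Lemma sc_err_le (e : R) :
  (forall mu, nrm (Zmin mu) ^+ 2 / (nrm (Dmin mu) * nrm (1 + rm mu)) <= e) ->
  nrm sc_err <= e + sp / eta * complex.Im (z * mstj).
Proof.
move=> He; rewrite sc_errE nrmM nrmV nrm_nat.
rewrite ler_pdivrMr ?Nr0 // mulrDl; apply: (le_trans (nrmD _ _)); rewrite nrmN.
apply: lerD.
  apply: (le_trans (nrm_sum _ _ _)).
  apply: (@le_trans _ _ (\sum_(mu < N) e)); last by rewrite sumr_const card_ord mulr_natr.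
  by apply: ler_sum => mu _; rewrite nrmM nrmV nrmX nrmM.
rewrite nrmM nrmR gtr0_norm ?sp_gt0 // -(mulrA (sp / eta)) -(mulrA sp) ler_pM2l ?sp_gt0 //.
rewrite Im_zm mulfVK ?gt_eqF ?Nr0 // mulr_sumr.
apply: (le_trans (nrm_sum _ _ _)); apply: ler_sum => mu _.
rewrite [leRHS]mulrC.
have := nrm_qf_sqr_div2_le (col mu X) (hermit_scov X (predC1 mu)) (psd_scov X (predC1 mu)) Im_zpar_gt0.
by rewrite Im_zpar.
Qed.

End SelfConsistent.

(** * The cut-off polynomial and its powers *)

Section KeyPointwise.
Variable R : realType.
Local Notation C := R[i].
Local Open Scope complex_scope.

(** Chosen so that h times it is |h|^(2k+2): an even moment becomes linear in one factor h, and that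
    factor can be expanded by the self-consistent equation. *)
Definition Gam (k : nat) (h : C) : C := h^* ^+ k.+1 * h ^+ k.

Lemma mul_Gam k h : h * Gam k h = ((nrm h ^+ 2) ^+ k.+1)%:C.
Proof.
rewrite rmorphXn /= -mulJ exprMn /Gam mulrCA; congr (_ * _).
by rewrite -exprS.
Qed.

Lemma nrm_Gam k h : nrm (Gam k h) = nrm h ^+ (2 * k).+1.
Proof. by rewrite /Gam nrmM !nrmX nrmJ -exprD; congr (_ ^+ _); lia. Qed.

Lemma nrm_exp_diff n (x y : C) (B : R) : nrm x <= B -> nrm y <= B ->
  nrm (x ^+ n.+1 - y ^+ n.+1) <= n.+1%:R * B ^+ n * nrm (x - y).
Proof.
move=> xB yB; have B0 := le_trans (nrm_ge0 x) xB.
elim: n => [|n IH]; first by rewrite expr0 !mul1r.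
have -> : x ^+ n.+2 - y ^+ n.+2 = x * (x ^+ n.+1 - y ^+ n.+1) + (x - y) * y ^+ n.+1.
  by rewrite (exprS x n.+1) (exprS y n.+1); ring.
apply: (le_trans (nrmD _ _)); rewrite !nrmM nrmX.
have -> : n.+2%:R * B ^+ n.+1 * nrm (x - y) =
   B * (n.+1%:R * B ^+ n * nrm (x - y)) + nrm (x - y) * B ^+ n.+1.
  by rewrite -[n.+2]addn1 natrD exprS; ring.
apply: lerD; first by apply: ler_pM => //; exact: nrm_ge0.
by apply: ler_wpM2l; [exact: nrm_ge0 | apply: lerXn2r; rewrite ?nnegrE ?nrm_ge0].
Qed.

Definition Gam_const k : R := (2 * k.+1)%:R * 2 ^+ (2 * k).

Lemma Gam_diff k (x y : C) :
  nrm (Gam k x - Gam k y) <=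
  Gam_const k * nrm (x - y) * (nrm x ^+ (2 * k) + nrm (x - y) ^+ (2 * k)).
Proof.
set B := nrm x + nrm (x - y).
have xB : nrm x <= B by rewrite lerDl nrm_ge0.
have yB : nrm y <= B.
  by have := nrmD (y - x) x; rewrite subrK nrmBC addrC.
have B0 := le_trans (nrm_ge0 x) xB.
apply: (@le_trans _ _ ((2 * k.+1)%:R * nrm (x - y) * B ^+ (2 * k))); last first.
  rewrite /Gam_const -!mulrA ler_wpM2l // mulrCA ler_wpM2l ?nrm_ge0 //.
  exact: (pow_sum_le (2 * k) (nrm_ge0 x) (nrm_ge0 (x - y))).
have -> : Gam k x - Gam k y =
    (x^* ^+ k.+1 - y^* ^+ k.+1) * x ^+ k + y^* ^+ k.+1 * (x ^+ k - y ^+ k).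
  by rewrite /Gam; ring.
apply: (le_trans (nrmD _ _)); rewrite !nrmM !nrmX nrmJ.
have e1 : nrm (x^* ^+ k.+1 - y^* ^+ k.+1) <= k.+1%:R * B ^+ k * nrm (x - y).
  have := @nrm_exp_diff k (x^*) (y^*) B; rewrite !nrmJ -rmorphB nrmJ; exact.
have Bk : 0 <= B ^+ k by rewrite exprn_ge0.
have e2 : nrm (x ^+ k - y ^+ k) * B <= k.+1%:R * B ^+ k * nrm (x - y).
  case: k Bk e1 => [|k] Bk e1.
    by rewrite subrr nrm0 mul0r !mulr_ge0 ?nrm_ge0.
  have := @nrm_exp_diff k x y B xB yB.
  move=> h; apply: (le_trans (ler_wpM2r B0 h)).
  rewrite mulrAC ler_wpM2r ?nrm_ge0 // -mulrA -exprSr ler_wpM2r // ler_nat //.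
apply: (@le_trans _ _ (k.+1%:R * B ^+ k * nrm (x - y) * B ^+ k + B ^+ k * (k.+1%:R * B ^+ k * nrm (x - y)))).
  apply: lerD.
    by apply: ler_pM; rewrite ?nrm_ge0 ?exprn_ge0 ?nrm_ge0 // lerXn2r ?nnegrE ?nrm_ge0.
  rewrite exprSr -mulrA; apply: ler_pM; rewrite ?exprn_ge0 ?mulr_ge0 ?nrm_ge0 //.
    by rewrite lerXn2r ?nnegrE ?nrm_ge0.
  by apply: le_trans e2; rewrite mulrC ler_wpM2l ?nrm_ge0.
rewrite (mulnC 2 k) exprM natrM; lra.
Qed.

Variables (M N : nat) (s : R) (w : C).
Hypotheses (N0 : (0 < N)%N) (NM : (N <= M)%N) (s0 : 0 < s) (sMN : s ^+ 2 * M%:R = N%:R).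
Local Notation eta := (complex.Im w).
Hypothesis eta0 : 0 < eta.
Local Notation z := (zpar s w).
Local Notation a := (apar s w).
Local Notation sp := (spar N s).
Local Notation q := (qpar N w).

Variables (m0 : C) (l : R).
Hypotheses (m0P : scpoly s w m0 = 0) (l0 : 0 < l) (ql : q <= l).
(** The derivative of [scpoly] at m0; at the root given by the limit law it is a square root of w^2
    - 4 ([mp_rho]). *)
Definition rhopar (m0 : C) : C := w + (2 * s)%:C + 2 * (a * m0).
Local Notation rho := (rhopar m0).

Lemma scpoly_factor v : scpoly s w v = (v - m0) * (a * (v - m0) + rho).
Proof.
rewrite -[LHS]subr0 -m0P /scpoly /rhopar; ring.
Qed.

(** Equal to 1 up to l and to 0 from 2 l on. It stands in for the indicator of |m_N - m0| <= l
    because passing from m_N to [mhat] must change it only a little. *)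
Definition chi (x : R) : R := Num.max 0 (Num.min 1 (2 - x / l)).
Definition hcut (v : C) : C := (chi (nrm (v - m0)))%:C * scpoly s w v.

Lemma chi_ge0 x : 0 <= chi x. Proof. by rewrite /chi le_max lexx. Qed.
Lemma chi_le1 x : chi x <= 1.
Proof. by rewrite /chi ge_max ler01 ge_min lexx. Qed.
Lemma chi1 x : x <= l -> chi x = 1.
Proof.
move=> xl; rewrite /chi.
have : x / l <= 1 by rewrite ler_pdivrMr // mul1r.
move=> h; rewrite min_l; last by lra.
by rewrite max_r // ler01.
Qed.
Lemma chi0 x : 2 * l <= x -> chi x = 0.
Proof.
move=> xl; rewrite /chi; have h : 2 <= x / l by rewrite ler_pdivlMr.
by rewrite max_l // ge_min; apply/orP; right; lra.
Qed.
Lemma chi_lip x y : `|chi x - chi y| <= `|x - y| / l.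
Proof.
have -> : `|x - y| / l = `|x / l - y / l|.
  by rewrite -mulrBl normrM (@gtr0_norm _ l^-1) // invr_gt0.
rewrite /chi; move: (x / l) (y / l) => u v.
have b1 := ler_norm (u - v); have := ler_norm (- (u - v)); rewrite normrN => b2.
rewrite ler_norml.
have [h1|h1] := leP (2 - u) 1; have [h2|h2] := leP (2 - v) 1;
 rewrite ?(max_r ler01); have [h3|h3] := leP 0 (2 - u); have [h4|h4] := leP 0 (2 - v);
 apply/andP; split; lra.
Qed.

Lemma nrm_hcut_le v : nrm (hcut v) <= 2 * l * (nrm rho + nrm a * (2 * l)).
Proof.
have rh0 := nrm_ge0 rho; have a0 := nrm_ge0 a.
rewrite /hcut nrmM nrmR (ger0_norm (chi_ge0 _)).
case: (leP (2 * l) (nrm (v - m0))) => [h|h].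
  by rewrite chi0 // mul0r !mulr_ge0 ?addr_ge0 ?mulr_ge0 // ltW.
apply: (@le_trans _ _ (1 * nrm (scpoly s w v))).
  by rewrite ler_wpM2r ?nrm_ge0 ?chi_le1.
rewrite mul1r scpoly_factor nrmM; apply: ler_pM; rewrite ?nrm_ge0 ?(ltW h) //.
apply: (le_trans (nrmD _ _)); rewrite addrC lerD2l nrmM ler_wpM2l //; exact: ltW.
Qed.

(** The slope 1 / l of the cut-off is compensated by [scpoly], which is of order l (|rho| + |a| l)
    on the disc. The radius 6 l leaves room for |m_N - m0| <= 4 l and a further distance 2 l to
    [mhat]. *)
Lemma hcut_lip v v' : nrm (v - m0) <= 6 * l -> nrm (v' - m0) <= 6 * l ->
  nrm (hcut v - hcut v') <= 48 * nrm (v - v') * (nrm rho + nrm a * l).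
Proof.
move=> hv hv'.
set x := v - m0 in hv *; set y := v' - m0 in hv' *.
have xy : v - v' = x - y by rewrite /x /y; ring.
have -> : hcut v - hcut v' = (chi (nrm x))%:C * (scpoly s w v - scpoly s w v')
   + (chi (nrm x) - chi (nrm y))%:C * scpoly s w v'.
  by rewrite /hcut -/x -/y rmorphB; ring.
apply: (le_trans (nrmD _ _)); rewrite !nrmM !nrmR (ger0_norm (chi_ge0 _)).
have -> : scpoly s w v - scpoly s w v' = (x - y) * (a * (x + y) + rho).
  by rewrite !scpoly_factor -/x -/y; ring.
rewrite (scpoly_factor v') -/y xy.
have rh0 := nrm_ge0 rho; have a0 := nrm_ge0 a; have d0 := nrm_ge0 (x - y).
have e1 : nrm (a * (x + y) + rho) <= nrm a * (12 * l) + nrm rho.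
  apply: (le_trans (nrmD _ _)); rewrite lerD2r nrmM ler_wpM2l //.
  by apply: (le_trans (nrmD _ _)); lra.
have e2 : nrm (a * y + rho) <= nrm a * (6 * l) + nrm rho.
  by apply: (le_trans (nrmD _ _)); rewrite lerD2r nrmM ler_wpM2l.
have e3 : `|chi (nrm x) - chi (nrm y)| * l <= nrm (x - y).
  rewrite -ler_pdivlMr //; apply: (le_trans (chi_lip _ _)).
  rewrite ler_pM2r ?invr_gt0 // ler_norml; apply/andP; split.
    by have := nrmB_ge y x; rewrite (nrmBC y x); lra.
  exact: nrmB_ge.
have al0 : 0 <= nrm a * l by rewrite mulr_ge0 // ltW.
apply: (@le_trans _ _ (nrm (x - y) * (nrm a * (12 * l) + nrm rho) +
   (`|chi (nrm x) - chi (nrm y)| * l) * (6 * (nrm a * (6 * l) + nrm rho)))).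
  apply: lerD.
    apply: (@le_trans _ _ (1 * nrm ((x - y) * (a * (x + y) + rho)))).
      by rewrite ler_wpM2r ?nrm_ge0 ?chi_le1.
    by rewrite mul1r nrmM ler_wpM2l.
  rewrite -mulrA ler_wpM2l // nrmM.
  rewrite (_ : l * _ = (6 * l) * (nrm a * (6 * l) + nrm rho)); last by ring.
  by apply: ler_pM; rewrite ?nrm_ge0.
apply: (@le_trans _ _ (nrm (x - y) * (nrm a * (12 * l) + nrm rho) +
   nrm (x - y) * (6 * (nrm a * (6 * l) + nrm rho)))).
  by rewrite lerD2l; apply: ler_wpM2r => //; lra.
rewrite -mulrDr [leRHS](_ : _ = nrm (x - y) * (48 * (nrm rho + nrm a * l))); last by ring.
by apply: ler_wpM2l => //; lra.
Qed.

End KeyPointwise.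

(** * Pointwise estimates when the large deviation bounds hold *)

Section PointwiseRecursion.
Variable R : realType.
Local Notation C := R[i].
Local Open Scope complex_scope.

Definition young_const k : R := (Gam_const R k + 1) * (2 + (4 * (Gam_const R k + 1)) ^+ (2 * k).+1).

Lemma Gam_const_ge0 k : 0 <= Gam_const R k.
Proof. by rewrite /Gam_const mulr_ge0 // exprn_ge0. Qed.

(** If x is at least [B * b], each term containing x is absorbed by a quarter of x^(2k+2); otherwise
    x itself is at most a multiple of b. *)
Lemma young_pow k (x b : R) : 0 <= x -> 0 <= b ->
  Gam_const R k * b ^+ 2 * (x ^+ (2 * k) + b ^+ (2 * k)) + b * x ^+ (2 * k).+1 <=
  1 / 2 * (x ^+ 2) ^+ k.+1 + young_const k * b ^+ (2 * k).+2.
Proof.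
move=> x0 b0; have G0 := Gam_const_ge0 k.
rewrite /young_const; set G := Gam_const R k in G0 *.
set B := 4 * (G + 1).
have B4 : 4 <= B by rewrite /B; lra.
rewrite -exprM (_ : (2 * k.+1)%N = (2 * k).+2); last by lia.
rewrite [b ^+ (2 * k).+2]exprS [b ^+ (2 * k).+1]exprS [x ^+ (2 * k).+2]exprS [x ^+ (2 * k).+1]exprS.
set n := (2 * k)%N.
have bn0 : 0 <= b ^+ n by rewrite exprn_ge0.
have xn0 : 0 <= x ^+ n by rewrite exprn_ge0.
have Bn1 : 1 <= B ^+ n by rewrite exprn_ege1 //; lra.
have [h|h] := leP (B * b) x.
- have e1 : G * b ^+ 2 * x ^+ n <= 1 / 4 * (x * (x * x ^+ n)).
    have : G * b ^+ 2 <= 1 / 4 * x ^+ 2.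
      have hb : 4 * b <= x by nra.
      have : 4 * G * b <= x by apply: le_trans h; rewrite /B; nra.
      nra.
    by rewrite expr2 => hh; nra.
  have e2 : b * (x * x ^+ n) <= 1 / 4 * (x * (x * x ^+ n)).
    have xx : 0 <= x * x ^+ n by rewrite mulr_ge0.
    have hb : 4 * b <= x by nra.
    by have := ler_wpM2r xx hb; lra.
  have e3 : 0 <= (G + 1) * (2 + B ^+ n.+1) * (b * (b * b ^+ n)) - G * b ^+ 2 * b ^+ n.
    have bb : 0 <= b * (b * b ^+ n) by rewrite !mulr_ge0.
    have B1 : 0 <= B ^+ n.+1 by rewrite exprn_ge0 //; lra.
    have -> : G * b ^+ 2 * b ^+ n = G * (b * (b * b ^+ n)) by ring.
    rewrite -mulrBl mulr_ge0 //.
    have : 0 <= (G + 1) * B ^+ n.+1 by rewrite mulr_ge0 //; lra.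
    by lra.
  by lra.
- have hn : x ^+ n <= B ^+ n * b ^+ n.
    by rewrite -exprMn; apply: lerXn2r; rewrite ?nnegrE ?mulr_ge0 ?(ltW h) //; lra.
  have hx : 0 <= 1 / 2 * (x * (x * x ^+ n)) by rewrite !mulr_ge0.
  have bb : 0 <= b * (b * b ^+ n) by rewrite !mulr_ge0.
  have e1 : G * b ^+ 2 * x ^+ n <= G * B ^+ n * (b * (b * b ^+ n)).
    have -> : G * B ^+ n * (b * (b * b ^+ n)) = G * b ^+ 2 * (B ^+ n * b ^+ n) by ring.
    by rewrite ler_wpM2l // mulr_ge0 // exprn_ge0.
  have e2 : b * (x * x ^+ n) <= B ^+ n.+1 * (b * (b * b ^+ n)).
    have -> : B ^+ n.+1 * (b * (b * b ^+ n)) = b * ((B * b) * (B ^+ n * b ^+ n)).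
      by rewrite exprS; ring.
    by rewrite ler_wpM2l //; apply: ler_pM => //; exact: ltW.
  have e3 : B ^+ n <= B ^+ n.+1 by rewrite exprS ler_peMl //; lra.
  have -> : G * b ^+ 2 * (x ^+ n + b ^+ n) = G * b ^+ 2 * x ^+ n + G * (b * (b * b ^+ n)) by ring.
  have e4 : G * B ^+ n * (b * (b * b ^+ n)) <= G * B ^+ n.+1 * (b * (b * b ^+ n)).
    by rewrite ler_wpM2r // ler_wpM2l.
  have e5 : 0 <= G * (b * (b * b ^+ n)) by rewrite mulr_ge0.
  lra.
Qed.

Variables (M N : nat) (s : R) (w : C).
Hypotheses (N0 : (0 < N)%N) (NM : (N <= M)%N) (s0 : 0 < s) (sMN : s ^+ 2 * M%:R = N%:R).
Local Notation eta := (complex.Im w).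
Hypothesis eta0 : 0 < eta.
Local Notation z := (zpar s w).
Local Notation a := (apar s w).
Local Notation sp := (spar N s).
Local Notation q := (qpar N w).
Variable X : 'M[C]_(M, N).
Local Notation t := (\tr (Gfull X z)).
Local Notation tau mu := (\tr (Gmin X z mu)).
Local Notation m := (mstj s w X).
Local Notation Fm mu := (frob2 (Gmin X z mu)).
Local Notation Zm mu := (Zmin s w X mu).
Local Notation Z2m mu := (Z2min s w X mu).
Local Notation Dm mu := (Dmin s w X mu).
Local Notation rm mu := (rmin X z mu).

(** The Ward identity makes the Frobenius norm Im tau / eta, and tau is within 1 / eta of the full
    trace. The term 1/N is the contribution of the M - N zero eigenvalues, as s^2 (M - N) <= N. *)
Lemma zF_le mu : (nrm z * sp) ^+ 2 * Fm mu <=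
  nrm a ^+ 2 * q * complex.Im m + N%:R^-1 + nrm a ^+ 2 * q ^+ 2.
Proof.
have Nr := Nr0 R N0.
have z0 : 0 < nrm z by rewrite nrm_gt0 (z_neq s eta0).
have az : nrm a = s * nrm z by rewrite (apar_z w s0) nrmM nrmR gtr0_norm.
have eF : Fm mu = complex.Im (tau mu) / eta.
  by rewrite (Im_tau s eta0 X mu) mulrAC divff ?mul1r // gt_eqF.
have h1 : complex.Im (tau mu) <= complex.Im t + eta^-1.
  have := le_trans (le_Im_nrm _) (trace_diff_le s eta0 X mu).
  by rewrite cImB ler_norml => /andP[]; lra.
have h2 : complex.Im t = N%:R * complex.Im m + (M - N)%:R * eta / nrm z ^+ 2.
  have -> : t = (N%:R : R)%:C * m - ((M - N)%:R : R)%:C * z^-1.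
    rewrite /mstj !rmorph_nat; field; rewrite (Nc0 R N0) ?(z_neq s eta0) //.
  by rewrite cImB !cImZ cIm_inv Im_zpar; ring.
have h3 : nrm z * sp = nrm a / N%:R by exact: nrm_z_sp.
have h4 : s ^+ 2 * (M - N)%:R / N%:R <= 1.
  rewrite ler_pdivrMr // mul1r natrB // mulrBr sMN lerBlDr lerDl.
  by rewrite mulr_ge0 // exprn_ge0 // ltW.
rewrite eF mulrA ler_pdivrMr //.
apply: (le_trans (ler_wpM2l (exprn_ge0 2 _) h1)).
  by rewrite mulr_ge0 ?nrm_ge0 // ltW // sp_gt0.
rewrite h2 h3 /q.
have -> : (nrm a ^+ 2 * (N%:R * eta)^-1 * complex.Im m + N%:R^-1 + nrm a ^+ 2 * (N%:R * eta)^-1 ^+ 2) * eta =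
  (nrm a / N%:R) ^+ 2 * (N%:R * complex.Im m + eta^-1) + N%:R^-1 * eta * 1.
  by field; rewrite !gt_eqF.
have -> : N%:R * complex.Im m + (M - N)%:R * eta / nrm z ^+ 2 + eta^-1 =
  (N%:R * complex.Im m + eta^-1) + (M - N)%:R * eta / nrm z ^+ 2 by ring.
rewrite mulrDr lerD2l.
have -> : (nrm a / N%:R) ^+ 2 * ((M - N)%:R * eta / nrm z ^+ 2) =
   N%:R^-1 * eta * (s ^+ 2 * (M - N)%:R / N%:R).
  by rewrite az; field; rewrite !gt_eqF.
by rewrite ler_wpM2l // mulr_ge0 ?invr_ge0 // ltW.
Qed.

Variables (m0 : C) (l : R).
Hypotheses (m0P : scpoly s w m0 = 0) (l0 : 0 < l) (ql : q <= l).
Local Notation rho := (rhopar s w m0).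
Local Notation Lam := (m - m0).
Variables (A c0 L g : R).
Hypotheses (Im0 : 0 <= complex.Im m0) (A0 : complex.Im m0 <= A) (c00 : 0 < c0) (L1 : 1 <= L) (g1 : 1 <= g).
Hypothesis (aL : nrm a <= 2 * L).
Hypothesis Hm : nrm Lam <= 4 * l -> c0 * L <= nrm (z * (1 + sp%:C * t)).

(** The right side of [zF_le] with Im m_N replaced by A + 4 l. From it [Sbd] bounds |z Z| and [psi]
    bounds |Z / D|; g is the loss in the large deviation bounds. *)
Definition Phi : R := nrm a ^+ 2 * q * (A + 4 * l) + N%:R^-1 + nrm a ^+ 2 * q ^+ 2.
Definition Sbd : R := g * Num.sqrt Phi.
Definition psi : R := 4 * Sbd / (c0 * L).
Hypothesis (aq : nrm a * q <= c0 * L / 4) (Ssm : Sbd <= c0 * L / 4).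

Hypothesis lde1 : forall mu, nrm (Zm mu) <= g * sp * Num.sqrt (Fm mu).
Hypothesis lde2 : forall mu, nrm (Z2m mu) <= g * sp * Num.sqrt (Fm mu) / eta.

Definition errbd : R := psi ^+ 2 + nrm a * q * (A + 4 * l) + sp * (nrm m0 + 4 * l).

Section Local.
Hypothesis Lam4 : nrm Lam <= 4 * l.

Lemma Im_m_le : complex.Im m <= A + 4 * l.
Proof.
have -> : m = m0 + Lam by rewrite addrC subrK.
rewrite cImD; apply: lerD => //; exact: le_trans (Im_le_nrm _) Lam4.
Qed.

Lemma zy_le mu : nrm z * (g * sp * Num.sqrt (Fm mu)) <= Sbd.
Proof.
have sp0 := sp_gt0 N0 s0.
have zs : 0 <= nrm z * sp by rewrite mulr_ge0 ?nrm_ge0 // ltW.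
rewrite (_ : nrm z * _ = g * (nrm z * sp * Num.sqrt (Fm mu))); last by ring.
have g0 : 0 <= g := le_trans ler01 g1.
rewrite /Sbd ler_wpM2l //.
rewrite -[X in X * _](ger0_norm zs) -sqrtr_sqr -sqrtrM ?sqr_ge0 //.
rewrite ler_wsqrtr //; apply: (le_trans (zF_le mu)).
rewrite /Phi !lerD2r ler_wpM2l ?Im_m_le //.
by rewrite mulr_ge0 ?exprn_ge0 ?nrm_ge0 // ltW // (q_gt0 N0 eta0).
Qed.

Lemma c0n : c0 != 0. Proof. by rewrite gt_eqF. Qed.
Lemma Ln : L != 0. Proof. by rewrite gt_eqF // (lt_le_trans ltr01 L1). Qed.
Lemma cL0 : 0 < c0 * L. Proof. by rewrite mulr_gt0 // (lt_le_trans ltr01 L1). Qed.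

Lemma zD_lower mu : 3 / 4 * (c0 * L) <= nrm (z * Dm mu).
Proof.
have -> : z * Dm mu = z * (1 + sp%:C * t) - z * sp%:C * (t - tau mu).
  by rewrite /Dmin; ring.
apply: le_trans (nrmB_ge _ _).
have h1 := Hm Lam4.
have h2 : nrm (z * sp%:C * (t - tau mu)) <= nrm a * q.
  rewrite !nrmM nrmR gtr0_norm ?(sp_gt0 N0 s0) // (nrm_z_sp N w s0).
  rewrite /q invfM mulrA ler_wpM2l ?mulr_ge0 ?nrm_ge0 ?invr_ge0 //.
  exact: trace_diff_le.
by move: aq h1 h2; lra.
Qed.

Lemma zZ_le mu : nrm (z * Zm mu) <= Sbd.
Proof. by rewrite nrmM; apply: le_trans (zy_le mu); rewrite ler_wpM2l ?nrm_ge0. Qed.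

Lemma zr_lower mu : 1 / 2 * (c0 * L) <= nrm (z * (1 + rm mu)).
Proof.
rewrite rm1 mulrDr; apply: le_trans (nrmD_ge _ _).
by have := zD_lower mu; have := zZ_le mu; move: Ssm; lra.
Qed.

Lemma Sbd_ge0 : 0 <= Sbd. Proof. by rewrite mulr_ge0 ?sqrtr_ge0 // (le_trans ler01 g1). Qed.
Lemma psi_ge0 : 0 <= psi.
Proof. by apply: divr_ge0; [apply: mulr_ge0 => //; exact: Sbd_ge0 | exact: ltW cL0]. Qed.

Lemma zn0 : 0 < nrm z. Proof. by rewrite nrm_gt0 (z_neq s eta0). Qed.

Lemma ZD_le mu : nrm (Zm mu / Dm mu) <= psi.
Proof.
have c := cL0; have S0 := Sbd_ge0.
have d0 : 0 < nrm (z * Dm mu) by apply: lt_le_trans (zD_lower mu); lra.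
have -> : Zm mu / Dm mu = (z * Zm mu) / (z * Dm mu).
  by rewrite -mulf_div divff ?mul1r // (z_neq s eta0).
rewrite [nrm (_ / _)]nrmM nrmV ler_pdivrMr //.
apply: (le_trans (zZ_le mu)).
apply: (@le_trans _ _ (psi * (3 / 4 * (c0 * L)))).
  rewrite /psi (_ : 4 * Sbd / (c0 * L) * _ = 3 * Sbd); first by lra.
  by field; rewrite ?c0n ?Ln.
by rewrite ler_wpM2l ?psi_ge0 ?zD_lower.
Qed.

Lemma mhat_le mu : nrm (m - mhat s w X mu) <= psi * q.
Proof.
have c := cL0; have S0 := Sbd_ge0; have q0 := q_gt0 N0 eta0.
apply: (le_trans (mstj_mhat_fine N0 s0 eta0 (lde1 mu) (lde2 mu))).
set y := g * sp * _; have zn := zn0; have zy := zy_le mu; rewrite -/y in zy.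
have r0 : 0 < nrm (1 + rm mu).
  by rewrite nrm_gt0 (rm1_neq0 s eta0 X mu).
rewrite ler_pdivrMr //.
have zr := zr_lower mu; rewrite nrmM in zr.
have e : nrm z * (2 * q * y) <= nrm z * (psi * q * nrm (1 + rm mu)).
  apply: (@le_trans _ _ (2 * q * Sbd)).
    by rewrite mulrCA ler_wpM2l // mulr_ge0 // ltW.
  rewrite (_ : nrm z * _ = psi * q * (nrm z * nrm (1 + rm mu))); last by ring.
  apply: (@le_trans _ _ (psi * q * (1 / 2 * (c0 * L)))).
    rewrite /psi le_eqVlt; apply/orP; left; apply/eqP.
    by field; rewrite ?c0n ?Ln.
  by rewrite ler_wpM2l // mulr_ge0 ?psi_ge0 // ltW.
by rewrite ler_pM2l in e.
Qed.

Lemma err_le : nrm (sc_err s w X) <= errbd.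
Proof.
have c := cL0; have S0 := Sbd_ge0; have q0 := q_gt0 N0 eta0; have sp0 := sp_gt0 N0 s0.
have zn := zn0.
have e1 mu : nrm (Zm mu) ^+ 2 / (nrm (Dm mu) * nrm (1 + rm mu)) <= psi ^+ 2.
  have dd : 0 < nrm (z * Dm mu) * nrm (z * (1 + rm mu)).
    rewrite mulr_gt0 //; first by apply: lt_le_trans (zD_lower mu); lra.
    by apply: lt_le_trans (zr_lower mu); lra.
  have -> : nrm (Zm mu) ^+ 2 / (nrm (Dm mu) * nrm (1 + rm mu)) =
     nrm (z * Zm mu) ^+ 2 / (nrm (z * Dm mu) * nrm (z * (1 + rm mu))).
    rewrite !nrmM; field.
    have D0 : nrm (Dm mu) != 0 by rewrite nrm_eq0 (Dmin_neq0 N0 s0 eta0).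
    have r0 : nrm (1 + rm mu) != 0 by rewrite nrm_eq0 (rm1_neq0 s eta0).
    by rewrite D0 r0 gt_eqF.
  rewrite ler_pdivrMr //.
  apply: (@le_trans _ _ (Sbd ^+ 2)).
    by rewrite lerXn2r ?nnegrE ?nrm_ge0 // zZ_le.
  apply: (@le_trans _ _ (psi ^+ 2 * (3 / 4 * (c0 * L) * (1 / 2 * (c0 * L))))).
    rewrite (_ : psi ^+ 2 * _ = 6 * Sbd ^+ 2); first by have := sqr_ge0 Sbd; lra.
    by rewrite /psi; field; rewrite ?c0n ?Ln.
  apply: ler_wpM2l; first by rewrite exprn_ge0 // psi_ge0.
  by apply: ler_pM; rewrite ?zD_lower ?zr_lower //; lra.
apply: (le_trans (sc_err_le N0 NM s0 sMN eta0 e1)).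
rewrite /errbd -addrA lerD2l.
have hm : nrm m <= nrm m0 + 4 * l.
  have -> : m = m0 + Lam by rewrite addrC subrK.
  by apply: (le_trans (nrmD _ _)); rewrite lerD2l.
apply: (@le_trans _ _ (sp / eta * (nrm z * (A + 4 * l) + eta * (nrm m0 + 4 * l)))).
  apply: ler_wpM2l; first by apply: divr_ge0; exact: ltW.
  rewrite cImM Im_zpar; apply: lerD.
    apply: (@le_trans _ _ (nrm z * `|complex.Im m|)).
      apply: (le_trans (ler_norm _)); rewrite normrM ler_wpM2r //; exact: le_Re_nrm.
    rewrite ler_wpM2l ?nrm_ge0 // ler_norml Im_m_le andbT.
    have -> : m = m0 + Lam by rewrite addrC subrK.
    have := le_trans (le_Im_nrm _) Lam4; rewrite cImD ler_norml => /andP[]; move: Im0 A0; lra.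
  rewrite ler_wpM2l ?(ltW eta0) //; exact: le_trans (Re_le_nrm _) hm.
rewrite mulrDr (_ : sp / eta * (eta * _) = sp * (nrm m0 + 4 * l)); last first.
  by field; rewrite gt_eqF.
rewrite lerD2r (_ : sp / eta * (nrm z * _) = (nrm z * sp) / eta * (A + 4 * l)); last by ring.
rewrite (nrm_z_sp N w s0) /q invfM -!mulrA lexx //.
Qed.

End Local.

Variables (k : nat) (b : R).
Definition hfun v := hcut s w m0 l v.
Definition del : R := 48 * (psi * q) * (nrm rho + nrm a * l).
Hypotheses (b0 : 0 <= b) (pdb : psi * del <= b ^+ 2) (db : del <= b) (eb : errbd <= b).

(** Beyond 4 l both cut-offs vanish, since [mhat] is within 2 q <= 2 l of m_N. Within 4 l each
    replacement of m_N by [mhat] costs [del], multiplied by |Z / D| <= [psi]; [young_pow] trades the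
    result for half of the quantity being estimated. *)
Lemma recursion_good :
  complex.Re ((\sum_mu Zm mu / Dm mu * (Gam k (hfun m) - Gam k (hfun (mhat s w X mu)))) / N%:R)
  + complex.Re (sc_err s w X * Gam k (hfun m)) <=
  1 / 2 * (nrm (hfun m) ^+ 2) ^+ k.+1 + young_const k * b ^+ (2 * k).+2.
Proof.
have Nr := Nr0 R N0.
have q0 := q_gt0 N0 eta0.
have yc0 : 0 <= young_const k.
  have G0 := Gam_const_ge0 k; rewrite /young_const mulr_ge0 //; first by lra.
  by rewrite addr_ge0 // exprn_ge0 // mulr_ge0 //; lra.
have [h|h] := leP (nrm Lam) (4 * l); last first.
  have h0 v : 2 * l <= nrm (v - m0) -> hfun v = 0.
    by move=> hv; rewrite /hfun /hcut chi0 // mul0r.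
  have G0 : Gam k (0 : C) = 0 by rewrite /Gam rmorph0 expr0n /= mul0r.
  rewrite (h0 m); last by move: h; have := l0; lra.
  rewrite G0 mulr0 [complex.Re 0]/= addr0 big1 => [|mu _].
    rewrite mul0r [complex.Re 0]/=; apply: addr_ge0; apply: mulr_ge0 => //.
      by rewrite exprn_ge0 // exprn_ge0 // nrm_ge0.
    by rewrite exprn_ge0.
  rewrite h0 ?G0 ?subrr ?mulr0 //.
  have h1 := mstj_mhat_crude N0 s0 eta0 X mu.
  have -> : mhat s w X mu - m0 = Lam - (m - mhat s w X mu) by ring.
  by apply: le_trans (nrmB_ge _ _); move: h h1 ql l0; lra.
apply: le_trans (young_pow k (nrm_ge0 _) b0).
apply: lerD; last first.
  apply: (le_trans (Re_le_nrm _)); rewrite nrmM nrm_Gam ler_wpM2r ?exprn_ge0 ?nrm_ge0 //.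
  exact: le_trans (err_le h) eb.
apply: (le_trans (Re_le_nrm _)); rewrite nrmM nrmV nrm_nat ler_pdivrMr //.
apply: (le_trans (nrm_sum _ _ _)).
rewrite mulr_natr -[X in _ *+ X](card_ord N) -sumr_const; apply: ler_sum => mu _.
rewrite nrmM.
set d := nrm (hfun m - hfun (mhat s w X mu)).
have mh : nrm (m - mhat s w X mu) <= 2 * l.
  by have := mstj_mhat_crude N0 s0 eta0 X mu; move: ql; lra.
have dd : d <= del.
  apply: (le_trans (hcut_lip m0P l0 _ _)).
  - by move: h l0; lra.
  - have -> : mhat s w X mu - m0 = Lam - (m - mhat s w X mu) by ring.
    by apply: (le_trans (nrmB _ _)); move: h mh l0; lra.
  rewrite /del ler_wpM2r //; last by rewrite ler_wpM2l // mhat_le.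
  by rewrite addr_ge0 ?nrm_ge0 // mulr_ge0 ?nrm_ge0 // ltW.
have d0 : 0 <= d by exact: nrm_ge0.
have p0 := psi_ge0; have G0 := Gam_const_ge0 k.
apply: (@le_trans _ _ (psi * (Gam_const R k * d * (nrm (hfun m) ^+ (2 * k) + d ^+ (2 * k))))).
  by apply: ler_pM; rewrite ?nrm_ge0 ?ZD_le // Gam_diff.
rewrite (_ : psi * _ = Gam_const R k * (psi * d) * (nrm (hfun m) ^+ (2 * k) + d ^+ (2 * k))); last by ring.
apply: ler_pM.
- by apply: mulr_ge0 => //; exact: mulr_ge0.
- by rewrite addr_ge0 // exprn_ge0 // nrm_ge0.
- rewrite ler_wpM2l //; apply: le_trans pdb; rewrite ler_wpM2l //.
- rewrite lerD2l lerXn2r ?nnegrE //; exact: le_trans dd db.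
Qed.

End PointwiseRecursion.

Lemma two_mulnS k : (2 * k.+1)%N = (2 * k).+2. Proof. lia. Qed.

(** * The moment recursion for the self-consistent equation *)

Section KeyProposition.
Variable R : realType.
Local Notation C := R[i].
Local Open Scope complex_scope.
Variables (M N : nat) (s : R) (w : C).
Hypotheses (N0 : (0 < N)%N) (NM : (N <= M)%N) (s0 : 0 < s) (sMN : s ^+ 2 * M%:R = N%:R).
Local Notation eta := (complex.Im w).
Hypothesis eta0 : 0 < eta.
Local Notation z := (zpar s w).
Local Notation a := (apar s w).
Local Notation sp := (spar N s).
Local Notation q := (qpar N w).

Variables (V : finType) (p : 'I_M -> 'I_N -> V -> R) (xv : 'I_M -> 'I_N -> V -> C) (c : nat -> R).
Hypothesis cm : forall mu, column_model (fun i => p i mu) (fun i => xv i mu) sp c.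

(** Outcomes are grouped by columns, so that [fE_fubini] resamples a whole column as a single
    coordinate. *)
Local Notation Om := {ffun 'I_N -> {ffun 'I_M -> V}}.
Definition wt : Om -> R := pw (fun mu => pw (fun i => p i mu)).
Definition Xmat (o : Om) : 'M[C]_(M, N) := \matrix_(i, mu) xv i mu (o mu i).

Lemma pcol_ge0 mu (sg : {ffun 'I_M -> V}) : 0 <= pw (fun i => p i mu) sg.
Proof. exact: pw_ge0 (cm_ge0 (cm mu)) sg. Qed.
Lemma pcol_sum1 mu : \sum_sg pw (fun i => p i mu) sg = 1.
Proof. exact: pw_sum1 (cm_sum1 (cm mu)). Qed.
Lemma wt_ge0 o : 0 <= wt o. Proof. exact: pw_ge0 pcol_ge0 o. Qed.
Lemma wt_sum1 : \sum_o wt o = 1. Proof. exact: pw_sum1 pcol_sum1. Qed.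

Lemma col_upd_neq o mu sg nu : nu != mu -> col nu (Xmat (upd o mu sg)) = col nu (Xmat o).
Proof. by move=> h; apply/colP => i; rewrite !mxE upd_neq. Qed.

Lemma Gmin_upd o mu sg : Gmin (Xmat (upd o mu sg)) z mu = Gmin (Xmat o) z mu.
Proof.
rewrite /Gmin (_ : scov (Xmat (upd o mu sg)) (predC1 mu) = scov (Xmat o) (predC1 mu)) //.
by apply: eq_bigr => nu nm; rewrite col_upd_neq.
Qed.
Lemma Dmin_upd o mu sg : Dmin s w (Xmat (upd o mu sg)) mu = Dmin s w (Xmat o) mu.
Proof. by rewrite /Dmin Gmin_upd. Qed.
Lemma mhat_upd o mu sg : mhat s w (Xmat (upd o mu sg)) mu = mhat s w (Xmat o) mu.
Proof. by rewrite /mhat /T2min Dmin_upd Gmin_upd. Qed.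

Lemma quadS_qf (B : 'M[C]_M) (o : Om) mu :
  quadS (fun i => xv i mu) sp B M (o mu) = qf B (col mu (Xmat o)) (col mu (Xmat o)) - sp%:C * \tr B.
Proof.
rewrite /quadS /mxtrace; congr (_ - _ * _); last by apply: eq_bigl => i; rewrite ltn_ord.
rewrite qfE; under eq_bigl => i do rewrite ltn_ord.
apply: eq_bigr => i _; rewrite /linS mulr_sumr; under eq_bigl => j do rewrite ltn_ord.
by apply: eq_bigr => j _; rewrite !mxE mulrA.
Qed.

Lemma Zmin_quad o mu : Zmin s w (Xmat o) mu =
  quadS (fun i => xv i mu) sp (Gmin (Xmat o) z mu) M (o mu).
Proof. by rewrite quadS_qf. Qed.
Lemma Z2min_quad o mu : Z2min s w (Xmat o) mu =
  quadS (fun i => xv i mu) sp (Gmin (Xmat o) z mu *m Gmin (Xmat o) z mu) M (o mu).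
Proof. by rewrite quadS_qf. Qed.

Lemma frob2_Gmin_gt0 o mu : 0 < frob2 (Gmin (Xmat o) z mu).
Proof.
rewrite lt_def frob2_ge0 andbT; apply/negP => /eqP f0.
have M0 : (0 < M)%N := leq_trans N0 NM.
pose i0 := Ordinal M0.
have G0 : Gmin (Xmat o) z mu = 0.
  apply/matrixP => i j; rewrite [RHS]mxE; apply: Normc.eq0_normc.
  have : frob2 (Gmin (Xmat o) z mu) == 0 by rewrite f0.
  rewrite /frob2 psumr_eq0 => [/allP /(_ i (mem_index_enum _)) /= h|i' _]; last first.
    by apply: sumr_ge0 => j' _; exact: exprn_ge0 (nrm_ge0 _).
  move: h; rewrite psumr_eq0 => [/allP /(_ j (mem_index_enum _)) /=|j' _].
    by rewrite sqrf_eq0 => /eqP.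
  exact: exprn_ge0 (nrm_ge0 _).
have u := resolvent_unit (hermit_scov (Xmat o) (predC1 mu)) (Im_zpar_gt0 s eta0).
have := mulVmx u; rewrite -/(resolvent _ _) -/(Gmin (Xmat o) z mu) G0 mul0mx.
move=> /matrixP /(_ i0 i0); rewrite !mxE eqxx mulr1n => /eqP.
by rewrite eq_sym oner_eq0.
Qed.

Lemma fE_col (f : Om -> R) mu :
  fE wt f = fE wt (fun o => fE (pw (fun i => p i mu)) (fun sg => f (upd o mu sg))).
Proof. exact: fE_fubini pcol_sum1 mu f. Qed.

(** Given the other columns, B and its Frobenius bound are constants and [quad_moment] applies to
    the remaining column. Dividing by [Wf] inside the expectation keeps the bound free of the random
    size of B. *)
Lemma lde_moment (k : nat) mu (B : Om -> 'M[C]_M) (Wf : Om -> R) :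
  (forall o sg, B (upd o mu sg) = B o) ->
  (forall o sg, Wf (upd o mu sg) = Wf o) ->
  (forall o, 0 < Wf o) -> (forall o, frob2 (B o) <= Wf o) ->
  fE wt (fun o => (nrm (quadS (fun i => xv i mu) sp (B o) M (o mu)) ^+ 2 / (sp ^+ 2 * Wf o)) ^+ k.+1)
  <= quad_const c k ^+ k.+1.
Proof.
move=> Bu Wu W0 BW; have sp0 := sp_gt0 N0 s0.
rewrite (fE_col _ mu).
rewrite -[leRHS](fE_const (w := wt) (quad_const c k ^+ k.+1) wt_sum1).
apply: fE_le; first exact: wt_ge0.
move=> o; have D0 : 0 < sp ^+ 2 * Wf o by rewrite mulr_gt0 ?exprn_gt0.
rewrite (_ : fE _ _ = fE (pw (fun i => p i mu))
   (fun sg => (nrm (quadS (fun i => xv i mu) sp (B o) M sg) ^+ 2) ^+ k.+1) / (sp ^+ 2 * Wf o) ^+ k.+1); last first.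
  by rewrite -fEZr; apply: fE_ext => sg; rewrite Bu Wu upd_eq expr_div_n.
rewrite ler_pdivrMr ?exprn_gt0 // -exprMn mulrA.
exact: (quad_moment (cm mu) k (W0 o) (BW o)).
Qed.

Lemma Fm_upd o mu sg : frob2 (Gmin (Xmat (upd o mu sg)) z mu) = frob2 (Gmin (Xmat o) z mu).
Proof. by rewrite Gmin_upd. Qed.

Lemma tail_bound (k : nat) mu (B : Om -> 'M[C]_M) (Wf : Om -> R) (g : R) : 0 < g ->
  (forall o sg, B (upd o mu sg) = B o) ->
  (forall o sg, Wf (upd o mu sg) = Wf o) ->
  (forall o, 0 < Wf o) -> (forall o, frob2 (B o) <= Wf o) ->
  fP wt (fun o => g * sp * Num.sqrt (Wf o) < nrm (quadS (fun i => xv i mu) sp (B o) M (o mu)))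
  <= (quad_const c k / g ^+ 2) ^+ k.+1.
Proof.
move=> g0 Bu Wu W0 BW; have sp0 := sp_gt0 N0 s0.
rewrite expr_div_n ler_pdivlMr ?exprn_gt0 //.
apply: le_trans (lde_moment k Bu Wu W0 BW); rewrite -fEZr.
apply: fE_le; first exact: wt_ge0.
move=> o; have D0 : 0 < sp ^+ 2 * Wf o by rewrite mulr_gt0 ?exprn_gt0.
case: ltP => [h|_]; last by rewrite mul0r exprn_ge0 // divr_ge0 ?exprn_ge0 ?nrm_ge0 // ltW.
rewrite mul1r; apply: lerXn2r; rewrite ?nnegrE ?exprn_ge0 ?divr_ge0 ?exprn_ge0 ?nrm_ge0 ?(ltW g0) ?(ltW D0) //.
rewrite ler_pdivlMr // -[Wf o in leLHS]sqr_sqrtr ?(ltW (W0 o)) // -!exprMn.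
rewrite mulrA; apply: lerXn2r; rewrite ?nnegrE ?nrm_ge0 ?(ltW h) //.
by rewrite !mulr_ge0 ?sqrtr_ge0 // ltW.
Qed.

Definition badZ g (o : Om) : bool :=
  [exists mu, (g * sp * Num.sqrt (frob2 (Gmin (Xmat o) z mu)) < nrm (Zmin s w (Xmat o) mu))
   || (g * sp * Num.sqrt (frob2 (Gmin (Xmat o) z mu)) / eta < nrm (Z2min s w (Xmat o) mu))].

Lemma badZ_le k g : 0 < g -> fP wt (badZ g) <= (2 * (quad_const c k / g ^+ 2) ^+ k.+1) *+ N.
Proof.
move=> g0; apply: (le_trans (fP_exists wt_ge0 _)).
rewrite -[X in _ *+ X](card_ord N) -sumr_const; apply: ler_sum => mu _.
apply: (le_trans (fPU wt_ge0 _ _)); rewrite mulr_natl mulr2n; apply: lerD.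
  have := tail_bound k (mu := mu) (B := fun o => Gmin (Xmat o) z mu)
     (Wf := fun o => frob2 (Gmin (Xmat o) z mu)) g0 (fun o sg => Gmin_upd o mu sg)
     (fun o sg => Fm_upd o mu sg) (fun o => frob2_Gmin_gt0 o mu) (fun o => lexx _).
  apply: le_trans; apply: fP_le; first exact: wt_ge0.
  by move=> o; rewrite Zmin_quad.
pose Wf o := frob2 (Gmin (Xmat o) z mu) / eta ^+ 2.
have h := tail_bound k (mu := mu) (B := fun o => Gmin (Xmat o) z mu *m Gmin (Xmat o) z mu) (Wf := Wf) g0.
apply: le_trans (h _ _ _ _).
- apply: fP_le; first exact: wt_ge0.
  move=> o; rewrite Z2min_quad /Wf sqrtrM ?frob2_ge0 // sqrtrV ?sqr_ge0 //.
  by rewrite sqrtr_sqr gtr0_norm // (mulrA (g * sp)).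
- by move=> o sg; rewrite Gmin_upd.
- by move=> o sg; rewrite /Wf Gmin_upd.
- by move=> o; rewrite /Wf divr_gt0 ?exprn_gt0 ?frob2_Gmin_gt0.
- move=> o; rewrite /Wf -(Im_zpar s w).
  exact: frob2_resolvent_sqr (hermit_scov _ _) (Im_zpar_gt0 s eta0).
Qed.

Lemma Fm_le o mu : frob2 (Gmin (Xmat o) z mu) <= M%:R / eta ^+ 2.
Proof.
rewrite frob2_col; apply: (@le_trans _ _ (\sum_(j < M) (eta ^+ 2)^-1)); last first.
  by rewrite sumr_const card_ord mulr_natl.
apply: ler_sum => j _; rewrite colE.
have := resolvent_contract (hermit_scov (Xmat o) (predC1 mu)) (Im_zpar_gt0 s eta0) (delta_mx j 0).
rewrite Im_zpar; move/le_trans; apply.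
rewrite ler_piMl ?invr_ge0 ?exprn_ge0 ?(ltW eta0) //.
rewrite /frob2 (bigD1 j) //= big_ord1 mxE nrm_nat !eqxx expr1n big1 ?addr0 // => i ij.
by rewrite big_ord1 mxE nrm_nat (negbTE ij) expr0n.
Qed.

(** A crude second moment, to control |Z| on the exceptional event where the large deviation bounds
    fail. *)
Lemma fE_Zsqr mu : fE wt (fun o => nrm (Zmin s w (Xmat o) mu) ^+ 2) <= quad_const c 0 / eta ^+ 2.
Proof.
have sp0 := sp_gt0 N0 s0; have Nr := Nr0 R N0.
have h := lde_moment 0 (mu := mu) (B := fun o => Gmin (Xmat o) z mu)
     (Wf := fun o => frob2 (Gmin (Xmat o) z mu)) (fun o sg => Gmin_upd o mu sg)
     (fun o sg => Fm_upd o mu sg) (fun o => frob2_Gmin_gt0 o mu) (fun o => lexx _).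
rewrite expr1 in h.
apply: (@le_trans _ _ (fE wt (fun o => eta ^- 2 *
   (nrm (quadS (fun i => xv i mu) sp (Gmin (Xmat o) z mu) M (o mu)) ^+ 2 /
      (sp ^+ 2 * frob2 (Gmin (Xmat o) z mu))) ^+ 1))); last first.
  by rewrite fEZ [leRHS]mulrC ler_wpM2l // invr_ge0 exprn_ge0 // ltW.
apply: fE_le; first exact: wt_ge0.
move=> o; rewrite expr1 Zmin_quad.
have F0 := frob2_Gmin_gt0 o mu.
set x := nrm _ ^+ 2; set F := frob2 _ in F0 *.
have x0 : 0 <= x by rewrite exprn_ge0 // nrm_ge0.
have FM : sp ^+ 2 * F <= eta ^- 2.
  apply: (@le_trans _ _ (sp ^+ 2 * (M%:R / eta ^+ 2))).
    by rewrite ler_wpM2l ?Fm_le // exprn_ge0 // ltW.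
  rewrite mulrA ler_piMl ?invr_ge0 ?exprn_ge0 ?(ltW eta0) //.
  rewrite /spar expr_div_n mulrAC sMN ler_pdivrMr ?exprn_gt0 // mul1r expr2.
  by rewrite ler_peMr ?(ltW Nr) // ler1n.
have D0 : 0 < sp ^+ 2 * F by rewrite mulr_gt0 ?exprn_gt0.
rewrite mulrCA ler_peMr // ler_pdivlMr // mul1r //.
Qed.

Variables (m0 : C) (l : R).
Hypotheses (m0P : scpoly s w m0 = 0) (l0 : 0 < l) (ql : q <= l).
Local Notation rho := (rhopar s w m0).
Variables (A c0 L g : R).
Hypotheses (Im0 : 0 <= complex.Im m0) (A0 : complex.Im m0 <= A) (c00 : 0 < c0) (L1 : 1 <= L) (g1 : 1 <= g).
Hypothesis (aL : nrm a <= 2 * L).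
Hypothesis Hm : forall X : 'M[C]_(M, N), nrm (mstj s w X - m0) <= 4 * l ->
  c0 * L <= nrm (z * (1 + sp%:C * \tr (Gfull X z))).
Local Notation psi := (psi N s w l A c0 L g).
Hypothesis (aq : nrm a * q <= c0 * L / 4) (Ssm : Sbd N s w l A g <= c0 * L / 4).
Variables (k : nat) (b : R).
Local Notation del := (del N s w m0 l A c0 L g).
Hypotheses (b0 : 0 < b) (pdb : psi * del <= b ^+ 2) (db : del <= b)
  (eb : errbd N s w m0 l A c0 L g <= b).
Local Notation mo o := (mstj s w (Xmat o)).
Local Notation hh o := (hfun s w m0 l (mo o)).

Definition H0 : R := 2 * l * (nrm rho + nrm a * (2 * l)).
Definition avgZ o : R := (\sum_mu nrm (Zmin s w (Xmat o) mu)) / N%:R.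

Lemma H0_ge0 : 0 <= H0.
Proof. by rewrite !(mulr_ge0, addr_ge0, nrm_ge0) // ltW. Qed.

(** Only deterministic bounds remain on the exceptional event: the cut-off polynomial is at most
    [H0], and |D| >= eta / |z|. *)
Lemma recursion_bad (o : Om) :
  complex.Re ((\sum_mu Zmin s w (Xmat o) mu / Dmin s w (Xmat o) mu *
     (Gam k (hh o) - Gam k (hfun s w m0 l (mhat s w (Xmat o) mu)))) / N%:R)
  + complex.Re (sc_err s w (Xmat o) * Gam k (hh o)) <=
  H0 ^+ (2 * k).+2 + nrm z / eta * H0 ^+ (2 * k).+1 * avgZ o.
Proof.
have Nr := Nr0 R N0; have H00 := H0_ge0.
have hl v : nrm (hfun s w m0 l v) <= H0 by exact: nrm_hcut_le.
rewrite -cReD.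
have -> : (\sum_mu Zmin s w (Xmat o) mu / Dmin s w (Xmat o) mu *
     (Gam k (hh o) - Gam k (hfun s w m0 l (mhat s w (Xmat o) mu)))) / N%:R
   + sc_err s w (Xmat o) * Gam k (hh o) =
   scpoly s w (mo o) * Gam k (hh o) - (\sum_mu Zmin s w (Xmat o) mu / Dmin s w (Xmat o) mu *
     Gam k (hfun s w m0 l (mhat s w (Xmat o) mu))) / N%:R.
  under eq_bigr => mu _ do rewrite mulrBr.
  by rewrite sumrB -mulr_suml /sc_err /sc_main; ring.
rewrite cReB; apply: lerD.
  apply: (le_trans (Re_le_nrm _)); rewrite nrmM nrm_Gam.
  have [h|h] := leP (2 * l) (nrm (mo o - m0)).
    rewrite /hfun /hcut chi0 // mul0r nrm0 expr0n /= mulr0 exprn_ge0 //.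
  rewrite [leRHS]exprS; apply: ler_pM; rewrite ?exprn_ge0 ?nrm_ge0 //; last first.
    by apply: lerXn2r; rewrite ?nnegrE ?nrm_ge0.
  rewrite (scpoly_factor m0P) nrmM; apply: ler_pM; rewrite ?nrm_ge0 ?(ltW h) //.
  apply: (le_trans (nrmD _ _)); rewrite addrC lerD2l nrmM ler_wpM2l ?nrm_ge0 //; exact: ltW.
apply: (le_trans (ler_norm _)); rewrite normrN; apply: (le_trans (le_Re_nrm _)).
rewrite nrmM nrmV nrm_nat /avgZ mulrA ler_wpM2r ?invr_ge0 ?(ltW Nr) //.
apply: (le_trans (nrm_sum _ _ _)); rewrite mulr_sumr; apply: ler_sum => mu _.
rewrite 2!nrmM nrmV nrm_Gam.
have D0 : 0 < nrm (Dmin s w (Xmat o) mu) by rewrite nrm_gt0 (Dmin_neq0 N0 s0 eta0).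
have Di : (nrm (Dmin s w (Xmat o) mu))^-1 <= nrm z / eta.
  rewrite -[leLHS]mul1r ler_pdivrMr // mulrAC ler_pdivlMr // mul1r -nrmM.
  exact: zD_ge.
rewrite [leRHS]mulrC -[leLHS]mulrA ler_wpM2l ?nrm_ge0 //.
apply: ler_pM; rewrite ?invr_ge0 ?nrm_ge0 ?exprn_ge0 ?nrm_ge0 //.
by apply: lerXn2r; rewrite ?nnegrE ?nrm_ge0.
Qed.

(** In the summand of mu everything but Z is a function of the other columns, and Z is a centred
    quadratic form in column mu. The recursion rests on this cancellation. *)
Lemma mean_zero :
  fE wt (fun o => complex.Re ((\sum_mu Zmin s w (Xmat o) mu / Dmin s w (Xmat o) mu *
     Gam k (hfun s w m0 l (mhat s w (Xmat o) mu))) / N%:R)) = 0.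
Proof.
rewrite (fE_ext wt (g := fun o => N%:R^-1 * \sum_mu complex.Re (Zmin s w (Xmat o) mu / Dmin s w (Xmat o) mu *
     Gam k (hfun s w m0 l (mhat s w (Xmat o) mu))))); last first.
  move=> o; have -> : (N%:R^-1 : C) = ((N%:R : R)^-1)%:C by rewrite fmorphV rmorph_nat.
  by rewrite mulrC cReZ cRe_sum.
rewrite fEZ fE_sum big1 ?mulr0 // => mu _.
rewrite (fE_col _ mu) /fE big1 // => o _; apply/eqP; rewrite mulf_eq0; apply/orP; right; apply/eqP.
pose B := Gmin (Xmat o) z mu.
pose G := Gam k (hfun s w m0 l (mhat s w (Xmat o) mu)) / Dmin s w (Xmat o) mu.
transitivity (fE (pw (fun i => p i mu)) (fun sg => 1 * complex.Re (G *
   quadS (fun i => xv i mu) sp B M sg))).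
  apply: eq_bigr => sg _; congr (_ * _).
  rewrite Dmin_upd mhat_upd Zmin_quad Gmin_upd upd_eq mul1r; congr complex.Re.
  by rewrite /G /B; ring.
have e := quad_mean (cm mu) B (leqnn M).
transitivity (complex.Re (G * \sum_sg (pw (fun i => p i mu) sg)%:C * quadS (fun i => xv i mu) sp B M sg)).
  rewrite /fE mulr_sumr cRe_sum; apply: eq_bigr => sg _.
  by rewrite mul1r (mulrCA G) cReZ.
by rewrite e mulr0.
Qed.

Lemma Gam_scale (x : R) v : Gam k (x%:C * v) = (x ^+ (2 * k).+1)%:C * Gam k v.
Proof.
rewrite /Gam (_ : Num.conj (x%:C * v) = x%:C * Num.conj v); last first.
  by rewrite rmorphM; congr (_ * _); exact: conjc_real.
rewrite !exprMn mulrACA -exprD rmorphXn.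
by rewrite addSn addnn mul2n.
Qed.

(** The cut-off has power 2k+2 on the left and 2k+1 on the right, and it lies between 0 and 1. *)
Lemma hh_le o : (nrm (hh o) ^+ 2) ^+ k.+1 <= complex.Re (scpoly s w (mo o) * Gam k (hh o)).
Proof.
rewrite /hfun /hcut; set x := chi _ _; set v := scpoly _ _ _.
have x0 : 0 <= x by exact: chi_ge0.
have x1 : x <= 1 by exact: chi_le1.
rewrite Gam_scale mulrCA cReZ mul_Gam cReR nrmM nrmR ger0_norm //.
rewrite -!exprM two_mulnS exprMn.
rewrite ler_wpM2r ?exprn_ge0 ?nrm_ge0 // exprS ler_piMl // exprn_ge0 //.
Qed.

Definition pibad K : R := (2 * (quad_const c K / g ^+ 2) ^+ K.+1) *+ N.

(** The moment is at most half of itself plus small terms, so the inequality can be solved for it. K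
    is the moment used against the exceptional event and T a truncation level: there |Z| is at most
    T + |Z|^2 / T. *)
Lemma key_moment K T : 0 < T ->
  fE wt (fun o => (nrm (hh o) ^+ 2) ^+ k.+1) <=
  2 * (young_const R k * b ^+ (2 * k).+2) +
  2 * (H0 ^+ (2 * k).+2 * pibad K + nrm z / eta * H0 ^+ (2 * k).+1 *
        (T * pibad K + quad_const c 0 / eta ^+ 2 / T)).
Proof.
move=> T0; have Nr := Nr0 R N0; have H00 := H0_ge0.
have g0 : 0 < g := lt_le_trans ltr01 g1.
have ze0 : 0 <= nrm z / eta by rewrite divr_ge0 ?nrm_ge0 // ltW.
set Y := young_const R k * _.
have Y0 : 0 <= Y.
  have G0 := Gam_const_ge0 R k; rewrite /Y mulr_ge0 ?exprn_ge0 ?(ltW b0) //.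
  rewrite /young_const mulr_ge0 ?addr_ge0 //.
  by rewrite exprn_ge0 // mulr_ge0 ?addr_ge0.
pose U o := complex.Re ((\sum_mu Zmin s w (Xmat o) mu / Dmin s w (Xmat o) mu *
     Gam k (hfun s w m0 l (mhat s w (Xmat o) mu))) / N%:R).
have avg0 o : 0 <= avgZ o.
  by rewrite divr_ge0 ?(ltW Nr) // sumr_ge0 // => mu _; exact: nrm_ge0.
pose cr o := H0 ^+ (2 * k).+2 + nrm z / eta * H0 ^+ (2 * k).+1 * avgZ o.
have cr0 o : 0 <= cr o.
  by rewrite /cr addr_ge0 ?exprn_ge0 // mulr_ge0 ?avg0 // mulr_ge0 ?exprn_ge0.
have pt o : (nrm (hh o) ^+ 2) ^+ k.+1 <=
    1 / 2 * (nrm (hh o) ^+ 2) ^+ k.+1 + (Y + ((badZ g o)%:R * cr o + U o)).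
  apply: (le_trans (hh_le o)).
  have -> : complex.Re (scpoly s w (mo o) * Gam k (hh o)) =
    (complex.Re ((\sum_mu Zmin s w (Xmat o) mu / Dmin s w (Xmat o) mu *
     (Gam k (hh o) - Gam k (hfun s w m0 l (mhat s w (Xmat o) mu)))) / N%:R)
     + complex.Re (sc_err s w (Xmat o) * Gam k (hh o))) + U o.
    rewrite /U -!cReD; congr complex.Re.
    under [in RHS]eq_bigr => mu _ do rewrite mulrBr.
    by rewrite sumrB -mulr_suml /sc_err /sc_main; ring.
  rewrite !addrA lerD2r.
  have hh0 : 0 <= 1 / 2 * (nrm (hh o) ^+ 2) ^+ k.+1.
    by rewrite mulr_ge0 // exprn_ge0 // exprn_ge0 // nrm_ge0.
  case E : (badZ g o).
    apply: (le_trans (recursion_bad o)); rewrite -[leLHS]/(cr o).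
    rewrite [true%:R * _]mul1r; move: (addr_ge0 hh0 Y0); set cc := cr o; lra.
  rewrite mul0r addr0.
  have nb mu : nrm (Zmin s w (Xmat o) mu) <= g * sp * Num.sqrt (frob2 (Gmin (Xmat o) z mu)) /\
     nrm (Z2min s w (Xmat o) mu) <= g * sp * Num.sqrt (frob2 (Gmin (Xmat o) z mu)) / eta.
    move/negbT: E; rewrite /badZ negb_exists => /forallP /(_ mu).
    by rewrite negb_or -!leNgt => /andP[].
  apply: (recursion_good N0 NM s0 sMN eta0 m0P l0 ql Im0 A0 c00 L1 g1 (@Hm (Xmat o)) aq Ssm
    (fun mu => (nb mu).1) (fun mu => (nb mu).2) k (ltW b0) pdb db eb).
have main : fE wt (fun o => (nrm (hh o) ^+ 2) ^+ k.+1) <= 2 * (Y + fE wt (fun o => (badZ g o)%:R * cr o)).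
  have := fE_le wt_ge0 pt; rewrite !fED fEZ (fE_const Y wt_sum1).
  rewrite (_ : fE wt U = 0); first by lra.
  exact: mean_zero.
apply: (le_trans main); rewrite mulrDr lerD2l ler_wpM2l //.
have pb : fP wt (badZ g) <= pibad K by exact: badZ_le.
apply: (@le_trans _ _ (fE wt (fun o => H0 ^+ (2 * k).+2 * (badZ g o)%:R +
   nrm z / eta * H0 ^+ (2 * k).+1 * (N%:R^-1 * \sum_mu (T * (badZ g o)%:R + T^-1 * nrm (Zmin s w (Xmat o) mu) ^+ 2))))).
  apply: fE_le; first exact: wt_ge0.
  move=> o; rewrite /cr mulrDr mulrC lerD2l mulrCA ler_wpM2l ?mulr_ge0 ?exprn_ge0 ?invr_ge0 ?nrm_ge0 ?(ltW eta0) //.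
  rewrite /avgZ mulrA mulrC ler_wpM2l ?invr_ge0 ?(ltW Nr) //.
  rewrite mulr_sumr; apply: ler_sum => mu _.
  set x := nrm _; have x0 : 0 <= x := nrm_ge0 _.
  case: (badZ g o); last first.
    by rewrite mul0r mulr0 add0r mulr_ge0 ?exprn_ge0 // invr_ge0 ltW.
  rewrite mul1r mulr1.
  have [xT|xT] := leP x T.
    by apply: (le_trans xT); rewrite lerDl mulr_ge0 ?exprn_ge0 // invr_ge0 ltW.
  apply: (@le_trans _ _ (T^-1 * x ^+ 2)); last by rewrite lerDr ltW.
  by rewrite mulrC ler_pdivlMr // expr2 ler_wpM2l // ltW.
rewrite fED !fEZ fE_sum; apply: lerD; first by rewrite ler_wpM2l ?exprn_ge0.
rewrite ler_wpM2l ?mulr_ge0 ?exprn_ge0 ?invr_ge0 ?nrm_ge0 ?(ltW eta0) //.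
rewrite mulrC ler_pdivrMr // mulr_natr -[X in _ *+ X](card_ord N) -sumr_const.
apply: ler_sum => mu _; rewrite fED !fEZ; apply: lerD.
  by rewrite ler_wpM2l // ltW.
rewrite mulrC ler_wpM2r ?invr_ge0 ?(ltW T0) //.
exact: fE_Zsqr.
Qed.

Lemma key_prob K T G : 0 < T -> 0 < G ->
  fP wt (fun o => (nrm (mo o - m0) <= l) && (G * b < nrm (scpoly s w (mo o)))) <=
  (2 * (young_const R k * b ^+ (2 * k).+2) +
  2 * (H0 ^+ (2 * k).+2 * pibad K + nrm z / eta * H0 ^+ (2 * k).+1 *
        (T * pibad K + quad_const c 0 / eta ^+ 2 / T))) / (G * b) ^+ (2 * k).+2.
Proof.
move=> T0 G0; have Gb : 0 < G * b by rewrite mulr_gt0.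
rewrite ler_pdivlMr ?exprn_gt0 //.
apply: le_trans (key_moment K T0); rewrite -fEZr.
apply: fE_le; first exact: wt_ge0.
move=> o; case: andP => [[h1 h2]|_]; last first.
  by rewrite mul0r exprn_ge0 // exprn_ge0 // nrm_ge0.
rewrite mul1r -exprM two_mulnS.
rewrite /hfun /hcut chi1 // nrmM nrmR normr1 mul1r.
by apply: lerXn2r; rewrite ?nnegrE ?nrm_ge0 // ltW.
Qed.

End KeyProposition.

(** * The limiting Stieltjes transform *)

Section Semicircle.
Variable R : realType.
Local Notation C := R[i].
Local Open Scope complex_scope.

(** The root (-w + sqrt(w^2 - 4)) / 2 in the upper half plane, in real coordinates: P + 2 i E eta is
    w^2 - 4 and V is the imaginary part of its square root. The formula remains meaningful at eta =
    0 inside the spectrum, where the counting argument evaluates it. *)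
Definition sc_u (E eta : R) : C :=
  let P := E ^+ 2 - eta ^+ 2 - 4 in
  let V := Num.sqrt ((Num.sqrt (P ^+ 2 + (2 * E * eta) ^+ 2) - P) / 2) in
  Complex ((E * eta / V - E) / 2) ((V - eta) / 2).

Lemma sc_V_gt (E eta P : R) : 0 < eta -> P = E ^+ 2 - eta ^+ 2 - 4 ->
  eta ^+ 2 < (Num.sqrt (P ^+ 2 + (2 * E * eta) ^+ 2) - P) / 2.
Proof.
move=> e0 PE.
have h : 2 * eta ^+ 2 + P < Num.sqrt (P ^+ 2 + (2 * E * eta) ^+ 2).
  have [h|h] := ltP (2 * eta ^+ 2 + P) 0.
    by apply: lt_le_trans h (sqrtr_ge0 _).
  have e : P ^+ 2 + (2 * E * eta) ^+ 2 = (2 * eta ^+ 2 + P) ^+ 2 + 16 * eta ^+ 2.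
    by rewrite PE; ring.
  have e2 := exprn_gt0 2 e0; have q0 := sqr_ge0 (2 * eta ^+ 2 + P).
  rewrite e -[ltLHS]ger0_norm // -sqrtr_sqr ltr_sqrt; lra.
lra.
Qed.

Lemma sc_u_spec (E eta : R) : 0 < eta ->
  0 < complex.Im (sc_u E eta) /\
  sc_u E eta ^+ 2 + Complex E eta * sc_u E eta + 1 = 0.
Proof.
move=> e0; have := sc_V_gt e0 (erefl (E ^+ 2 - eta ^+ 2 - 4)); rewrite /sc_u /=.
set P := E ^+ 2 - eta ^+ 2 - 4; set S := Num.sqrt (P ^+ 2 + _); set Q := (S - P) / 2.
move=> hQ; set V := Num.sqrt Q.
have Q0 : 0 < Q by apply: le_lt_trans hQ; rewrite sqr_ge0.
have VQ : V ^+ 2 = Q by rewrite sqr_sqrtr // ltW.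
have V0 : 0 < V by rewrite sqrtr_gt0.
have Ve : eta < V by rewrite -(ltr_pXn2r (n := 2)) ?nnegrE ?VQ // ltW.
have SS : S ^+ 2 = P ^+ 2 + (2 * E * eta) ^+ 2 by rewrite sqr_sqrtr // addr_ge0 ?sqr_ge0.
split; first by rewrite divr_gt0 // subr_gt0.
have S2 : S = 2 * V ^+ 2 + P by rewrite VQ /Q; lra.
have V4 : (V ^+ 2) ^+ 2 + P * V ^+ 2 = (E * eta) ^+ 2.
  by move: SS; rewrite S2; nra.
have Vn : V != 0 by rewrite gt_eqF.
have e1 : (E * eta / V) ^+ 2 = V ^+ 2 + P.
  rewrite expr_div_n -V4; field; exact: Vn.
have e2 : V * (E * eta / V) = E * eta by field; exact: Vn.
apply: cplx_eq; rewrite expr2 !(cReD, cImD, cReM, cImM) /=.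
  by move: (E * eta / V) e1 e2 => x; rewrite /P => e1 e2; nra.
by move: (E * eta / V) e1 e2 => x; rewrite /P => e1 e2; nra.
Qed.
End Semicircle.

Section SemicircleBounds.
Variable R : realType.
Local Notation C := R[i].
Local Open Scope complex_scope.
Variables (w u : C).
Local Notation eta := (complex.Im w).
Local Notation E := (complex.Re w).
Hypotheses (e0 : 0 < eta) (Iu : 0 < complex.Im u) (Hu : u ^+ 2 + w * u + 1 = 0).
Local Notation r := (nrm u).
Local Notation L := (1 + nrm w).

Lemma u_neq0 : u != 0.
Proof. by apply: contraTneq Iu => ->; rewrite ltxx. Qed.
Lemma r_gt0 : 0 < r. Proof. by rewrite nrm_gt0 u_neq0. Qed.

Lemma w_u : w = - (u + u^-1).
Proof.
have h : w * u = - (u ^+ 2 + 1).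
  apply/eqP; rewrite -addr_eq0; apply/eqP.
  by transitivity (u ^+ 2 + w * u + 1); [ring | exact: Hu].
by rewrite -[w](mulfK u_neq0) h; field; exact: u_neq0.
Qed.

(** The imaginary part of w = -(u + 1/u). Together with the real part [E_u] it reduces estimates on
    u to its modulus. *)
Lemma eta_u : eta * r ^+ 2 = complex.Im u * (1 - r ^+ 2).
Proof.
have r0 := r_gt0.
rewrite [in LHS]w_u cImN cImD cIm_inv; field; exact: lt0r_neq0.
Qed.

Lemma E_u : E * r ^+ 2 = - complex.Re u * (1 + r ^+ 2).
Proof.
have r0 := r_gt0.
rewrite [in LHS]w_u cReN cReD cRe_inv; field; exact: lt0r_neq0.
Qed.

Lemma r_lt1 : r < 1.
Proof.
have r0 := r_gt0; have h := eta_u.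
have : 0 < complex.Im u * (1 - r ^+ 2) by rewrite -h mulr_gt0 // exprn_gt0.
by rewrite pmulr_rgt0 //; nra.
Qed.

(** With [r_geL], |u| is comparable to 1 / L; this decay keeps the estimates uniform for large
    spectral parameters. *)
Lemma r_le3L : r <= 3 / L.
Proof.
have r0 := r_gt0; have r1 := r_lt1; have w0 := nrm_ge0 w.
have h : nrm w <= r + r^-1.
  by rewrite {1}w_u nrmN; apply: (le_trans (nrmD _ _)); rewrite nrmV.
rewrite ler_pdivlMr; last by lra.
have : r * nrm w <= r * (r + r^-1) by rewrite ler_wpM2l // ltW.
by rewrite mulrDr mulfV ?gt_eqF //; nra.
Qed.

Lemma r_geL : 1 <= r * L.
Proof.
have r0 := r_gt0; have r1 := r_lt1.
have h : r^-1 <= r + nrm w.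
  have : u^-1 = - (u + w) by rewrite [in RHS]w_u; ring.
  by move=> e; rewrite -nrmV e nrmN; exact: nrmD.
have : r * r^-1 <= r * (r + nrm w) by rewrite ler_wpM2l // ltW.
rewrite mulfV ?gt_eqF // => h2; apply: (le_trans h2).
by rewrite ler_wpM2l ?(ltW r0) // lerD2r ltW.
Qed.

Definition sc_rho : C := w + 2 * u.

Lemma sc_rho_sqr : sc_rho ^+ 2 = w ^+ 2 - 4.
Proof.
have -> : sc_rho ^+ 2 = w ^+ 2 + 4 * (u ^+ 2 + w * u + 1) - 4 by rewrite /sc_rho; ring.
by rewrite Hu mulr0 addr0.
Qed.

Lemma sc_rho_le : nrm sc_rho <= 2 * L.
Proof.
have r1 := r_lt1; have w0 := nrm_ge0 w.
by apply: (le_trans (nrmD _ _)); rewrite nrmM nrm_nat; lra.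
Qed.

Lemma r_rho : r * nrm sc_rho = nrm (1 - u ^+ 2).
Proof.
rewrite -nrmM -(nrmN (1 - u ^+ 2)); congr nrm.
have -> : u * sc_rho = u ^+ 2 - 1 + (u ^+ 2 + w * u + 1) by rewrite /sc_rho; ring.
by rewrite Hu; ring.
Qed.

Lemma Im_u_le_rho : complex.Im u * L ^+ 2 <= 9 * nrm sc_rho.
Proof.
have r0 := r_gt0; have r3 := r_le3L; have w0 := nrm_ge0 w.
have L0 : 0 < L by lra.
have h : complex.Im u <= r ^+ 2 * nrm sc_rho.
  have h1 : complex.Im sc_rho <= nrm sc_rho := Im_le_nrm _.
  have e1 : complex.Im sc_rho * r ^+ 2 = complex.Im u * (1 + r ^+ 2).
    rewrite /sc_rho cImD mulrDl eta_u.
    have -> : complex.Im (2 * u) = 2 * complex.Im u by rewrite cImM /=; ring.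
    ring.
  have h2 : complex.Im u <= complex.Im sc_rho * r ^+ 2.
    by rewrite e1 ler_peMr ?(ltW Iu) // lerDl sqr_ge0.
  by apply: (le_trans h2); rewrite mulrC ler_wpM2l // sqr_ge0.
apply: (@le_trans _ _ ((r * L) ^+ 2 * nrm sc_rho)).
  by rewrite exprMn [leRHS]mulrAC ler_wpM2r // exprn_ge0 // ltW.
rewrite ler_wpM2r ?nrm_ge0 //.
have : r * L <= 3 by rewrite -ler_pdivlMr.
have : 0 <= r * L by rewrite mulr_ge0 // ltW.
by move: (r * L) => x; nra.
Qed.

Lemma Im_u_ge : eta <= complex.Im u * L ^+ 2.
Proof.
have r0 := r_gt0; have h := eta_u; have rL := r_geL.
have h1 : eta * r ^+ 2 <= complex.Im u.
  by rewrite h mulrBr mulr1 gerBl mulr_ge0 ?sqr_ge0 // ltW.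
apply: (@le_trans _ _ (eta * (r * L) ^+ 2)).
  by rewrite ler_peMr ?(ltW e0) // exprn_ege1.
by rewrite exprMn mulrA ler_wpM2r // sqr_ge0.
Qed.

(** Outside [-2, 2] the relation [E_u] forces |Re u| so close to r that Im u <= 1 - r^2. Then 1 -
    u^2, and with it r |rho|, is of order 1 - r^2, and [eta_u] turns Im u (1 - r^2) into eta r^2. *)
Lemma Im_u_outside : 2 <= `|E| -> complex.Im u * (L * nrm sc_rho) <= 15 * eta.
Proof.
move=> hE; have r0 := r_gt0; have r1 := r_lt1; have w0 := nrm_ge0 w.
have he := eta_u; have hEu := E_u.
set U := complex.Re u in hEu; set v := complex.Im u in he *.
have UV : U ^+ 2 + v ^+ 2 = r ^+ 2 by rewrite nrm_sqr.
have hU : 2 * r ^+ 2 <= `|U| * (1 + r ^+ 2).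
  have -> : `|U| * (1 + r ^+ 2) = `|E| * r ^+ 2.
    rewrite -[r ^+ 2 in RHS]ger0_norm ?sqr_ge0 // -normrM hEu normrM normrN.
    by congr (_ * _); rewrite ger0_norm // addr_ge0 // sqr_ge0.
  by rewrite ler_wpM2r // sqr_ge0.
have v0 : 0 < v := Iu.
have r20 : 0 < 1 - r ^+ 2 by nra.
have hv : v <= 1 - r ^+ 2.
  have U0 : 0 <= `|U| by exact: normr_ge0.
  have UU : `|U| ^+ 2 = U ^+ 2 by rewrite real_normK ?num_real.
  have s1 : (2 * r ^+ 2) ^+ 2 <= (`|U| * (1 + r ^+ 2)) ^+ 2.
    have q0 := sqr_ge0 r.
    apply: lerXn2r => //; rewrite nnegrE; first by lra.
    by apply: mulr_ge0 => //; lra.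
  rewrite [leRHS]exprMn UU in s1.
  have s2 : v ^+ 2 * (1 + r ^+ 2) ^+ 2 <= r ^+ 2 * (1 - r ^+ 2) ^+ 2.
    have -> : v ^+ 2 = r ^+ 2 - U ^+ 2 by lra.
    by move: s1; rewrite exprMn; move: (r ^+ 2) => x; nra.
  have s3 : v ^+ 2 <= (1 - r ^+ 2) ^+ 2.
    apply: (@le_trans _ _ (v ^+ 2 * (1 + r ^+ 2) ^+ 2)).
      by rewrite ler_peMr ?sqr_ge0 // exprn_ege1 // lerDl sqr_ge0.
    apply: (le_trans s2); rewrite ler_piMl ?sqr_ge0 //; lra.
  by rewrite -(ler_pXn2r (n := 2)) // ?nnegrE ?(ltW v0) ?(ltW r20).
have h5 : r * nrm sc_rho <= 5 * (1 - r ^+ 2).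
  rewrite r_rho; apply: (le_trans (nrm_le_ReIm _)).
  have -> : complex.Re (1 - u ^+ 2) = (1 - r ^+ 2) + 2 * v ^+ 2.
    by rewrite expr2 cReB cReM cRe1 -/U -/v -UV; ring.
  have -> : complex.Im (1 - u ^+ 2) = - (2 * U * v).
    by rewrite expr2 cImB cImM cIm1 -/U -/v; ring.
  rewrite normrN ger0_norm; last by rewrite addr_ge0 ?(ltW r20) // mulr_ge0 // sqr_ge0.
  rewrite !normrM (gtr0_norm v0) (gtr0_norm (_ : 0 < 2)) //.
  have U1 : `|U| <= 1 by apply: le_trans (le_Re_nrm u) (ltW r1).
  have : v ^+ 2 <= 1 - r ^+ 2 by nra.
  have : `|U| * v <= 1 - r ^+ 2.
    by apply: le_trans hv; rewrite ler_piMl // ltW.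
  lra.
have rL3 : r * L <= 3 by rewrite -ler_pdivlMr; [exact: r_le3L | lra].
have r2 : 0 < r ^+ 2 by rewrite exprn_gt0.
rewrite -(ler_pM2r r2) -/v.
have -> : v * (L * nrm sc_rho) * r ^+ 2 = (r * L) * (v * (r * nrm sc_rho)) by ring.
have -> : 15 * eta * r ^+ 2 = 3 * (v * (5 * (1 - r ^+ 2))) by have := he; lra.
apply: ler_pM => //.
- by rewrite mulr_ge0 ?(ltW r0) //; lra.
- by rewrite !mulr_ge0 ?nrm_ge0 ?(ltW v0) ?(ltW r0).
- by rewrite ler_wpM2l // ltW.
Qed.

Variable (s : R).
Hypotheses (s0 : 0 < s) (s1 : s <= 1).

Lemma su_neq0 : 1 - s%:C * u != 0.
Proof.
apply/negP => /eqP /(congr1 (@complex.Im R)).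
rewrite cImB cIm1 cImZ => /eqP; rewrite sub0r oppr_eq0 mulf_eq0 !gt_eqF //.
Qed.

Definition mp_m : C := u / (1 - s%:C * u).

Lemma mp_m_root : scpoly s w mp_m = 0.
Proof.
have h : scpoly s w mp_m = (u ^+ 2 + w * u + 1) / (1 - s%:C * u) ^+ 2.
  rewrite /scpoly /mp_m /apar rmorphXn rmorphM rmorph_nat.
  by field; exact: su_neq0.
by rewrite h Hu mul0r.
Qed.

Lemma mp_rho : rhopar s w mp_m = sc_rho.
Proof.
have h : rhopar s w mp_m = sc_rho + 2 * s%:C * (u ^+ 2 + w * u + 1) / (1 - s%:C * u).
  rewrite /rhopar /sc_rho /mp_m /apar rmorphXn rmorphM rmorph_nat.
  by field; exact: su_neq0.
by rewrite h Hu mulr0 mul0r addr0.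
Qed.

Lemma apar_le : nrm (apar s w) <= 2 * L.
Proof.
have w0 := nrm_ge0 w.
rewrite /apar; apply: (le_trans (nrmD _ _)).
have : nrm (1 + (s ^+ 2)%:C) <= 2.
  apply: (le_trans (nrmD _ _)); rewrite nrm1 nrmR ger0_norm ?sqr_ge0 //.
  have : s ^+ 2 <= 1 by rewrite expr_le1 // ltW.
  lra.
have : nrm (s%:C * w) <= nrm w.
  by rewrite nrmM nrmR gtr0_norm // ler_piMl.
lra.
Qed.

(* The domain: away from the hard edge, or with aspect ratio bounded away from 1. *)
Variable tt : R.
Hypotheses (tt0 : 0 < tt) (tt1 : tt <= 1) (dom : (- 2 + tt <= E) || (s <= 1 - tt / 2)).

(** The denominator degenerates only for s and u both near 1, that is at the hard edge w = -2. Away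
    from it Re u <= 1 - tt / 2; otherwise s itself is at most 1 - tt / 2. *)
Lemma su_lower : tt / 2 <= nrm (1 - s%:C * u).
Proof.
have t0 := tt0; have t1 := tt1; have s0' := s0; have s1' := s1.
have r0 := r_gt0; have r1 := r_lt1.
case/orP: dom => h.
  apply: le_trans (Re_le_nrm _); rewrite cReB cRe1 cReZ.
  have hE := E_u; set U := complex.Re u in hE *.
  have r2 : 0 < r ^+ 2 by rewrite exprn_gt0.
  have r21 : r ^+ 2 <= 1 by rewrite expr_le1 ?(ltW r0) ?(ltW r1).
  have hU : U <= 1 - tt / 2.
    have h1 : U * (1 + r ^+ 2) <= (2 - tt) * r ^+ 2 by nra.
    have h2 : (2 - tt) * r ^+ 2 <= (1 - tt / 2) * (1 + r ^+ 2) by nra.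
    by move: (le_trans h1 h2); rewrite ler_pM2r //; lra.
  have [U0|U0] := leP 0 U; last by (have : s * U <= 0 by nra); lra.
  have : s * U <= 1 * U by rewrite ler_wpM2r.
  lra.
apply: le_trans (nrmB_ge _ _); rewrite nrm1 nrmM nrmR gtr0_norm //.
have : s * r <= s * 1 by rewrite ler_wpM2l ?(ltW s0) ?(ltW r1).
lra.
Qed.

Lemma su_upper : nrm (1 - s%:C * u) <= 2.
Proof.
apply: (le_trans (nrmB _ _)); rewrite nrm1 nrmM nrmR gtr0_norm //.
have : s * r <= 1 * 1 by apply: ler_pM; rewrite ?nrm_ge0 ?(ltW s0) ?(ltW r_lt1).
lra.
Qed.

Lemma mp_m_le : nrm mp_m <= 6 / tt / L.
Proof.
have t0 := tt0; have t1 := tt1; have s0' := s0; have s1' := s1.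
have k := su_lower; have w0 := nrm_ge0 w.
rewrite /mp_m nrmM nrmV ler_pdivrMr; last by lra.
apply: (le_trans r_le3L).
rewrite (_ : 3 / L = 6 / tt / L * (tt / 2)); last by field; rewrite !gt_eqF //; lra.
by rewrite ler_wpM2l // !divr_ge0 //; lra.
Qed.

Lemma Im_mp_m : complex.Im mp_m = complex.Im u / nrm (1 - s%:C * u) ^+ 2.
Proof.
have d : nrm (1 - s%:C * u) != 0 by rewrite nrm_eq0 su_neq0.
rewrite /mp_m cImM cIm_inv cRe_inv cReB cImB cRe1 cIm1 cReZ cImZ.
by field.
Qed.

Lemma Im_mp_m_ge : eta <= complex.Im mp_m * (4 * L ^+ 2).
Proof.
have t0 := tt0; have t1 := tt1; have s0' := s0; have s1' := s1.
apply: (le_trans Im_u_ge); rewrite [leRHS]mulrA ler_wpM2r ?sqr_ge0 //.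
have d0 : 0 < nrm (1 - s%:C * u) by rewrite nrm_gt0 su_neq0.
rewrite Im_mp_m mulrAC ler_pdivlMr ?exprn_gt0 // ler_wpM2l ?(ltW Iu) //.
by have := su_upper; nra.
Qed.

Lemma Im_mp_m_gt0 : 0 < complex.Im mp_m.
Proof.
rewrite Im_mp_m divr_gt0 // exprn_gt0 //.
by rewrite nrm_gt0 su_neq0.
Qed.

Lemma Im_mp_m_le_u : complex.Im mp_m <= 4 / tt ^+ 2 * complex.Im u.
Proof.
have t0 := tt0; have t1 := tt1; have s0' := s0; have s1' := s1.
have k := su_lower.
have d0 : 0 < nrm (1 - s%:C * u) by rewrite nrm_gt0 su_neq0.
rewrite Im_mp_m mulrC ler_wpM2r ?(ltW Iu) //.
rewrite -[leLHS]mul1r ler_pdivrMr ?exprn_gt0 //.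
rewrite mulrAC ler_pdivlMr ?exprn_gt0 // mul1r.
by have := tt0; nra.
Qed.

Lemma Im_mp_m_le_rho : complex.Im mp_m * L ^+ 2 <= 36 / tt ^+ 2 * nrm sc_rho.
Proof.
have t0 := tt0; have t1 := tt1; have s0' := s0; have s1' := s1.
apply: (@le_trans _ _ (4 / tt ^+ 2 * (complex.Im u * L ^+ 2))).
  by rewrite [leRHS]mulrA ler_wpM2r ?sqr_ge0 // Im_mp_m_le_u.
rewrite (_ : 36 / _ * _ = 4 / tt ^+ 2 * (9 * nrm sc_rho)); last by field; rewrite gt_eqF.
by rewrite ler_wpM2l ?Im_u_le_rho // divr_ge0 // sqr_ge0.
Qed.

Lemma Im_mp_m_outside : 2 <= `|E| -> complex.Im mp_m * (L * nrm sc_rho) <= 60 / tt ^+ 2 * eta.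
Proof.
have t0 := tt0; have t1 := tt1; have s0' := s0; have s1' := s1.
move=> hE; apply: (@le_trans _ _ (4 / tt ^+ 2 * (complex.Im u * (L * nrm sc_rho)))).
  rewrite [leRHS]mulrA ler_wpM2r ?Im_mp_m_le_u // mulr_ge0 ?nrm_ge0 //.
  by have := nrm_ge0 w; lra.
rewrite (_ : 60 / _ * _ = 4 / tt ^+ 2 * (15 * eta)); last by field; rewrite gt_eqF.
by rewrite ler_wpM2l ?Im_u_outside // divr_ge0 // sqr_ge0.
Qed.

End SemicircleBounds.

Section SemicircleLipschitz.
Variable R : realType.
Local Notation C := R[i].
Local Open Scope complex_scope.
Variables (w u w' u' : C).
Hypotheses (e0 : 0 < complex.Im w) (Iu : 0 < complex.Im u) (Hu : u ^+ 2 + w * u + 1 = 0).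
Hypotheses (e0' : 0 < complex.Im w') (Iu' : 0 < complex.Im u') (Hu' : u' ^+ 2 + w' * u' + 1 = 0).

(** The two equations give u - u' = u u' ((w - w') + (u - u')), and 1 - |u u'| is at least |u| Im w
    / 2; the factor |u| cancels. *)
Lemma u_lip : nrm (u - u') <= 2 / complex.Im w * nrm (w - w').
Proof.
have un := u_neq0 Iu; have un' := u_neq0 Iu'.
have r0 := r_gt0 Iu; have r1 := r_lt1 e0 Iu Hu.
have r0' := r_gt0 Iu'; have r1' := r_lt1 e0' Iu' Hu'.
have e : u - u' = u * u' * ((w - w') + (u - u')).
  have -> : w - w' = - (u + u^-1) + (u' + u'^-1).
    by rewrite {1}(w_u Iu Hu) {1}(w_u Iu' Hu') opprK.
  by field; rewrite un un'.
have h : nrm (u - u') * (1 - nrm u * nrm u') <= nrm u * nrm u' * nrm (w - w').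
  have : nrm (u - u') <= nrm u * nrm u' * (nrm (w - w') + nrm (u - u')).
    rewrite {1}e !nrmM ler_wpM2l ?mulr_ge0 ?nrm_ge0 //; exact: nrmD.
  lra.
have he := eta_u Iu Hu.
have Imr := Im_le_nrm u.
have h1 : complex.Im w * nrm u <= 2 * (1 - nrm u).
  have h2 : complex.Im w * nrm u ^+ 2 <= nrm u * (1 - nrm u ^+ 2).
    by rewrite he ler_wpM2r //; nra.
  have h3 : nrm u * (complex.Im w * nrm u) <= nrm u * (1 - nrm u ^+ 2).
    by move: h2; rewrite expr2; lra.
  by rewrite ler_pM2l // in h3; nra.
have h4 : complex.Im w * nrm u / 2 <= 1 - nrm u * nrm u' by nra.
have d0 := nrm_ge0 (u - u'); have D0 := nrm_ge0 (w - w').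
rewrite mulrAC ler_pdivlMr //.
have h5 : nrm (u - u') * (complex.Im w * nrm u / 2) <= nrm u * nrm (w - w').
  apply: (@le_trans _ _ (nrm (u - u') * (1 - nrm u * nrm u'))).
    by rewrite ler_wpM2l.
  apply: (le_trans h); rewrite ler_wpM2r // ler_piMr // ltW //.
have h6 : nrm u * (nrm (u - u') * complex.Im w) <= nrm u * (2 * nrm (w - w')) by lra.
by rewrite ler_pM2l in h6.
Qed.

End SemicircleLipschitz.

(** * Eigenvalues and traces of resolvents *)

Section Spectra.
Variable R : realType.
Local Notation C := R[i].
Local Open Scope complex_scope.

Lemma char_poly_simil (F : fieldType) n (P D : 'M[F]_n) : P \in unitmx ->
  char_poly (invmx P *m D *m P) = char_poly D.
Proof.
move=> uP; rewrite /char_poly.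
have -> : char_poly_mx (invmx P *m D *m P) =
   map_mx polyC (invmx P) *m char_poly_mx D *m map_mx polyC P.
  rewrite /char_poly_mx mulmxBr mulmxBl !map_mxM /=; congr (_ - _).
  by rewrite mul_mx_scalar -scalemxAl -map_mxM mulVmx // map_mx1 scalemx1.
rewrite !det_mulmx mulrAC -det_mulmx -map_mxM mulVmx // map_mx1 det1 mul1r //.
Qed.

Lemma hermit_normal n (A : 'M[C]_n) : hermit A -> A \is spectral.normalmx.
Proof.
move=> hA; apply/spectral.normalmxP.
have -> : (map_mx (@Num.conj C) A^T) = A.
  by rewrite -[RHS]hA; apply/matrixP => i j; rewrite !mxE.
by [].
Qed.

Lemma spectral_decomp n (A : 'M[C]_n) : hermit A ->
  exists P (d : 'rV[C]_n), P \in unitmx /\ A = invmx P *m diag_mx d *m P.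
Proof.
move=> /hermit_normal /spectral.orthomx_spectralP h.
exists (spectral.spectralmx A), (spectral.spectral_diag A).
by split; [exact: spectral.spectral_unit | exact: h].
Qed.

Lemma trace_resolvent_diag n (A : 'M[C]_n) P (d : 'rV[C]_n) z : hermit A ->
  0 < complex.Im z -> P \in unitmx -> A = invmx P *m diag_mx d *m P ->
  \tr (resolvent A z) = \sum_i (d 0 i - z)^-1.
Proof.
move=> hA Iz uP eA.
have uA := resolvent_unit hA Iz.
have e : A - z%:M = invmx P *m diag_mx (d - const_mx z) *m P.
  rewrite linearB /= mulmxBr mulmxBl -eA; congr (_ - _).
  rewrite diag_const_mx mul_mx_scalar -scalemxAl mulVmx // scalemx1 //.
have uD : diag_mx (d - const_mx z) \in unitmx.
  by move: uA; rewrite e !unitmx_mul unitmx_inv uP /= andbT.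
have d0 i : d 0 i - z != 0.
  move: uD; rewrite unitmxE det_diag unitfE => /prodf_neq0 /(_ i isT).
  by rewrite !mxE.
have eG : resolvent A z = invmx P *m diag_mx (\row_i (d 0 i - z)^-1) *m P.
  have e2 : (A - z%:M) *m (invmx P *m diag_mx (\row_i (d 0 i - z)^-1) *m P) = 1%:M.
    rewrite e -!mulmxA mulKVmx // (mulmxA (diag_mx _)) mulmx_diag.
    rewrite (_ : diag_mx _ = 1%:M) ?mul1mx ?mulVmx //.
    apply/matrixP => i j; rewrite !mxE; case: eqP => [->|//].
    by rewrite !mulr1n mulfV.
  by rewrite -[RHS](mulKmx uA) e2 mulmx1.
rewrite eG mxtrace_mulC mulmxA mulmxV // mul1mx mxtrace_diag.
by apply: eq_bigr => i _; rewrite mxE.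
Qed.

Lemma trace_resolvent_spec n (A : 'M[C]_n) (lam : nat -> R) z : hermit A ->
  0 < complex.Im z ->
  char_poly A = \prod_(1 <= k < n.+1) ('X - ((lam k)%:C)%:P) ->
  \tr (resolvent A z) = \sum_(1 <= k < n.+1) ((lam k)%:C - z)^-1.
Proof.
move=> hA Iz hc; have [P [d [uP eA]]] := spectral_decomp hA.
rewrite (trace_resolvent_diag hA Iz uP eA).
have hp : perm_eq [seq d 0 i | i <- index_enum 'I_n] [seq (lam k)%:C | k <- index_iota 1 n.+1].
  apply: prod_XsubC_eq; rewrite !big_map -hc eA char_poly_simil //.
  rewrite char_poly_trig; last exact: diag_mx_is_trig.
  by apply: eq_bigr => i _; rewrite mxE eqxx mulr1n.
transitivity (\sum_(x <- [seq d 0 i | i <- index_enum 'I_n]) (x - z)^-1); first by rewrite big_map.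
by rewrite (perm_big _ hp) /= big_map.
Qed.

(** The rows of P are eigenvectors, so the diagonal entries are real, being quotients of real
    quadratic forms; sorting them gives a decreasing enumeration. *)
Lemma hermit_real_spectrum n (A : 'M[C]_n) : hermit A ->
  exists lam : nat -> R, nontrivial_spectrum n A lam.
Proof.
move=> hA; have [P [d [uP eA]]] := spectral_decomp hA.
have cp : char_poly A = \prod_i ('X - (d 0 i)%:P).
  rewrite {1}eA char_poly_simil // char_poly_trig; last exact: diag_mx_is_trig.
  by apply: eq_bigr => i _; rewrite mxE eqxx mulr1n.
have dreal i : d 0 i = (complex.Re (d 0 i))%:C.
  pose v : 'rV[C]_n := row i P.
  have vA : v *m A = d 0 i *: v.
    rewrite /v {1}eA -row_mul !mulmxA mulmxV // mul1mx row_mul row_diag_mx -scalemxAl.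
    by rewrite -rowE.
  have v0 : v != 0.
    apply/negP => /eqP v0; have := oner_neq0 C.
    have : (P *m invmx P) i i = 1 by rewrite mulmxV // mxE eqxx.
    by rewrite mxE => <-; rewrite big1 ?eqxx // => j _; have /rowP/(_ j) := v0; rewrite !mxE => ->; rewrite mul0r.
  have e1 : qf A (adjm v) (adjm v) = d 0 i * (frob2 (adjm v))%:C.
    by rewrite /qf adjmK vA -scalemxAl scalemxE frob2_cv adjmK.
  have := qf_hermit_real (adjm v) hA.
  rewrite e1 cImM /= mulr0 add0r => /eqP; rewrite mulf_eq0 => /orP[/eqP h|/eqP f0].
    by apply: cplx_eq.
  case/eqP: v0; apply/rowP => j; rewrite [RHS]mxE; apply: Normc.eq0_normc.
  have := f0; rewrite frob2_adj /frob2 big_ord1 => /eqP.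
  rewrite psumr_eq0 => [|k _]; last exact: exprn_ge0 (nrm_ge0 _).
  by move=> /allP /(_ j (mem_index_enum _)) /=; rewrite sqrf_eq0 => /eqP.
pose sq := sort (fun x y : R => y <= x) [seq complex.Re (d 0 i) | i <- index_enum 'I_n].
have szs : size sq = n by rewrite size_sort size_map -sum1_size sum1_card card_ord.
exists (fun k => nth 0 sq k.-1); split.
  rewrite subnn expr0 mul1r cp.
  rewrite (eq_bigr (fun i => 'X - ((complex.Re (d 0 i))%:C)%:P)); last by move=> i _; rewrite -dreal.
  rewrite -(big_map (fun i => complex.Re (d 0 i)) xpredT (fun x : R => 'X - (x%:C)%:P)).
  rewrite (perm_big sq) /=; last by rewrite perm_sym perm_sort.
  rewrite (big_nth 0) szs big_add1 /=; apply: eq_big_nat => k _ //.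
move=> k1 k2 k10 k12 k2n.
have trT : transitive (fun x y : R => y <= x) by move=> x y t xy yt; apply: le_trans yt xy.
have tot : total (fun x y : R => y <= x) by move=> x y; exact: le_total.
have reflT : reflexive (fun x y : R => y <= x) by move=> x; exact: lexx.
have so : sorted (fun x y : R => y <= x) sq by apply: sort_sorted.
apply: (sorted_leq_nth trT reflT 0 so); rewrite ?inE ?szs; lia.
Qed.

Lemma hermit_gram M N (X : 'M[C]_(M, N)) : hermit (gram X).
Proof.
rewrite /hermit (_ : gram X = adjm X *m X) //.
by rewrite adjmM adjmK.
Qed.

Lemma scov_predT M N (X : 'M[C]_(M, N)) : scov X xpredT = X *m adjm X.
Proof.
apply/matrixP => i j; rewrite /scov summxE !mxE; apply: eq_bigr => mu _.
by rewrite !mxE big_ord1 !mxE.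
Qed.

(** With G the resolvent of the Gram matrix, z times the other resolvent is X G X* - 1; cyclicity of
    the trace compares the two sides. *)
Lemma trace_swap M N (X : 'M[C]_(M, N)) z : 0 < complex.Im z ->
  z * \tr (Gfull X z) + M%:R = z * \tr (resolvent (gram X) z) + N%:R.
Proof.
move=> Iz; set G := resolvent (gram X) z.
have z0 := z_neq0 Iz.
have uG := resolvent_unit (hermit_gram X) Iz.
have uA := resolvent_unit (hermit_scov X xpredT) Iz.
have gE : gram X = adjm X *m X by [].
have e1 : adjm X *m X *m G = 1%:M + z *: G.
  have : (gram X - z%:M) *m G = 1%:M by rewrite mulmxV.
  rewrite mulmxBl mul_scalar_mx -gE => <-; by rewrite subrK.
set B := X *m G *m adjm X - 1%:M.
have e2 : (scov X xpredT - z%:M) *m B = z%:M.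
  rewrite scov_predT /B mulmxBr mulmx1 mulmxBl mul_scalar_mx.
  have -> : X *m adjm X *m (X *m G *m adjm X) = X *m (adjm X *m X *m G) *m adjm X.
    by rewrite !mulmxA.
  rewrite e1 mulmxDr mulmxDl mulmx1 -scalemxAr -scalemxAl addrK.
  by rewrite opprB addrC subrK.
have e3 : z *: Gfull X z = B.
  by rewrite -[B](mulKmx uA) e2 mul_mx_scalar.
have e4 : z * \tr (Gfull X z) = \tr B by rewrite -e3 linearZ.
rewrite e4 /B linearB /= mxtrace1 subrK -mulmxA mxtrace_mulC -mulmxA mxtrace_mulC e1.
by rewrite linearD linearZ /= mxtrace1 addrC.
Qed.

Variables (M N : nat) (s : R) (w : C).
Hypotheses (N0 : (0 < N)%N) (NM : (N <= M)%N).
Hypothesis eta0 : 0 < complex.Im w.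

(* Eigenvalues recentred like the spectral parameter. *)
Definition ycen (lam : nat -> R) k : R := lam k - (s^-1 + s).

Definition stj (lam : nat -> R) (v : C) : C :=
  (\sum_(1 <= k < N.+1) ((ycen lam k)%:C - v)^-1) / N%:R.

Lemma mstj_stj (X : 'M[C]_(M, N)) lam : nontrivial_spectrum N (gram X) lam ->
  mstj s w X = stj lam w.
Proof.
case=> hc _; rewrite subnn expr0 mul1r in hc.
have Iz : 0 < complex.Im (zpar s w) by rewrite Im_zpar.
have z0 := z_neq0 Iz.
rewrite /mstj /stj; congr (_ / _).
have e := trace_swap X Iz.
have -> : \tr (Gfull X (zpar s w)) + (M - N)%:R / zpar s w = \tr (resolvent (gram X) (zpar s w)).
  apply: (mulfI z0); rewrite mulrDr (mulrCA (zpar s w)) mulfV // mulr1 natrB //.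
  by rewrite addrA e addrK.
rewrite (trace_resolvent_spec (hermit_gram X) Iz hc).
apply: eq_bigr => k _; congr (_^-1).
by rewrite /ycen /zpar rmorphB; ring.
Qed.

End Spectra.

(** * Stieltjes transforms of finitely many atoms *)

Section StieltjesOfAtoms.
Variable R : realType.
Local Notation C := R[i].
Local Open Scope complex_scope.

Lemma Im_inv_atom (y : R) (w : C) : complex.Im ((y%:C - w)^-1) =
   complex.Im w / ((y - complex.Re w) ^+ 2 + complex.Im w ^+ 2).
Proof. by rewrite cIm_inv nrm_sqr !(cReB, cImB) /= sub0r opprK sqrrN. Qed.

Lemma Re_inv_atom (y : R) (w : C) : complex.Re ((y%:C - w)^-1) =
   (y - complex.Re w) / ((y - complex.Re w) ^+ 2 + complex.Im w ^+ 2).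
Proof. by rewrite cRe_inv nrm_sqr !(cReB, cImB) /= sub0r sqrrN. Qed.

Lemma nrm_atom_ge (y : R) (w : C) : 0 < complex.Im w -> complex.Im w <= nrm (y%:C - w).
Proof.
move=> h; apply: le_trans (le_Im_nrm _); rewrite cImB cImR sub0r normrN.
exact: ler_norm.
Qed.

Variables (N : nat) (s : R) (lam : nat -> R).
Hypothesis (N0 : (0 < N)%N).

Lemma ReN_inv (x : C) : complex.Re (x / N%:R) = complex.Re x / N%:R.
Proof.
have -> : (N%:R^-1 : C) = ((N%:R : R)^-1)%:C by rewrite fmorphV rmorph_nat.
by rewrite mulrC cReZ mulrC.
Qed.
Lemma ImN_inv (x : C) : complex.Im (x / N%:R) = complex.Im x / N%:R.
Proof.
have -> : (N%:R^-1 : C) = ((N%:R : R)^-1)%:C by rewrite fmorphV rmorph_nat.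
by rewrite mulrC cImZ mulrC.
Qed.

Lemma stj_Im w : complex.Im (stj N s lam w) =
 (\sum_(1 <= k < N.+1) complex.Im w / ((ycen s lam k - complex.Re w) ^+ 2 + complex.Im w ^+ 2)) / N%:R.
Proof.
by rewrite /stj ImN_inv cIm_sum; congr (_ / _); apply: eq_bigr => k _; rewrite Im_inv_atom.
Qed.

Lemma stj_Re w : complex.Re (stj N s lam w) =
 (\sum_(1 <= k < N.+1) (ycen s lam k - complex.Re w) / ((ycen s lam k - complex.Re w) ^+ 2 + complex.Im w ^+ 2)) / N%:R.
Proof.
by rewrite /stj ReN_inv cRe_sum; congr (_ / _); apply: eq_bigr => k _; rewrite Re_inv_atom.
Qed.

Lemma stj_lip w w' : 0 < complex.Im w -> 0 < complex.Im w' ->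
  nrm (stj N s lam w - stj N s lam w') <= nrm (w - w') / (complex.Im w * complex.Im w').
Proof.
move=> h h'; have Nr : 0 < N%:R :> R by rewrite ltr0n.
rewrite /stj -mulrBl -sumrB nrmM nrmV nrm_nat ler_pdivrMr //.
apply: (le_trans (nrm_sum _ _ _)).
apply: (@le_trans _ _ (\sum_(1 <= k < N.+1) (nrm (w - w') / (complex.Im w * complex.Im w')))); last first.
  by rewrite sumr_const_nat subSS subn0 mulr_natr.
apply: ler_sum => k _; set y := ycen _ _ _.
have g := nrm_atom_ge y h; have g' := nrm_atom_ge y h'.
have d0 : 0 < nrm (y%:C - w) by exact: lt_le_trans g.
have d0' : 0 < nrm (y%:C - w') by exact: lt_le_trans g'.
have -> : (y%:C - w)^-1 - (y%:C - w')^-1 = (w - w') / ((y%:C - w) * (y%:C - w')).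
  by field; rewrite -!nrm_eq0 !gt_eqF.
rewrite nrmM nrmV nrmM ler_wpM2l ?nrm_ge0 // lef_pV2 ?posrE ?mulr_gt0 //.
by apply: ler_pM => //; exact: ltW.
Qed.

Lemma stj_atom_le w k : 0 < complex.Im w -> (1 <= k <= N)%N ->
  complex.Im w / ((ycen s lam k - complex.Re w) ^+ 2 + complex.Im w ^+ 2) <= N%:R * complex.Im (stj N s lam w).
Proof.
move=> h /andP[k1 kN]; have Nr : 0 < N%:R :> R by rewrite ltr0n.
rewrite stj_Im mulrCA mulfV ?gt_eqF // mulr1.
rewrite (bigD1_seq k) /=; [|by rewrite mem_index_iota; lia|exact: iota_uniq].
rewrite lerDl sumr_ge0 // => j _.
by rewrite divr_ge0 ?addr_ge0 ?sqr_ge0 // ltW.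
Qed.

End StieltjesOfAtoms.

Ltac nneg := repeat first [done | assumption | exact: ltW | apply: addr_ge0 | apply: mulr_ge0 | apply: sqr_ge0 | apply: nrm_ge0].

(** * The local law *)

Section PointLaw.
Variable R : realType.
Local Notation C := R[i].
Local Open Scope complex_scope.
Variables (tt : R) (c : nat -> R).
Hypotheses (tt0 : 0 < tt) (tt1 : tt <= 1) (c_ge0 : forall k, 0 <= c k).

(** The product of 1/2 and tt / 7 in [H_lower], where 7 / tt bounds |m_N| L. *)
Definition c0tt : R := tt / 14.
Definition K1tt : R := 6 / tt.

(* The bound on the self-consistent error when |m_N - m| <= l is known. *)
Definition Bsharp (N : nat) (w m0 rho : C) (l : R) : R :=
  qpar N w * Num.sqrt ((complex.Im m0 + l) * (nrm rho + (1 + nrm w) * l))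
  + (1 + nrm w) * qpar N w * (complex.Im m0 + l).

(** The square dominates (28 / c0)^2, which comes from [psi_le]; 4 (K1 + 18) is 8 + 4 (K1 + 16), the
    sum of the two other contributions in [errbd_le]. *)
Definition Kb : R := (32 * (1 / c0tt + 1)) ^+ 2 + 4 * (K1tt + 18).

Lemma Kb_ge1 : 1 <= Kb.
Proof.
have c00 : 0 < c0tt by rewrite divr_gt0.
have K0 : 0 < K1tt by rewrite divr_gt0.
have h : 1 <= 1 / c0tt + 1 by rewrite lerDr divr_ge0 // ltW.
by rewrite /Kb; move: (1 / c0tt + 1) h => x h; nra.
Qed.

Lemma Kb_gt0 : 0 < Kb. Proof. by apply: lt_le_trans Kb_ge1. Qed.

Section Fixed.
Variables (M N : nat) (s : R) (w u : C) (l g : R).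
Hypotheses (N0 : (0 < N)%N) (NM : (N <= M)%N) (s0 : 0 < s) (sMN : s ^+ 2 * M%:R = N%:R).
Local Notation eta := (complex.Im w).
Local Notation E := (complex.Re w).
Local Notation L := (1 + nrm w).
Local Notation q := (qpar N w).
Local Notation m0 := (mp_m u s).
Local Notation rho := (sc_rho w u).
Local Notation A := (complex.Im m0).
Hypotheses (e0 : 0 < eta) (Iu : 0 < complex.Im u) (Hu : u ^+ 2 + w * u + 1 = 0).
Hypothesis dom : (- 2 + tt <= E) || (s <= 1 - tt / 2).
Hypotheses (ql : q <= l) (g1 : 1 <= g).
Hypothesis lcase : (L * l <= 1 / 24) \/ (L * l <= 4 /\ c0tt * L <= eta).
Hypothesis small : g ^+ 2 * (L * q) * (6 * (K1tt + 5)) <= (c0tt / 28) ^+ 2.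

Let s1 := s_le1 N0 NM s0 sMN.
Let L1 : 1 <= L. Proof. by rewrite lerDl nrm_ge0. Qed.
Let q0 : 0 < q. Proof. exact: q_gt0. Qed.
Let l0 : 0 < l. Proof. exact: lt_le_trans q0 ql. Qed.
Let A0 : 0 < A. Proof. exact: (Im_mp_m_gt0 Iu s0). Qed.
Let c00 : 0 < c0tt. Proof. by rewrite divr_gt0. Qed.
Let K10 : 6 <= K1tt. Proof. by rewrite /K1tt ler_pdivlMr // ler_piMr. Qed.
Let aL : nrm (apar s w) <= 2 * L. Proof. exact: apar_le. Qed.
Let rhoL : nrm rho <= 2 * L. Proof. exact: (sc_rho_le e0 Iu Hu). Qed.
Let Ll4 : L * l <= 4.
Proof. by case: lcase => [h|[h _]] //; apply: (le_trans h); lra. Qed.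
Let l4 : l <= 4.
Proof. by apply: le_trans Ll4; rewrite ler_peMl // ltW. Qed.
Let AK : A <= K1tt.
Proof.
apply: (le_trans (Im_le_nrm _)); apply: (le_trans (mp_m_le e0 Iu Hu s0 s1 tt0 tt1 dom)).
rewrite ler_pdivrMr ?(lt_le_trans ltr01 L1) //; rewrite ler_peMr //.
by apply: le_trans K10.
Qed.
Let mK : nrm m0 * L <= K1tt.
Proof.
have := mp_m_le e0 Iu Hu s0 s1 tt0 tt1 dom.
by rewrite ler_pdivlMr // (lt_le_trans ltr01 L1).
Qed.

(** If L l is small, P(m_N) = 1 + z (1 + sp t) m_N is at most 1/2 in modulus while |m_N| is of order
    1 / L, so the remaining factor is of order L. If eta is of order L, the positivity of Im(z t)
    suffices. *)
Lemma H_lower (X : 'M[C]_(M, N)) : nrm (mstj s w X - m0) <= 4 * l ->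
  c0tt * L <= nrm (zpar s w * (1 + (spar N s)%:C * \tr (Gfull X (zpar s w)))).
Proof.
move=> h; set zD := zpar s w * _.
case: lcase => [hl|[_ he]]; last first.
  apply: (le_trans he); apply: le_trans (Im_le_nrm _).
  rewrite /zD mulrDr mulr1 cImD Im_zpar lerDl mulrCA cImZ mulr_ge0 ?(ltW (sp_gt0 N0 s0)) //.
  exact: Im_z_trace_ge0 (hermit_scov _ _) (Im_zpar_gt0 s e0) (psd_scov _ _).
have hl2 : l <= 1 / 24 by apply: le_trans hl; rewrite ler_peMl // ltW.
have nm : nrm (mstj s w X) * L <= 7 / tt.
  have -> : mstj s w X = m0 + (mstj s w X - m0) by rewrite addrC subrK.
  have h1 : nrm (m0 + (mstj s w X - m0)) <= nrm m0 + 4 * l.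
    by apply: (le_trans (nrmD _ _)); rewrite lerD2l.
  have := ler_wpM2r (le_trans ler01 L1) h1; rewrite mulrDl => h2.
  apply: (le_trans h2).
  have t1 : 1 <= 1 / tt by rewrite ler_pdivlMr // mul1r.
  have -> : 7 / tt = K1tt + 1 / tt by rewrite /K1tt; field; rewrite gt_eqF.
  by apply: lerD => //; apply: le_trans t1; move: hl; lra.
have hP : nrm (scpoly s w (mstj s w X)) <= 1 / 2.
  rewrite (scpoly_factor (mp_m_root Iu Hu s0)) (mp_rho Iu Hu s0) nrmM.
  have h1 : nrm (apar s w * (mstj s w X - m0) + rho) <= 2 * L * (4 * l) + 2 * L.
    apply: (le_trans (nrmD _ _)); apply: lerD => //; rewrite nrmM.
    by apply: ler_pM => //; exact: nrm_ge0.
  apply: (@le_trans _ _ (4 * l * (2 * L * (4 * l) + 2 * L))).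
    by apply: ler_pM => //; exact: nrm_ge0.
  have -> : 4 * l * (2 * L * (4 * l) + 2 * L) = (L * l) * (8 * (4 * l + 1)) by ring.
  apply: (@le_trans _ _ (1 / 24 * (8 * (4 * (1 / 24) + 1)))); last by lra.
  apply: ler_pM => //; last by lra.
    by rewrite mulr_ge0 ?(ltW l0) // (le_trans ler01 L1).
  by rewrite mulr_ge0 // addr_ge0 // mulr_ge0 // ltW.
have e1 : scpoly s w (mstj s w X) = 1 + zD * mstj s w X.
  by rewrite (scpoly_mstj N0 NM s0 sMN e0) /zD; ring.
have h2 : 1 / 2 <= nrm zD * nrm (mstj s w X).
  rewrite -nrmM; have := nrmB_ge 1 (scpoly s w (mstj s w X)); rewrite nrm1.
  rewrite (_ : 1 - scpoly s w (mstj s w X) = - (zD * mstj s w X)); last by rewrite e1; ring.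
  by rewrite nrmN; lra.
have h3 : 1 / 2 * L <= nrm zD * (7 / tt).
  apply: (@le_trans _ _ (nrm zD * (nrm (mstj s w X) * L))).
    by rewrite mulrA ler_wpM2r // (le_trans ler01 L1).
  by rewrite ler_wpM2l ?nrm_ge0.
have -> : c0tt * L = (1 / 2 * L) * (tt / 7) by rewrite /c0tt; field.
have -> : nrm zD = nrm zD * (7 / tt) * (tt / 7) by field; rewrite gt_eqF.
by rewrite ler_wpM2r // divr_ge0 // ltW.
Qed.

Let Lp : 0 < L. Proof. exact: lt_le_trans ltr01 L1. Qed.
Let Al0 : 0 < A + l. Proof. by rewrite addr_gt0. Qed.
Let Lq0 : 0 < L * q. Proof. by rewrite mulr_gt0. Qed.

Lemma Lq_small : L * q <= c0tt / 8 /\ L * q <= 1.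
Proof.
have h := small; have k := K10; have gg : 1 <= g ^+ 2 by rewrite exprn_ege1.
have cc : c0tt <= 1 / 14 by rewrite /c0tt ler_pM2r.
have c00' := c00.
have h1 : L * q * 66 <= (c0tt / 28) ^+ 2.
  apply: le_trans h; rewrite -[L * q in leLHS]mul1r; apply: ler_pM => //.
  - by rewrite mul1r ltW.
  - by rewrite ler_wpM2r // ltW.
  - lra.
have h2 : (c0tt / 28) ^+ 2 <= c0tt / 28 by rewrite expr2 ler_piMl //; lra.
split; lra.
Qed.

(** 1/N is q eta, and eta is at most 4 L^2 Im m0; so the zero eigenvalues in [zF_le] cost no more
    than the main term. *)
Lemma invN_le : N%:R^-1 <= 4 * L ^+ 2 * q * A.
Proof.
have e : N%:R^-1 = q * eta.
  by rewrite /q; field; rewrite !gt_eqF // ltr0n.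
rewrite e (_ : 4 * L ^+ 2 * q * A = q * (A * (4 * L ^+ 2))); last by ring.
by rewrite ler_wpM2l ?(ltW q0) // (Im_mp_m_ge e0 Iu Hu s0 s1 tt0 tt1).
Qed.

Lemma Phi_le : Phi N s w l A <= 48 * L ^+ 2 * q * (A + l).
Proof.
have a0 := nrm_ge0 (apar s w); have h := invN_le.
have a2 : nrm (apar s w) ^+ 2 <= 4 * L ^+ 2.
  rewrite (_ : 4 * L ^+ 2 = (2 * L) ^+ 2); last by ring.
  by apply: lerXn2r; rewrite ?nnegrE // (le_trans a0).
have L2 : 0 <= L ^+ 2 by rewrite sqr_ge0.
have x1 : nrm (apar s w) ^+ 2 * q * (A + 4 * l) <= 4 * L ^+ 2 * q * (A + 4 * l).
  apply: ler_wpM2r; first by rewrite addr_ge0 ?(ltW A0) // mulr_ge0 // ltW.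
  by rewrite ler_wpM2r // ltW.
have x2 : nrm (apar s w) ^+ 2 * q ^+ 2 <= 4 * L ^+ 2 * q * l.
  rewrite (_ : _ * q ^+ 2 = nrm (apar s w) ^+ 2 * q * q); last by ring.
  apply: ler_pM => //; last by rewrite ler_wpM2r // ltW.
  - by rewrite mulr_ge0 ?sqr_ge0 // ltW.
  - by rewrite ltW.
rewrite /Phi.
have L2q : 0 <= L ^+ 2 * q by rewrite mulr_ge0 // ltW.
have L2qA : 0 <= L ^+ 2 * q * A by rewrite mulr_ge0 // ltW.
have L2ql : 0 <= L ^+ 2 * q * l by rewrite mulr_ge0 // ltW.
lra.
Qed.

Let rt := Num.sqrt (q * (A + l)).
Let rt2 : rt ^+ 2 = q * (A + l). Proof. by rewrite sqr_sqrtr // mulr_ge0 // ltW. Qed.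
Let rt0 : 0 <= rt. Proof. exact: sqrtr_ge0. Qed.
Let g0 : 0 < g. Proof. exact: lt_le_trans ltr01 g1. Qed.

(** The 7 rounds up the square root of the 48 in [Phi_le]. *)
Lemma Sbd_le : Sbd N s w l A g <= 7 * g * L * rt.
Proof.
rewrite /Sbd (_ : 7 * g * L * rt = g * (7 * L * rt)); last by ring.
rewrite ler_wpM2l ?(ltW g0) //.
have nn : 0 <= 7 * L * rt by rewrite !mulr_ge0 // ltW.
rewrite -[leRHS]ger0_norm // -sqrtr_sqr ler_wsqrtr //.
apply: (le_trans Phi_le); rewrite !exprMn rt2.
have : 0 <= L ^+ 2 * (q * (A + l)).
  by apply: mulr_ge0; [exact: sqr_ge0 | apply: mulr_ge0; exact: ltW].
lra.
Qed.

Lemma rt_small : 7 * g * rt <= c0tt / 4.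
Proof.
have c00' := c00; have A0' := A0; have l4' := l4; have AK' := AK; have K10' := K10.
have h : (g * rt) ^+ 2 <= (c0tt / 28) ^+ 2.
  apply: le_trans small; rewrite exprMn rt2 -mulrA ler_wpM2l ?sqr_ge0 //.
  apply: ler_pM; rewrite ?(ltW q0) ?(ltW Al0) //.
    by rewrite ler_peMl // ltW.
  lra.
have : g * rt <= c0tt / 28.
  have cc : 0 <= c0tt / 28 by lra.
  have gr : 0 <= g * rt by apply: mulr_ge0 => //; exact: ltW.
  by rewrite -(ler_pXn2r (n := 2)) // ?nnegrE.
lra.
Qed.

Lemma psi_le : psi N s w l A c0tt L g <= 28 * g / c0tt * rt.
Proof.
have h := Sbd_le.
rewrite /psi ler_pdivrMr ?mulr_gt0 // (_ : 28 * g / c0tt * rt * (c0tt * L) = 4 * (7 * g * L * rt)).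
  by rewrite ler_wpM2l.
by field; rewrite gt_eqF.
Qed.

Let S1 := q * Num.sqrt ((A + l) * (nrm rho + L * l)).
Let S2 := L * q * (A + l).
Definition bpar : R := Kb * g ^+ 2 * (S1 + S2).

Lemma bparE : bpar = Kb * g ^+ 2 * Bsharp N w m0 rho l. Proof. by []. Qed.

Let rl0 : 0 < nrm rho + L * l. Proof. by rewrite ltr_wpDl ?nrm_ge0 // mulr_gt0. Qed.
Let S10 : 0 <= S1. Proof. by rewrite mulr_ge0 ?sqrtr_ge0 // ltW. Qed.
Let S20 : 0 < S2. Proof. by rewrite !mulr_gt0. Qed.

Lemma bpar_gt0 : 0 < bpar.
Proof.
rewrite /bpar mulr_gt0 ?ltr_wpDl // mulr_gt0 ?exprn_gt0 //.
exact: Kb_gt0.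
Qed.

Lemma S1sq : S1 ^+ 2 = q ^+ 2 * ((A + l) * (nrm rho + L * l)).
Proof. by rewrite exprMn sqr_sqrtr // mulr_ge0 // ltW. Qed.

Lemma del_le : del N s w m0 l A c0tt L g <= 96 * (28 * g / c0tt * rt) * q * (nrm rho + L * l).
Proof.
have h := psi_le; have a0 := nrm_ge0 (apar s w).
have p0 : 0 <= psi N s w l A c0tt L g.
  by apply: (@psi_ge0 R N s w l A c0tt L g).
rewrite /del (mp_rho Iu Hu s0).
have x1 : nrm rho + nrm (apar s w) * l <= 2 * (nrm rho + L * l).
  have : nrm (apar s w) * l <= 2 * L * l by rewrite ler_wpM2r // ltW.
  by have := nrm_ge0 rho; lra.
rewrite (_ : 96 * _ * q * _ = 48 * (28 * g / c0tt * rt * q) * (2 * (nrm rho + L * l))); last by ring.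
apply: ler_pM => //.
- by apply: mulr_ge0 => //; apply: mulr_ge0 => //; exact: ltW.
- by rewrite addr_ge0 ?nrm_ge0 // mulr_ge0 ?nrm_ge0 // ltW.
- by rewrite ler_wpM2l // ler_wpM2r // ltW.
Qed.

Let kk := 28 * g / c0tt.
Let kk0 : 0 <= kk. Proof. by rewrite divr_ge0 ?mulr_ge0 ?ltW. Qed.

Let kkK : 300 * kk <= Kb * g.
Proof.
have -> : 300 * kk = (300 * 28 * (1 / c0tt)) * g by rewrite /kk; field; rewrite gt_eqF.
rewrite ler_wpM2r ?(ltW g0) //.
have x0 : 14 <= 1 / c0tt.
  by rewrite /c0tt ler_pdivlMr ?divr_gt0 //; have := tt1; lra.
have := K10; rewrite /Kb; move: (1 / c0tt) x0 => x x0 k0.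
have : 300 * 28 * x <= (32 * (x + 1)) ^+ 2 by nra.
by lra.
Qed.

Lemma kkS1_le : 300 * (kk * S1) <= bpar.
Proof.
rewrite mulrA; apply: (@le_trans _ _ (Kb * g * S1)); first by rewrite ler_wpM2r.
have KK := Kb_gt0.
have gg : g <= g ^+ 2 by rewrite expr2 ler_peMl // ltW.
rewrite /bpar; apply: ler_pM => //.
- by rewrite mulr_ge0 ?(ltW g0) //; lra.
- by rewrite ler_wpM2l //; lra.
- by rewrite lerDl ltW.
Qed.

(** The bound for [psi] carries sqrt(q (A + l)), the one for [del] the same root times q (|rho| + L
    l); their product is a multiple of [S1] squared. This is why [Bsharp] contains a geometric
    mean. *)
Lemma psidel_le : psi N s w l A c0tt L g * del N s w m0 l A c0tt L g <= bpar ^+ 2.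
Proof.
have h1 := psi_le; have h2 := del_le.
have p0 : 0 <= psi N s w l A c0tt L g by apply: (@psi_ge0 R N s w l A c0tt L g).
have d0 : 0 <= del N s w m0 l A c0tt L g.
  apply: mulr_ge0; last by rewrite addr_ge0 ?nrm_ge0 // mulr_ge0 ?nrm_ge0 // ltW.
  by apply: mulr_ge0 => //; apply: mulr_ge0 => //; exact: ltW.
apply: (le_trans (ler_pM p0 d0 h1 h2)).
rewrite -/kk (_ : kk * rt * _ = 96 * (kk * S1) ^+ 2); last first.
  rewrite [(kk * S1) ^+ 2]exprMn S1sq.
  by transitivity (96 * kk ^+ 2 * q * (nrm rho + L * l) * rt ^+ 2); [ring | rewrite rt2; ring].
have b1 := kkS1_le.
have kS0 : 0 <= kk * S1 by rewrite mulr_ge0.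
move: b1 kS0; move: (kk * S1) bpar => x y; nra.
Qed.

Lemma del_le_b : del N s w m0 l A c0tt L g <= bpar.
Proof.
have h2 := del_le; apply: (le_trans h2); rewrite -/kk.
have e : (96 * (kk * rt) * q * (nrm rho + L * l)) ^+ 2 = (96 * kk) ^+ 2 * S1 ^+ 2 * (q * (nrm rho + L * l)).
  rewrite S1sq !exprMn rt2; ring.
have [_ Lq1] := Lq_small.
have hq : q * (nrm rho + L * l) <= 6.
  apply: (@le_trans _ _ (q * (2 * L + 2 * (2 * L)))).
    rewrite ler_wpM2l ?(ltW q0) //; apply: lerD => //.
    by apply: (le_trans Ll4); have := L1; lra.
  by lra.
have b1 := kkS1_le; have bp := bpar_gt0.
have kS0 : 0 <= kk * S1 by rewrite mulr_ge0.
have D0 : 0 <= 96 * (kk * rt) * q * (nrm rho + L * l) by nneg.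
rewrite -(ler_pXn2r (n := 2)) // ?nnegrE ?(ltW bp) // e.
have kS2 : 0 <= (kk * S1) ^+ 2 by rewrite sqr_ge0.
apply: (@le_trans _ _ ((96 * kk) ^+ 2 * S1 ^+ 2 * 6)).
  by rewrite ler_wpM2l // mulr_ge0 ?sqr_ge0.
rewrite (_ : _ * 6 = 6 * (96 * (kk * S1)) ^+ 2); last by ring.
have t0 : 0 <= 96 * (kk * S1) by nneg.
have t1 : 3 * (96 * (kk * S1)) <= bpar by move: b1 kS0; lra.
by move: t0 t1; move: (96 * (kk * S1)) bpar => x y; nra.
Qed.

Lemma errbd_le : errbd N s w m0 l A c0tt L g <= bpar.
Proof.
have h1 := psi_le; have a0 := nrm_ge0 (apar s w); have mK' := mK; have Ll4' := Ll4.
have p0 : 0 <= psi N s w l A c0tt L g by apply: (@psi_ge0 R N s w l A c0tt L g).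
have S2p := S20; have gg : 1 <= g ^+ 2 by rewrite exprn_ege1.
set x := 1 / c0tt.
have k2 : 0 <= kk ^+ 2 by exact: sqr_ge0.
have x1 : psi N s w l A c0tt L g ^+ 2 <= kk ^+ 2 * S2.
  apply: (@le_trans _ _ ((kk * rt) ^+ 2)).
    by apply: lerXn2r; rewrite ?nnegrE // mulr_ge0.
  rewrite exprMn rt2 ler_wpM2l // /S2 ler_wpM2r ?(ltW Al0) //.
  by rewrite ler_peMl // ltW.
have x2 : nrm (apar s w) * q * (A + 4 * l) <= 8 * S2.
  rewrite (_ : 8 * S2 = (2 * L * q) * (4 * (A + l))); last by rewrite /S2; ring.
  apply: ler_pM; [by nneg | by nneg | by rewrite ler_wpM2r // ltW | by have := A0; lra].
have x3 : spar N s * (nrm m0 + 4 * l) <= 4 * (K1tt + 16) * S2.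
  have sN : spar N s <= 4 * L ^+ 2 * q * A.
    apply: le_trans invN_le; rewrite /spar -[leRHS]mul1r ler_wpM2r // invr_ge0 ler0n //.
  apply: (@le_trans _ _ (4 * L ^+ 2 * q * A * (nrm m0 + 4 * l))).
    by rewrite ler_wpM2r //; nneg.
  rewrite (_ : 4 * L ^+ 2 * q * A * _ = (4 * (nrm m0 * L + 4 * (L * l))) * (L * q * A)); last by ring.
  apply: ler_pM.
  - by nneg.
  - by nneg.
  - lra.
  - by rewrite /S2 ler_wpM2l ?(ltW Lq0) // lerDl ltW.
have xp : 0 < x by rewrite /x divr_gt0.
rewrite /errbd; apply: (@le_trans _ _ ((kk ^+ 2 + 8 + 4 * (K1tt + 16)) * S2)); first by lra.
apply: (@le_trans _ _ (Kb * g ^+ 2 * S2)).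
  rewrite ler_wpM2r ?(ltW S2p) //.
  have K10' := K10.
  have -> : kk ^+ 2 = (28 * x) ^+ 2 * g ^+ 2 by rewrite /kk /x; field; rewrite gt_eqF.
  have hx : (28 * x) ^+ 2 <= (32 * (x + 1)) ^+ 2.
    by apply: lerXn2r; rewrite ?nnegrE; lra.
  have := ler_wpM2r (sqr_ge0 g) hx; rewrite /Kb -/x.
  have : (8 + 4 * (K1tt + 16)) * 1 <= (8 + 4 * (K1tt + 16)) * g ^+ 2 by rewrite ler_wpM2l //; lra.
  by move: ((32 * (x + 1)) ^+ 2) ((28 * x) ^+ 2) => X1 X2; lra.
rewrite /bpar ler_wpM2l ?lerDr // mulr_ge0 ?sqr_ge0 //.
exact: ltW Kb_gt0.
Qed.

End Fixed.
End PointLaw.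

Ltac nng := repeat first [done | assumption | exact: ltW | apply: normr_ge0 | apply: nrm_ge0 | apply: addr_ge0 | apply: mulr_ge0 | apply: exprn_ge0].

(** * The self-consistent equation with high probability at one point *)

Section PointLawProb.
Variable R : realType.
Local Notation C := R[i].
Local Open Scope complex_scope.
Variables (tt : R) (c : nat -> R).
Hypotheses (tt0 : 0 < tt) (tt1 : tt <= 1) (c_ge0 : forall k, 0 <= c k).

Record fmodel (M N : nat) (s : R) (V : finType) (p : 'I_M -> 'I_N -> V -> R)
    (xv : 'I_M -> 'I_N -> V -> C) : Prop := FModel {
  fm_N : (0 < N)%N; fm_NM : (N <= M)%N; fm_s : 0 < s; fm_sMN : s ^+ 2 * M%:R = N%:R;
  fm_cm : forall mu, column_model (fun i => p i mu) (fun i => xv i mu) (spar N s) c }.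

Lemma expr_scale_ge (n G : R) (e D j : nat) : 1 <= n -> 1 <= G -> n <= G ^+ e -> (e * D <= j)%N ->
  n ^+ D <= G ^+ j.
Proof.
move=> n1 G1 nG ej; apply: (@le_trans _ _ (G ^+ (e * D))).
  by rewrite exprM lerXn2r ?nnegrE ?exprn_ge0 //; lra.
by rewrite ler_weXn2l.
Qed.

Definition lcases (w : C) (l : R) : Prop :=
  ((1 + nrm w) * l <= 1 / 24) \/ ((1 + nrm w) * l <= 4 /\ c0tt tt * (1 + nrm w) <= complex.Im w).

(** All parameters are polynomial in N, and N <= G^e. Since the order of the moment may depend on e
    and D, Markov's inequality gains any power of N out of powers of G. *)
Lemma point_law (B e D : nat) : exists G0 : R, 1 <= G0 /\
  forall (G : R) (M N : nat) (s : R) (V : finType) (p : 'I_M -> 'I_N -> V -> R)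
    (xv : 'I_M -> 'I_N -> V -> C), fmodel s p xv -> G0 <= G -> N%:R <= G ^+ e ->
  s^-1 <= N%:R ^+ B ->
  forall (w u : C) (l : R), 0 < complex.Im w -> 0 < complex.Im u -> u ^+ 2 + w * u + 1 = 0 ->
  (- 2 + tt <= complex.Re w) || (s <= 1 - tt / 2) ->
  N%:R^-1 <= complex.Im w -> 1 + nrm w <= N%:R ^+ B ->
  G ^+ 4 * ((1 + nrm w) * qpar N w) <= 1 -> qpar N w <= l -> lcases w l ->
  fP (wt p) (fun o => (nrm (mstj s w (Xmat xv o) - mp_m u s) <= l) &&
    (G ^+ 4 * Bsharp N w (mp_m u s) (sc_rho w u) l < nrm (scpoly s w (mstj s w (Xmat xv o)))))
  <= (N%:R ^+ D)^-1.
Proof.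
(* k makes G^(2k+1) at least N^D in Markov's inequality. K makes the exceptional event rarer than
   the inverse square of the truncation level N^T0. The exponent b2 is that of the lower bound on b,
   which dominates q^2. *)
pose k := (e * D)%N; pose m := (2 * k).+2; pose b2 := (2 * B + 2)%N.
pose T0 := (B + 3 + b2 * m + D + 1)%N; pose K := (e * (2 * T0 + 1))%N.
pose Y := young_const R k; pose Q0 := quad_const c 0; pose QK := quad_const c K ^+ K.+1.
pose Cc : R := 2 * 144 ^+ m * (1 + 3 * (1 + `|Q0|)).
pose c28 : R := 6 * (K1tt tt + 5) * (28 / c0tt tt) ^+ 2.
have hk : (e * D <= (2 * k).+1)%N by rewrite /k; lia.
have hK : (e * (2 * T0 + 1) <= 2 * K)%N by rewrite /K; lia.
pose T1 := (b2 * m + D + 1)%N.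
have hT : T0 = (B + 3 + T1)%N by rewrite /T0 /T1; lia.
have hb2 : b2 = (B.+1 + B.+1)%N by rewrite /b2; lia.
exists (1 + 4 * `|Y| + 2 * `|QK| + 2 * Cc + Kb tt + c28).
have Y0 := normr_ge0 Y; have QK0 := normr_ge0 QK.
have Cc0 : 0 <= Cc by rewrite /Cc; nng.
have Kb0 := Kb_gt0 tt0.
have c280 : 0 <= c28.
  rewrite mulr_ge0 ?sqr_ge0 // mulr_ge0 // addr_ge0 // divr_ge0 // ltW //.
split; first by lra.
move=> G M N s V p xv fm GG0 nG sB w u l eta0 Iu Hu dom nEta LB GLq ql lc.
have N0 := fm_N fm; have NM := fm_NM fm; have s0 := fm_s fm; have sMN := fm_sMN fm; have cm := fm_cm fm.
have G1 : 1 <= G by lra.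
have Gp : 0 < G by lra.
set n := N%:R in nG sB nEta LB *.
have n1 : 1 <= n by rewrite ler1n.
have np : 0 < n by lra.
set L := 1 + nrm w in LB GLq lc *.
have L1 : 1 <= L by rewrite lerDl nrm_ge0.
have q0 := q_gt0 N0 eta0; set q := qpar N w in GLq ql q0 *.
have etaL : complex.Im w <= L by rewrite /L; have := Im_le_nrm w; lra.
have Lqn : n^-1 <= L * q.
  rewrite /q /qpar invfM mulrCA -[leLHS]mulr1 ler_wpM2l ?invr_ge0 ?(ltW np) //.
  by rewrite ler_pdivlMr // mul1r.
have nG4 : G <= n.
  have h1 : G ^+ 4 * n^-1 <= 1.
    by apply: le_trans GLq; rewrite ler_wpM2l ?exprn_ge0 // ltW.
  rewrite ler_pdivrMr // mul1r in h1; apply: le_trans h1.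
  by rewrite exprS ler_peMr ?(ltW Gp) // exprn_ege1.
have small : G ^+ 2 * (L * q) * (6 * (K1tt tt + 5)) <= (c0tt tt / 28) ^+ 2.
  have c00 : 0 < c0tt tt by rewrite divr_gt0.
  have hc : c28 <= G ^+ 2.
    by apply: (@le_trans _ _ G); [lra | rewrite expr2 ler_peMr // ltW].
  have e1 : G ^+ 2 * (L * q) <= (G ^+ 2)^-1.
    rewrite -[leRHS]mul1r ler_pdivlMr ?exprn_gt0 //; apply: le_trans GLq.
    by rewrite le_eqVlt; apply/orP; left; apply/eqP; ring.
  have K6 : 0 <= 6 * (K1tt tt + 5) by rewrite mulr_ge0 // addr_ge0 // divr_ge0 // ltW.
  apply: (le_trans (ler_wpM2r K6 e1)).
  rewrite mulrC ler_pdivrMr ?exprn_gt0 //.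
  have -> : 6 * (K1tt tt + 5) = c28 * (c0tt tt / 28) ^+ 2.
    by rewrite /c28; field; rewrite gt_eqF.
  by rewrite mulrC ler_wpM2l ?sqr_ge0.
have l0 : 0 < l by apply: lt_le_trans ql.
set m0 := mp_m u s; set rho := sc_rho w u.
set b := bpar tt N s w u l G.
have bp : 0 < b by exact: (bpar_gt0 tt0 N0 s0 eta0 Iu ql G1).
have pd := psidel_le tt0 tt1 N0 NM s0 sMN eta0 Iu Hu ql G1.
have db := del_le_b tt0 tt1 N0 NM s0 sMN eta0 Iu Hu ql G1 lc small.
have eb := errbd_le tt0 tt1 N0 NM s0 sMN eta0 Iu Hu dom ql G1 lc.
have [Lq8 Lq1] := Lq_small tt0 tt1 N0 eta0 G1 small.
have aL : nrm (apar s w) <= 2 * L by apply: apar_le => //; exact: (s_le1 N0 NM s0 sMN).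
have cL : 0 < c0tt tt * L by rewrite mulr_gt0 ?divr_gt0 //; lra.
have aq : nrm (apar s w) * q <= c0tt tt * L / 4.
  apply: (@le_trans _ _ (2 * (L * q))).
    by rewrite mulrA ler_wpM2r // ltW.
  apply: (@le_trans _ _ (c0tt tt / 4)); first by move: Lq8; rewrite -/L -/q; lra.
  by rewrite ler_wpM2r // ler_peMr // ltW // divr_gt0.
have Ssm : Sbd N s w l (complex.Im m0) G <= c0tt tt * L / 4.
  have h1 := Sbd_le tt0 tt1 N0 NM s0 sMN eta0 Iu Hu ql G1.
  have h2 := rt_small tt0 tt1 N0 NM s0 sMN eta0 Iu Hu dom ql G1 lc small.
  apply: (le_trans h1).
  have -> : c0tt tt * L / 4 = c0tt tt / 4 * L by ring.
  move: h2; set x := Num.sqrt _; rewrite -/L => h2.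
  rewrite (_ : 7 * G * L * x = 7 * G * x * L); last by ring.
  by rewrite ler_wpM2r // (le_trans ler01 L1).
have Im0 : 0 <= complex.Im m0 by apply: ltW; apply: Im_mp_m_gt0.
have mr : scpoly s w m0 = 0 by apply: mp_m_root.
have c00 : 0 < c0tt tt by rewrite divr_gt0.
have key := key_prob N0 NM s0 sMN eta0 cm mr l0 ql Im0 (lexx _) c00 L1 G1
  (fun X => H_lower tt0 tt1 N0 NM s0 sMN eta0 Iu Hu dom ql lc (X := X)) aq Ssm k bp pd db eb K
  (exprn_gt0 T0 np) Gp.
apply: (@le_trans _ _ (fP (wt p) (fun o => (nrm (mstj s w (Xmat xv o) - m0) <= l) &&
    (G * b < nrm (scpoly s w (mstj s w (Xmat xv o))))))).
  apply: fP_le; first exact: (wt_ge0 cm).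
  move=> o /andP[-> h] /=; apply: le_lt_trans h.
  rewrite /b bparE -/m0 -/rho (_ : G ^+ 4 = G * (G * G ^+ 2)); last by ring.
  rewrite -[leRHS]mulrA ler_pM2l // ler_wpM2r //.
    by rewrite addr_ge0 ?mulr_ge0 ?sqrtr_ge0 ?(ltW q0) ?addr_ge0 ?(ltW l0) ?nrm_ge0.
  by rewrite ler_wpM2r ?sqr_ge0 //; lra.
apply: (le_trans key).
clear key pd db eb aq Ssm.
rewrite -/m -/Y -/Q0.
have Gm : 0 < (G * b) ^+ m by rewrite exprn_gt0 // mulr_gt0.
rewrite mulrDl.
have half : (n ^+ D)^-1 = 1 / 2 * (n ^+ D)^-1 + 1 / 2 * (n ^+ D)^-1 by lra.
have nD : 0 < n ^+ D by rewrite exprn_gt0.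
have bm0 : b ^+ m != 0 by rewrite expf_neq0 // gt_eqF.
have Gm0 : G ^+ m != 0 by rewrite expf_neq0 // gt_eqF.
have Gmp : 0 < G ^+ m by rewrite exprn_gt0.
rewrite half; apply: lerD.
  have h1 : n ^+ D <= G ^+ (2 * k).+1 by exact: (expr_scale_ge n1 G1 nG).
  have h2 : 4 * Y * n ^+ D <= G ^+ m.
    rewrite /m exprS; apply: (@le_trans _ _ (4 * `|Y| * n ^+ D)).
      by rewrite ler_wpM2r ?(ltW nD) // ler_wpM2l // ler_norm.
    apply: ler_pM => //; rewrite ?mulr_ge0 ?(ltW nD) //; lra.
  rewrite [(G * b) ^+ m]exprMn (_ : 2 * (Y * b ^+ m) / (G ^+ m * b ^+ m) = 2 * Y / G ^+ m); last first.
    by field; rewrite bm0 Gm0.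
  rewrite ler_pdivrMr // mulrAC ler_pdivlMr //; move: h2; lra.
set S := 2 * (_ + _).
have H144 : H0 s w m0 l <= 144.
  rewrite /H0 (mp_rho Iu Hu s0) -/rho.
  have Ll4 : L * l <= 4 by case: lc => [h|[h _]] //; apply: (le_trans h); lra.
  have rL : nrm rho <= 2 * L := sc_rho_le eta0 Iu Hu.
  have l4 : l <= 4 by apply: le_trans Ll4; rewrite ler_peMl // ltW.
  apply: (@le_trans _ _ (2 * l * (2 * L + 2 * L * (2 * 4)))).
    rewrite ler_wpM2l ?mulr_ge0 ?(ltW l0) //; apply: lerD => //.
    by apply: ler_pM; rewrite ?nrm_ge0 ?mulr_ge0 ?(ltW l0) // ler_wpM2l.
  rewrite (_ : _ * (_ + _) = 36 * (L * l)); last by ring.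
  by apply: (@le_trans _ _ (36 * 4)); [rewrite ler_wpM2l | lra].
have H00 := H0_ge0 s w m0 l0.
have Hm : H0 s w m0 l ^+ m <= 144 ^+ m by apply: lerXn2r; rewrite ?nnegrE.
have Hm1 : H0 s w m0 l ^+ (2 * k).+1 <= 144 ^+ m.
  apply: (@le_trans _ _ (144 ^+ (2 * k).+1)); first by apply: lerXn2r; rewrite ?nnegrE.
  by rewrite /m ler_weXn2l // -[1]/(1%:R) ler_nat.
have pi_le : pibad N c G K <= (n ^+ (2 * T0))^-1.
  rewrite /pibad -mulr_natr -/n expr_div_n -/QK -exprM.
  have h1 : n ^+ (2 * T0 + 1) <= G ^+ (2 * K) by exact: (expr_scale_ge n1 G1 nG).
  have h2 : 2 * QK * n ^+ (2 * T0 + 1) <= G ^+ (2 * K.+1).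
    rewrite two_mulnS.
    rewrite exprS; apply: (@le_trans _ _ (2 * `|QK| * G ^+ (2 * K))).
      apply: (@le_trans _ _ (2 * `|QK| * n ^+ (2 * T0 + 1))).
        by rewrite ler_wpM2r ?exprn_ge0 ?(ltW np) // ler_wpM2l // ler_norm.
      by rewrite ler_wpM2l // mulr_ge0.
    apply: ler_pM; rewrite ?mulr_ge0 ?exprn_ge0 ?(ltW Gp) //; first by lra.
    by rewrite ler_weXn2l.
  rewrite mulrA [leLHS]mulrAC ler_pdivrMr ?exprn_gt0 // ler_pdivlMl ?exprn_gt0 //.
  apply: le_trans h2; rewrite exprD expr1 le_eqVlt; apply/orP; left; apply/eqP; ring.
have pi0 : 0 <= pibad N c G K.
  have hb := badZ_le N0 NM s0 eta0 cm K Gp.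
  rewrite /pibad; apply: (le_trans _ hb); exact: (fP_ge0 (wt_ge0 cm)).
have zB : nrm (zpar s w) / complex.Im w <= 3 * n ^+ B * n.
  rewrite ler_pdivrMr //; apply: (@le_trans _ _ (3 * n ^+ B)).
    have nB1 : 1 <= n ^+ B by rewrite exprn_ege1.
    apply: (le_trans (nrmD _ _)); rewrite nrmR ger0_norm ?addr_ge0 ?invr_ge0 ?(ltW s0) //.
    have := s_le1 N0 NM s0 sMN; move: sB LB; rewrite /L; have := nrm_ge0 w; lra.
  rewrite -[leRHS]mulrA ler_peMr ?mulr_ge0 ?exprn_ge0 ?(ltW np) //.
  by rewrite -ler_pdivrMl // mulr1.
have eB : (complex.Im w ^+ 2)^-1 <= n ^+ 2.
  rewrite -[n]invrK exprVn lef_pV2 ?posrE ?exprn_gt0 ?invr_gt0 //.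
  by apply: lerXn2r; rewrite ?nnegrE ?invr_ge0 ?(ltW np) ?(ltW eta0).
have nT0 : n ^+ T0 = n ^+ (B + 3) * n ^+ T1.
  by rewrite -exprD hT.
have nT1 : 0 < n ^+ T1 by rewrite exprn_gt0.
have nB3 : 0 < n ^+ (B + 3) by rewrite exprn_gt0.
have nT0p : 0 < n ^+ T0 by rewrite exprn_gt0.
have pi1 : n ^+ T0 * pibad N c G K <= (n ^+ T0)^-1.
  rewrite -[leRHS]mul1r ler_pdivlMr // mulrAC -expr2 -exprM.
  by rewrite -ler_pdivlMl ?exprn_gt0 // mulr1 mulnC.
have pi2 : pibad N c G K <= (n ^+ T0)^-1.
  by apply: le_trans pi1; rewrite ler_peMl // exprn_ege1.
have hS : S <= Cc / n ^+ T1.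
  have x1 : H0 s w m0 l ^+ m * pibad N c G K <= 144 ^+ m * (n ^+ T0)^-1.
    by apply: ler_pM => //; rewrite exprn_ge0.
  have x2 : n ^+ T0 * pibad N c G K + Q0 / complex.Im w ^+ 2 / n ^+ T0 <= (1 + `|Q0|) * n ^+ 2 / n ^+ T0.
    have n21 : 1 <= n ^+ 2 by rewrite exprn_ege1.
    rewrite mulrDl mul1r mulrDl; apply: lerD.
      by apply: (le_trans pi1); rewrite ler_peMl // invr_ge0 ltW.
    rewrite ler_wpM2r ?invr_ge0 ?(ltW nT0p) //.
    apply: (@le_trans _ _ (`|Q0| / complex.Im w ^+ 2)).
      by rewrite ler_wpM2r ?ler_norm // invr_ge0 sqr_ge0.
    by rewrite ler_wpM2l.
  have x3 : nrm (zpar s w) / complex.Im w * H0 s w m0 l ^+ (2 * k).+1 *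
      (n ^+ T0 * pibad N c G K + Q0 / complex.Im w ^+ 2 / n ^+ T0) <=
      (3 * n ^+ B * n) * 144 ^+ m * ((1 + `|Q0|) * n ^+ 2 / n ^+ T0).
    have z0 : 0 <= nrm (zpar s w) / complex.Im w by rewrite divr_ge0 ?nrm_ge0 // ltW.
    apply: (@le_trans _ _ (nrm (zpar s w) / complex.Im w * H0 s w m0 l ^+ (2 * k).+1 * ((1 + `|Q0|) * n ^+ 2 / n ^+ T0))).
      by rewrite ler_wpM2l // mulr_ge0 // exprn_ge0.
    rewrite ler_wpM2r //.
      by rewrite divr_ge0 ?(ltW nT0p) // mulr_ge0 ?exprn_ge0 ?(ltW np) // addr_ge0.
    by apply: ler_pM => //; rewrite exprn_ge0.
  rewrite /S; apply: (@le_trans _ _ (2 * (144 ^+ m * (n ^+ T0)^-1 + (3 * n ^+ B * n) * 144 ^+ m * ((1 + `|Q0|) * n ^+ 2 / n ^+ T0)))).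
    by rewrite ler_wpM2l // lerD.
  have e3 : n ^+ (B + 3) = n ^+ B * n * n ^+ 2 by rewrite exprD; ring.
  have nBn1 : 1 <= n ^+ (B + 3) by rewrite exprn_ege1.
  rewrite (_ : 2 * (_ + _) = 2 * 144 ^+ m * (1 + 3 * (1 + `|Q0|) * n ^+ (B + 3)) / n ^+ T0); last first.
    by rewrite e3; ring.
  rewrite nT0 invfM mulrA ler_wpM2r ?invr_ge0 ?(ltW nT1) //.
  have c144 : 0 <= 2 * 144 ^+ m :> R by apply: mulr_ge0 => //; apply: exprn_ge0.
  rewrite ler_pdivrMr // /Cc -[leRHS]mulrA (ler_wpM2l c144) //.
  rewrite -subr_ge0 (_ : _ - _ = n ^+ (B + 3) - 1); last by ring.
  by rewrite subr_ge0.
have bge : (n ^+ b2)^-1 <= G * b.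
  have qn : (n ^+ B.+1)^-1 <= q.
    rewrite /q /qpar lef_pV2 ?posrE ?exprn_gt0 ?mulr_gt0 // exprS -/n.
    by rewrite ler_wpM2l ?(ltW np) //; apply: le_trans LB.
  have b1 : q * q <= b.
    rewrite /b bparE; apply: (@le_trans _ _ (1 * (q * q))); first by rewrite mul1r.
    apply: ler_pM; rewrite ?mulr_ge0 ?(ltW q0) //.
      apply: (@le_trans _ _ (1 * 1)); first by rewrite mulr1.
      by apply: ler_pM => //; [exact: Kb_ge1 | rewrite exprn_ege1].
    rewrite /Bsharp -/q -/L; apply: (@le_trans _ _ (L * q * (complex.Im m0 + l))).
      rewrite -mulrA; apply: (@le_trans _ _ (1 * (q * q))); first by rewrite mul1r.
      apply: ler_pM; rewrite ?mulr_ge0 ?(ltW q0) // ler_wpM2l ?(ltW q0) //.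
      by apply: (le_trans ql); rewrite lerDr.
    by rewrite lerDr mulr_ge0 ?sqrtr_ge0 // ltW.
  apply: (@le_trans _ _ b); last by rewrite ler_peMl // ltW.
  apply: le_trans b1; rewrite hb2.
  rewrite exprD invfM; apply: ler_pM; rewrite ?invr_ge0 ?exprn_ge0 ?(ltW np) //.
rewrite ler_pdivrMr //; apply: (le_trans hS).
have bm : (n ^+ (b2 * m))^-1 <= (G * b) ^+ m.
  rewrite exprM -exprVn; apply: lerXn2r; rewrite ?nnegrE ?invr_ge0 ?exprn_ge0 ?(ltW np) //.
  by rewrite mulr_ge0 // ltW.
apply: (@le_trans _ _ (1 / 2 * (n ^+ D)^-1 * (n ^+ (b2 * m))^-1)); last first.
  by rewrite ler_wpM2l // mulr_ge0 // invr_ge0 ltW.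
rewrite /T1 !exprD expr1 !invfM.
rewrite (_ : Cc * _ = (Cc / n) * ((n ^+ D)^-1 * (n ^+ (b2 * m))^-1)); last by ring.
rewrite -[leRHS]mulrA ler_wpM2r ?mulr_ge0 ?invr_ge0 ?exprn_ge0 ?(ltW np) //.
by rewrite ler_pdivrMr //; move: nG4 GG0; lra.
Qed.
End PointLawProb.

Lemma sqr_le_le (R : realType) (x y : R) : 0 <= y -> x ^+ 2 <= y ^+ 2 -> x <= y.
Proof.
move=> y0 h; rewrite leNgt; apply/negP => yx; move: h; rewrite leNgt => /negP; apply.
by rewrite !expr2; apply: ltr_pM.
Qed.

(** * Stability of the self-consistent equation *)

Section SelfImproving.
Variable R : realType.
Local Notation C := R[i].
Local Open Scope complex_scope.
Variables (tt : R) (N : nat) (s : R) (w u : C) (l : R).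
Hypotheses (tt0 : 0 < tt) (tt1 : tt <= 1) (N0 : (0 < N)%N) (s0 : 0 < s) (s1 : s <= 1).
Local Notation L := (1 + nrm w).
Local Notation q := (qpar N w).
Local Notation m0 := (mp_m u s).
Local Notation rho := (sc_rho w u).
Hypotheses (e0 : 0 < complex.Im w) (Iu : 0 < complex.Im u) (Hu : u ^+ 2 + w * u + 1 = 0).
Hypothesis dom : (- 2 + tt <= complex.Re w) || (s <= 1 - tt / 2).
Hypotheses (l0 : 0 <= l) (lrho : 4 * (L * l) <= nrm rho).

(** In the factorization Lam (a Lam + rho), the assumption on l makes a Lam at most half of rho. *)
Lemma stable_quotient v b : nrm (v - m0) <= l -> nrm (scpoly s w v) <= b ->
  nrm (v - m0) * nrm rho <= 2 * b.
Proof.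
move=> hl; rewrite (scpoly_factor (mp_m_root Iu Hu s0)) (mp_rho Iu Hu s0) nrmM.
have x0 := nrm_ge0 (v - m0); set x := nrm (v - m0) in hl x0 *.
have al : nrm (apar s w * (v - m0)) <= nrm rho / 2.
  rewrite nrmM -/x; apply: (@le_trans _ _ (2 * L * l)).
    by apply: ler_pM; rewrite ?nrm_ge0 //; exact: apar_le.
  by move: lrho; lra.
have h : nrm rho / 2 <= nrm (apar s w * (v - m0) + rho).
  have h0 := nrmD_ge rho (apar s w * (v - m0)); rewrite [_ + rho]addrC; move: al h0; lra.
move=> hb; apply: (@le_trans _ _ (2 * (x * (nrm rho / 2)))); first by lra.
by rewrite ler_pM2l // (le_trans _ hb) // ler_wpM2l.
Qed.

(** Im m0 L^2 is of order |rho| and L l is at most |rho|, so both terms are of order q |rho|; the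
    factor |rho| cancels against the one in [stable_quotient]. *)
Lemma Bsharp_le : Bsharp N w m0 rho l <= 3 * (36 / tt ^+ 2 + 1) * (q * nrm rho).
Proof.
have q0 := ltW (q_gt0 N0 e0); have r0 := nrm_ge0 rho; have w0 := nrm_ge0 w.
have K0 : 0 <= 36 / tt ^+ 2 by rewrite divr_ge0 // sqr_ge0.
have hA := Im_mp_m_le_rho e0 Iu Hu s0 s1 tt0 tt1 dom.
have A0 : 0 < complex.Im m0 by apply: Im_mp_m_gt0.
have ll : L * l <= nrm rho by move: lrho; have := mulr_ge0 (addr_ge0 ler01 w0) l0; lra.
set K := 36 / tt ^+ 2 in K0 hA *; set A := complex.Im m0 in hA A0 *.
have LA : L * A <= K * nrm rho.
  apply: le_trans hA; rewrite mulrC ler_wpM2l ?(ltW A0) // expr2 ler_peMr //; lra.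
have Al : L * (A + l) <= (K + 1) * nrm rho by rewrite mulrDr [leRHS]mulrDl mul1r lerD.
have Al1 : A + l <= (K + 1) * nrm rho.
  by apply: le_trans Al; rewrite ler_peMl ?addr_ge0 ?(ltW A0) //; lra.
have sq : Num.sqrt ((A + l) * (nrm rho + L * l)) <= 2 * (K + 1) * nrm rho.
  have z0 : 0 <= 2 * (K + 1) * nrm rho by rewrite mulr_ge0 // mulr_ge0 //; lra.
  rewrite -[leRHS](ger0_norm z0) -sqrtr_sqr ler_wsqrtr //.
  apply: (@le_trans _ _ ((K + 1) * nrm rho * (2 * nrm rho))).
    apply: ler_pM => //; rewrite ?addr_ge0 ?(ltW A0) ?mulr_ge0 //; first by lra.
    by move: ll; lra.
  rewrite (_ : (2 * (K + 1) * nrm rho) ^+ 2 = (K + 1) * nrm rho * (2 * nrm rho) * (2 * (K + 1))); last by ring.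
  rewrite ler_peMr //; last by lra.
  by rewrite !mulr_ge0 //; lra.
rewrite /Bsharp -/A.
apply: (@le_trans _ _ (q * (2 * (K + 1) * nrm rho) + q * ((K + 1) * nrm rho))).
  apply: lerD; first by rewrite ler_wpM2l.
  by rewrite -mulrA mulrCA ler_wpM2l.
by rewrite le_eqVlt; apply/orP; left; apply/eqP; ring.
Qed.

End SelfImproving.

Section DistanceToEdges.
Variable R : realType.
Local Notation C := R[i].
Local Open Scope complex_scope.

(** rho^2 = (w - 2)(w + 2), and the larger of the two factors is at least (1 + |w|) / 2 in
    modulus. *)
Lemma sc_rho_ge (w u : C) (x : R) : 0 < complex.Im w -> u ^+ 2 + w * u + 1 = 0 -> 0 <= x ->
  x <= nrm (w - 2) -> x <= nrm (w + 2) -> (1 + nrm w) * x <= 2 * nrm (sc_rho w u) ^+ 2.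
Proof.
move=> e0 Hu x0 h1 h2; rewrite -nrmX (sc_rho_sqr Hu).
rewrite (_ : w ^+ 2 - 4 = (w - 2) * (w + 2)); last by ring.
rewrite nrmM.
have t1 : 4 <= nrm (w - 2) + nrm (w + 2).
  apply: (@le_trans _ _ (nrm ((w + 2) - (w - 2)))); last by rewrite [leRHS]addrC nrmB.
  rewrite (_ : _ - _ = (4%:R : C)); last by ring.
  by rewrite nrm_nat.
have t2 : 2 * nrm w <= nrm (w - 2) + nrm (w + 2).
  apply: (@le_trans _ _ (nrm ((w - 2) + (w + 2)))); last exact: nrmD.
  rewrite (_ : _ + _ = 2%:R * w); last by ring.
  by rewrite nrmM nrm_nat.
have w0 := nrm_ge0 w; set a := nrm (w - 2) in h1 t1 t2 *; set b := nrm (w + 2) in h2 t1 t2 *.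
have [ab|ab] := leP a b.
  have : 0 <= (b - (1 + nrm w) / 2) * x by rewrite mulr_ge0 //; lra.
  have : 0 <= (a - x) * b by rewrite mulr_ge0 //; lra.
  lra.
have : 0 <= (a - (1 + nrm w) / 2) * x by rewrite mulr_ge0 //; lra.
have : 0 <= (b - x) * a by rewrite mulr_ge0 //; lra.
lra.
Qed.

Lemma dist_edge_ge (w : C) : `| `|complex.Re w| - 2| <= nrm (w - 2) /\ `| `|complex.Re w| - 2| <= nrm (w + 2).
Proof.
have h x : `|complex.Re w + x| <= nrm (w + x%:C) by have := le_Re_nrm (w + x%:C); rewrite cReD cReR.
have i2 : (2%:C : C) = 2 by rewrite -[2]/(2%:R) rmorph_nat.
have n2 : `|2| = 2 :> R by rewrite ger0_norm.
split.
  have h1 := ler_dist_dist (complex.Re w) 2; rewrite n2 in h1; apply: (le_trans h1).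
  apply: (le_trans (h _)); rewrite (_ : w + (- 2)%:C = w - 2) //.
  by congr (_ + _); apply: cplx_eq => /=; rewrite ?addr0 ?oppr0.
have h1 := ler_dist_dist (complex.Re w) (- 2); rewrite normrN n2 opprK in h1; apply: (le_trans h1).
by apply: (le_trans (h _)); rewrite i2.
Qed.

End DistanceToEdges.

(** * Descent along a vertical line *)

Section VerticalLine.
Variable R : realType.
Local Notation C := R[i].
Local Open Scope complex_scope.
Variables (tt : R) (N : nat) (s E : R).
Hypotheses (tt0 : 0 < tt) (tt1 : tt <= 1) (N0 : (0 < N)%N) (s0 : 0 < s) (s1 : s <= 1).
Hypothesis dom : (- 2 + tt <= E) || (s <= 1 - tt / 2).

Definition vw (x : R) : C := E +i* x.
Definition vu (x : R) : C := sc_u E x.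
Definition vm (x : R) : C := mp_m (vu x) s.
Definition vq (x : R) : R := (N%:R * x)^-1.
Local Notation K := (36 / tt ^+ 2 + 1).

Lemma vu_Im x : 0 < x -> 0 < complex.Im (vu x).
Proof. by move=> x0; case: (sc_u_spec E x0). Qed.
Lemma vu_eq x : 0 < x -> vu x ^+ 2 + vw x * vu x + 1 = 0.
Proof. by move=> x0; case: (sc_u_spec E x0). Qed.

Arguments vu : simpl never.
Arguments vm : simpl never.
Arguments vq : simpl never.

Lemma vq_gt0 x : 0 < x -> 0 < vq x.
Proof. by move=> x0; rewrite invr_gt0 mulr_gt0 // ltr0n. Qed.

Lemma vm_lip x y : 0 < x -> 0 < y -> nrm (vm x - vm y) <= 8 / tt ^+ 2 / x * `|x - y|.
Proof.
move=> x0 y0; have Ix := vu_Im x0; have Iy := vu_Im y0; have Hx := vu_eq x0; have Hy := vu_eq y0.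
have e0 : 0 < complex.Im (vw x) by []. have e1 : 0 < complex.Im (vw y) by [].
have dx := su_lower e0 Ix Hx s0 s1 tt0 tt1 dom; have dy := su_lower e1 Iy Hy s0 s1 tt0 tt1 dom.
have t2 : 0 < tt / 2 by rewrite divr_gt0.
have nx : 1 - s%:C * vu x != 0 by rewrite -nrm_gt0 (lt_le_trans t2).
have ny : 1 - s%:C * vu y != 0 by rewrite -nrm_gt0 (lt_le_trans t2).
have -> : vm x - vm y = (vu x - vu y) / ((1 - s%:C * vu x) * (1 - s%:C * vu y)).
  by rewrite /vm /mp_m; field; rewrite nx ny.
rewrite nrmM nrmV nrmM; have hl := u_lip e0 Ix Hx e1 Iy Hy.
have ew : nrm (vw x - vw y) = `|x - y|.
  by rewrite nrmE cReB cImB /= subrr expr0n /= add0r sqrtr_sqr.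
rewrite ew /= in hl.
have d4 : tt ^+ 2 / 4 <= nrm (1 - s%:C * vu x) * nrm (1 - s%:C * vu y).
  rewrite (_ : tt ^+ 2 / 4 = tt / 2 * (tt / 2)); last by field.
  by apply: ler_pM => //; exact: ltW.
have t4 : 0 < tt ^+ 2 / 4 by rewrite divr_gt0 // exprn_gt0.
apply: (@le_trans _ _ (2 / x * `|x - y| / (tt ^+ 2 / 4))).
  apply: ler_pM; rewrite ?nrm_ge0 ?invr_ge0 ?mulr_ge0 ?nrm_ge0 //.
  by rewrite lef_pV2 ?posrE // (lt_le_trans t4).
by rewrite le_eqVlt; apply/orP; left; apply/eqP; field; rewrite !gt_eqF.
Qed.

Lemma nrm_vw x : 0 <= x -> nrm (vw x) <= `|E| + x.
Proof. by move=> x0; have := nrm_le_ReIm (vw x); rewrite /= (ger0_norm x0). Qed.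

Variables (e0 G : R).
Hypotheses (e00 : 0 < e0) (G1 : 1 <= G) (G128 : 128 <= G) (GK : 6 * K <= G).
Hypothesis cond1 : G ^+ 12 * ((1 + `|E| + e0) * vq e0 ^+ 2) <= `| `|E| - 2|.
Hypothesis cond2 : G ^+ 6 * ((1 + `|E| + e0) * vq e0) <= 1.

Lemma Lq_mono x : e0 <= x -> (1 + nrm (vw x)) * vq x <= (1 + `|E| + e0) * vq e0.
Proof.
move=> ex; have x0 := lt_le_trans e00 ex; have Nr : 0 < N%:R :> R by rewrite ltr0n.
apply: (@le_trans _ _ ((1 + `|E| + x) * vq x)).
  by rewrite ler_wpM2r ?(ltW (vq_gt0 x0)) //; have := nrm_vw (ltW x0); lra.
rewrite /vq ler_pdivrMr ?mulr_gt0 // mulrAC ler_pdivlMr ?mulr_gt0 //.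
rewrite -subr_ge0 (_ : _ - _ = N%:R * ((1 + `|E|) * (x - e0))); last by ring.
by apply: mulr_ge0; [exact: ltW | apply: mulr_ge0; [rewrite addr_ge0 | rewrite subr_ge0]].
Qed.

Lemma vq_mono x : e0 <= x -> vq x <= vq e0.
Proof.
move=> ex; have x0 := lt_le_trans e00 ex; have Nr : 0 < N%:R :> R by rewrite ltr0n.
by rewrite /vq lef_pV2 ?posrE ?mulr_gt0 // ler_pM2l.
Qed.

(** Twice the bound to be proved: the slack absorbs the step from one grid height to the next.
    [cond1] and [cond2] make it small against |rho| / L and against 1 / L. *)
Definition vl (x : R) : R := 2 * (G ^+ 5 * vq x).

Lemma vl_small x : e0 <= x -> (1 + nrm (vw x)) * vl x <= 1 / 24.
Proof.
move=> ex; have h := Lq_mono ex; have g5 : 0 < G ^+ 5 by rewrite exprn_gt0 // (lt_le_trans ltr01).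
have h2 := cond2; rewrite exprS -mulrA in h2.
rewrite /vl; have -> : (1 + nrm (vw x)) * (2 * (G ^+ 5 * vq x)) = 2 * (G ^+ 5 * ((1 + nrm (vw x)) * vq x)) by ring.
have h3 : G ^+ 5 * ((1 + nrm (vw x)) * vq x) <= G ^+ 5 * ((1 + `|E| + e0) * vq e0) by rewrite ler_wpM2l // ltW.
have g := G128; set y := G ^+ 5 * ((1 + `|E| + e0) * vq e0) in h2 h3.
have y0 : 0 <= y.
  by rewrite mulr_ge0 ?(ltW g5) // mulr_ge0 ?(ltW (vq_gt0 e00)) // addr_ge0 ?(ltW e00) // addr_ge0.
have : 0 <= (G - 128) * y by rewrite mulr_ge0 // subr_ge0.
lra.
Qed.

Lemma vl_rho x : e0 <= x -> 4 * ((1 + nrm (vw x)) * vl x) <= nrm (sc_rho (vw x) (vu x)) /\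
  0 < nrm (sc_rho (vw x) (vu x)).
Proof.
move=> ex; have x0 := lt_le_trans e00 ex.
have [d1 d2] := dist_edge_ge (vw x).
have q0 := vq_gt0 x0; have w0 := nrm_ge0 (vw x).
have hr := sc_rho_ge (x0 : 0 < complex.Im (vw x)) (vu_eq x0) (normr_ge0 _) d1 d2.
have h1 : G ^+ 12 * ((1 + nrm (vw x)) * vq x ^+ 2) <= `| `|E| - 2|.
  apply: le_trans cond1; rewrite ler_wpM2l ?exprn_ge0 ?(le_trans ler01) // expr2 [leRHS]mulrA mulrA.
  by apply: ler_pM; rewrite ?mulr_ge0 ?addr_ge0 ?(ltW q0) // ?Lq_mono // vq_mono.
have {}hr : (1 + nrm (vw x)) * `| `|E| - 2| <= 2 * nrm (sc_rho (vw x) (vu x)) ^+ 2 := hr.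
set kap := `| `|E| - 2| in hr h1; set L := 1 + nrm (vw x) in hr h1 *.
have L1 : 1 <= L by rewrite lerDl.
have r0 := nrm_ge0 (sc_rho (vw x) (vu x)); set r := nrm _ in hr r0 *.
have lk : L * (G ^+ 12 * (L * vq x ^+ 2)) <= 2 * r ^+ 2.
  by apply: le_trans hr; rewrite ler_wpM2l //; lra.
have y0 : 0 < L * (G ^+ 5 * vq x) by apply: mulr_gt0; [exact: lt_le_trans ltr01 L1 | apply: mulr_gt0 => //; apply: exprn_gt0; exact: lt_le_trans ltr01 G1].
have h2 : (8 * (L * (G ^+ 5 * vq x))) ^+ 2 <= r ^+ 2.
  have e : L * (G ^+ 12 * (L * vq x ^+ 2)) = G ^+ 2 * (L * (G ^+ 5 * vq x)) ^+ 2 by ring.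
  rewrite e in lk.
  have g2 : 128 <= G ^+ 2 by rewrite expr2; have := G128; have := G1; nra.
  have : 0 <= (G ^+ 2 - 128) * (L * (G ^+ 5 * vq x)) ^+ 2 by rewrite mulr_ge0 ?sqr_ge0 // subr_ge0.
  rewrite exprMn; lra.
have {}h2 : 8 * (L * (G ^+ 5 * vq x)) <= r by exact: sqr_le_le.
split; last by apply: lt_le_trans h2; rewrite mulr_gt0.
by apply: le_trans h2; rewrite /vl le_eqVlt; apply/orP; left; apply/eqP; ring.
Qed.

(** The improvement from 2 G^5 q to G^5 q: the stability estimates turn the bound with G^4 into one
    with 6 K G^4, and 6 K <= G. *)
Lemma ray_step x v : e0 <= x -> nrm (v - vm x) <= vl x ->
  nrm (scpoly s (vw x) v) <= G ^+ 4 * Bsharp N (vw x) (vm x) (sc_rho (vw x) (vu x)) (vl x) ->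
  nrm (v - vm x) <= G ^+ 5 * vq x.
Proof.
move=> ex hl hb; have x0 := lt_le_trans e00 ex; have [lr r0] := vl_rho ex.
have q0 := vq_gt0 x0; have l0 : 0 <= vl x.
  by rewrite /vl mulr_ge0 // mulr_ge0 ?(ltW q0) // exprn_ge0 // (le_trans ler01).
have eI : 0 < complex.Im (vw x) by [].
have h1 := stable_quotient s0 s1 (vu_Im x0) (vu_eq x0) lr hl hb.
have h2 := Bsharp_le tt0 tt1 N0 s0 s1 eI (vu_Im x0) (vu_eq x0) dom l0 lr.
have G4 : 0 <= G ^+ 4 by rewrite exprn_ge0 // (le_trans ler01).
have h3 : nrm (v - vm x) * nrm (sc_rho (vw x) (vu x)) <=
    2 * (G ^+ 4 * (3 * K * (vq x * nrm (sc_rho (vw x) (vu x))))).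
  by apply: (le_trans h1); rewrite ler_pM2l // ler_wpM2l.
rewrite -(ler_pM2r r0); apply: (le_trans h3).
rewrite (_ : 2 * _ = 6 * K * (G ^+ 4 * (vq x * nrm (sc_rho (vw x) (vu x))))); last by ring.
rewrite (_ : G ^+ 5 * _ * _ = G * (G ^+ 4 * (vq x * nrm (sc_rho (vw x) (vu x))))); last by ring.
by rewrite ler_wpM2r // mulr_ge0 // mulr_ge0 ?nrm_ge0 // ltW.
Qed.

Variables (lam : nat -> R) (h H : R).
Local Notation mN x := (stj N s lam (vw x)).
Hypotheses (h0 : 0 < h) (Hpos : 0 < H).
Hypothesis lip_small : ((e0 ^+ 2)^-1 + 8 / tt ^+ 2 / e0) * h <= G ^+ 5 * vq H.
Hypothesis top : nrm (mN H - vm H) <= G ^+ 5 * vq H.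
Hypothesis grid : forall j : nat, e0 <= H - j%:R * h ->
  nrm (mN (H - j%:R * h) - vm (H - j%:R * h)) <= vl (H - j%:R * h) ->
  nrm (scpoly s (vw (H - j%:R * h)) (mN (H - j%:R * h))) <=
  G ^+ 4 * Bsharp N (vw (H - j%:R * h)) (vm (H - j%:R * h)) (sc_rho (vw (H - j%:R * h)) (vu (H - j%:R * h))) (vl (H - j%:R * h)).

Lemma ray_lip x y : e0 <= x -> x <= y -> y <= H -> y <= x + h ->
  nrm (mN x - vm x) <= nrm (mN y - vm y) + G ^+ 5 * vq H.
Proof.
move=> ex xy yH yh; have x0 := lt_le_trans e00 ex; have y0 := lt_le_trans x0 xy.
have xyn : `|x - y| <= h by rewrite distrC ger0_norm ?subr_ge0 //; lra.
have l1 : nrm (mN x - mN y) <= h / e0 ^+ 2.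
  apply: (le_trans (stj_lip s lam N0 (x0 : 0 < complex.Im (vw x)) (y0 : 0 < complex.Im (vw y)))).
  rewrite (_ : nrm (vw x - vw y) = `|x - y|); last first.
    by rewrite nrmE cReB cImB /= subrr expr0n /= add0r sqrtr_sqr.
  apply: ler_pM; rewrite ?invr_ge0 ?mulr_ge0 ?(ltW x0) ?(ltW y0) //.
  rewrite lef_pV2 ?posrE ?exprn_gt0 ?mulr_gt0 // expr2; apply: ler_pM; rewrite ?(ltW e00) //.
  exact: le_trans ex xy.
have l2 : nrm (vm x - vm y) <= 8 / tt ^+ 2 / e0 * h.
  apply: (le_trans (vm_lip x0 y0)).
  have t8 : 0 <= 8 / tt ^+ 2 by rewrite divr_ge0 // sqr_ge0.
  apply: ler_pM => //; first by rewrite divr_ge0 // ltW.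
  by rewrite ler_wpM2l // lef_pV2 ?posrE.
have -> : mN x - vm x = (mN y - vm y) + ((mN x - mN y) - (vm x - vm y)) by ring.
apply: (le_trans (nrmD _ _)); rewrite lerD2l; apply: (le_trans (nrmB _ _)).
apply: le_trans lip_small; apply: (le_trans (lerD l1 l2)).
by rewrite le_eqVlt; apply/orP; left; apply/eqP; ring.
Qed.

Lemma vq_anti x y : 0 < x -> x <= y -> vq y <= vq x.
Proof.
move=> x0 xy; have Nr : 0 < N%:R :> R by rewrite ltr0n.
by rewrite /vq lef_pV2 ?posrE ?mulr_gt0 // ?ler_pM2l // (lt_le_trans x0).
Qed.

(** The bound at one height plus the Lipschitz change over a mesh step is the a priori bound [vl] at
    the next height, which [ray_step] improves again. *)
Lemma ray_grid (j : nat) : e0 <= H - j%:R * h ->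
  nrm (mN (H - j%:R * h) - vm (H - j%:R * h)) <= G ^+ 5 * vq (H - j%:R * h).
Proof.
have g5 : 0 <= G ^+ 5 by rewrite exprn_ge0 // (le_trans ler01).
elim: j => [|j IH] hj; first by rewrite mul0r subr0.
have e : H - j.+1%:R * h = H - j%:R * h - h by rewrite -natr1; ring.
have hj' : e0 <= H - j%:R * h by move: hj; rewrite e; have := h0; lra.
apply: ray_step => //; last first.
  apply: grid => //.
all: have x0 := lt_le_trans e00 hj.
all: have jh : 0 <= j%:R * h by rewrite mulr_ge0 // ltW.
all: apply: (le_trans (ray_lip hj (_ : _ <= H - j%:R * h) _ _)); rewrite ?e; [by have := h0; lra|by lra|by lra|].
all: rewrite /vl -e mulrDl mul1r; apply: lerD; [apply: (le_trans (IH hj')) |]; rewrite ler_wpM2l //; apply: vq_anti => //; rewrite ?e; have := h0; lra.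
Qed.

Lemma ray_all x : e0 <= x -> x <= H -> nrm (mN x - vm x) <= vl x.
Proof.
move=> ex xH; have x0 := lt_le_trans e00 ex.
have g5 : 0 <= G ^+ 5 by rewrite exprn_ge0 // (le_trans ler01).
pose j := Num.truncn ((H - x) / h).
have d0 : 0 <= (H - x) / h by rewrite divr_ge0 ?subr_ge0 // ltW.
have /andP[j1 j2] := Num.Theory.truncn_itv d0; rewrite -/j in j1 j2.
rewrite ler_pdivlMr // in j1; rewrite ltr_pdivrMr // -natr1 mulrDl mul1r in j2.
have jh : 0 <= j%:R * h by rewrite mulr_ge0 // ltW.
have hj : e0 <= H - j%:R * h by lra.
apply: (le_trans (ray_lip ex (_ : x <= H - j%:R * h) _ _)); [by lra|by lra|by lra|].
rewrite /vl mulrDl mul1r; apply: lerD.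
  apply: (le_trans (ray_grid hj)); rewrite ler_wpM2l //; apply: vq_anti => //; lra.
by rewrite ler_wpM2l // vq_anti.
Qed.

(** Far from the spectrum both transforms are -1/w up to O(1 / H^2), so at a polynomially large
    height the descent starts without any probabilistic input. *)
Lemma ray_top (Y : R) : 0 <= Y -> (forall k, (1 <= k <= N)%N -> `|ycen s lam k| <= Y) ->
  N%:R * (Y + 12 / tt) <= G ^+ 5 * H -> nrm (mN H - vm H) <= G ^+ 5 * vq H.
Proof.
move=> Y0 hY hH; have Nr : 0 < N%:R :> R by rewrite ltr0n.
have Iu := vu_Im Hpos; have Hu := vu_eq Hpos; have eI : 0 < complex.Im (vw H) by [].
have w0 : 0 < nrm (vw H) by apply: lt_le_trans (Im_le_nrm _).
have wn : vw H != 0 by rewrite -nrm_gt0.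
have wH : H <= nrm (vw H) := Im_le_nrm (vw H).
have t2 : 0 < tt / 2 by rewrite divr_gt0.
have d := su_lower eI Iu Hu s0 s1 tt0 tt1 dom.
have dn : 1 - s%:C * vu H != 0 by rewrite -nrm_gt0 (lt_le_trans t2).
have d' : 0 < nrm (1 - s%:C * vu H) by rewrite nrm_gt0.
have a1 : nrm (vm H + (vw H)^-1) <= 12 / tt / H ^+ 2.
  have -> : vm H + (vw H)^-1 = - (vu H * (vu H + s%:C)) / ((1 - s%:C * vu H) * vw H).
    rewrite -[LHS](mulfK (mulf_neq0 dn wn)); congr (_ / _).
    rewrite /vm /mp_m mulrDl mulrA mulfVK // mulrCA mulVf // mulr1.
    have -> : vu H * vw H = - 1 - vu H ^+ 2.
      by apply/eqP; rewrite -subr_eq0 -Hu; apply/eqP; ring.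
    by ring.
  rewrite nrmM nrmN nrmV !nrmM ler_pdivrMr ?mulr_gt0 //.
  have r3 := r_le3L eI Iu Hu; have r1 := r_lt1 eI Iu Hu; have r0 := nrm_ge0 (vu H).
  have us : nrm (vu H + s%:C) <= 2.
    by apply: (le_trans (nrmD _ _)); rewrite nrmR ger0_norm ?(ltW s0) //; have := s1; lra.
  have r3H : nrm (vu H) <= 3 / H.
    apply: (le_trans r3); rewrite ler_pM2l // lef_pV2 ?posrE //; last by lra.
    by have := wH; lra.
  apply: (@le_trans _ _ (3 / H * 2)); first by apply: ler_pM; rewrite ?nrm_ge0.
  apply: (@le_trans _ _ (12 / tt / H ^+ 2 * (tt / 2 * H))).
    by rewrite le_eqVlt; apply/orP; left; apply/eqP; field; rewrite !gt_eqF.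
  rewrite ler_wpM2l ?divr_ge0 ?sqr_ge0 ?(ltW tt0) //.
  by apply: ler_pM => //; exact: ltW.
have a2 : nrm (mN H + (vw H)^-1) <= Y / H ^+ 2.
  have -> : (vw H)^-1 = (\sum_(1 <= k < N.+1) (vw H)^-1) / N%:R.
    by rewrite sumr_const_nat subSS subn0 -[_ *+ N]mulr_natr mulfK // pnatr_eq0 -lt0n.
  rewrite /stj -mulrDl -big_split /= nrmM nrmV nrm_nat ler_pdivrMr //.
  apply: (le_trans (nrm_sum _ _ _)).
  apply: (@le_trans _ _ (\sum_(1 <= k < N.+1) (Y / H ^+ 2))); last first.
    by rewrite sumr_const_nat subSS subn0 mulr_natr.
  rewrite big_nat_cond [leRHS]big_nat_cond; apply: ler_sum => k /andP[/andP[k1 k2] _].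
  have hk := hY k; rewrite k1 -ltnS k2 in hk; have {}hk := hk isT.
  have g := nrm_atom_ge (ycen s lam k) eI.
  have g0 : 0 < nrm ((ycen s lam k)%:C - vw H) by apply: lt_le_trans g.
  have -> : ((ycen s lam k)%:C - vw H)^-1 + (vw H)^-1 = (ycen s lam k)%:C / (((ycen s lam k)%:C - vw H) * vw H).
    by field; rewrite wn -nrm_gt0 g0.
  rewrite nrmM nrmV nrmM nrmR; apply: ler_pM; rewrite ?invr_ge0 ?mulr_ge0 ?nrm_ge0 //.
  rewrite lef_pV2 ?posrE ?exprn_gt0 ?mulr_gt0 // expr2.
  by apply: ler_pM => //; exact: ltW.
have -> : mN H - vm H = (mN H + (vw H)^-1) - (vm H + (vw H)^-1) by ring.
apply: (le_trans (nrmB _ _)); apply: (le_trans (lerD a2 a1)).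
rewrite -mulrDl /vq ler_pdivrMr ?exprn_gt0 //.
rewrite (_ : G ^+ 5 / (N%:R * H) * H ^+ 2 = G ^+ 5 * H / N%:R); last by field; rewrite !gt_eqF.
by rewrite ler_pdivlMr // mulrC.
Qed.

End VerticalLine.

(** * The good event on a vertical line *)

Section RayLaw.
Variable R : realType.
Local Notation C := R[i].
Local Open Scope complex_scope.
Variables (tt : R) (c : nat -> R).
Hypotheses (tt0 : 0 < tt) (tt1 : tt <= 1).

Definition badpt (M N : nat) (s G E x : R) (X : 'M[C]_(M, N)) : bool :=
  (nrm (mstj s (vw E x) X - vm s E x) <= vl N G x) &&
  (G ^+ 4 * Bsharp N (vw E x) (vm s E x) (sc_rho (vw E x) (vu E x)) (vl N G x)
     < nrm (scpoly s (vw E x) (mstj s (vw E x) X))).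

Definition raytop (N B : nat) : R := N%:R ^+ B.+1.
Definition raymesh (N B : nat) : R := (N%:R ^+ (B + 4))^-1.

(** The lowest height e0 is tested separately because it need not lie on the grid. N^(2B+5) mesh
    steps reach from the top down to 0. *)
Definition badray (M N B : nat) (s G E e0 : R) (X : 'M[C]_(M, N)) : bool :=
  badpt s G E e0 X ||
  has (fun j => (e0 <= raytop N B - j%:R * raymesh N B) && badpt s G E (raytop N B - j%:R * raymesh N B) X)
    (iota 0 (N ^ (2 * B + 5)).+1).

Definition raycond (N B : nat) (s G E e0 : R) : Prop :=
  [/\ `|E| <= N%:R ^+ B, (- 2 + tt <= E) || (s <= 1 - tt / 2),
   N%:R^-1 <= e0 <= N%:R ^+ B, G ^+ 12 * ((1 + `|E| + e0) * vq N e0 ^+ 2) <= `| `|E| - 2|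
   & G ^+ 6 * ((1 + `|E| + e0) * vq N e0) <= 1].

Lemma raycond_G6 (N B : nat) (s G E e0 : R) : (0 < N)%N -> 1 <= G -> raycond N B s G E e0 ->
  G ^+ 6 <= N%:R.
Proof.
move=> N0 G1 [_ _ /andP[e0N e01] _ h]; have Nr : 0 < N%:R :> R by rewrite ltr0n.
have e00 : 0 < e0 by apply: lt_le_trans e0N; rewrite invr_gt0.
have g6 : 0 <= G ^+ 6 by rewrite exprn_ge0 // (le_trans ler01).
rewrite -[leRHS]mul1r -ler_pdivrMr //; apply: le_trans h; rewrite ler_wpM2l //.
rewrite /vq ler_pdivlMr ?mulr_gt0 // mulrA mulVf ?gt_eqF // mul1r.
by have := normr_ge0 E; lra.
Qed.

Lemma badray_prob (B e D : nat) : exists G0 : R, 128 <= G0 /\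
  forall (G : R) (M N : nat) (s : R) (V : finType) (p : 'I_M -> 'I_N -> V -> R)
    (xv : 'I_M -> 'I_N -> V -> C), fmodel c s p xv -> G0 <= G -> N%:R <= G ^+ e ->
  s^-1 <= N%:R ^+ B -> forall E e0 : R, raycond N B s G E e0 ->
  fP (wt p) (fun o => badray B s G E e0 (Xmat xv o)) <= (N%:R ^+ D)^-1.
Proof.
(* B + 3 accommodates 1 + |w| up to the top of the ray; the exponent 2 B + 6 pays for the union over
   the grid. *)
have [G0 [G01 PL]] := point_law c tt0 tt1 (B + 3) e (D + (2 * B + 6)).
exists (128 + G0); split; first by lra.
move=> G M N s V p xv fm GG0 nG sB E e0 rc.
have N0 := fm_N fm; have s0 := fm_s fm; have cm := fm_cm fm.
have s1 : s <= 1 := s_le1 N0 (fm_NM fm) s0 (fm_sMN fm).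
have G1 : 1 <= G by lra.
have g6 := raycond_G6 N0 G1 rc; case: (rc) => EB dom /andP[e0N e01] c1 c2.
have Nr : 0 < N%:R :> R by rewrite ltr0n.
have e00 : 0 < e0 by apply: lt_le_trans e0N; rewrite invr_gt0.
have G128 : 128 <= G by lra.
have N128 : 128 <= N%:R :> R.
  apply: le_trans g6; apply: (le_trans G128); rewrite exprS ler_peMr ?exprn_ege1 //; lra.
have GG1 : G0 <= G by apply: le_trans GG0; rewrite lerDr.
have sB3 : s^-1 <= N%:R ^+ (B + 3).
  by apply: (le_trans sB); rewrite ler_weXn2l ?leq_addr // ler1n.
have pt x : e0 <= x -> x <= raytop N B ->
    fP (wt p) (fun o => badpt s G E x (Xmat xv o)) <= (N%:R ^+ (D + (2 * B + 6)))^-1.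
  move=> ex xH; have x0 := lt_le_trans e00 ex.
  have NB1 : 1 <= N%:R ^+ B :> R by rewrite exprn_ege1 //; lra.
  have hq : (1 + nrm (vw E x)) * vq N x <= (1 + `|E| + e0) * vq N e0 by exact: Lq_mono.
  apply: (PL G M N s V p xv fm GG1 nG sB3 (vw E x) (vu E x)) => {PL} //.
  - exact: vu_Im.
  - exact: vu_eq.
  - exact: le_trans ex.
  - have h1 := nrm_vw E (ltW x0).
    apply: (@le_trans _ _ (3 * N%:R ^+ B.+1)).
      have h2 : N%:R ^+ B <= N%:R ^+ B.+1 :> R by rewrite ler_weXn2l //; lra.
      by move: xH; rewrite /raytop; lra.
    rewrite (_ : (B + 3)%N = (B.+1 + 2)%N); last by rewrite addnS addSn addnS.
    rewrite exprD [leRHS]mulrC ler_wpM2r ?exprn_ge0 ?(ltW Nr) // expr2.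
    by apply: (@le_trans _ _ (3 * 1)); [lra | apply: ler_pM; lra].
  - apply: le_trans c2; apply: (@le_trans _ _ (G ^+ 4 * ((1 + `|E| + e0) * vq N e0))).
      by rewrite ler_wpM2l // exprn_ge0 //; lra.
    rewrite ler_wpM2r ?ler_weXn2l // mulr_ge0 ?(ltW (vq_gt0 N0 e00)) //.
    by have := normr_ge0 E; lra.
  - have q0 := ltW (vq_gt0 N0 x0); rewrite /vl -[qpar N _]/(vq N x).
    have g5 : 1 <= G ^+ 5 by rewrite exprn_ege1.
    apply: (@le_trans _ _ (G ^+ 5 * vq N x)); first by rewrite ler_peMl.
    by rewrite ler_peMl ?mulr_ge0 //; lra.
  - by left; exact: (vl_small N0 e00 G1 G128 c2 ex).
clear PL.
have H1 : 1 <= raytop N B by rewrite /raytop exprn_ege1 //; lra.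
have h0 : 0 <= raymesh N B by rewrite /raymesh invr_ge0 exprn_ge0 // ltW.
set n := (N ^ (2 * B + 5)).+1.
apply: (le_trans (fPU (wt_ge0 cm) _ _)).
apply: (@le_trans _ _ ((N%:R ^+ (D + (2 * B + 6)))^-1 + \sum_(j <- iota 0 n) (N%:R ^+ (D + (2 * B + 6)))^-1)).
  apply: lerD.
    apply: pt => //; apply: (le_trans e01); rewrite /raytop exprS ler_peMl ?exprn_ge0 ?(ltW Nr) //; lra.
  apply: (le_trans (fP_has (wt_ge0 cm) _ (fun j o => (e0 <= raytop N B - j%:R * raymesh N B) && badpt s G E (raytop N B - j%:R * raymesh N B) (Xmat xv o)))).
  apply: ler_sum => j _; case: (leP e0 (raytop N B - j%:R * raymesh N B)) => hj /=.
    by apply: pt => //; rewrite lerBlDr lerDl mulr_ge0.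
  rewrite /fP /fE big1 ?invr_ge0 ?exprn_ge0 ?(ltW Nr) // => o _; by rewrite mulr0.
rewrite big_const_seq count_predT size_iota iter_addr addr0 -mulrS.
rewrite -[_ *+ _]mulr_natl ler_pdivrMr ?exprn_gt0 // exprD mulKf ?gt_eqF ?exprn_gt0 //.
rewrite (_ : (2 * B + 6)%N = (2 * B + 5).+1); last by rewrite addnS.
rewrite exprS /n -!natr1 natrX; have : 1 <= N%:R ^+ (2 * B + 5) :> R by rewrite exprn_ege1 //; lra.
set y := N%:R ^+ _ => y1; have : 0 <= (N%:R - 128) * y by rewrite mulr_ge0 //; lra.
lra.
Qed.

(** The second conclusion keeps the bound at the lowest height in its sharp form, with Im m0 still
    visible; outside the spectrum this is what excludes eigenvalues. *)
Lemma badray_good (B : nat) (G : R) (M N : nat) (s E e0 : R) (X : 'M[C]_(M, N)) lam :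
  (0 < N)%N -> (N <= M)%N -> 0 < s -> s <= 1 ->
  128 + 12 / tt + 8 / tt ^+ 2 + 6 * (36 / tt ^+ 2 + 1) <= G ->
  raycond N B s G E e0 -> ~~ badray B s G E e0 X ->
  nontrivial_spectrum N (gram X) lam -> (forall k, (1 <= k <= N)%N -> `|ycen s lam k| <= N%:R ^+ B) ->
  (forall x, e0 <= x -> x <= raytop N B -> nrm (stj N s lam (vw E x) - vm s E x) <= vl N G x) /\
  nrm (stj N s lam (vw E e0) - vm s E e0) * nrm (sc_rho (vw E e0) (vu E e0)) <=
    2 * (G ^+ 4 * Bsharp N (vw E e0) (vm s E e0) (sc_rho (vw E e0) (vu E e0)) (vl N G e0)).
Proof.
have eB : (B.+1 + (B + 4))%N = (2 * B + 5)%N by lia.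
move=> N0 NM s0 s1 GG rc nb sp yB.
have i1 : 0 < 12 / tt by rewrite divr_gt0.
have i2 : 0 < 8 / tt ^+ 2 by rewrite divr_gt0 // exprn_gt0.
have i3 : 0 < 36 / tt ^+ 2 by rewrite divr_gt0 // exprn_gt0.
have G1 : 1 <= G by lra.
have G128 : 128 <= G by lra.
have GK : 6 * (36 / tt ^+ 2 + 1) <= G by lra.
have g6 := raycond_G6 N0 G1 rc; case: (rc) => EB dom /andP[e0N e01] c1 c2.
have Nr : 0 < N%:R :> R by rewrite ltr0n.
have e00 : 0 < e0 by apply: lt_le_trans e0N; rewrite invr_gt0.
have g5 : G <= G ^+ 5 by rewrite exprS ler_peMr ?exprn_ege1 //; lra.
have N1 : 1 <= N%:R :> R by rewrite ler1n.
have H1 : 1 <= raytop N B by rewrite /raytop exprn_ege1.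
have Hpos : 0 < raytop N B by lra.
have hpos : 0 < raymesh N B by rewrite /raymesh invr_gt0 exprn_gt0.
have stE x : 0 < x -> mstj s (vw E x) X = stj N s lam (vw E x).
  by move=> x0; apply: mstj_stj => //.
move: nb; rewrite /badray negb_or => /andP[nb0 nbj].
have good x : 0 < x -> ~~ badpt s G E x X -> nrm (stj N s lam (vw E x) - vm s E x) <= vl N G x ->
  nrm (scpoly s (vw E x) (stj N s lam (vw E x))) <= G ^+ 4 * Bsharp N (vw E x) (vm s E x) (sc_rho (vw E x) (vu E x)) (vl N G x).
  by move=> x0; rewrite /badpt stE // negb_and -leNgt => /orP[/negP h1 /h1|].
have lip : ((e0 ^+ 2)^-1 + 8 / tt ^+ 2 / e0) * raymesh N B <= G ^+ 5 * vq N (raytop N B).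
  have -> : vq N (raytop N B) = N%:R ^+ 2 * raymesh N B.
    rewrite /vq /raytop /raymesh -exprS (_ : (B + 4)%N = (B.+2 + 2)%N) ?exprD.
      have aux (a b : R) : b != 0 -> a^-1 = b / (a * b).
        by move=> b0; rewrite invfM mulrCA mulfV // mulr1.
      by apply: aux; rewrite expf_neq0 // gt_eqF.
    by rewrite !addSn !addnS.
  rewrite mulrA ler_wpM2r ?(ltW hpos) //.
  have ei : e0^-1 <= N%:R by rewrite -[N%:R]invrK lef_pV2 ?posrE ?invr_gt0.
  have ei0 : 0 < e0^-1 by rewrite invr_gt0.
  rewrite -exprVn; apply: (@le_trans _ _ ((1 + 8 / tt ^+ 2) * N%:R ^+ 2)).
    rewrite [leRHS]mulrDl mul1r; apply: lerD; first by apply: lerXn2r; rewrite ?nnegrE ?(ltW Nr) ?(ltW ei0).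
    rewrite ler_wpM2l ?(ltW i2) //; apply: (le_trans ei); rewrite expr2 ler_peMr ?(ltW Nr) //.
  by rewrite ler_wpM2r ?exprn_ge0 ?(ltW Nr) //; lra.
have top : nrm (stj N s lam (vw E (raytop N B)) - vm s E (raytop N B)) <= G ^+ 5 * vq N (raytop N B).
  apply: (ray_top tt0 tt1 N0 s0 s1 dom Hpos (exprn_ge0 B (ltW Nr)) yB).
  rewrite /raytop [_ ^+ B.+1]exprS; have NB1 : 1 <= N%:R ^+ B :> R by rewrite exprn_ege1.
  rewrite mulrCA ler_wpM2l ?(ltW Nr) //.
  apply: (@le_trans _ _ (G * N%:R ^+ B)); last by rewrite ler_wpM2r //; lra.
  set y := N%:R ^+ B in NB1 *; have : 0 <= (G - 1 - 12 / tt) * y by rewrite mulr_ge0 //; lra.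
  have : 0 <= 12 / tt * (y - 1) by rewrite mulr_ge0 //; lra.
  lra.
have all x : e0 <= x -> x <= raytop N B -> nrm (stj N s lam (vw E x) - vm s E x) <= vl N G x.
  move=> ex xH; apply: (ray_all tt0 tt1 N0 s0 s1 dom e00 G1 G128 GK c1 hpos lip top _ ex xH).
  move=> j hj hl; apply: good => //; first exact: lt_le_trans hj.
  have jn : (j < (N ^ (2 * B + 5)).+1)%N.
    rewrite ltnS -(ler_nat R) natrX; have := le_trans (ltW e00) hj.
    rewrite subr_ge0 -ler_pdivlMr // /raymesh invrK /raytop -exprD.
    by rewrite eB.
  move/hasPn: nbj => /(_ j); rewrite mem_iota add0n jn => /(_ isT).
  by rewrite hj.
split=> //.
have eH : e0 <= raytop N B by apply: (le_trans e01); rewrite /raytop exprS ler_peMl // exprn_ge0 // ltW.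
have he := all e0 (lexx _) eH.
have [lr r0] := vl_rho N0 e00 G1 G128 c1 (lexx e0) (E := E).
exact: (stable_quotient s0 s1 (vu_Im E e00) (vu_eq E e00) lr he (good _ e00 nb0 he)).
Qed.
End RayLaw.

(** * The counting function *)

Section RealCalculus.
Variable R : realType.
Implicit Types (f g : R -> R) (x l : R).

(** Algebra on the quadratic equation delivers a quadratic remainder with an explicit radius; it is
    converted into a derivative once and for all here. *)
Lemma is_derive_quad f x l K d : 0 < d ->
  (forall h, `|h| < d -> `|f (x + h) - f x - h * l| <= K * h ^+ 2) -> is_derive x 1 f l.
Proof.
move=> d0 hf.
have lim : h^-1 *: (f (h *: (1 : R) + x) - f x) @[h --> 0^'] --> l.
  apply/cvgrPdist_le => e e0.
  near=> h.
  have hn : h != 0 by near: h; exact: nbhs_dnbhs_neq.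
  have hd : `|h| < d by near: h; exact: dnbhs0_lt.
  have hK : `|h| < e / (1 + `|K|) by near: h; apply: dnbhs0_lt; rewrite divr_gt0 // ltr_wpDr.
  rewrite -[h *: 1]/(h * 1) mulr1 [h + x]addrC -[h^-1 *: _]/(h^-1 * _).
  have -> : l - h^-1 * (f (x + h) - f x) = - (h^-1 * (f (x + h) - f x - h * l)).
    by rewrite [X in _ = - X]mulrBr mulKf // opprB.
  rewrite normrN normrM normfV mulrC ler_pdivrMr ?normr_gt0 //.
  apply: (le_trans (hf _ hd)).
  have h2 : h ^+ 2 = `|h| * `|h| by rewrite -expr2 real_normK ?num_real.
  rewrite h2 mulrA ler_wpM2r //.
  apply: (@le_trans _ _ ((1 + `|K|) * `|h|)).
    by rewrite ler_wpM2r // (le_trans (ler_norm K)) // lerDr.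
  by rewrite mulrC -ler_pdivlMr ?(ltW hK) // ltr_wpDr.
by split; [apply/cvg_ex; exists l | exact: cvg_lim].
Unshelve. all: by end_near. Qed.

Lemma drv_eq f x l l' : is_derive x 1 f l -> l = l' -> is_derive x 1 f l'.
Proof. by move=> h <-. Qed.
Lemma drv_c (c x : R) : is_derive x 1 (fun=> c) 0.
Proof. exact: is_derive_cst. Qed.
Lemma drv_id x : is_derive x (1 : R) (fun t : R => t) 1.
Proof. exact: is_derive_id. Qed.
Lemma drvD f g x a b : is_derive x 1 f a -> is_derive x 1 g b -> is_derive x 1 (fun t => f t + g t) (a + b).
Proof. by move=> hf hg; exact: (is_deriveD hf hg). Qed.
Lemma drvN f x a : is_derive x 1 f a -> is_derive x 1 (fun t => - f t) (- a).
Proof. by move=> hf; exact: (is_deriveN hf). Qed.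
Lemma drvB f g x a b : is_derive x 1 f a -> is_derive x 1 g b -> is_derive x 1 (fun t => f t - g t) (a - b).
Proof. by move=> hf hg; exact: (is_deriveB hf hg). Qed.
Lemma drvM f g x a b : is_derive x 1 f a -> is_derive x 1 g b ->
  is_derive x 1 (fun t => f t * g t) (f x * b + g x * a).
Proof. by move=> hf hg; exact: (is_deriveM hf hg). Qed.
Lemma drvV f x a : f x != 0 -> is_derive x 1 f a -> is_derive x 1 (fun t => (f t)^-1) (- a / f x ^+ 2).
Proof. by move=> h0 hf; apply: (drv_eq (is_deriveV h0 hf)); rewrite -[_ *: _]/(_ * _) mulNr mulrC mulNr. Qed.
Lemma drv_div f g x a b : g x != 0 -> is_derive x 1 f a -> is_derive x 1 g b ->
  is_derive x 1 (fun t => f t / g t) ((a * g x - f x * b) / g x ^+ 2).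
Proof.
by move=> h0 hf hg; apply: (drv_eq (drvM hf (drvV h0 hg))); field.
Qed.
Lemma drv_comp f g x a b : is_derive (g x) 1 f a -> is_derive x 1 g b -> is_derive x 1 (fun t => f (g t)) (a * b).
Proof. by move=> hf hg; exact: (is_derive1_comp hf hg). Qed.
Lemma drv_atan f x a : is_derive x 1 f a -> is_derive x 1 (fun t => atan (f t)) (a / (1 + f x ^+ 2)).
Proof.
by move=> hf; apply: (drv_eq (drv_comp (is_derive1_atan (f x)) hf)); rewrite mulrC.
Qed.
Lemma drv_sum (I : Type) (r : seq I) (F : I -> R -> R) (D : I -> R) x :
  (forall i, is_derive x 1 (F i) (D i)) ->
  is_derive x 1 (fun t => \sum_(i <- r) F i t) (\sum_(i <- r) D i).
Proof.
move=> h; elim: r => [|i r IH].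
  rewrite big_nil (_ : (fun t => _) = (fun=> 0)); first exact: drv_c.
  by apply/funext => t; rewrite big_nil.
rewrite big_cons (_ : (fun t => _) = (fun t => F i t + \sum_(j <- r) F j t)).
  exact: drvD.
by apply/funext => t; rewrite big_cons.
Qed.
Lemma drv_cont f x a : is_derive x 1 f a -> {for x, continuous f}.
Proof. by case=> h _; exact/differentiable_continuous/derivable1_diffP. Qed.

Lemma drv_decr f df (a b : R) : a <= b -> (forall x, a <= x <= b -> is_derive x 1 f (df x)) ->
  (forall x, a <= x <= b -> df x <= 0) -> f b <= f a.
Proof.
move=> ab hd h0.
have hc : {within `[a, b], continuous f}.
  by apply: continuous_in_subspaceT => x; rewrite inE /= in_itv /= => /hd; exact: drv_cont.
have hd' (x : R) : x \in `]a, b[%R -> is_derive x 1 f (df x).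
  by rewrite in_itv /= => /andP[h1 h2]; apply: hd; rewrite !ltW.
have [c hcI e] := MVT_segment ab hd' hc.
move: hcI; rewrite in_itv /= => hcI.
rewrite -subr_le0 e mulr_le0_ge0 ?subr_ge0 //; exact: h0.
Qed.

Lemma drv_lip f df (a b L : R) : a <= b -> (forall x, a < x < b -> is_derive x 1 f (df x)) ->
  (forall x, a <= x <= b -> {for x, continuous f}) ->
  (forall x, a < x < b -> `|df x| <= L) -> 0 <= L -> `|f b - f a| <= L * (b - a).
Proof.
move=> ab hd hc0 hL L0; move: ab; rewrite le_eqVlt => /orP[/eqP <-|ab].
  by rewrite !subrr normr0 mulr0.
have hc : {within `[a, b], continuous f}.
  by apply: continuous_in_subspaceT => x; rewrite inE /= in_itv /= => /hc0.
have hd' (x : R) : x \in `]a, b[%R -> is_derive x 1 f (df x).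
  by rewrite in_itv /=; exact: hd.
have [c hcI e] := MVT ab hd' hc.
move: hcI; rewrite in_itv /= => hcI.
rewrite e normrM (ger0_norm (_ : 0 <= b - a)) ?subr_ge0 ?(ltW ab) //.
by rewrite ler_wpM2r ?subr_ge0 ?(ltW ab) // hL.
Qed.

Lemma atan_bounds x : 0 <= x -> x / (1 + x ^+ 2) <= atan x <= x.
Proof.
move=> x0.
have hd (t : R) : is_derive t 1 (@atan R) (1 + t ^+ 2)^-1 := is_derive1_atan t.
have hc : {within `[0, x], continuous (@atan R)}.
  by apply: continuous_subspaceT => y; exact: drv_cont (hd y).
have [c hcI] := MVT_segment x0 (fun t _ => hd t) hc.
rewrite atan0 !subr0 => ->; move: hcI; rewrite in_itv /= => /andP[c0 cx].
have p (t : R) : 0 < 1 + t ^+ 2 by rewrite ltr_wpDr ?sqr_ge0.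
apply/andP; split.
  rewrite mulrC ler_wpM2r // lef_pV2 ?posrE ?p // lerD2l.
  by apply: lerXn2r; rewrite ?nnegrE.
by rewrite ler_piMl // invf_le1 ?p // lerDl sqr_ge0.
Qed.

Lemma atan_inv x : 0 < x -> atan x + atan x^-1 = pi / 2.
Proof.
move=> x0; pose f (t : R) := atan t + atan t^-1.
have hd (t : R) : 0 < t -> is_derive t 1 f 0.
  move=> t0; have h1 := is_derive1_atan t.
  have h2 := drv_atan (drvV (lt0r_neq0 t0) (drv_id t)).
  apply: (drv_eq (drvD h1 h2)).
  have p : 1 + t ^+ 2 != 0 by rewrite gt_eqF // ltr_wpDr ?sqr_ge0.
  have p2 : 1 + t^-1 ^+ 2 = (1 + t ^+ 2) / t ^+ 2 by field; rewrite gt_eqF.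
  by rewrite p2; field; rewrite p gt_eqF.
have lip a b : 0 < a -> a <= b -> f b = f a.
  move=> a0 ab; apply/eqP; rewrite -subr_eq0 -normr_eq0 eq_le normr_ge0 andbT.
  have := @drv_lip f (fun=> 0) a b 0 ab; rewrite mul0r; apply=> //.
  - by move=> t /andP[h _]; apply: hd; exact: lt_trans h.
  - by move=> t /andP[h _]; apply: drv_cont (hd t _); exact: lt_le_trans h.
  - by move=> t _; rewrite normr0.
have f1 : f 1 = pi / 2 by rewrite /f invr1 atan1; field.
rewrite -f1 -[LHS]/(f x); have [h|h] := leP 1 x; first exact: lip.
by rewrite (lip _ _ x0 (ltW h)).
Qed.

(** Without its first-order term at infinity, the error has the size of a Poisson kernel, which sums
    to a multiple of eta Im m_N over the eigenvalues. *)
Lemma atan_tail x : 0 < x -> `|pi / 2 - atan x - x / (1 + x ^+ 2)| <= 4 / (1 + x ^+ 2).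
Proof.
move=> x0; have y0 : 0 < x^-1 by rewrite invr_gt0.
rewrite -(atan_inv x0) [atan x + _]addrC addrK.
have p1 : 1 + x ^+ 2 != 0 by rewrite gt_eqF // ltr_wpDr ?sqr_ge0.
have xn : x != 0 by rewrite gt_eqF.
have p2 : 1 + x^-1 ^+ 2 = (1 + x ^+ 2) / x ^+ 2 by field.
have e : x / (1 + x ^+ 2) = x^-1 / (1 + x^-1 ^+ 2).
  by rewrite p2; field; rewrite p1 xn.
have e2 : (1 + x ^+ 2)^-1 = x^-1 ^+ 2 / (1 + x^-1 ^+ 2).
  by rewrite p2; field; rewrite p1 xn.
rewrite e e2; move: (x^-1) y0 => t t0; have /andP[h1 h2] := atan_bounds (ltW t0).
have p : 0 < 1 + t ^+ 2 by rewrite ltr_wpDr ?sqr_ge0.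
rewrite ger0_norm ?subr_ge0 //.
have [t1|t1] := leP t 1.
  apply: (@le_trans _ _ (t - t / (1 + t ^+ 2))); first by rewrite lerD2r.
  rewrite (_ : t - t / (1 + t ^+ 2) = t ^+ 2 * t / (1 + t ^+ 2)); last by field; rewrite gt_eqF.
  rewrite mulrA ler_wpM2r ?invr_ge0 ?(ltW p) // mulrC ler_wpM2r ?sqr_ge0 //; lra.
have pb : atan t <= 2.
  by have := atan_ltpi2 t; have := pihalf_lt2 R; lra.
apply: (@le_trans _ _ 2); first by have : 0 <= t / (1 + t ^+ 2); [rewrite divr_ge0 // ltW | lra].
rewrite mulrA ler_pdivlMr //; have : 1 <= t ^+ 2 by rewrite expr_ge1 // ltW.
lra.
Qed.

End RealCalculus.

(** * Differentiation along the vertical line *)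

Section ComplexCurves.
Variable R : realType.
Local Notation C := R[i].
Local Open Scope complex_scope.

Definition qdiff (f : R -> C) (x : R) (l : C) := exists K d, 0 < d /\
  forall h : R, `|h| < d -> nrm (f (x + h) - f x - h%:C * l) <= K * h ^+ 2.

Lemma qdiff_Re f x l : qdiff f x l -> is_derive x 1 (fun t => complex.Re (f t)) (complex.Re l).
Proof.
move=> [K [d [d0 h]]]; apply: (is_derive_quad d0 (K := K)) => y /h; apply: le_trans.
by rewrite -cReZ -!cReB; exact: le_Re_nrm.
Qed.
Lemma qdiff_Im f x l : qdiff f x l -> is_derive x 1 (fun t => complex.Im (f t)) (complex.Im l).
Proof.
move=> [K [d [d0 h]]]; apply: (is_derive_quad d0 (K := K)) => y /h; apply: le_trans.
by rewrite -cImZ -!cImB; exact: le_Im_nrm.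
Qed.

Variables (tt s E : R).
Hypotheses (tt0 : 0 < tt) (tt1 : tt <= 1) (s0 : 0 < s) (s1 : s <= 1).
Hypothesis dom : (- 2 + tt <= E) || (s <= 1 - tt / 2).
Local Notation u := (vu E).

Definition du (x : R) : C := 'i * (u x ^+ 2 / (1 - u x ^+ 2)).
Definition dm (x : R) : C := du x / (1 - s%:C * u x) ^+ 2.

Lemma one_sub_ge (z z' : C) : nrm z < 1 -> nrm z' <= 1 -> 1 - nrm z <= nrm (1 - z * z').
Proof.
move=> z1 z1'; apply: le_trans (nrmB_ge _ _); rewrite nrm1 nrmM lerD2l lerN2.
by rewrite ler_piMr ?nrm_ge0.
Qed.

Lemma vu_lt1 x : 0 < x -> nrm (u x) < 1.
Proof. by move=> x0; exact: (@r_lt1 _ (vw E x) (u x) x0 (vu_Im E x0) (vu_eq E x0)). Qed.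

Lemma vu_sqr_neq x : 0 < x -> 1 - u x ^+ 2 != 0.
Proof.
move=> x0; have r1 := vu_lt1 x0; rewrite -nrm_gt0 expr2.
by apply: lt_le_trans (one_sub_ge r1 (ltW r1)); lra.
Qed.

(** The difference of the quadratic equations at two heights. Dividing by 1 - u u', at least 1 -
    |u(x)| in modulus, yields both the derivative and its remainder. *)
Lemma vu_diff x y : 0 < x -> 0 < y ->
  (u y - u x) * (1 - u x * u y) = ('i * (y - x)%:C) * (u x * u y).
Proof.
move=> x0 y0; have hx := vu_eq E x0; have hy := vu_eq E y0.
have -> : 'i * (y - x)%:C = vw E y - vw E x :> C.
  by apply: cplx_eq; rewrite !(cReM, cImM, cReB, cImB) /=; ring.
have -> : (u y - u x) * (1 - u x * u y) =
  (vw E y - vw E x) * (u x * u y) + u y * (u x ^+ 2 + vw E x * u x + 1) - u x * (u y ^+ 2 + vw E y * u y + 1) by ring.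
by rewrite hx hy !mulr0 addr0 subr0.
Qed.

Lemma nrm_i : nrm ('i : C) = 1.
Proof. by rewrite nrmE /= expr0n /= add0r expr1n sqrtr1. Qed.

Lemma vu_qdiff x : 0 < x -> qdiff u x (du x).
Proof.
move=> x0; have r1 := vu_lt1 x0.
have g0 : 0 < 1 - nrm (u x) by lra.
exists (2 / x / (1 - nrm (u x)) ^+ 2), x; split=> // h hx.
have y0 : 0 < x + h by move: hx; rewrite ltr_norml => /andP[]; lra.
have ry := vu_lt1 y0; have r0 := nrm_ge0 (u x).
have n1 := one_sub_ge r1 (ltW ry); have n2 := one_sub_ge r1 (ltW r1); rewrite -expr2 in n2.
have m1 : 1 - u x * u (x + h) != 0 by rewrite -nrm_gt0 (lt_le_trans g0).
have m2 := vu_sqr_neq x0.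
have e1 : u (x + h) - u x = 'i * h%:C * (u x * u (x + h)) / (1 - u x * u (x + h)).
  by rewrite -[LHS](mulfK m1) vu_diff // [x + h]addrC addrK.
have -> : u (x + h) - u x - h%:C * du x =
   'i * h%:C * u x * (u (x + h) - u x) / ((1 - u x * u (x + h)) * (1 - u x ^+ 2)).
  by rewrite [X in X - _]e1 /du; field; rewrite m1 m2.
have hl : nrm (u (x + h) - u x) <= 2 / x * `|h|.
  have := u_lip (x0 : 0 < complex.Im (vw E x)) (vu_Im E x0) (vu_eq E x0) (y0 : 0 < complex.Im (vw E (x + h))) (vu_Im E y0) (vu_eq E y0).
  rewrite nrmBC (_ : nrm (vw E x - vw E (x + h)) = `|h|) //.
  by rewrite nrmE cReB cImB /= subrr expr0n /= add0r sqrtr_sqr opprD addrA subrr add0r normrN.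
rewrite nrmM nrmV !nrmM nrm_i mul1r nrmR.
apply: (@le_trans _ _ ((`|h| * 1 * (2 / x * `|h|)) / (1 - nrm (u x)) ^+ 2)).
  apply: ler_pM; rewrite ?invr_ge0 ?mulr_ge0 ?nrm_ge0 //.
    by apply: ler_pM; rewrite ?mulr_ge0 ?nrm_ge0 // ler_wpM2l // ltW.
  rewrite lef_pV2 ?posrE ?exprn_gt0 ?mulr_gt0 ?nrm_gt0 // expr2.
  by apply: ler_pM => //; exact: ltW.
have h2 : h ^+ 2 = `|h| * `|h| by rewrite -expr2 real_normK ?num_real.
by rewrite h2 le_eqVlt; apply/orP; left; apply/eqP; field; rewrite !gt_eqF.
Qed.

Lemma vsu_ge x : 0 < x -> tt / 2 <= nrm (1 - s%:C * u x).
Proof.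
by move=> x0; exact: (su_lower (x0 : 0 < complex.Im (vw E x)) (vu_Im E x0) (vu_eq E x0) s0 s1 tt0 tt1 dom).
Qed.

Lemma vm_qdiff x : 0 < x -> qdiff (vm s E) x (dm x).
Proof.
move=> x0; have [K [d [d0 hK]]] := vu_qdiff x0.
have t2 : 0 < tt / 2 by rewrite divr_gt0.
have gx := vsu_ge x0; have nx : 1 - s%:C * u x != 0 by rewrite -nrm_gt0 (lt_le_trans t2).
exists (K / (tt / 2) ^+ 2 + nrm (du x) * (2 / x) / (tt / 2) ^+ 3), (Num.min d x).
split; first by rewrite lt_min d0 x0.
move=> h; rewrite lt_min => /andP[hd hx].
have y0 : 0 < x + h by move: hx; rewrite ltr_norml => /andP[]; lra.
have gy := vsu_ge y0; have ny : 1 - s%:C * u (x + h) != 0 by rewrite -nrm_gt0 (lt_le_trans t2).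
have -> : vm s E (x + h) - vm s E x - h%:C * dm x =
  (u (x + h) - u x - h%:C * du x) / ((1 - s%:C * u x) * (1 - s%:C * u (x + h)))
  + h%:C * du x * (s%:C * (u (x + h) - u x)) / ((1 - s%:C * u x) ^+ 2 * (1 - s%:C * u (x + h))).
  by rewrite /vm /mp_m /dm; field; rewrite nx ny.
have hl : nrm (u (x + h) - u x) <= 2 / x * `|h|.
  have := u_lip (x0 : 0 < complex.Im (vw E x)) (vu_Im E x0) (vu_eq E x0) (y0 : 0 < complex.Im (vw E (x + h))) (vu_Im E y0) (vu_eq E y0).
  rewrite nrmBC (_ : nrm (vw E x - vw E (x + h)) = `|h|) //.
  by rewrite nrmE cReB cImB /= subrr expr0n /= add0r sqrtr_sqr opprD addrA subrr add0r normrN.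
have h2 : h ^+ 2 = `|h| * `|h| by rewrite -expr2 real_normK ?num_real.
apply: (le_trans (nrmD _ _)); rewrite [leRHS]mulrDl; apply: lerD.
  rewrite nrmM nrmV nrmM mulrAC; apply: ler_pM; rewrite ?nrm_ge0 ?invr_ge0 ?mulr_ge0 ?nrm_ge0 ?hK //.
  rewrite lef_pV2 ?posrE ?exprn_gt0 ?mulr_gt0 ?nrm_gt0 // expr2.
  by apply: ler_pM => //; exact: ltW.
move: (du x) => dd.
rewrite nrmM nrmV [in X in _ * X <= _]nrmM nrmX !nrmM !nrmR (ger0_norm (ltW s0)) h2.
rewrite (_ : _ / (tt / 2) ^+ 3 * (`|h| * `|h|) = `|h| * nrm dd * (1 * (2 / x * `|h|)) / (tt / 2) ^+ 3); last by ring.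
apply: ler_pM; rewrite ?invr_ge0 //.
- by rewrite mulr_ge0 ?mulr_ge0 ?nrm_ge0 ?(ltW s0).
- by rewrite mulr_ge0 ?exprn_ge0 ?nrm_ge0.
- rewrite ler_wpM2l ?mulr_ge0 ?nrm_ge0 //; apply: ler_pM; rewrite ?nrm_ge0 ?(ltW s0) //.
rewrite lef_pV2 ?posrE ?exprn_gt0 ?mulr_gt0 ?exprn_gt0 ?nrm_gt0 // exprSr.
apply: ler_pM; rewrite ?exprn_ge0 ?(ltW t2) //.
by apply: lerXn2r; rewrite ?nnegrE ?nrm_ge0 ?(ltW t2).
Qed.

(** u rho = -(1 - u^2) cancels the singular denominator of the derivative of u, so only the
    denominator 1 - s u of m remains. *)
Lemma dm_le x : 0 < x -> nrm (dm x) * nrm (sc_rho (vw E x) (u x)) <= 4 / tt ^+ 2.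
Proof.
move=> x0; have m2 := vu_sqr_neq x0; have un := u_neq0 (vu_Im E x0).
have t2 : 0 < tt / 2 by rewrite divr_gt0.
have gx := vsu_ge x0; have nx : 1 - s%:C * u x != 0 by rewrite -nrm_gt0 (lt_le_trans t2).
have e : u x * sc_rho (vw E x) (u x) = - (1 - u x ^+ 2).
  rewrite /sc_rho; have -> : u x * (vw E x + 2 * u x) = (u x ^+ 2 + vw E x * u x + 1) - (1 - u x ^+ 2) by ring.
  by rewrite vu_eq // add0r.
rewrite -nrmM.
have -> : dm x * sc_rho (vw E x) (u x) = - 'i * u x / (1 - s%:C * u x) ^+ 2.
  rewrite /dm /du.
  rewrite (_ : _ * sc_rho _ _ = 'i * u x * (u x * sc_rho (vw E x) (u x)) / (1 - u x ^+ 2) / (1 - s%:C * u x) ^+ 2); last by ring.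
  by rewrite e; field; rewrite nx m2.
rewrite nrmM nrmV nrmX nrmM nrmN nrm_i mul1r.
apply: (@le_trans _ _ (1 / (tt / 2) ^+ 2)).
  apply: ler_pM; rewrite ?nrm_ge0 ?invr_ge0 ?exprn_ge0 ?nrm_ge0 ?(ltW (vu_lt1 x0)) //.
  rewrite lef_pV2 ?posrE ?exprn_gt0 ?nrm_gt0 //.
  by apply: lerXn2r; rewrite ?nnegrE ?nrm_ge0 ?(ltW t2).
by rewrite le_eqVlt; apply/orP; left; apply/eqP; field; rewrite gt_eqF.
Qed.

End ComplexCurves.

Arguments vu : simpl never.
Arguments vm : simpl never.
Arguments vq : simpl never.

Lemma atan_le_norm (R : realType) (t : R) : `|atan t| <= `|t|.
Proof.
have pos (x : R) : 0 <= x -> `|atan x| <= `|x|.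
  move=> x0; have /andP[h1 h2] := atan_bounds x0; rewrite !ger0_norm //.
  by apply: le_trans h1; rewrite divr_ge0 // addr_ge0 // sqr_ge0.
have [h|h] := leP 0 t; first exact: pos.
by rewrite -normrN -atanN -[leRHS]normrN; apply: pos; rewrite oppr_ge0 ltW.
Qed.

(** * Phases of the empirical and the limiting law *)

Section Counting.
Variable R : realType.
Local Notation C := R[i].
Local Open Scope complex_scope.

(** With u' = i (1 / (1 - u^2) - 1) inserted, the derivative of [theta] is rational in p, v and s;
    this is the identity that makes it equal to -Re m. *)
Lemma theta_identity (p v s a D1 D2 : R) : a = 1 - p ^+ 2 + v ^+ 2 ->
  D1 = a ^+ 2 + (2 * p * v) ^+ 2 -> D2 = (1 - s * p) ^+ 2 + (s * v) ^+ 2 ->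
  v != 0 -> p ^+ 2 + v ^+ 2 != 0 -> s != 0 -> 1 - s * p != 0 -> D1 != 0 -> D2 != 0 ->
  let p' := - (2 * p * v / D1) in let v' := a / D1 - 1 in
  (p' * v - p * v') / v ^+ 2 / (1 + (p / v) ^+ 2) - v' / s
  + (s ^- 2 - 1) * ((s * v' * (1 - s * p) - s * v * (0 - s * p')) / (1 - s * p) ^+ 2 / (1 + (s * v / (1 - s * p)) ^+ 2))
  = - ((p * (1 - s * p) - s * v ^+ 2) / D2).
Proof.
move=> ea e1 e2 vn rn sn qn d1 d2 /=.
have -> : 1 + (p / v) ^+ 2 = (p ^+ 2 + v ^+ 2) / v ^+ 2 by field.
have -> : 1 + (s * v / (1 - s * p)) ^+ 2 = D2 / (1 - s * p) ^+ 2 by rewrite e2; field.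
rewrite e1 ea in d1; rewrite e2 in d2; rewrite e1 e2 ea; field.
by rewrite vn rn sn qn d1 d2.
Qed.

Variables (tt : R) (N : nat) (s E : R) (lam : nat -> R).
Hypotheses (tt0 : 0 < tt) (tt1 : tt <= 1) (N0 : (0 < N)%N) (s0 : 0 < s) (s1 : s <= 1).
Hypothesis dom : (- 2 + tt <= E) || (s <= 1 - tt / 2).
Hypothesis E2 : `|E| < 2.
Local Notation u := (vu E).
Local Notation p := (fun x : R => complex.Re (vu E x)).
Local Notation v := (fun x : R => complex.Im (vu E x)).

(** A closed primitive of -Re m along the vertical line, vanishing at infinity. At height 0 it is pi
    times the mass above E minus 1/2 ([nE_theta]). *)
Definition theta (x : R) : R := atan (p x / v x) - v x / s + (s ^- 2 - 1) * atan (s * v x / (1 - s * p x)).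
Definition remp (x : R) : R := (p x * (1 - s * p x) - s * v x ^+ 2) / ((1 - s * p x) ^+ 2 + (s * v x) ^+ 2).
(* Adding x Re m cancels the first-order term of atan (t / x) at infinity, so that the error is controlled by Im m. *)
Definition gtheta (x : R) : R := theta x + x * remp x.
(** The corresponding primitive of -Re m_N. As x decreases to 0 it tends to pi/2 times the average
    of the signs collected in [signN]. *)
Definition thetaN (x : R) : R := (\sum_(1 <= k < N.+1) atan ((ycen s lam k - E) / x)) / N%:R.
Definition signN : R := \sum_(1 <= k < N.+1) Num.sg (ycen s lam k - E).

Lemma rempE x : complex.Re (vm s E x) = remp x.
Proof.
rewrite /vm /mp_m cReM cRe_inv cIm_inv cReB cImB cRe1 cIm1 cReZ cImZ nrm_sqr cReB cImB cRe1 cIm1 cReZ cImZ /remp.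
move: (complex.Re (u x)) (complex.Im (u x)) => P V.
have e : (1 - s * P) ^+ 2 + (0 - s * V) ^+ 2 = (1 - s * P) ^+ 2 + (s * V) ^+ 2 by ring.
by rewrite e; ring.
Qed.

Lemma gtheta_drv_gen (x a b : R) : v x != 0 -> 1 - s * p x != 0 -> is_derive x 1 p a -> is_derive x 1 v b ->
  is_derive x 1 theta ((a * v x - p x * b) / v x ^+ 2 / (1 + (p x / v x) ^+ 2) - b / s
  + (s ^- 2 - 1) * ((s * b * (1 - s * p x) - s * v x * (0 - s * a)) / (1 - s * p x) ^+ 2 / (1 + (s * v x / (1 - s * p x)) ^+ 2))).
Proof.
move=> vn qn hp hv.
have hsv : is_derive x 1 (fun t => s * v t) (s * b).
  by apply: (drv_eq (drvM (drv_c s x) hv)); rewrite mulr0 addr0.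
have hsp : is_derive x 1 (fun t => 1 - s * p t) (0 - s * a).
  by apply: (drvB (drv_c 1 x)); apply: (drv_eq (drvM (drv_c s x) hp)); rewrite mulr0 addr0.
have h1 := drv_atan (drv_div vn hp hv).
have h2 : is_derive x 1 (fun t => v t / s) (b / s).
  by apply: (drv_eq (drvM hv (drv_c s^-1 x))); rewrite mulr0 add0r mulrC.
have h3 := drv_atan (@drv_div R (fun t => s * v t) (fun t => 1 - s * p t) x _ _ qn hsv hsp).
have h4 := drvM (drv_c (s ^- 2 - 1) x) h3.
by apply: (drv_eq (drvD (drvB h1 h2) h4)); rewrite mulr0 addr0.
Qed.

Lemma one_sub_sp x : 0 < x -> 0 < 1 - s * p x.
Proof.
move=> x0; have r1 := vu_lt1 E x0; have h := Re_le_nrm (u x).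
have [h0|h0] := leP (p x) 0.
  by rewrite subr_gt0 (le_lt_trans _ ltr01) // mulr_ge0_le0 // ltW.
rewrite subr_gt0; apply: (@le_lt_trans _ _ (p x)); first by rewrite ler_piMl // ltW.
exact: le_lt_trans h r1.
Qed.

Lemma du_ReIm x : 0 < x ->
  let a := 1 - p x ^+ 2 + v x ^+ 2 in let D1 := a ^+ 2 + (2 * p x * v x) ^+ 2 in
  D1 != 0 /\ complex.Re (du E x) = - (2 * p x * v x / D1) /\ complex.Im (du E x) = a / D1 - 1.
Proof.
move=> x0 a D1; have m2 := vu_sqr_neq E x0.
have eR : complex.Re (1 - u x ^+ 2) = a by rewrite cReB cRe1 expr2 cReM /a; ring.
have eI : complex.Im (1 - u x ^+ 2) = - (2 * p x * v x) by rewrite cImB cIm1 expr2 cImM; ring.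
have eD : nrm (1 - u x ^+ 2) ^+ 2 = D1 by rewrite nrm_sqr eR eI /D1 sqrrN.
have e : du E x = 'i * ((1 - u x ^+ 2)^-1 - 1) by rewrite /du; field.
split; first by rewrite -eD expf_neq0 // nrm_eq0.
rewrite e cReM cImM cReB cImB cRe1 cIm1 cRe_inv cIm_inv eD eR eI /=.
by split; rewrite ?opprK; ring.
Qed.

Lemma theta_drv (x : R) : 0 < x -> is_derive x 1 theta (- remp x).
Proof.
move=> x0; have hq := vu_qdiff E x0; have [d1 [eR eI]] := du_ReIm x0.
have v0 := vu_Im E x0; have qn := one_sub_sp x0.
have hp := qdiff_Re hq; have hv := qdiff_Im hq.
apply: (drv_eq (gtheta_drv_gen (lt0r_neq0 v0) (lt0r_neq0 qn) hp hv)).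
rewrite eR eI; apply: theta_identity => //; try exact: lt0r_neq0.
- by rewrite gt_eqF // ltr_wpDl ?sqr_ge0 // exprn_gt0.
- by rewrite gt_eqF // ltr_wpDr ?sqr_ge0 // exprn_gt0.
Qed.

Lemma remp_drv (x : R) : 0 < x -> is_derive x 1 remp (complex.Re (dm s E x)).
Proof.
move=> x0; have h := qdiff_Re (vm_qdiff tt0 tt1 s0 s1 dom x0).
by rewrite (_ : remp = (fun t => complex.Re (vm s E t))) //; apply/funext => t; rewrite rempE.
Qed.

Lemma gtheta_drv (x : R) : 0 < x -> is_derive x 1 gtheta (x * complex.Re (dm s E x)).
Proof.
move=> x0; apply: (drv_eq (drvD (theta_drv x0) (drvM (drv_id x) (remp_drv x0)))).
by rewrite mulr1 addrC addrK.
Qed.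

Lemma vu0 : p 0 = - E / 2 /\ v 0 = Num.sqrt (4 - E ^+ 2) / 2.
Proof.
have h : 0 <= 4 - E ^+ 2 by move: E2; rewrite ltr_norml => /andP[]; nra.
rewrite /vu /sc_u /= !mulr0 mul0r expr0n /= addr0 !subr0 sqrtr_sqr.
rewrite ler0_norm; last by lra.
split; first by rewrite sub0r.
by congr (Num.sqrt _ / 2); lra.
Qed.

(** For |E| < 2 the radicands in [sc_u] are positive at height 0, so the explicit formulas are
    differentiable there as well. *)
Lemma gtheta_cont0 : {for 0, continuous gtheta}.
Proof.
have h0 : 0 < 4 - E ^+ 2 by move: E2; rewrite ltr_norml => /andP[]; nra.
pose P (t : R) := E ^+ 2 - t ^+ 2 - 4.
have [dP hP] : exists d, is_derive (0 : R) 1 P d.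
  by eexists; exact: (drvB (drvB (drv_c (E ^+ 2) 0) (drvM (drv_id 0) (drv_id 0))) (drv_c 4 0)).
have [dT hT] : exists d, is_derive (0 : R) 1 (fun t => P t ^+ 2 + (2 * E * t) ^+ 2) d.
  have h2 := drvM (drv_c (2 * E) 0) (drv_id 0).
  by eexists; exact: (drvD (drvM hP hP) (drvM h2 h2)).
have T0 : 0 < P 0 ^+ 2 + (2 * E * 0) ^+ 2.
  by rewrite /P mulr0 expr0n /= addr0 subr0 exprn_even_gt0 //= lt_eqF //; lra.
have hS := @drv_comp R Num.sqrt (fun t => P t ^+ 2 + (2 * E * t) ^+ 2) 0 _ _ (is_derive1_sqrt T0) hT.
have [dQ hQ] : exists d, is_derive (0 : R) 1 (fun t => (Num.sqrt (P t ^+ 2 + (2 * E * t) ^+ 2) - P t) / 2) d.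
  by eexists; exact: (drvM (drvB hS hP) (drv_c 2^-1 0)).
have eQ : (Num.sqrt (P 0 ^+ 2 + (2 * E * 0) ^+ 2) - P 0) / 2 = 4 - E ^+ 2.
  rewrite /P mulr0 expr0n /= addr0 subr0 sqrtr_sqr ler0_norm; last by lra.
  by lra.
have Q0 : 0 < (Num.sqrt (P 0 ^+ 2 + (2 * E * 0) ^+ 2) - P 0) / 2 by rewrite eQ.
have hV := @drv_comp R Num.sqrt (fun t => (Num.sqrt (P t ^+ 2 + (2 * E * t) ^+ 2) - P t) / 2) 0 _ _ (is_derive1_sqrt Q0) hQ.
have V0 : Num.sqrt ((Num.sqrt (P 0 ^+ 2 + (2 * E * 0) ^+ 2) - P 0) / 2) != 0 by rewrite gt_eqF // sqrtr_gt0.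
have [a hp] : exists a, is_derive (0 : R) 1 p a.
  by eexists; exact: (drvM (drvB (@drv_div R (fun t => E * t) (fun t => Num.sqrt ((Num.sqrt (P t ^+ 2 + (2 * E * t) ^+ 2) - P t) / 2)) 0 _ _ V0 (drvM (drv_c E 0) (drv_id 0)) hV) (drv_c E 0)) (drv_c 2^-1 0)).
have [b hv] : exists b, is_derive (0 : R) 1 v b.
  by eexists; exact: (drvM (drvB hV (drv_id 0)) (drv_c 2^-1 0)).
have [p0 v0] := vu0.
have vp : 0 < v 0 by rewrite v0 divr_gt0 // sqrtr_gt0.
have qp : 0 < 1 - s * p 0.
  rewrite p0 subr_gt0; move: E2; rewrite ltr_norml => /andP[l1 l2].
  have [h|h] := leP (- E / 2) 0; first by rewrite (le_lt_trans _ ltr01) // mulr_ge0_le0 // ltW.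
  apply: (@le_lt_trans _ _ (- E / 2)); last by lra.
  by rewrite ler_piMl // ltW.
have hth := gtheta_drv_gen (lt0r_neq0 vp) (lt0r_neq0 qp) hp hv.
have hsp : is_derive (0 : R) 1 (fun t => 1 - s * p t) _ := drvB (drv_c 1 0) (drvM (drv_c s 0) hp).
have hsv := drvM (drv_c s 0) hv.
have hnum := drvB (drvM hp hsp) (drvM (drv_c s 0) (drvM hv hv)).
have hden := drvD (drvM hsp hsp) (drvM hsv hsv).
have dn : (1 - s * p 0) * (1 - s * p 0) + s * v 0 * (s * v 0) != 0.
  by rewrite gt_eqF // ltr_wpDr ?mulr_gt0 // mulr_ge0 // mulr_ge0 // ltW.
exact: (drv_cont (drvD hth (drvM (drv_id 0) (@drv_div R (fun t => p t * (1 - s * p t) - s * (v t * v t)) (fun t => (1 - s * p t) * (1 - s * p t) + s * v t * (s * v t)) 0 _ _ dn hnum hden)))).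
Qed.

(** The derivative x Re m' carries a factor x, and |m'| is at most a constant over |rho|; hence a
    bound quadratic in e0. *)
Lemma gtheta_lip e0 rm : 0 < e0 -> 0 < rm -> (forall x, 0 < x -> rm <= nrm (sc_rho (vw E x) (u x))) ->
  `|gtheta e0 - gtheta 0| <= 4 / tt ^+ 2 / rm * e0 ^+ 2.
Proof.
move=> e00 rm0 hr.
have t4 : 0 <= 4 / tt ^+ 2 by rewrite divr_ge0 // sqr_ge0.
have := @drv_lip R gtheta (fun x => x * complex.Re (dm s E x)) 0 e0 (4 / tt ^+ 2 / rm * e0) (ltW e00).
rewrite subr0 -[_ * e0 * e0]mulrA -expr2; apply.
- by move=> x /andP[x0 _]; exact: gtheta_drv.
- move=> x /andP[]; rewrite le_eqVlt => /orP[/eqP <- _|x0 _]; first exact: gtheta_cont0.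
  exact: drv_cont (gtheta_drv x0).
- move=> x /andP[x0 xe]; rewrite normrM (ger0_norm (ltW x0)) mulrC.
  apply: ler_pM => //; rewrite ?(ltW x0) ?(ltW xe) //.
  apply: (le_trans (le_Re_nrm _)); rewrite ler_pdivlMr //.
  apply: le_trans (dm_le tt0 tt1 s0 s1 dom x0); rewrite ler_wpM2l ?nrm_ge0 ?hr //.
- by rewrite mulr_ge0 ?(ltW e00) // divr_ge0 // ltW.
Qed.

Lemma thetaN_drv (x : R) : 0 < x -> is_derive x 1 thetaN (- complex.Re (stj N s lam (vw E x))).
Proof.
move=> x0.
have h k : is_derive x 1 (fun t => atan ((ycen s lam k - E) / t)) (- ((ycen s lam k - E) / ((ycen s lam k - E) ^+ 2 + x ^+ 2))).
  have xn := lt0r_neq0 x0.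
  apply: (drv_eq (drv_atan (drv_div xn (drv_c (ycen s lam k - E) x) (drv_id x)))).
  set y := _ - E; have d0 : y ^+ 2 + x ^+ 2 != 0 by rewrite gt_eqF // ltr_wpDl ?sqr_ge0 // exprn_gt0.
  have -> : 1 + (y / x) ^+ 2 = (y ^+ 2 + x ^+ 2) / x ^+ 2 by field.
  by field; rewrite xn d0.
apply: (drv_eq (drvM (drv_sum (index_iota 1 N.+1) h) (drv_c N%:R^-1 x))).
by rewrite mulr0 add0r stj_Re sumrN mulrN mulrC.
Qed.

Lemma thetaN_sign e0 : 0 < e0 ->
  `|pi / 2 * (signN / N%:R) - (thetaN e0 + e0 * complex.Re (stj N s lam (vw E e0)))| <=
  4 * e0 * complex.Im (stj N s lam (vw E e0)).
Proof.
move=> e00; have Nr : 0 < N%:R :> R by rewrite ltr0n.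
rewrite stj_Re stj_Im /thetaN /signN !mulrA -mulrDl -mulrBl normrM [`|N%:R^-1|]ger0_norm ?invr_ge0 ?(ltW Nr) //.
rewrite ler_wpM2r ?invr_ge0 ?(ltW Nr) // !mulr_sumr -big_split /= -sumrB.
apply: (le_trans (ler_norm_sum _ _ _)); apply: ler_sum => k _.
set y := ycen s lam k - E; have d0 : 0 < y ^+ 2 + e0 ^+ 2 by rewrite ltr_wpDl ?sqr_ge0 // exprn_gt0.
have en := lt0r_neq0 e00.
have e1 : 1 + (y / e0) ^+ 2 = (y ^+ 2 + e0 ^+ 2) / e0 ^+ 2 by field.
have e2 : e0 * (y / (y ^+ 2 + e0 ^+ 2)) = y / e0 / (1 + (y / e0) ^+ 2).
  by rewrite e1; field; rewrite en gt_eqF.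
have e3 : 4 * e0 * (e0 / (y ^+ 2 + e0 ^+ 2)) = 4 / (1 + (y / e0) ^+ 2).
  by rewrite e1; field; rewrite en gt_eqF.
rewrite e2 e3.
have [yn|yp|->] := ltrgtP y 0; last first.
- by rewrite sgr0 !mul0r atan0 mulr0 !add0r oppr0 normr0 expr0n /= addr0 divr1.
- by rewrite gtr0_sg // mulr1 opprD addrA; apply: atan_tail; rewrite divr_gt0.
rewrite ltr0_sg // mulrN1 -normrN opprD !opprK.
have := @atan_tail R (- y / e0); rewrite mulNr atanN sqrrN mulNr !opprK addrA; apply.
by rewrite oppr_gt0 pmulr_llt0 ?invr_gt0.
Qed.

(** Explicit in s, which may be as small as a negative power of N; the height of the ray outgrows 1
    / s. *)
Lemma theta_top H : 6 <= H -> `|theta H| <= (2 + 9 / s) / H.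
Proof.
move=> H6; have H0 : 0 < H by lra.
have v0 := vu_Im E H0; have qp := one_sub_sp H0; have Hu := vu_eq E H0.
have r1 := vu_lt1 E H0; have r0 : 0 < nrm (u H) := r_gt0 v0.
have eu : H * nrm (u H) ^+ 2 = v H * (1 - nrm (u H) ^+ 2) := eta_u (w := vw E H) v0 Hu.
have Eu : E * nrm (u H) ^+ 2 = - p H * (1 + nrm (u H) ^+ 2) := E_u (w := vw E H) v0 Hu.
have r3 : nrm (u H) <= 3 / H.
  apply: (le_trans (r_le3L (w := vw E H) H0 v0 Hu)); rewrite ler_pM2l // lef_pV2 ?posrE //.
    by have := Im_le_nrm (vw E H); rewrite /=; lra.
  by have := nrm_ge0 (vw E H); lra.
have rh : nrm (u H) <= 1 / 2.
  by apply: (le_trans r3); rewrite ler_pdivrMr //; lra.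
have vr := Im_le_nrm (u H); have pr := Re_le_nrm (u H).
have vH : v H <= 3 / H := le_trans vr r3.
have q2 : 1 / 2 <= 1 - s * p H.
  have [h|h] := leP (p H) 0; first by have := mulr_ge0_le0 (ltW s0) h; lra.
  have : s * p H <= p H by rewrite ler_piMl // ltW.
  by lra.
have a1 : `|atan (p H / v H)| <= 2 / H.
  apply: (le_trans (atan_le_norm _)).
  have -> : p H / v H = - (E / H) * ((1 - nrm (u H) ^+ 2) / (1 + nrm (u H) ^+ 2)).
    have d : 1 + nrm (u H) ^+ 2 != 0 by rewrite gt_eqF // ltr_wpDr ?sqr_ge0.
    have r2 : nrm (u H) ^+ 2 != 0 by rewrite expf_neq0 // gt_eqF.
    have e1 : p H = - (E * nrm (u H) ^+ 2 / (1 + nrm (u H) ^+ 2)).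
      by rewrite Eu; field.
    have k : 1 - nrm (u H) ^+ 2 != 0 by rewrite gt_eqF //; nra.
    have e2 : v H = H * nrm (u H) ^+ 2 / (1 - nrm (u H) ^+ 2) by rewrite eu; field.
    rewrite e1 e2; move: (nrm (u H) ^+ 2) d r2 k => z d r2 k; field.
    by rewrite d r2 k gt_eqF.
  rewrite normrM normrN normrM normfV (gtr0_norm H0).
  have f1 : `|(1 - nrm (u H) ^+ 2) / (1 + nrm (u H) ^+ 2)| <= 1.
    have z0 := sqr_ge0 (nrm (u H)); have z1 : nrm (u H) ^+ 2 <= 1 by rewrite expr_le1 // ltW.
    rewrite ger0_norm; last by rewrite divr_ge0; lra.
    by rewrite ler_pdivrMr; lra.
  apply: (@le_trans _ _ (`|E| / H * 1)); first by rewrite ler_wpM2l // divr_ge0 // ltW.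
  by rewrite mulr1 ler_wpM2r ?invr_ge0 ?(ltW H0) // ltW.
have a2 : `|v H / s| <= 3 / s / H.
  have -> : `|v H / s| = v H / s by apply: ger0_norm; apply: divr_ge0; exact: ltW.
  by rewrite [leRHS]mulrAC; apply: ler_wpM2r => //; rewrite invr_ge0 ltW.
have s2 : 0 <= s ^- 2 - 1 by rewrite subr_ge0 invf_ge1 ?exprn_gt0 // expr_le1 // ltW.
have a3 : `|(s ^- 2 - 1) * atan (s * v H / (1 - s * p H))| <= 6 / s / H.
  rewrite normrM (ger0_norm s2); apply: (@le_trans _ _ (s ^- 2 * (s * v H / (1 / 2)))).
    apply: ler_pM => //; first by lra.
    apply: (le_trans (atan_le_norm _)); rewrite ger0_norm; last by apply: divr_ge0; [rewrite mulr_ge0 // ltW | exact: ltW].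
    by apply: ler_wpM2l; [rewrite mulr_ge0 // ltW | rewrite lef_pV2 ?posrE].
  rewrite (_ : s ^- 2 * _ = 2 / s * v H); last by field; rewrite gt_eqF.
  rewrite (_ : 6 / s / H = 2 / s * (3 / H)); last by field; rewrite !gt_eqF.
  by rewrite ler_wpM2l // divr_ge0 // ltW.
rewrite /theta; apply: (le_trans (ler_normD _ _)); apply: (@le_trans _ _ ((2 / H + 3 / s / H) + 6 / s / H)).
  by apply: lerD => //; apply: (le_trans (ler_normB _ _)); exact: lerD.
by rewrite le_eqVlt; apply/orP; left; apply/eqP; field; rewrite !gt_eqF.
Qed.

Lemma thetaN_top H Y : 0 < H -> (forall k, (1 <= k <= N)%N -> `|ycen s lam k| <= Y) ->
  `|thetaN H| <= (Y + 2) / H.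
Proof.
move=> H0 hY; have Nr : 0 < N%:R :> R by rewrite ltr0n.
rewrite /thetaN normrM [`|N%:R^-1|]ger0_norm ?invr_ge0 ?(ltW Nr) // ler_pdivrMr //.
apply: (le_trans (ler_norm_sum _ _ _)).
apply: (@le_trans _ _ (\sum_(1 <= k < N.+1) ((Y + 2) / H))); last first.
  by rewrite sumr_const_nat subSS subn0 mulr_natr.
rewrite big_nat_cond [leRHS]big_nat_cond; apply: ler_sum => k /andP[/andP[k1 k2] _].
have hk := hY k; rewrite k1 -ltnS k2 in hk; have {}hk := hk isT.
apply: (le_trans (atan_le_norm _)); rewrite normrM normfV (gtr0_norm H0) ler_wpM2r ?invr_ge0 ?(ltW H0) //.
by apply: (le_trans (ler_normB _ _)); apply: lerD => //; exact: ltW.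
Qed.

(** The derivatives differ by at most Kk / x, whose integral costs only a logarithm. *)
Lemma thetaN_theta e0 H Kk : 0 < e0 -> e0 <= H ->
  (forall x, e0 <= x -> x <= H -> nrm (stj N s lam (vw E x) - vm s E x) <= Kk / x) ->
  `|thetaN e0 - theta e0| <= `|thetaN H - theta H| + Kk * (ln H - ln e0).
Proof.
move=> e00 eH hL.
pose D x := - complex.Re (stj N s lam (vw E x)) - - remp x.
have hd (x : R) : 0 < x -> is_derive x 1 (fun t => thetaN t - theta t) (D x).
  by move=> x0; exact: drvB (thetaN_drv x0) (theta_drv x0).
have hln (x : R) : 0 < x -> is_derive x 1 (fun t => Kk * ln t) (Kk * x^-1).
  by move=> x0; apply: (drv_eq (drvM (drv_c Kk x) (is_derive1_ln x0))); rewrite mulr0 addr0.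
have DL x : e0 <= x -> x <= H -> `|D x| <= Kk / x.
  move=> h1 h2; apply: le_trans (hL _ h1 h2); rewrite /D -rempE opprK addrC -normrN opprB -cReB.
  exact: le_Re_nrm.
have up := @drv_decr R (fun t => (thetaN t - theta t) - Kk * ln t) (fun x => D x - Kk * x^-1) e0 H eH.
have dn := @drv_decr R (fun t => - (thetaN t - theta t) - Kk * ln t) (fun x => - D x - Kk * x^-1) e0 H eH.
have {}up := up _ _; have {}dn := dn _ _.
have {up}up : (thetaN H - theta H) - Kk * ln H <= (thetaN e0 - theta e0) - Kk * ln e0.
  apply: up => x /andP[h1 h2]; have x0 := lt_le_trans e00 h1.
    exact: drvB (hd x x0) (hln x x0).
  by have := DL x h1 h2; rewrite ler_norml subr_le0 => /andP[].
have {dn}dn : - (thetaN H - theta H) - Kk * ln H <= - (thetaN e0 - theta e0) - Kk * ln e0.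
  apply: dn => x /andP[h1 h2]; have x0 := lt_le_trans e00 h1.
    exact: drvB (drvN (hd x x0)) (hln x x0).
  by have := DL x h1 h2; rewrite ler_norml subr_le0 => /andP[]; lra.
have a1 := ler_norm (thetaN H - theta H); have a2 := ler_norm (- (thetaN H - theta H)).
rewrite normrN in a2; rewrite ler_norml; lra.
Qed.

(** Four comparisons: the signs with the arctangents at height e0, the empirical with the limiting
    phase there, the two corrections x Re m, and height e0 with height 0. *)
Lemma signN_theta e0 H rm Y G : 1 <= G -> 0 < e0 -> e0 <= H -> 6 <= H -> 0 < rm ->
  (forall x, 0 < x -> rm <= nrm (sc_rho (vw E x) (u x))) ->
  (forall k, (1 <= k <= N)%N -> `|ycen s lam k| <= Y) ->
  (forall x, e0 <= x -> x <= H -> nrm (stj N s lam (vw E x) - vm s E x) <= vl N G x) ->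
  `|pi / 2 * (signN / N%:R) - theta 0| <=
    4 * e0 * complex.Im (vm s E e0) + 2 * G ^+ 5 / N%:R * (5 + (ln H - ln e0))
    + (Y + 4 + 9 / s) / H + 4 / tt ^+ 2 / rm * e0 ^+ 2.
Proof.
move=> G1 e00 eH H6 rm0 hr hY hL; have Nr : 0 < N%:R :> R by rewrite ltr0n.
have Hp : 0 < H by lra.
have vlE x : 0 < x -> vl N G x = 2 * G ^+ 5 / N%:R / x.
  by move=> x0; rewrite /vl /vq; field; rewrite !gt_eqF.
have h1 := thetaN_sign e00.
have h2 := thetaN_theta e00 eH (Kk := 2 * G ^+ 5 / N%:R).
have h3 := gtheta_lip e00 rm0 hr; rewrite /gtheta mul0r addr0 in h3.
have h4 := theta_top H6; have h5 := thetaN_top Hp hY.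
have hL0 := hL e0 (lexx _) eH.
have l1 := le_trans (le_Re_nrm _) hL0; have l2 := le_trans (le_Im_nrm _) hL0.
rewrite cReB rempE in l1; rewrite cImB in l2; rewrite vlE // in l1 l2.
set Kk := 2 * G ^+ 5 / N%:R in h2 l1 l2 *.
have {h2}h2 : `|thetaN e0 - theta e0| <= `|thetaN H - theta H| + Kk * (ln H - ln e0).
  by apply: h2 => x a b; rewrite -vlE ?hL // (lt_le_trans e00).
have h6 : `|thetaN H - theta H| <= (Y + 4 + 9 / s) / H.
  apply: (le_trans (ler_normB _ _)); rewrite (_ : (Y + 4 + 9 / s) / H = (Y + 2) / H + (2 + 9 / s) / H).
    exact: lerD.
  by rewrite -mulrDl; congr (_ / _); ring.
set m := complex.Re (stj _ _ _ _) in h1 l1; set im := complex.Im (stj _ _ _ _) in h1 l2.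
have i2 : im <= complex.Im (vm s E e0) + Kk / e0 by move: l2; rewrite ler_norml => /andP[]; lra.
have i3 : 4 * e0 * im <= 4 * e0 * complex.Im (vm s E e0) + 4 * Kk.
  apply: (@le_trans _ _ (4 * e0 * (complex.Im (vm s E e0) + Kk / e0))).
    by rewrite ler_wpM2l // mulr_ge0 // ltW.
  by rewrite le_eqVlt; apply/orP; left; apply/eqP; field; rewrite gt_eqF.
have i1 : `|e0 * m - e0 * remp e0| <= Kk.
  rewrite -mulrBr normrM (gtr0_norm e00); apply: (@le_trans _ _ (e0 * (Kk / e0))).
    by rewrite ler_wpM2l // ltW.
  by rewrite mulrC divfK // gt_eqF.
have -> : pi / 2 * (signN / N%:R) - theta 0 =
  (pi / 2 * (signN / N%:R) - (thetaN e0 + e0 * m)) + (thetaN e0 - theta e0) + (e0 * m - e0 * remp e0)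
  + (theta e0 + e0 * remp e0 - theta 0) by ring.
apply: (le_trans (ler_normD _ _)); apply: (le_trans (lerD (le_trans (ler_normD _ _) (lerD (ler_normD _ _) (lexx _))) (lexx _))).
set Z1 := `|_ - _| in h1 *; lra.
Qed.

End Counting.

(** * The limiting density and distribution function near the edges *)

Section SpectralEdge.
Variable R : realType.
Local Notation C := R[i].
Local Open Scope complex_scope.

Definition rr (E : R) : R := Num.sqrt (4 - E ^+ 2).
Definition mpden (s E : R) : R := 1 + s * E + s ^+ 2.
Definition dens (s E : R) : R := rr E / (2 * pi * mpden s E).
Definition nE (s E : R) : R :=
  1 / 2 + (atan (- E / rr E) - rr E / (2 * s) + (s ^- 2 - 1) * atan (s * rr E / (2 + s * E))) / pi.

Lemma rr_gt0 E : `|E| < 2 -> 0 < rr E.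
Proof. by rewrite ltr_norml sqrtr_gt0 => /andP[h1 h2]; nra. Qed.
Lemma rr_sqr E : `|E| <= 2 -> rr E ^+ 2 = 4 - E ^+ 2.
Proof. by rewrite ler_norml => /andP[h1 h2]; rewrite sqr_sqrtr //; nra. Qed.

Lemma nE_theta s E : 0 < s -> `|E| < 2 -> nE s E = 1 / 2 + theta s E 0 / pi.
Proof.
move=> s0 h; have [ep ev] := vu0 h; rewrite /theta ep ev -/(rr E) /nE; congr (_ + _ / _).
have r0 := rr_gt0 h; have rn := lt0r_neq0 r0; have sn := lt0r_neq0 s0.
congr (_ - _ + _ * atan _).
- by congr atan; field.
- by field.
- rewrite (_ : 1 - s * (- E / 2) = (2 + s * E) / 2); last by field.
  by rewrite invf_div mulrA; congr (_ / _); field.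
Qed.

Lemma mpden_gt0 s E : 0 < s -> s <= 1 -> `|E| < 2 -> 0 < mpden s E.
Proof.
move=> s0 s1; rewrite ltr_norml /mpden => /andP[h1 h2].
have : 0 < s * (E + 2) by rewrite mulr_gt0 //; lra.
have := sqr_ge0 (1 - s); nra.
Qed.

Lemma nE_drv (s E : R) : 0 < s -> s <= 1 -> `|E| < 2 -> is_derive E 1 (nE s) (- dens s E).
Proof.
move=> s0 s1 h; have r0 := rr_gt0 h; have dn0 := mpden_gt0 s0 s1 h.
have q0 : 0 < 2 + s * E.
  move: h; rewrite ltr_norml => /andP[h1 h2]; have [hE|hE] := leP 0 E.
    by rewrite ltr_wpDr // mulr_ge0 // ltW.
  have : 0 <= (1 - s) * (- E) by rewrite mulr_ge0; lra.
  lra.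
have hi := drv_id E.
have hE2 : is_derive E 1 (fun t : R => 4 - t ^+ 2) (- (2 * E)).
  by apply: (drv_eq (drvB (drv_c 4 E) (drvM hi hi))); ring.
have r2 : rr E ^+ 2 = 4 - E ^+ 2 by apply: rr_sqr; exact: ltW.
have p4 : 0 < 4 - E ^+ 2 by rewrite -r2 exprn_gt0.
have hr : is_derive E 1 rr (- E / rr E).
  apply: (drv_eq (@drv_comp R Num.sqrt (fun t => 4 - t ^+ 2) E _ _ (is_derive1_sqrt p4) hE2)).
  by rewrite -/(rr E); field; rewrite gt_eqF.
have rn := lt0r_neq0 r0; have qn := lt0r_neq0 q0; have sn := lt0r_neq0 s0; have dn := lt0r_neq0 dn0.
have h1 := drv_atan (@drv_div R (fun t => - t) rr E _ _ rn (drvN hi) hr).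
have h2 := drvM hr (drv_c (2 * s)^-1 E).
have hsr := drvM (drv_c s E) hr.
have hsE := drvD (drv_c 2 E) (drvM (drv_c s E) hi).
have h3 := drvM (drv_c (s ^- 2 - 1) E) (drv_atan (@drv_div R (fun t => s * rr t) (fun t => 2 + s * t) E _ _ qn hsr hsE)).
have h4 := drvD (drv_c (1 / 2) E) (drvM (drvD (drvB h1 h2) h3) (drv_c pi^-1 E)).
apply: (drv_eq h4); rewrite /dens.
have pn : pi != 0 :> R by rewrite gt_eqF // pi_gt0.
have e1 : 1 + (- E / rr E) ^+ 2 = 4 / rr E ^+ 2 by rewrite expr_div_n sqrrN r2; field; rewrite gt_eqF.
have e2 : 1 + (s * rr E / (2 + s * E)) ^+ 2 = 4 * mpden s E / (2 + s * E) ^+ 2.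
  by rewrite expr_div_n exprMn r2 /mpden; field.
rewrite e1 e2.
have e3 : s * (- E / rr E) + rr E * 0 = s * - E / rr E by ring.
rewrite !mulr0 !addr0 ?add0r.
(* All denominators are cleared at once; what remains is polynomial after replacing the square of
   [rr E] by 4 - E^2. *)
apply: (@mulIf _ (2 * pi * s * rr E * mpden s E)); first by rewrite !mulf_neq0 // gt_eqF // ltr0n.
have k : 1 * mpden s E = 1 + s * E + s ^+ 2 by rewrite mul1r.
transitivity ((- 2 * s + E) * mpden s E - (1 - s ^+ 2) * (E + 2 * s)).
  transitivity (- (2 * s * mpden s E * ((4 - E ^+ 2) + E ^+ 2) / 4) + E * mpden s E
     + (1 - s ^+ 2) / 2 * (- (E * (2 + s * E)) - (4 - E ^+ 2) * s)); last first.
    by field.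
  by rewrite -r2; move: (@pi R) pn => pp pn; field; rewrite ?rn ?qn ?sn ?dn ?pn.
transitivity (- (s * rr E ^+ 2)); last by move: (@pi R) pn => pp pn; field; rewrite ?dn ?pn.
by rewrite r2 /mpden; ring.
Qed.

Variables (tt s sg : R).
Hypotheses (tt0 : 0 < tt) (tt1 : tt <= 1) (s0 : 0 < s) (s1 : s <= 1).
Hypothesis sgP : sg = 1 \/ sg = -1.

(** The mass within distance x of the edge 2 if sg = 1, of the edge -2 if sg = -1, so that one
    argument serves both edges. *)
Definition nu (x : R) : R := 1 / 2 + sg * (nE s (sg * (2 - x)) - 1 / 2).

Lemma sg_norm x : `|sg * x| = `|x|.
Proof. by case: sgP => ->; rewrite ?mul1r // mulN1r normrN. Qed.
Lemma sg_sqr : sg * sg = 1.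
Proof. by case: sgP => ->; rewrite ?mul1r // mulN1r opprK. Qed.

Lemma edge_lt2 x : 0 < x -> x < 4 -> `|sg * (2 - x)| < 2.
Proof. by move=> x0 x4; rewrite sg_norm ltr_norml; lra. Qed.

Lemma rr_edge x : rr (sg * (2 - x)) = Num.sqrt (x * (4 - x)).
Proof. by rewrite /rr exprMn expr2 sg_sqr mul1r; congr Num.sqrt; ring. Qed.

Lemma nu_drv (x : R) : 0 < x -> x < 4 -> is_derive x 1 nu (dens s (sg * (2 - x))).
Proof.
move=> x0 x4; have h := nE_drv s0 s1 (edge_lt2 x0 x4).
have h1 : is_derive x 1 (fun t => sg * (2 - t)) (- sg).
  by apply: (drv_eq (drvM (drv_c sg x) (drvB (drv_c 2 x) (drv_id x)))); ring.
have h2 := @drv_comp R (nE s) (fun t => sg * (2 - t)) x _ _ h h1.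
apply: (drv_eq (drvD (drv_c (1 / 2) x) (drvM (drv_c sg x) (drvB h2 (drv_c (1 / 2) x))))).
rewrite mulr0 addr0 subr0 add0r mulrNN mulrCA sg_sqr mulr1 //.
Qed.

Lemma dens_ge0 x : 0 < x -> x < 4 -> 0 <= dens s (sg * (2 - x)).
Proof.
move=> x0 x4; rewrite divr_ge0 ?sqrtr_ge0 // mulr_ge0 ?(ltW (mpden_gt0 s0 s1 (edge_lt2 x0 x4))) //.
by rewrite mulr_ge0 // pi_ge0.
Qed.

Lemma nu_comp (f df : R -> R) (a b : R) : 0 < a -> a <= b -> b < 4 ->
  (forall x, a <= x <= b -> is_derive x 1 f (df x)) ->
  (forall x, a <= x <= b -> dens s (sg * (2 - x)) <= df x) -> nu b - nu a <= f b - f a.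
Proof.
move=> a0 ab b4 hf hd.
have := @drv_decr R (fun x => nu x - f x) (fun x => dens s (sg * (2 - x)) - df x) a b ab.
have h1 x : a <= x <= b -> is_derive x 1 (fun x => nu x - f x) (dens s (sg * (2 - x)) - df x).
  by move=> h; apply: drvB (hf x h); case/andP: h => h1 h2; apply: nu_drv; lra.
move=> /(_ h1) h2; suff : nu b - f b <= nu a - f a by lra.
by apply: h2 => x /hd; lra.
Qed.

Lemma nu_comp_ge (f df : R -> R) (a b : R) : 0 < a -> a <= b -> b < 4 ->
  (forall x, a <= x <= b -> is_derive x 1 f (df x)) ->
  (forall x, a <= x <= b -> df x <= dens s (sg * (2 - x))) -> f b - f a <= nu b - nu a.
Proof.
move=> a0 ab b4 hf hd.
have := @drv_decr R (fun x => f x - nu x) (fun x => df x - dens s (sg * (2 - x))) a b ab.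
have h1 x : a <= x <= b -> is_derive x 1 (fun x => f x - nu x) (df x - dens s (sg * (2 - x))).
  by move=> h; apply: (drvB (hf x h)); case/andP: h => h1 h2; apply: nu_drv; lra.
move=> /(_ h1) h2; suff : f b - nu b <= f a - nu a by lra.
by apply: h2 => x /hd; lra.
Qed.

Lemma nu_mono a b : 0 < a -> a <= b -> b < 4 -> nu a <= nu b.
Proof.
move=> a0 ab b4; have := @nu_comp_ge (fun=> 0) (fun=> 0) a b a0 ab b4 (fun x _ => drv_c 0 x).
rewrite subrr subr_ge0; apply=> x /andP[h1 h2]; apply: dens_ge0; lra.
Qed.

Lemma mpden_le x : 0 < x -> x < 4 -> mpden s (sg * (2 - x)) <= 4.
Proof.
move=> x0 x4; have := edge_lt2 x0 x4; rewrite ltr_norml /mpden => /andP[h1 h2].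
have : s * (sg * (2 - x)) <= 2.
  apply: (@le_trans _ _ (s * 2)); first by rewrite ler_pM2l // ltW.
  by rewrite ger_pMl.
have : s ^+ 2 <= 1 by rewrite expr_le1 // ltW.
lra.
Qed.

Lemma dens_lower x : 0 < x -> x <= 4 - tt -> Num.sqrt (tt * x) / 32 <= dens s (sg * (2 - x)).
Proof.
move=> x0 x4; have x4' : x < 4 by have := tt0; lra.
have d0 := mpden_gt0 s0 s1 (edge_lt2 x0 x4'); have d4 := mpden_le x0 x4'.
have pi0 : 0 < pi :> R := pi_gt0 R; have pi4 : pi <= 4 :> R by have := pihalf_lt2 R; lra.
rewrite /dens rr_edge; apply: ler_pM; rewrite ?sqrtr_ge0 ?invr_ge0 //.
  by rewrite ler_wsqrtr // mulrC ler_wpM2l ?(ltW x0) //; lra.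
rewrite lef_pV2 ?posrE ?mulr_gt0 //.
rewrite (_ : 32 = 2 * 4 * 4 :> R); last by ring.
by apply: ler_pM => //; rewrite ?mulr_ge0 ?(ltW pi0) ?(ltW d0) // ler_wpM2l.
Qed.

(** Only the half of the interval nearer to b is used: there x >= b / 2, so [dens_lower] gives a
    constant lower bound. *)
Lemma nu_lower a b : 0 < a -> a <= b -> b <= 4 - tt ->
  (b - a) / 2 * (Num.sqrt (tt * b / 2) / 32) <= nu b - nu a.
Proof.
move=> a0 ab b4; pose m := (a + b) / 2; have t0 := tt0.
have am : a <= m by rewrite /m; lra.
have mb : m <= b by rewrite /m; lra.
have m0 : 0 < m by lra.
have b4' : b < 4 by lra.
pose k := Num.sqrt (tt * b / 2) / 32.
have hf (x : R) : m <= x <= b -> is_derive x 1 (fun t => k * t) k.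
  by move=> _; apply: (drv_eq (drvM (drv_c k x) (drv_id x))); rewrite mulr1 mulr0 addr0.
have := nu_comp_ge m0 mb b4' hf _; rewrite -mulrBr => h.
have h1 := nu_mono a0 am (le_lt_trans mb b4').
apply: (@le_trans _ _ (nu b - nu m)); last by lra.
rewrite (_ : (b - a) / 2 * _ = k * (b - m)); last by rewrite /k /m; field.
apply: h => x /andP[mx xb]; have x0 : 0 < x by lra.
apply: le_trans (dens_lower x0 (le_trans xb b4)).
rewrite /k ler_wpM2r // ler_wsqrtr // -mulrA ler_wpM2l ?(ltW t0) //.
by move: mx; rewrite /m; lra.
Qed.

(* Away from the hard edge x = 4 of the upper regime, or if the aspect ratio stays away from one. *)
Definition soft (b : R) := (sg = 1 /\ b <= 4 - tt) \/ s <= 1 - tt / 2.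

Lemma soft_dom x b : x <= b -> soft b -> (- 2 + tt <= sg * (2 - x)) || (s <= 1 - tt / 2).
Proof.
move=> xb [[-> h]|->]; last by rewrite orbT.
by rewrite mul1r; apply/orP; left; lra.
Qed.

Lemma mpden_lower E : `|E| < 2 -> (- 2 + tt <= E) || (s <= 1 - tt / 2) -> tt ^+ 2 / 4 <= mpden s E.
Proof.
have [t0 t1 s00 s11] : [/\ 0 < tt, tt <= 1, 0 < s & s <= 1] by [].
rewrite ltr_norml /mpden => /andP[h1 h2] /orP[h|h].
  have [hs|hs] := leP (1 / 2) s.
    have : 0 <= (s - 1 / 2) * (E + 2) by rewrite mulr_ge0; lra.
    have := sqr_ge0 (1 - s); nra.
  have : 0 <= s * (E + 2) by rewrite mulr_ge0; lra.
  have : 0 <= (1 / 2 - s) * (3 / 2 - s) by rewrite mulr_ge0; lra.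
  nra.
have : 0 <= s * (E + 2) by rewrite mulr_ge0; lra.
have : 0 <= (1 - s - tt / 2) * (1 - s + tt / 2) by rewrite mulr_ge0; lra.
nra.
Qed.

Lemma dens_upper x b : 0 < x -> x <= b -> b < 4 -> soft b -> dens s (sg * (2 - x)) <= 2 / tt ^+ 2 * Num.sqrt b.
Proof.
move=> x0 xb b4 sb; have x4 : x < 4 by lra.
have d0 := mpden_lower (edge_lt2 x0 x4) (soft_dom xb sb).
have pi2 : 2 <= pi :> R := pi_ge2 R.
have t2 : 0 < tt ^+ 2 / 4 by rewrite divr_gt0 // exprn_gt0.
have -> : 2 / tt ^+ 2 * Num.sqrt b = 2 * Num.sqrt b / (2 * 2 * (tt ^+ 2 / 4)).
  by field; rewrite gt_eqF.
rewrite /dens rr_edge; apply: ler_pM; rewrite ?sqrtr_ge0 ?invr_ge0 ?mulr_ge0 ?pi_ge0 //.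
- by apply: le_trans d0; exact: ltW.
- rewrite -[X in X * Num.sqrt b]ger0_norm // -sqrtr_sqr -sqrtrM ?sqr_ge0 // ler_wsqrtr //.
  rewrite (_ : 2 ^+ 2 * b = b * 4); last by ring.
  by apply: ler_pM; lra.
rewrite lef_pV2 ?posrE ?mulr_gt0 ?pi_gt0 //; last by apply: lt_le_trans d0.
by apply: ler_pM => //; [exact: ltW | rewrite ler_wpM2l].
Qed.

Lemma nu_upper a b : 0 < a -> a <= b -> b < 4 -> soft b ->
  nu b - nu a <= 2 / tt ^+ 2 * Num.sqrt b * (b - a).
Proof.
move=> a0 ab b4 sb; set k := 2 / tt ^+ 2 * Num.sqrt b.
have hf (x : R) : a <= x <= b -> is_derive x 1 (fun t => k * t) k.
  by move=> _; apply: (drv_eq (drvM (drv_c k x) (drv_id x))); rewrite mulr1 mulr0 addr0.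
have := nu_comp a0 ab b4 hf _; rewrite -mulrBr; apply.
move=> x /andP[ax xb]; apply: dens_upper => //; lra.
Qed.

(** Qualitative, as the constant depends on s: it anchors nu at 0, so that bounds on increments
    become bounds on nu. At the hard edge with s = 1 the coefficient of the second arctangent
    vanishes, which replaces a lower bound on its denominator. *)
Lemma nu_zero : exists K, 0 <= K /\ forall x, 0 < x -> x <= 1 -> `|nu x| <= K * Num.sqrt x.
Proof.
have [d [d0 hd]] : exists d, 0 < d /\ (s = 1 /\ sg = -1 \/ forall x, 0 < x -> x <= 1 -> d <= 2 + s * (sg * (2 - x))).
  case: sgP => e; first (exists 2; split => //; right => x x0 x1).
    by rewrite e mul1r lerDl mulr_ge0 ?(ltW s0) //; lra.
  move: s1; rewrite le_eqVlt => /orP[/eqP h|h]; first by exists 1; split => //; left.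
  exists (2 - 2 * s); split; first by lra.
  right => x x0 x1; rewrite e mulN1r.
  by have := mulr_ge0 (ltW s0) (ltW x0); lra.
exists (2 * (1 + s^-1 + s^-1 / d)).
have si : 0 < s^-1 by rewrite invr_gt0.
split; first by rewrite mulr_ge0 // !addr_ge0 ?divr_ge0 ?(ltW si) ?(ltW d0).
move=> x x0 x1; have x4 : x < 4 by lra.
have h := edge_lt2 x0 x4; have r0 := rr_gt0 h.
set E := sg * (2 - x) in h r0 *; set r := rr E in r0 *.
have rx : r <= 2 * Num.sqrt x.
  rewrite /r /E rr_edge -[X in X * Num.sqrt x]ger0_norm // -sqrtr_sqr -sqrtrM ?sqr_ge0 // ler_wsqrtr //.
  by rewrite (_ : 2 ^+ 2 * x = x * 4); [rewrite ler_wpM2l ?(ltW x0) //; lra | ring].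
have pi2 : 2 <= pi :> R := pi_ge2 R.
have y0 : 0 < 2 - x by lra.
have A : `|pi / 2 + sg * atan (- E / r)| <= r.
  have -> : sg * atan (- E / r) = - atan ((2 - x) / r).
    rewrite /E; case: sgP => ->; rewrite ?mul1r ?mulN1r ?opprK ?mulNr ?atanN ?mulNr //.
  have := atan_inv (divr_gt0 y0 r0) => hi.
  have -> : pi / 2 - atan ((2 - x) / r) = atan ((2 - x) / r)^-1 by rewrite -hi; ring.
  apply: (le_trans (atan_le_norm _)); rewrite invf_div ger0_norm ?divr_ge0 ?(ltW r0) ?(ltW y0) //.
  by rewrite ler_pdivrMr // ler_peMr ?(ltW r0) //; lra.
have T : `|(s ^- 2 - 1) * atan (s * r / (2 + s * E))| <= s^-1 / d * r.
  case: hd => [[es _]|hd].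
    by rewrite es expr1n invr1 subrr mul0r normr0 !mulr_ge0 ?invr_ge0 ?(ltW r0) ?(ltW d0).
  have hq := hd x x0 x1; rewrite -/E in hq.
  have q0 : 0 < 2 + s * E by apply: lt_le_trans hq.
  have s2 : 1 <= s ^- 2 by rewrite invf_ge1 ?exprn_gt0 // expr_le1 // ltW.
  rewrite normrM ger0_norm ?subr_ge0 //.
  apply: (@le_trans _ _ (s ^- 2 * (s * r / d))).
    apply: ler_pM; rewrite ?subr_ge0 //; first by lra.
    apply: (le_trans (atan_le_norm _)); rewrite ger0_norm; last first.
      by apply: divr_ge0; [rewrite mulr_ge0 // ltW | exact: ltW].
    apply: ler_wpM2l; first by rewrite mulr_ge0 // ltW.
    by rewrite lef_pV2 ?posrE.
  by rewrite le_eqVlt; apply/orP; left; apply/eqP; field; rewrite !gt_eqF.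
have B : `|r / (2 * s)| <= s^-1 * r.
  rewrite ger0_norm; last by apply: divr_ge0; [exact: ltW | rewrite mulr_ge0 // ltW].
  rewrite mulrC ler_wpM2r ?(ltW r0) // lef_pV2 ?posrE ?mulr_gt0 //; have := s0; lra.
have -> : nu x = ((pi / 2 + sg * atan (- E / r)) - sg * (r / (2 * s)) + sg * ((s ^- 2 - 1) * atan (s * r / (2 + s * E)))) / pi.
  have pn : (@pi R) != 0 by rewrite gt_eqF ?pi_gt0.
  have sn := lt0r_neq0 s0; rewrite /nu /nE -/E -/r; move: (@pi R) pn => pp pn; field.
  by rewrite ?pn ?sn.
rewrite normrM [`|pi^-1|]ger0_norm ?invr_ge0 ?pi_ge0 // ler_pdivrMr ?pi_gt0 //.
apply: (@le_trans _ _ (r + s^-1 * r + s^-1 / d * r)).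
  apply: (le_trans (ler_normD _ _)); apply: lerD; last by rewrite sg_norm.
  by apply: (le_trans (ler_normB _ _)); apply: lerD => //; rewrite sg_norm.
have K0 : 0 <= 1 + s^-1 + s^-1 / d by rewrite !addr_ge0 ?divr_ge0 ?(ltW si) ?(ltW d0).
apply: (@le_trans _ _ ((1 + s^-1 + s^-1 / d) * (2 * Num.sqrt x))).
  by rewrite (_ : r + _ + _ = (1 + s^-1 + s^-1 / d) * r); [rewrite ler_wpM2l | ring].
rewrite mulrA [X in X * Num.sqrt x]mulrC ler_peMr ?mulr_ge0 ?sqrtr_ge0 //; lra.
Qed.

Lemma nu_small e : 0 < e -> exists2 a0, 0 < a0 & forall a, 0 < a -> a <= a0 -> `|nu a| <= e.
Proof.
move=> e0; have [K [K0 h]] := nu_zero.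
have K1 : 0 < K + 1 by lra.
exists (Num.min 1 ((e / (K + 1)) ^+ 2)); first by rewrite lt_min ltr01 exprn_gt0 // divr_gt0.
move=> a a0; rewrite le_min => /andP[a1 a2]; apply: (le_trans (h a a0 a1)).
apply: (@le_trans _ _ ((K + 1) * (e / (K + 1)))); last by rewrite mulrC divfK // gt_eqF.
apply: ler_pM; rewrite ?sqrtr_ge0 //; first by lra.
rewrite -[leRHS]ger0_norm; last by rewrite divr_ge0 // ltW.
by rewrite -sqrtr_sqr ler_wsqrtr.
Qed.

Lemma nu_ge b : 0 < b -> b <= 4 - tt -> b / 2 * (Num.sqrt (tt * b / 2) / 32) <= nu b.
Proof.
move=> b0 b4; rewrite leNgt; apply/negP => hlt; have t0 := tt0.
set k := Num.sqrt (tt * b / 2) / 32 in hlt.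
have k0 : 0 <= k by rewrite divr_ge0 // sqrtr_ge0.
have e0 : 0 < (b / 2 * k - nu b) / 2 by lra.
have [a0 a00 ha] := nu_small e0.
pose a := Num.min (Num.min a0 b) ((b / 2 * k - nu b) / (k + 1)).
have a_gt0 : 0 < a by rewrite !lt_min a00 b0 divr_gt0 //; lra.
have [aa0 ab ak] : [/\ a <= a0, a <= b & a <= (b / 2 * k - nu b) / (k + 1)].
  by rewrite /a !ge_min !lexx ?orbT.
have h1 := nu_lower a_gt0 ab b4; rewrite -/k in h1.
have h2 := ha a a_gt0 aa0; rewrite ler_norml in h2; case/andP: h2 => h2 _.
rewrite ler_pdivlMr in ak; last by lra.
have : 0 <= a by exact: ltW.
nra.
Qed.

Lemma nu_le b : 0 < b -> b < 4 -> soft b -> nu b <= 2 / tt ^+ 2 * Num.sqrt b * b.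
Proof.
move=> b0 b4 sb; rewrite leNgt; apply/negP => hlt.
set k := 2 / tt ^+ 2 * Num.sqrt b in hlt.
have k0 : 0 <= k by rewrite mulr_ge0 ?sqrtr_ge0 // divr_ge0 // sqr_ge0.
have e0 : 0 < (nu b - k * b) / 2 by lra.
have [a0 a00 ha] := nu_small e0.
pose a := Num.min a0 b.
have a_gt0 : 0 < a by rewrite lt_min a00 b0.
have [aa0 ab] : a <= a0 /\ a <= b by rewrite /a !ge_min !lexx ?orbT.
have h1 := nu_upper a_gt0 ab b4 sb; rewrite -/k in h1.
have h2 := ha a a_gt0 aa0; rewrite ler_norml in h2; case/andP: h2 => _ h2.
have := mulr_ge0 k0 (ltW a_gt0); lra.
Qed.

(* Uniform in s: the density is at worst of order x^(-1/2) at the hard edge. *)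
Lemma nu_le_sqrt b : 0 < b -> b <= 1 -> nu b <= 4 * Num.sqrt b.
Proof.
move=> b0 b1; rewrite leNgt; apply/negP => hlt.
have e0 : 0 < (nu b - 4 * Num.sqrt b) / 2 by lra.
have [a0 a00 ha] := nu_small e0; pose a := Num.min a0 b.
have a_gt0 : 0 < a by rewrite lt_min a00 b0.
have [aa0 ab] : a <= a0 /\ a <= b by rewrite /a !ge_min !lexx ?orbT.
have hf (x : R) : a <= x <= b -> is_derive x 1 (fun t => 4 * Num.sqrt t) (2 / Num.sqrt x).
  move=> /andP[ax xb]; have x0 : 0 < x by lra.
  apply: (drv_eq (drvM (drv_c 4 x) (is_derive1_sqrt x0))); rewrite mulr0 addr0.
  by field; rewrite gt_eqF // sqrtr_gt0.
have b4 : b < 4 by lra.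
have h1 := nu_comp a_gt0 ab b4 hf _.
have h2 := ha a a_gt0 aa0; rewrite ler_norml in h2; case/andP: h2 => _ h2.
have q0 := sqrtr_ge0 a.
suff : nu b - nu a <= 4 * Num.sqrt b - 4 * Num.sqrt a by lra.
apply: h1 => x /andP[ax xb]; have x0 : 0 < x by lra.
have x4 : x < 4 by lra.
have hE := edge_lt2 x0 x4; have d0 := mpden_gt0 s0 s1 hE.
have pi2 : 2 <= pi :> R := pi_ge2 R.
have sx : 0 < Num.sqrt x by rewrite sqrtr_gt0.
(* For sg = -1 the denominator is (1 - s)^2 + s x, at least x / 4 whether s is above or below
   1/2. *)
have dx : x / 4 <= mpden s (sg * (2 - x)).
  have [s00 s11] : 0 < s /\ s <= 1 by [].
  rewrite /mpden; case: sgP => ->; rewrite ?mul1r ?mulN1r.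
    by have : 0 <= s * (2 - x) by [rewrite mulr_ge0 //; lra]; have := sqr_ge0 s; lra.
  have [hs|hs] := leP (1 / 2) s.
    have : 0 <= (s - 1 / 2) * x by rewrite mulr_ge0; lra.
    have := sqr_ge0 (1 - s); nra.
  have : 0 <= s * x by rewrite mulr_ge0; lra.
  have : 0 <= (1 / 2 - s) * (3 / 2 - s) by rewrite mulr_ge0; lra.
  nra.
rewrite /dens rr_edge ler_pdivrMr ?mulr_gt0 ?pi_gt0 // mulrAC ler_pdivlMr //.
have e1 : Num.sqrt (x * (4 - x)) * Num.sqrt x <= 2 * x.
  rewrite -sqrtrM; last by rewrite mulr_ge0; lra.
  rewrite -[leRHS]ger0_norm; last by lra.
  by rewrite -sqrtr_sqr ler_wsqrtr //; nra.
apply: (le_trans e1); apply: (@le_trans _ _ (2 * (2 * 2 * (x / 4)))); first by lra.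
rewrite ler_pM2l //; apply: ler_pM => //; [by lra | by rewrite ler_pM2l].
Qed.

End SpectralEdge.

(** At distance kap outside the spectrum and height z^2 (1 + kap), q is 1/(N eta). The condition kap
    >= G^30 z^2 makes rho exceed q by powers of G, and both Im m and the error of the local law fall
    below q / 8; an eigenvalue nearby would alone contribute q / 2. *)
Lemma exclusion_arith (R : realType) (G z kap q L rho A l K x : R) :
  400 <= G -> 8 * K <= G -> 0 < z -> G ^+ 20 * z <= 1 -> G ^+ 30 * z ^+ 2 <= kap -> 0 < kap ->
  q = z / (1 + kap) -> L * kap <= 2 * rho ^+ 2 -> 1 + kap <= L -> L <= 4 * (1 + kap) ->
  A * (L * rho) <= K * (z ^+ 2 * (1 + kap)) -> 0 <= K -> 0 < A -> l = 2 * (G ^+ 5 * q) ->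
  4 * (L * l) <= rho -> 0 <= x ->
  x * rho <= 2 * (G ^+ 4 * (q * Num.sqrt ((A + l) * (rho + L * l)) + L * q * (A + l))) ->
  0 <= rho -> A <= q / 8 /\ x <= q / 8.
Proof.
move=> G400 GK z0 Gz kge k qE r2 L1 L4 hA K0 A0 lE lr x_ge0 hx rho0.
have Gp : 0 < G by lra.
have G1 : 1 <= G by lra.
have g n : 1 <= G ^+ n by rewrite exprn_ege1.
have gp n : 0 < G ^+ n by rewrite exprn_gt0.
have k1 : 0 < 1 + kap by lra.
have kn := lt0r_neq0 k1.
have q0 : 0 < q by rewrite qE divr_gt0.
have qk : q * (1 + kap) = z by rewrite qE mulfVK.
have L0 : 0 < L by lra.
have l0 : 0 < l by rewrite lE; apply: mulr_gt0 => //; apply: mulr_gt0.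
have qz : q <= z by rewrite -qk; apply: ler_peMr; [exact: ltW | lra].
have rz : G ^+ 15 * z <= 2 * rho.
  apply: sqr_le_le; first by apply: mulr_ge0.
  have : (G ^+ 15 * z) ^+ 2 <= kap by rewrite exprMn -exprM.
  have : 1 * kap <= L * kap by rewrite ler_wpM2r ?(ltW k) //; lra.
  by rewrite [(2 * rho) ^+ 2]exprMn; move: r2 (sqr_ge0 rho); clear; lra.
have rq : G ^+ 15 * q <= 2 * rho by apply: le_trans rz; rewrite ler_wpM2l // ltW.
have rho_gt0 : 0 < rho.
  have : 0 < G ^+ 15 * q by apply: mulr_gt0.
  by move: rq; clear; lra.
(* For kap <= 1 this comes from kap >= G^30 z^2, for larger kap from G^20 z <= 1. *)
have rk : G ^+ 10 * (z * (1 + kap)) <= rho.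
  apply: sqr_le_le => //.
  have gi : 0 < (G ^+ 10)^-1 by rewrite invr_gt0.
  have h1 : (G ^+ 10 * z) ^+ 2 <= kap / G ^+ 10.
    by rewrite ler_pdivlMr // exprMn -exprM mulrAC -exprD.
  have h2 : (G ^+ 10 * z) ^+ 2 <= (G ^+ 10)^-1.
    have x0 : 0 <= G ^+ 10 * z by apply: mulr_ge0; exact: ltW.
    have x1 : G ^+ 10 * z <= (G ^+ 10)^-1.
      by rewrite -[leRHS]mul1r ler_pdivlMr // mulrAC -exprD.
    have x2 : (G ^+ 10)^-1 <= 1 by rewrite invf_le1.
    by apply: (le_trans _ x1); rewrite expr2 -[leRHS]mulr1 ler_wpM2l // (le_trans x1 x2).
  have h3 : (G ^+ 10 * z) ^+ 2 * (1 + kap) ^+ 2 <= 4 * (kap * (1 + kap)) / G ^+ 10.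
    have y0 : 0 <= kap * (1 + kap) by apply: mulr_ge0; exact: ltW.
    have [kk|kk] := leP kap 1.
      apply: (@le_trans _ _ (kap / G ^+ 10 * (1 + kap) ^+ 2)); first by rewrite ler_wpM2r ?sqr_ge0.
      rewrite mulrAC ler_wpM2r ?(ltW gi) //.
      have : 0 <= (1 - kap) * (kap * (1 + kap)) by apply: mulr_ge0 => //; rewrite subr_ge0.
      by rewrite expr2; move: y0; clear; lra.
    apply: (@le_trans _ _ ((G ^+ 10)^-1 * (1 + kap) ^+ 2)); first by rewrite ler_wpM2r ?sqr_ge0.
    rewrite mulrC ler_wpM2r ?(ltW gi) // expr2 mulrA ler_wpM2r ?(ltW k1) //; lra.
  have g8 : 8 <= G ^+ 10.
    by apply: (@le_trans _ _ G); [lra | rewrite exprS; apply: ler_peMr; [exact: ltW | exact: g]].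
  have h4 : kap * (1 + kap) <= 2 * rho ^+ 2.
    by apply: le_trans r2; rewrite mulrC ler_wpM2r // ltW.
  rewrite mulrA exprMn; apply: (le_trans h3); rewrite ler_pdivrMr //.
  have : 0 <= (G ^+ 10 - 8) * rho ^+ 2 by apply: mulr_ge0; [rewrite subr_ge0 | exact: sqr_ge0].
  by move: h4; clear; lra.
have GG10 : G <= G ^+ 10 by rewrite exprS; apply: ler_peMr; [exact: ltW | exact: g].
have Aq : A <= q / 8.
  have a1 : A * rho <= K * z ^+ 2.
    rewrite -(ler_pM2r k1) -[leRHS]mulrA; apply: le_trans hA.
    rewrite -[leLHS]mulrA ler_wpM2l ?(ltW A0) // mulrC ler_wpM2r //.
  rewrite -(ler_pM2r rho_gt0); apply: (le_trans a1).
  apply: (@le_trans _ _ (q / 8 * (G ^+ 10 * (z * (1 + kap))))); last by rewrite ler_wpM2l // ltW // divr_gt0.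
  rewrite (_ : q / 8 * _ = G ^+ 10 / 8 * z * (q * (1 + kap))); last by ring.
  rewrite qk -mulrA -expr2 ler_wpM2r ?sqr_ge0 //.
  by move: GG10 GK; clear; lra.
split=> //.
have Al : A + l <= 3 * (G ^+ 5 * q).
  rewrite lE; have : 1 * q <= G ^+ 5 * q by rewrite ler_wpM2r ?g // ltW.
  by move: Aq q0; clear; lra.
have Al0 : 0 <= A + l by apply: addr_ge0; exact: ltW.
have G55 : G ^+ 10 = G ^+ 5 * G ^+ 5 by rewrite -exprD.
have LAl : L * (A + l) * G ^+ 5 <= 12 * rho.
  apply: (@le_trans _ _ (4 * (1 + kap) * (3 * (G ^+ 5 * q)) * G ^+ 5)).
    by rewrite ler_wpM2r ?(ltW (gp 5)) //; apply: ler_pM => //; exact: ltW.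
  rewrite (_ : _ * G ^+ 5 = 12 * (G ^+ 10 * (q * (1 + kap)))); last by rewrite G55; ring.
  rewrite qk ler_pM2l //; apply: le_trans rk; rewrite ler_wpM2l ?(ltW (gp 10)) //.
  by apply: ler_peMr; [exact: ltW | move: k; clear; lra].
have Ll : L * l <= rho.
  have : 0 <= L * l by apply: mulr_ge0; exact: ltW.
  by move: lr; clear; lra.
have sq : G ^+ 5 * Num.sqrt ((A + l) * (rho + L * l)) <= 5 * rho.
  have z5 : 0 <= 5 * rho by apply: mulr_ge0.
  rewrite -[G ^+ 5]ger0_norm ?(ltW (gp 5)) // -sqrtr_sqr -sqrtrM ?sqr_ge0 //.
  rewrite -[leRHS](ger0_norm z5) -sqrtr_sqr ler_wsqrtr //.
  apply: (@le_trans _ _ ((G ^+ 5) ^+ 2 * (3 * (G ^+ 5 * q) * (2 * rho)))).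
    rewrite ler_wpM2l ?sqr_ge0 //; apply: ler_pM => //.
      by apply: addr_ge0 => //; apply: mulr_ge0; exact: ltW.
    by move: Ll; clear; lra.
  have -> : (G ^+ 5) ^+ 2 * (3 * (G ^+ 5 * q) * (2 * rho)) = 6 * rho * (G ^+ 15 * q) by ring.
  apply: (@le_trans _ _ (6 * rho * (2 * rho))); first by rewrite ler_wpM2l // mulr_ge0.
  by rewrite exprMn expr2; have := mulr_ge0 rho0 rho0; clear; lra.
have l2 : x * G <= 40 * q.
  rewrite -(ler_pM2r rho_gt0) mulrAC.
  apply: (@le_trans _ _ (2 * (G ^+ 4 * (q * Num.sqrt ((A + l) * (rho + L * l)) + L * q * (A + l))) * G)).
    by rewrite ler_wpM2r // ltW.
  move: sq; set S := Num.sqrt _ => sq.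
  rewrite (_ : _ * G = 2 * q * (G ^+ 5 * S) + 2 * q * (L * (A + l) * G ^+ 5)); last by ring.
  have q2 : 0 <= 2 * q by apply: mulr_ge0 => //; exact: ltW.
  have := ler_wpM2l q2 sq; have := ler_wpM2l q2 LAl.
  have := mulr_ge0 q2 rho0; clear; lra.
rewrite -(ler_pM2r Gp); apply: (le_trans l2).
have : 0 <= q * (G - 400) by apply: mulr_ge0; [exact: ltW | rewrite subr_ge0].
by move: q0; clear; lra.
Qed.

(** * Rigidity for finitely supported entries *)

Section Exclusion.
Variable R : realType.
Local Notation C := R[i].
Local Open Scope complex_scope.
Variables (tt : R) (N B : nat) (s G z kap sg : R) (lam : nat -> R).
Hypotheses (tt0 : 0 < tt) (tt1 : tt <= 1) (N0 : (0 < N)%N) (s0 : 0 < s) (s1 : s <= 1).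
Hypotheses (z0 : 0 < z) (zN : z ^+ 3 * N%:R = 1) (sgP : sg = 1 \/ sg = -1).
Hypotheses (G400 : 400 <= G) (GK : 480 / tt ^+ 2 <= G) (Gz : G ^+ 20 * z <= 1).
Hypothesis kap_ge : G ^+ 30 * z ^+ 2 <= kap.
Local Notation E := (sg * (2 + kap)).
Local Notation e0 := (z ^+ 2 * (1 + kap)).
Local Notation q := (z / (1 + kap)).
Hypothesis dom : (- 2 + tt <= E) || (s <= 1 - tt / 2).

Lemma Gpow_ge1 n : 1 <= G ^+ n. Proof. by rewrite exprn_ege1 //; have := G400; lra. Qed.

Lemma kap_gt0 : 0 < kap.
Proof. by apply: lt_le_trans kap_ge; rewrite mulr_gt0 ?exprn_gt0 //; have := G400; lra. Qed.

Lemma Gz_le n : (n <= 20)%N -> G ^+ n * z <= 1.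
Proof.
move=> h; apply: le_trans Gz; rewrite ler_wpM2r ?(ltW z0) // ler_weXn2l //.
by have := G400; lra.
Qed.

Lemma excl_norm : `|E| = 2 + kap.
Proof.
have k := kap_gt0; case: sgP => ->; rewrite ?mul1r ?mulN1r ?normrN ger0_norm //; lra.
Qed.

Lemma NzE : N%:R = (z ^+ 3)^-1.
Proof.
have zn := lt0r_neq0 z0; apply: (mulfI (expf_neq0 3 zn)).
by rewrite zN mulfV // expf_neq0.
Qed.

Lemma excl_vq : vq N e0 = q.
Proof.
have k := kap_gt0; rewrite /vq; have Nn : N%:R != 0 :> R by rewrite pnatr_eq0 -lt0n.
have kn : 1 + kap != 0 by rewrite gt_eqF //; lra.
have zn := lt0r_neq0 z0.
by rewrite NzE; field; rewrite kn zn.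
Qed.

Lemma excl_e0 : 0 < e0.
Proof. by have := kap_gt0 => k; rewrite mulr_gt0 ?exprn_gt0 //; lra. Qed.

Lemma excl_z1 : z <= 1.
Proof. by have := Gz_le (leq0n 20); rewrite expr0 mul1r. Qed.

Lemma excl_e0_le : e0 <= 1 + kap.
Proof.
have k := kap_gt0; rewrite ler_piMl //; first by lra.
by rewrite expr_le1 ?excl_z1 // ltW.
Qed.

Lemma excl_ray : 2 + kap <= N%:R ^+ B -> raycond tt N B s G E e0.
Proof.
move=> hB; have k := kap_gt0; have z1 := excl_z1; have g := Gpow_ge1.
have k1 : 0 < 1 + kap by lra.
have e1 : 1 + (2 + kap) + e0 <= 4 * (1 + kap) by have := excl_e0_le; lra.
have kn := lt0r_neq0 k1.
split=> //; first by rewrite excl_norm.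
- apply/andP; split; last by apply: le_trans hB; have := excl_e0_le; lra.
  rewrite NzE invrK exprS mulrC ler_pM2l ?exprn_gt0 //; lra.
- rewrite excl_vq excl_norm [`| _ - 2|]ger0_norm; last by lra.
  apply: (@le_trans _ _ (G ^+ 12 * (4 * z ^+ 2))).
    rewrite ler_wpM2l ?exprn_ge0 //; first by have := G400; lra.
    apply: (le_trans (ler_wpM2r (sqr_ge0 _) e1)).
    rewrite (_ : _ * q ^+ 2 = 4 * z ^+ 2 / (1 + kap)); last by field.
    by rewrite ler_pdivrMr //; apply: ler_peMr; [apply: mulr_ge0 => //; apply: sqr_ge0 | lra].
  have h : G ^+ 12 * 4 <= G ^+ 30.
    rewrite (_ : 30%N = (12 + 18)%N) // exprD ler_wpM2l //; first by have := g 12%N; lra.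
    by rewrite exprS; have := G400; have := g 17%N; nra.
  have : G ^+ 12 * (4 * z ^+ 2) <= G ^+ 30 * z ^+ 2 by rewrite mulrA ler_wpM2r ?sqr_ge0.
  by have := kap_ge; lra.
rewrite excl_vq excl_norm; apply: (@le_trans _ _ (G ^+ 6 * (4 * z))).
  rewrite ler_wpM2l //; first by have := g 6%N; lra.
  apply: (le_trans (ler_wpM2r (_ : 0 <= q) e1)); first by rewrite divr_ge0 // ltW.
  by rewrite (_ : _ * q = 4 * z) //; field.
apply: (@le_trans _ _ (G ^+ 7 * z)); last exact: Gz_le.
rewrite mulrA ler_wpM2r ?(ltW z0) // [leRHS]exprSr ler_wpM2l //; have := G400; have := g 6%N; lra.
Qed.

Hypothesis sharp : nrm (stj N s lam (vw E e0) - vm s E e0) * nrm (sc_rho (vw E e0) (vu E e0)) <=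
    2 * (G ^+ 4 * Bsharp N (vw E e0) (vm s E e0) (sc_rho (vw E e0) (vu E e0)) (vl N G e0)).
Hypothesis hray : raycond tt N B s G E e0.

Lemma excl_Im : complex.Im (stj N s lam (vw E e0)) <= q / 4.
Proof.
have k := kap_gt0; have z1 := excl_z1; have g := Gpow_ge1; have e00 := excl_e0.
have k1 : 0 < 1 + kap by lra.
have Gp : 0 < G by have := G400; lra.
have eI : 0 < complex.Im (vw E e0) by [].
have Iu := vu_Im E e00; have Hu := vu_eq E e00.
have w0 := nrm_ge0 (vw E e0).
have q0 : 0 < q by rewrite divr_gt0.
have kE : `| `|E| - 2| = kap by rewrite excl_norm ger0_norm; lra.
have [d1 d2] := dist_edge_ge (vw E e0).
have r2 : (1 + nrm (vw E e0)) * kap <= 2 * nrm (sc_rho (vw E e0) (vu E e0)) ^+ 2.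
  by apply: (sc_rho_ge eI Hu (ltW k)); rewrite -[leLHS]kE; [exact: d1 | exact: d2].
have [_ _ _ c1 c2] := hray.
have G1 : 1 <= G by have := G400; lra.
have G128 : 128 <= G by have := G400; lra.
have [lr _] := vl_rho N0 e00 G1 G128 c1 (lexx e0).
have L1 : 1 + kap <= 1 + nrm (vw E e0).
  have := le_Re_nrm (vw E e0); rewrite -[complex.Re _]/E excl_norm; lra.
have L4 : 1 + nrm (vw E e0) <= 4 * (1 + kap).
  have := nrm_vw E (ltW e00); rewrite excl_norm; have := excl_e0_le; lra.
have hA := Im_mp_m_outside eI Iu Hu s0 s1 tt0 tt1 dom _.
have {hA}hA : complex.Im (vm s E e0) * ((1 + nrm (vw E e0)) * nrm (sc_rho (vw E e0) (vu E e0))) <= 60 / tt ^+ 2 * e0.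
  by apply: hA; rewrite -[complex.Re _]/E excl_norm; lra.
have A0 : 0 < complex.Im (vm s E e0) by apply: Im_mp_m_gt0.
have qE : qpar N (vw E e0) = q by rewrite -excl_vq.
have lE : vl N G e0 = 2 * (G ^+ 5 * q) by rewrite /vl excl_vq.
move: sharp; rewrite /Bsharp qE.
move=> hsh; have K0 : 0 <= 60 / tt ^+ 2 by rewrite divr_ge0 // sqr_ge0.
have K8 : 8 * (60 / tt ^+ 2) <= G by apply: le_trans GK; rewrite mulrA -natrM.
have [Aq xq] := exclusion_arith G400 K8 z0 Gz kap_ge k (erefl q) r2 L1 L4 hA K0 A0 lE lr (nrm_ge0 _) hsh (nrm_ge0 _).
have := le_trans (Im_le_nrm _) xq; rewrite cImB; lra.
Qed.

(** An eigenvalue within e0 would make Im m_N at least 1 / (2 N e0), twice the bound of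
    [excl_Im]. *)
Lemma excluded k : (1 <= k <= N)%N -> e0 < `|ycen s lam k - E|.
Proof.
move=> hk; rewrite ltNge; apply/negP => h.
have kp := kap_gt0; have e00 := excl_e0; have Nr : 0 < N%:R :> R by rewrite ltr0n.
have h1 := stj_atom_le s lam N0 (e00 : 0 < complex.Im (vw E e0)) hk.
have h2 := excl_Im; have q0 : 0 < q by rewrite divr_gt0 //; lra.
have h3 : (ycen s lam k - E) ^+ 2 <= e0 ^+ 2.
  by rewrite -[X in X <= _]real_normK ?num_real //; apply: lerXn2r; rewrite ?nnegrE ?(ltW e00).
have d0 : 0 < (ycen s lam k - E) ^+ 2 + e0 ^+ 2 by rewrite ltr_wpDl ?sqr_ge0 // exprn_gt0.
have e20 : 0 < 2 * e0 by apply: mulr_gt0.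
have h4 : (2 * e0)^-1 <= N%:R * complex.Im (stj N s lam (vw E e0)).
  apply: le_trans h1; rewrite -[complex.Re _]/E -[complex.Im _]/e0 ler_pdivlMr // mulrC ler_pdivrMr //.
  by rewrite mulrCA -expr2; lra.
have h5 : N%:R * complex.Im (stj N s lam (vw E e0)) <= N%:R * (q / 4) by rewrite ler_wpM2l // ltW.
have h6 : N%:R * q = e0^-1.
  by rewrite -excl_vq /vq invfM mulrA mulfV ?mul1r // gt_eqF.
have ei : 0 < e0^-1 by rewrite invr_gt0.
have h7 : N%:R * (q / 4) = e0^-1 / 4 by rewrite (mulrA _ q) h6.
have h8 : (2 * e0)^-1 = e0^-1 / 2 by rewrite invfM mulrC.
move: h4 h5; rewrite h7 h8; lra.
Qed.
End Exclusion.

Lemma edge_product (R : realType) (E e0 k : R) : `|E| <= 2 -> `| `|E| - 2| = k -> 0 < e0 -> e0 <= k -> k <= 2 ->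
  nrm (vw E e0 - 2) * nrm (vw E e0 + 2) <= 16 * k.
Proof.
move=> hE hk e00 ek k2.
have n2 y : nrm (vw E e0 + (y%:C)%C) <= `|E + y| + e0.
  by apply: (le_trans (nrm_le_ReIm _)); rewrite cReD cImD /= addr0 (ger0_norm (ltW e00)).
have i2 : ((2 : R)%:C)%C = 2 by rewrite -[2]/(2%:R) rmorph_nat.
have i2n : ((- (2 : R))%:C)%C = - 2 by apply: cplx_eq => /=; rewrite ?addr0 ?oppr0.
have m1 := n2 (- 2); have m2 := n2 2; rewrite i2 in m2; rewrite i2n in m1.
have c1 : 0 <= nrm (vw E e0 - 2) := nrm_ge0 _.
have c2 : 0 <= nrm (vw E e0 + 2) := nrm_ge0 _.
move: m1 m2 c1 c2; move: (nrm _) (nrm _) => A B; rewrite ler_norml in hE; case/andP: hE => l1 l2.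
rewrite (ler0_norm (_ : E + -2 <= 0)); last by lra.
rewrite (ger0_norm (_ : 0 <= E + 2)); last by lra.
move=> mA mB A0 B0; have kk : k = 2 - E \/ k = 2 + E.
  move: hk; clear - l1 l2; have [h|h] := leP 0 E.
    by rewrite [`|E|]ger0_norm // ler0_norm; [left; lra | lra].
  by rewrite [`|E|]ler0_norm ?(ltW h) // ler0_norm; [right; lra | lra].
have k0 : 0 <= k by lra.
case: kk => kk.
  apply: (@le_trans _ _ ((2 * k) * 8)); last by lra.
  by apply: ler_pM => //; lra.
apply: (@le_trans _ _ (8 * (2 * k))); last by lra.
by apply: ler_pM => //; lra.
Qed.

(** * The eigenvalue counting function inside the spectrum *)

Section CountingFunction.
Variable R : realType.
Local Notation C := R[i].
Local Open Scope complex_scope.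
Variables (tt : R) (N B e : nat) (s G z x sg : R) (lam : nat -> R).
Hypotheses (tt0 : 0 < tt) (tt1 : tt <= 1) (N0 : (0 < N)%N) (s0 : 0 < s) (s1 : s <= 1).
Hypotheses (z0 : 0 < z) (zN : z ^+ 3 * N%:R = 1) (sgP : sg = 1 \/ sg = -1).
Hypotheses (G400 : 400 <= G) (GK : 584 / tt ^+ 2 + 24 + 2 * (e * (B + 2))%:R <= G).
Hypotheses (nG : N%:R <= G ^+ e) (B1 : (0 < B)%N) (N4 : 4 <= N%:R :> R).
Hypotheses (x0 : 0 < x) (x4 : x < 4).
Local Notation k := (Num.min x (4 - x)).
Hypothesis kz : G ^+ 6 * z ^+ 2 <= k.
Local Notation E := (sg * (2 - x)).
Local Notation e0 := (G ^+ 7 / (N%:R * Num.sqrt k)).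
Hypothesis dom : (- 2 + tt <= E) || (s <= 1 - tt / 2).

Lemma cnt_k : 0 < k /\ k <= 2.
Proof.
split; first by rewrite lt_min x0 subr_gt0.
by have [h|h] := leP x 2; rewrite ge_min; apply/orP; [left | right]; lra.
Qed.

Lemma cnt_dist : `| `|E| - 2| = k.
Proof.
rewrite sg_norm //; have [h|h] := leP x 2.
  rewrite [`|2 - x|]ger0_norm ?subr_ge0 // min_l; last by lra.
  by rewrite (_ : 2 - x - 2 = - x); [rewrite normrN gtr0_norm | ring].
rewrite [`|2 - x|]ler0_norm; last by lra.
rewrite min_r; last by lra.
by rewrite (_ : - (2 - x) - 2 = - (4 - x)); [rewrite normrN gtr0_norm // subr_gt0 | ring].
Qed.

Lemma cnt_sk : 0 < Num.sqrt k /\ Num.sqrt k ^+ 2 = k.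
Proof. by have [k0 _] := cnt_k; rewrite sqrtr_gt0 sqr_sqrtr // ltW. Qed.

Lemma cnt_skz : G ^+ 3 * z <= Num.sqrt k.
Proof.
have [k0 _] := cnt_k; have [s00 sE] := cnt_sk.
have Gp : 0 < G by have := G400; lra.
by apply: sqr_le_le; [exact: ltW | rewrite sE exprMn -exprM].
Qed.

(** At this height 1/(N eta) is sqrt k / G^7, a power of G below the size sqrt k of |rho|; [kz]
    ensures that the height is still at most the distance k to the edge. *)
Lemma cnt_e0 : 0 < e0 /\ e0 <= k.
Proof.
have [k0 _] := cnt_k; have [s00 sE] := cnt_sk; have h := cnt_skz.
have Gp : 0 < G by have := G400; lra.
have Nr : 0 < N%:R :> R by rewrite ltr0n.
have z30 : 0 < z ^+ 3 by rewrite exprn_gt0.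
split; first by rewrite divr_gt0 ?exprn_gt0 // mulr_gt0.
rewrite ler_pdivrMr ?mulr_gt0 //.
have h3 : (G ^+ 3 * z) ^+ 3 <= Num.sqrt k ^+ 3.
  by apply: lerXn2r; rewrite ?nnegrE ?(ltW s00) // mulr_ge0 ?exprn_ge0 // ltW.
rewrite mulrCA -{1}sE -exprSr; apply: (@le_trans _ _ (N%:R * (G ^+ 9 * z ^+ 3))).
  rewrite mulrCA [N%:R * _]mulrC zN mulr1 ler_weXn2l //.
  by have := G400; lra.
by rewrite ler_wpM2l ?(ltW Nr) //; apply: le_trans h3; rewrite exprMn -exprM.
Qed.

Lemma cnt_norm : `|E| <= 2.
Proof. by rewrite sg_norm // ler_norml; have := x0; have := x4; lra. Qed.

Lemma cnt_ray : raycond tt N B s G E e0.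
Proof.
have [k0 k2] := cnt_k; have [s00 sE] := cnt_sk; have [e00 ek] := cnt_e0.
have hE := cnt_norm; have G4 := G400.
have Gp : 0 < G by lra.
have Nr : 0 < N%:R :> R by rewrite ltr0n.
have s2 : Num.sqrt k <= 2 by apply: sqr_le_le; rewrite // sE; lra.
have NB : 4 <= N%:R ^+ B :> R.
  apply: (le_trans N4); case: (B) B1 => // b _; rewrite exprS ler_peMr ?(ltW Nr) // exprn_ege1 //.
  by have := N4; lra.
have qE : vq N e0 = Num.sqrt k / G ^+ 7.
  by rewrite /vq; field; rewrite !gt_eqF // exprn_gt0.
have g7 : 0 < G ^+ 7 by rewrite exprn_gt0.
have E5 : 1 + `|E| + e0 <= 5 by lra.
split=> //; first by lra.
- apply/andP; split; last by lra.
  rewrite invfM mulrA [G ^+ 7 * _]mulrC -mulrA ler_peMr ?invr_ge0 ?(ltW Nr) //.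
  rewrite ler_pdivlMr // mul1r; apply: (le_trans s2).
  by apply: (@le_trans _ _ G); [lra | rewrite exprS ler_peMr ?(ltW Gp) // exprn_ege1 //; lra].
- rewrite cnt_dist qE expr_div_n sE.
  apply: (@le_trans _ _ (G ^+ 12 * (5 * (k / (G ^+ 7) ^+ 2)))).
    by rewrite ler_wpM2l ?exprn_ge0 ?(ltW Gp) // ler_wpM2r // divr_ge0 ?(ltW k0) // exprn_ge0 // ltW.
  rewrite (_ : G ^+ 12 * (5 * (k / (G ^+ 7) ^+ 2)) = 5 / G ^+ 2 * k); last by field; rewrite gt_eqF.
  rewrite ler_piMl ?(ltW k0) // ler_pdivrMr ?exprn_gt0 // mul1r expr2; nra.
rewrite qE; apply: (@le_trans _ _ (G ^+ 6 * (5 * (2 / G ^+ 7)))).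
  rewrite ler_wpM2l ?exprn_ge0 ?(ltW Gp) //; apply: ler_pM => //.
  - by rewrite addr_ge0 ?(ltW e00) // addr_ge0.
  - by rewrite divr_ge0 // ltW.
  - by rewrite ler_wpM2r // invr_ge0 ltW.
rewrite (_ : G ^+ 6 * (5 * (2 / G ^+ 7)) = 10 / G); last by field; rewrite gt_eqF.
rewrite ler_pdivrMr //; lra.
Qed.

Hypothesis yB : forall j, (1 <= j <= N)%N -> `|ycen s lam j| <= N%:R ^+ B.
Hypothesis sB : s^-1 <= N%:R ^+ B.
Hypothesis ray : forall y, e0 <= y -> y <= raytop R N B ->
  nrm (stj N s lam (vw E y) - vm s E y) <= vl N G y.

(** A sign is twice an indicator minus one, so the left side compares the proportion of eigenvalues
    within x of the edge with nu. Every error in [signN_theta] is a constant times G^7 / N, and the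
    last factor G absorbs the constants. *)
Lemma count_nu :
  `|(\sum_(1 <= j < N.+1) Num.sg (x - (2 - sg * ycen s lam j))) / (2 * N%:R) + 1 / 2 - nu s sg x| <= G ^+ 8 / N%:R.
Proof.
have [k0 k2] := cnt_k; have [s00 sE] := cnt_sk; have [e00 ek] := cnt_e0; have skz := cnt_skz.
have hE := cnt_norm; have G4 := G400.
have Gp : 0 < G by lra.
have G1 : 1 <= G by lra.
have Nr : 0 < N%:R :> R by rewrite ltr0n.
have E2 : `|E| < 2 by apply: edge_lt2.
have N1 : 1 <= N%:R :> R by have := N4; lra.
have NB1 : 1 <= N%:R ^+ B :> R by rewrite exprn_ege1.
have NB : N%:R <= raytop R N B by rewrite /raytop exprS ler_peMr // ltW.
have e0H : e0 <= raytop R N B by have := N4; lra.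
have H4 : 4 * 4 <= raytop R N B.
  rewrite /raytop; case: (B) B1 NB1 => // b _ _; rewrite exprS; apply: ler_pM => //.
  by rewrite exprS -[leLHS]mulr1; apply: ler_pM => //; rewrite exprn_ege1.
have H6 : 6 <= raytop R N B by lra.
have Hp : 0 < raytop R N B by lra.
have rm0 : 0 < Num.sqrt k / 2 by rewrite divr_gt0.
have hrm y : 0 < y -> Num.sqrt k / 2 <= nrm (sc_rho (vw E y) (vu E y)).
  move=> y0; apply: sqr_le_le; first exact: nrm_ge0.
  have [d1 d2] := dist_edge_ge (vw E y); rewrite -[complex.Re _]/E cnt_dist in d1 d2.
  have := sc_rho_ge (y0 : 0 < complex.Im (vw E y)) (vu_eq E y0) (ltW k0) d1 d2.
  have : 1 * k <= (1 + nrm (vw E y)) * k by rewrite ler_wpM2r ?(ltW k0) // lerDl nrm_ge0.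
  by rewrite expr_div_n sE; lra.
have hs := signN_theta tt0 tt1 N0 s0 s1 dom E2 G1 e00 e0H H6 rm0 hrm yB ray.
have ImB : complex.Im (vm s E e0) <= 144 / tt ^+ 2 * Num.sqrt k.
  have eI : 0 < complex.Im (vw E e0) by [].
  have h1 := Im_mp_m_le_rho eI (vu_Im E e00) (vu_eq E e00) s0 s1 tt0 tt1 dom.
  have A0 : 0 < complex.Im (vm s E e0) by apply: Im_mp_m_gt0 => //; exact: vu_Im.
  have h2 : complex.Im (vm s E e0) <= 36 / tt ^+ 2 * nrm (sc_rho (vw E e0) (vu E e0)).
    apply: le_trans h1; rewrite ler_peMr ?(ltW A0) // exprn_ege1 //.
    by rewrite lerDl nrm_ge0.
  apply: (le_trans h2); rewrite (_ : 144 / tt ^+ 2 * _ = 36 / tt ^+ 2 * (4 * Num.sqrt k)); last by field; rewrite gt_eqF.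
  rewrite ler_wpM2l ?divr_ge0 ?sqr_ge0 //; apply: sqr_le_le; first by rewrite mulr_ge0 // ltW.
  rewrite -nrmX (sc_rho_sqr (vu_eq E e00)) exprMn sE.
  rewrite (_ : vw E e0 ^+ 2 - 4 = (vw E e0 - 2) * (vw E e0 + 2)); last by ring.
  rewrite nrmM (_ : (4 : R) ^+ 2 = 16); last by ring.
  by apply: edge_product => //; exact: cnt_dist.
have T1 : 4 * e0 * complex.Im (vm s E e0) <= 576 / tt ^+ 2 * (G ^+ 7 / N%:R).
  apply: (@le_trans _ _ (4 * e0 * (144 / tt ^+ 2 * Num.sqrt k))).
    by rewrite ler_wpM2l // mulr_ge0 // ltW.
  by rewrite le_eqVlt; apply/orP; left; apply/eqP; field; rewrite !gt_eqF.
have T2 : ln (raytop R N B) - ln e0 <= (e * (B + 2))%:R * G.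
  have ei : N%:R^-1 <= e0 by case: cnt_ray => _ _ /andP[].
  have l1 : - ln e0 <= ln (N%:R : R).
    by rewrite -lnV ?posrE // ler_ln ?posrE ?invr_gt0 // -[leRHS]invrK lef_pV2 ?posrE ?invr_gt0.
  have l2 : ln (N%:R : R) <= e%:R * G.
    apply: (@le_trans _ _ (ln (G ^+ e))); first by rewrite ler_ln ?posrE ?exprn_gt0.
    rewrite lnXn // -[leLHS]mulr_natl ler_wpM2l // ltW // ln_sublinear //.
  have l3 : ln (raytop R N B) = B.+1%:R * ln (N%:R : R) by rewrite /raytop lnXn // mulr_natl.
  rewrite l3; apply: (@le_trans _ _ (B.+1%:R * ln (N%:R : R) + ln (N%:R : R))); first by rewrite lerD2l.
  rewrite (_ : B.+1%:R * ln (N%:R : R) + ln (N%:R : R) = (B + 2)%:R * ln (N%:R : R)); last by rewrite addn2 -[X in _ + X]mul1r -mulrDl natr1.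
  by rewrite natrM mulrAC [leRHS]mulrC ler_wpM2l.
have T3 : (N%:R ^+ B + 4 + 9 / s) / raytop R N B <= 14 * (1 / N%:R).
  rewrite ler_pdivrMr // /raytop exprS (_ : 14 * (1 / N%:R) * (N%:R * N%:R ^+ B) = 14 * N%:R ^+ B); last by field; rewrite gt_eqF.
  by have := sB; have := NB1; lra.
have T4 : 4 / tt ^+ 2 / (Num.sqrt k / 2) * e0 ^+ 2 <= 8 / tt ^+ 2 * (G ^+ 7 / N%:R).
  rewrite (_ : _ * e0 ^+ 2 = 8 / tt ^+ 2 * (G ^+ 7 / N%:R * (G ^+ 7 / (N%:R * Num.sqrt k ^+ 3)))); last by field; rewrite !gt_eqF.
  rewrite ler_wpM2l ?divr_ge0 ?sqr_ge0 // ler_piMr ?divr_ge0 ?exprn_ge0 ?(ltW Gp) ?(ltW Nr) //.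
  rewrite ler_pdivrMr ?mulr_gt0 ?exprn_gt0 // mul1r.
  have := ek; rewrite ler_pdivrMr ?mulr_gt0 // mulrCA -{1}sE -exprSr => h.
  exact: h.
have i1 : 1 / N%:R <= G ^+ 7 / N%:R by rewrite ler_wpM2r ?invr_ge0 ?(ltW Nr) // exprn_ege1.
have total : `|pi / 2 * (signN N s E lam / N%:R) - theta s E 0| <= G ^+ 8 / N%:R.
  apply: (le_trans hs).
  have T5 : 2 * G ^+ 5 / N%:R * (5 + (ln (raytop R N B) - ln e0)) <= (10 + 2 * (e * (B + 2))%:R) * (G ^+ 7 / N%:R).
    apply: (@le_trans _ _ (2 * G ^+ 5 / N%:R * (5 * G + (e * (B + 2))%:R * G))).
      rewrite ler_wpM2l ?divr_ge0 ?mulr_ge0 ?exprn_ge0 ?(ltW Gp) ?(ltW Nr) //; apply: lerD => //; lra.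
    rewrite (_ : _ * _ = (10 + 2 * (e * (B + 2))%:R) * (G ^+ 6 / N%:R)); last by ring.
    by rewrite ler_wpM2l ?addr_ge0 // ler_wpM2r ?invr_ge0 ?(ltW Nr) // ler_weXn2l.
  rewrite (_ : G ^+ 8 / N%:R = G * (G ^+ 7 / N%:R)); last by rewrite exprS mulrA.
  have y0 : 0 <= G ^+ 7 / N%:R by rewrite divr_ge0 ?exprn_ge0 ?(ltW Gp) ?(ltW Nr).
  have := ler_wpM2r y0 GK; move: T1 T5 T3 T4 i1; set y := G ^+ 7 / N%:R; lra.
have p0 : 0 < pi :> R := pi_gt0 R.
have -> : \sum_(1 <= j < N.+1) Num.sg (x - (2 - sg * ycen s lam j)) = sg * signN N s E lam.
  rewrite /signN mulr_sumr; apply: eq_bigr => j _.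
  have ss := sg_sqr sgP.
  rewrite (_ : x - (2 - sg * ycen s lam j) = sg * (ycen s lam j - E)); last first.
    by rewrite [RHS]mulrBr [sg * (sg * (2 - x))]mulrA ss; ring.
  by rewrite sgrM; case: sgP => ->; rewrite ?sgr1 ?sgrN1.
rewrite /nu nE_theta //.
have -> : sg * signN N s E lam / (2 * N%:R) + 1 / 2 - (1 / 2 + sg * (1 / 2 + theta s E 0 / pi - 1 / 2)) =
   sg * ((pi / 2 * (signN N s E lam / N%:R) - theta s E 0) / pi).
  by move: (@pi R) p0 => p p0; field; rewrite !gt_eqF.
rewrite sg_norm // normrM [`|pi^-1|]ger0_norm ?invr_ge0 ?(ltW p0) // ler_pdivrMr //.
apply: (le_trans total); rewrite ler_peMr ?divr_ge0 ?exprn_ge0 ?(ltW Gp) ?(ltW Nr) //.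
by have := pi_ge2 R; lra.
Qed.

End CountingFunction.

(** * From counting to eigenvalue locations *)

Section Rigidity.
Variable R : realType.

Lemma sum_sg_lt (N j : nat) (Y : nat -> R) (x : R) : (1 <= j <= N)%N ->
  (forall a b, (1 <= a)%N -> (a <= b)%N -> (b <= N)%N -> Y a <= Y b) -> x < Y j ->
  \sum_(1 <= k < N.+1) Num.sg (x - Y k) <= (2 * j)%:R - 2 - N%:R.
Proof.
move=> /andP[j1 jN] mono xY.
rewrite (@big_cat_nat _ _ _ j) //=; last by rewrite ltnW.
have h1 : \sum_(1 <= k < j) Num.sg (x - Y k) <= \sum_(1 <= k < j) 1.
  by apply: ler_sum => k _; apply: le_trans (ler_norm _) _; rewrite normr_sg lern1 leq_b1.
have h2 : \sum_(j <= k < N.+1) Num.sg (x - Y k) = \sum_(j <= k < N.+1) (-1).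
  rewrite big_nat [RHS]big_nat; apply: eq_bigr => k /andP[jk kN]; apply: ltr0_sg.
  by rewrite subr_lt0 (lt_le_trans xY) // mono.
rewrite h2 in h1 *; apply: (le_trans (lerD h1 (lexx _))).
rewrite !sumr_const_nat mulNrn.
rewrite natrB // natrB; last exact: ltnW.
rewrite natrM -natr1; lra.
Qed.

Lemma sum_sg_gt (N j : nat) (Y : nat -> R) (x : R) : (1 <= j <= N)%N ->
  (forall a b, (1 <= a)%N -> (a <= b)%N -> (b <= N)%N -> Y a <= Y b) -> Y j < x ->
  (2 * j)%:R - N%:R <= \sum_(1 <= k < N.+1) Num.sg (x - Y k).
Proof.
move=> /andP[j1 jN] mono xY.
rewrite (@big_cat_nat _ _ _ j.+1) //=.
have h1 : \sum_(j.+1 <= k < N.+1) (-1) <= \sum_(j.+1 <= k < N.+1) Num.sg (x - Y k).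
  apply: ler_sum => k _; have := ler_norm (- Num.sg (x - Y k)); rewrite normrN normr_sg.
  by have : (x - Y k != 0)%:R <= 1 :> R by [rewrite lern1 leq_b1]; lra.
have h2 : \sum_(1 <= k < j.+1) Num.sg (x - Y k) = \sum_(1 <= k < j.+1) 1.
  rewrite big_nat [RHS]big_nat; apply: eq_bigr => k /andP[k1 kj]; apply: gtr0_sg.
  by rewrite subr_gt0 (le_lt_trans _ xY) // mono.
rewrite h2; apply: le_trans (lerD (lexx _) h1).
rewrite !sumr_const_nat mulNrn subSS subn0.
rewrite natrB // natrM -!natr1; lra.
Qed.

Variables (tt s sg G z t X dl : R) (N j : nat) (Y : nat -> R).
Hypotheses (tt0 : 0 < tt) (tt1 : tt <= 1) (N0 : (0 < N)%N) (s0 : 0 < s) (s1 : s <= 1).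
Hypotheses (z0 : 0 < z) (zN : z ^+ 3 * N%:R = 1) (sgP : sg = 1 \/ sg = -1).
Hypotheses (G400 : 400 <= G) (Gt : 1024 / tt <= G) (Gt2 : 4 / tt ^+ 2 <= G).
Hypotheses (t1 : 1 <= t) (tj : t ^+ 3 = j%:R) (hj : (1 <= j <= N)%N).
Hypothesis dlE : dl = G ^+ 60 * z ^+ 2 / t.
Hypothesis mono : forall a b, (1 <= a)%N -> (a <= b)%N -> (b <= N)%N -> Y a <= Y b.
Hypotheses (X4 : X + dl <= 4 - tt) (X0 : 0 <= X) (Xsoft : soft tt s sg X) (ztt : G ^+ 6 * z ^+ 2 <= tt).
Hypothesis Xloc : (X = 0 /\ j = 1%N) \/ (0 < X /\ `|nu s sg X - j%:R / N%:R| <= 1 / N%:R).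

Definition counted (x : R) := `|(\sum_(1 <= k < N.+1) Num.sg (x - Y k)) / (2 * N%:R) + 1 / 2 - nu s sg x| <= G ^+ 8 / N%:R.
Definition countable_at (x : R) := G ^+ 6 * z ^+ 2 <= Num.min x (4 - x).

Let Gp : 0 < G. Proof. by have := G400; lra. Qed.
Let G1 : 1 <= G. Proof. by have := G400; lra. Qed.
Let Nr : 0 < N%:R :> R. Proof. by rewrite ltr0n. Qed.
Let tp : 0 < t. Proof. by have := t1; lra. Qed.
Let dl0 : 0 < dl. Proof. by rewrite dlE divr_gt0 // mulr_gt0 ?exprn_gt0 ?Gp. Qed.
Let Niz : N%:R^-1 = z ^+ 3.
Proof. by apply: (mulIf (lt0r_neq0 Nr)); rewrite zN mulVf // gt_eqF. Qed.

Lemma cube_le (a b : R) : 0 <= b -> a ^+ 3 <= b ^+ 3 -> a <= b.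
Proof. by move=> b0 h; have [//|l] := leP a b; move: h; rewrite leNgt ltrXn2r // (ltW (le_lt_trans b0 l)) ?orbT. Qed.

Lemma t_one : j = 1%N -> t = 1.
Proof.
move=> je; have h : t ^+ 3 = 1 by rewrite tj je.
by apply/eqP; rewrite eq_le t1 andbT; apply: cube_le; rewrite ?h ?expr1n.
Qed.

(** j / N is close to nu(X), which is at most a multiple of X^(3/2); cube roots are then taken, t
    and z being those of j and 1/N. For j = 1 the tolerance 1/N in [Xloc] would consume all of j /
    N. *)
Lemma loc_scale : (2 <= j)%N -> t * z <= G * Num.sqrt X.
Proof.
case: Xloc => [[_ ->] //|[Xp h]] j2; have Xq := X4; have d0 := dl0.
have X4' : X < 4 by have := tt0; lra.
have le1 := nu_le tt0 tt1 s0 s1 sgP Xp X4' Xsoft.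
have g := Gt2; have jr : 2 <= j%:R :> R by rewrite (ler_nat _ 2).
apply: cube_le; first by rewrite mulr_ge0 ?sqrtr_ge0 // ltW.
rewrite !exprMn tj -Niz.
have sX : Num.sqrt X ^+ 2 = X by rewrite sqr_sqrtr // ltW.
have s3 : Num.sqrt X ^+ 3 = Num.sqrt X * X by rewrite exprS sX.
have q0 : 0 <= Num.sqrt X * X by rewrite mulr_ge0 ?sqrtr_ge0 // ltW.
have l2 : j%:R / N%:R - nu s sg X <= 1 / N%:R by apply: le_trans h; rewrite distrC ler_norm.
have iN : 0 < N%:R^-1 :> R by rewrite invr_gt0.
have l3 : 2 * N%:R^-1 <= j%:R * N%:R^-1 :> R by rewrite ler_wpM2r // ltW.
have l4 := ler_wpM2r q0 g.
have l5 : G * (Num.sqrt X * X) <= G ^+ 3 * (Num.sqrt X * X).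
  by rewrite ler_wpM2r // exprS ler_peMr ?(ltW Gp) // exprn_ege1.
rewrite s3; move: l2 l3 l4 l5 le1; rewrite -[2 / tt ^+ 2 * _ * X]mulrA.
rewrite (_ : 4 / tt ^+ 2 * (Num.sqrt X * X) = 2 * (2 / tt ^+ 2 * (Num.sqrt X * X))); last by ring.
rewrite div1r; set a := j%:R / _; set b := N%:R^-1; set cc := 2 / tt ^+ 2 * _.
lra.
Qed.

(** Either t is at most G^50 and dl is large enough, or X is ([X_large_t]); in both cases X + dl is
    far enough from the edge for counting. *)
Lemma dl_small_t : t <= G ^+ 50 -> G ^+ 10 * z ^+ 2 <= dl.
Proof.
move=> h; rewrite dlE ler_pdivlMr // mulrAC (_ : 60%N = (10 + 50)%N) // exprD.
by rewrite ler_wpM2r ?sqr_ge0 // ler_wpM2l // exprn_ge0 // ltW.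
Qed.

Lemma X_large_t : G ^+ 50 < t -> G ^+ 10 * z ^+ 2 <= X.
Proof.
move=> h; have j2 : (2 <= j)%N.
  case/andP: hj => j1 _; rewrite leqNgt; apply/negP => jl.
  have je : j = 1%N by apply/eqP; rewrite eqn_leq -ltnS jl.
  by move: h; rewrite (t_one je) ltNge exprn_ege1.
have l := loc_scale j2; rewrite -(sqr_sqrtr X0).
have : (G ^+ 50 * z) ^+ 2 <= (G * Num.sqrt X) ^+ 2.
  apply: lerXn2r; rewrite ?nnegrE ?mulr_ge0 ?exprn_ge0 ?sqrtr_ge0 ?(ltW z0) ?(ltW Gp) //.
  by apply: le_trans l; rewrite ler_wpM2r ?(ltW z0) // ltW.
rewrite (_ : (G ^+ 50 * z) ^+ 2 = G ^+ 2 * (G ^+ 98 * z ^+ 2)); last by ring.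
rewrite [(G * _) ^+ 2]exprMn ler_pM2l ?exprn_gt0 //.
apply: le_trans; rewrite ler_wpM2r ?sqr_ge0 // ler_weXn2l //.
Qed.

Lemma G6_G10 : 4 * (G ^+ 6 * z ^+ 2) <= G ^+ 10 * z ^+ 2.
Proof.
rewrite mulrA ler_wpM2r ?sqr_ge0 // (_ : 10%N = (1 + 3 + 6)%N) // !exprD ler_wpM2r ?exprn_ge0 ?(ltW Gp) //.
by have := G400; have : 1 <= G ^+ 3 by [rewrite exprn_ege1]; rewrite expr1 => h1 h2; apply: (@le_trans _ _ (G * 1)); [lra | rewrite ler_wpM2l // ltW].
Qed.

Lemma up_countable : countable_at (X + dl).
Proof.
have g := G6_G10; have d0 := dl0; have Xn := X0; have X4' := X4; have zt := ztt.
have z20 : 0 <= G ^+ 6 * z ^+ 2 by apply: mulr_ge0; [rewrite exprn_ge0 // ltW | exact: sqr_ge0].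
rewrite /countable_at le_min; apply/andP; split; last by lra.
have [h|h] := leP t (G ^+ 50); first by have := dl_small_t h; lra.
by have := X_large_t h; lra.
Qed.

(** A step of at most dl towards the edge, but never more than halfway, so that counting remains
    available. *)
Definition down_point := X - Num.min dl (X / 2).

Lemma down_min : dl / 2 < X -> [/\ 0 < Num.min dl (X / 2), Num.min dl (X / 2) <= dl, Num.min dl (X / 2) <= X / 2 & dl / 4 <= Num.min dl (X / 2)].
Proof.
move=> h; have d0 := dl0; split; rewrite ?lt_min ?ge_min ?le_min ?lexx ?orbT //.
  by apply/andP; split; lra.
by apply/andP; split; lra.
Qed.

Lemma down_countable : dl / 2 < X -> countable_at down_point.
Proof.
move=> hX; have [m0 m1 m2 m3] := down_min hX; rewrite /countable_at /down_point.
have g := G6_G10; have d0 := dl0; have X4' := X4; have zt := ztt.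
have z20 : 0 <= G ^+ 6 * z ^+ 2 by apply: mulr_ge0; [rewrite exprn_ge0 // ltW | exact: sqr_ge0].
rewrite le_min; apply/andP; split; last by lra.
have [h|h] := leP t (G ^+ 50); first by have := dl_small_t h; lra.
by have := X_large_t h; lra.
Qed.

Lemma sqrt_low b : 0 <= b -> Num.sqrt b / G <= Num.sqrt (tt * b / 2) / 32.
Proof.
move=> b0; have g := Gt; have t0 := tt0; have g4 := G400.
apply: sqr_le_le; first by rewrite divr_ge0 ?sqrtr_ge0.
rewrite !expr_div_n !sqr_sqrtr ?divr_ge0 ?mulr_ge0 ?(ltW t0) //.
rewrite (_ : tt * b / 2 / 32 ^+ 2 = b * (tt / 2048)); last by field.
rewrite ler_wpM2l //; move: g; rewrite ler_pdivrMr // => g.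
rewrite -[X in X <= _]mul1r ler_pdivrMr ?exprn_gt0 //; rewrite expr2; nra.
Qed.

Lemma dl_gap x : t * z <= G * x -> 0 <= x -> G ^+ 58 / N%:R <= dl * (x / G).
Proof.
move=> h x0; rewrite Niz dlE (_ : G ^+ 60 * z ^+ 2 / t * (x / G) = G ^+ 58 * z ^+ 2 / t * (G * x)); last first.
  by field; rewrite !gt_eqF.
rewrite (_ : G ^+ 58 * z ^+ 3 = G ^+ 58 * z ^+ 2 / t * (t * z)); last by field; rewrite gt_eqF.
by rewrite ler_wpM2l // divr_ge0 ?mulr_ge0 ?exprn_ge0 ?(ltW Gp) ?(ltW z0) // ltW.
Qed.

Lemma G_gap : 16 * (G ^+ 8 + 1) < G ^+ 58.
Proof.
have g1 : 1 <= G ^+ 8 by rewrite exprn_ege1.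
have g2 : 1 <= G ^+ 49 by rewrite exprn_ege1.
rewrite (_ : 58%N = (8 + (1 + 49))%N) // exprD exprD expr1; apply: (@lt_le_trans _ _ (G ^+ 8 * (400 * 1))); first by lra.
rewrite ler_wpM2l ?exprn_ge0 ?(ltW Gp) // mulr1; apply: (@le_trans _ _ (G * 1)); first by have := G400; lra.
by rewrite ler_wpM2l // ltW.
Qed.

(** Otherwise at most j - 1 points would lie within X + dl of the edge, while nu grows by dl sqrt(X
    + dl) / (2 G) >= G^58 / (2 N) on the way there, far more than the counting error G^8 / N. *)
Lemma rigid_up : counted (X + dl) -> Y j <= X + dl.
Proof.
move=> ct; rewrite leNgt; apply/negP => hY.
have h1 := sum_sg_lt hj mono hY; have d0 := dl0; have Xn := X0; have t0 := tt0.
have b0 : 0 < X + dl by lra.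
have b4 : X + dl < 4 by have := X4; lra.
have sc : t * z <= G * Num.sqrt (X + dl).
  have [j2|j2] := leqP 2 j.
    apply: (le_trans (loc_scale j2)); rewrite ler_wpM2l ?(ltW Gp) // ler_sqrt ?(ltW b0) //; lra.
  have te : t = 1 by apply: t_one; apply/eqP; rewrite eqn_leq -ltnS j2; case/andP: hj.
  rewrite te mul1r; apply: (@le_trans _ _ (1 * Num.sqrt (X + dl))); last by rewrite ler_wpM2r ?sqrtr_ge0.
  rewrite mul1r; apply: sqr_le_le; rewrite ?sqrtr_ge0 // sqr_sqrtr ?(ltW b0) //.
  apply: (@le_trans _ _ dl); last by lra.
  by rewrite dlE te divr1 ler_peMl ?sqr_ge0 // exprn_ege1.
have gap := dl_gap sc (sqrtr_ge0 _); have low := sqrt_low (ltW b0).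
have lowd : dl / 2 * (Num.sqrt (X + dl) / G) <= dl / 2 * (Num.sqrt (tt * (X + dl) / 2) / 32).
  by rewrite ler_wpM2l // divr_ge0 // ltW.
have nb : (j%:R - 1) / N%:R + dl / 2 * (Num.sqrt (X + dl) / G) <= nu s sg (X + dl).
  case: Xloc => [[XE jE]|[Xp hX]].
    have := nu_ge tt0 s0 s1 sgP b0 X4; rewrite jE subrr mul0r add0r; apply: le_trans.
    by move: lowd; rewrite XE add0r.
  have := nu_lower tt0 s0 s1 sgP Xp (_ : X <= X + dl) X4; rewrite lerDl (ltW d0) => /(_ isT).
  rewrite (_ : X + dl - X = dl); last by ring.
  have l2 : j%:R / N%:R - nu s sg X <= 1 / N%:R by apply: le_trans hX; rewrite distrC ler_norm.
  rewrite mulrBl; move: l2 lowd; set a := j%:R / _; set b := 1 / _; lra.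
have l3 : nu s sg (X + dl) - ((\sum_(1 <= k < N.+1) Num.sg (X + dl - Y k)) / (2 * N%:R) + 1 / 2) <= G ^+ 8 / N%:R.
  by apply: le_trans ct; rewrite distrC ler_norm.
have l4 : (\sum_(1 <= k < N.+1) Num.sg (X + dl - Y k)) / (2 * N%:R) + 1 / 2 <= (j%:R - 1) / N%:R.
  rewrite (_ : (j%:R - 1) / N%:R = (2 * j%:R - 2 - N%:R) / (2 * N%:R) + 1 / 2); last by field; rewrite gt_eqF.
  by rewrite lerD2r ler_wpM2r ?invr_ge0 ?mulr_ge0 ?(ltW Nr) // -natrM.
have g2 : 16 * (G ^+ 8 + 1) / N%:R < G ^+ 58 / N%:R by rewrite ltr_pM2r ?invr_gt0 // G_gap.
have iN : 0 < N%:R^-1 :> R by rewrite invr_gt0.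
have e1 : dl / 2 * (Num.sqrt (X + dl) / G) = dl * (Num.sqrt (X + dl) / G) / 2 by rewrite mulrAC.
have e2 : 16 * (G ^+ 8 + 1) / N%:R = 16 * (G ^+ 8 / N%:R) + 16 * N%:R^-1 by ring.
have p8 : 0 <= G ^+ 8 / N%:R by rewrite divr_ge0 ?exprn_ge0 ?(ltW Gp) ?(ltW Nr).
move: nb l3 l4 g2 gap; rewrite e1 e2; move: iN p8; set q := dl * _; lra.
Qed.

(** For X > dl / 2 this mirrors [rigid_up] at [down_point]. For X <= dl / 2 the index is small, t <=
    G^21, and the absence of eigenvalues outside the spectrum already gives the bound. *)
Lemma rigid_down : - (2 * (G ^+ 30 * z ^+ 2)) <= Y j -> (dl / 2 < X -> counted down_point) -> X - dl <= Y j.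
Proof.
move=> ex ct; have d0 := dl0; have [hX|hX] := ltP (dl / 2) X; last first.
  apply: le_trans ex.
  have t21 : t <= G ^+ 21.
    have [j2|j2] := leqP 2 j; last first.
      by rewrite t_one ?exprn_ege1 //; apply/eqP; rewrite eqn_leq -ltnS j2; case/andP: hj.
    have l := loc_scale j2; apply: cube_le; first by rewrite exprn_ge0 // ltW.
    have l2 : (t * z) ^+ 2 <= (G * Num.sqrt X) ^+ 2.
      by apply: lerXn2r; rewrite ?nnegrE ?mulr_ge0 ?sqrtr_ge0 ?(ltW z0) ?(ltW Gp) ?(ltW tp).
    rewrite [(t * z) ^+ 2]exprMn [(G * _) ^+ 2]exprMn sqr_sqrtr // in l2.
    have l3 : t ^+ 2 * z ^+ 2 <= G ^+ 2 * (G ^+ 60 * z ^+ 2 / t).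
      by apply: (le_trans l2); rewrite ler_wpM2l ?sqr_ge0 // -dlE; lra.
    rewrite (_ : G ^+ 2 * (G ^+ 60 * z ^+ 2 / t) = G ^+ 62 / t * z ^+ 2) in l3; last by field; rewrite gt_eqF.
    rewrite ler_pM2r ?exprn_gt0 // ler_pdivlMr // -exprSr in l3.
    by apply: (le_trans l3); rewrite -exprM ler_weXn2l.
  suff : 2 * (G ^+ 30 * z ^+ 2) <= dl / 2 by lra.
  rewrite dlE (_ : G ^+ 60 * z ^+ 2 / t / 2 = (G ^+ 60 * z ^+ 2) / (t * 2)); last by field; rewrite gt_eqF.
  rewrite ler_pdivlMr ?mulr_gt0 // (_ : 2 * (G ^+ 30 * z ^+ 2) * (t * 2) = 4 * (G ^+ 30 * t) * z ^+ 2); last by ring.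
  rewrite ler_wpM2r ?sqr_ge0 // (_ : 60%N = (30 + (21 + (1 + 8)))%N) // exprD mulrCA ler_wpM2l ?exprn_ge0 ?(ltW Gp) //.
  rewrite exprD mulrC; apply: ler_pM => //; first by rewrite ltW.
  rewrite exprS; have := G400; have g1 : 1 <= G ^+ 8 by rewrite exprn_ege1.
  by move=> g; apply: (@le_trans _ _ (G * 1)); [lra | rewrite ler_wpM2l // ltW].
have [m0 m1 m2 m3] := down_min hX; rewrite leNgt; apply/negP => hY.
have hY' : Y j < down_point by apply: (lt_le_trans hY); rewrite /down_point lerD2l lerN2.
have := ct hX; rewrite /counted; have h1 := sum_sg_gt hj mono hY'.
have t0 := tt0.
have Xp : 0 < X by lra.
case: Xloc => [[XE _]|[_ hloc]]; first by move: Xp; rewrite XE ltxx.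
have a0 : 0 < down_point by rewrite /down_point; lra.
have aX : down_point <= X by rewrite /down_point; lra.
have X4' : X <= 4 - tt by have := X4; lra.
have sc : t * z <= G * Num.sqrt X.
  have [j2|j2] := leqP 2 j; first exact: loc_scale j2.
  have te : t = 1 by apply: t_one; apply/eqP; rewrite eqn_leq -ltnS j2; case/andP: hj.
  rewrite te mul1r; apply: sqr_le_le; first by rewrite mulr_ge0 ?sqrtr_ge0 // ltW.
  rewrite exprMn sqr_sqrtr ?(ltW Xp) //.
  apply: (@le_trans _ _ (1 * dl)).
    by rewrite mul1r dlE te divr1 ler_peMl ?sqr_ge0 // exprn_ege1.
  apply: (@le_trans _ _ (G ^+ 2 / 2 * dl)); last by rewrite mulrAC -mulrA ler_wpM2l ?sqr_ge0 // ltW.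
  by rewrite ler_wpM2r ?(ltW d0) // expr2; have := G400; nra.
have gap := dl_gap sc (sqrtr_ge0 _); have low := sqrt_low (ltW Xp).
have nX := nu_lower tt0 s0 s1 sgP a0 aX X4'.
have nb : dl / 8 * (Num.sqrt X / G) <= nu s sg X - nu s sg down_point.
  apply: le_trans nX; apply: ler_pM; rewrite ?divr_ge0 ?sqrtr_ge0 ?(ltW d0) ?(ltW Gp) //.
  by rewrite /down_point; lra.
have l2 : nu s sg X - j%:R / N%:R <= 1 / N%:R by apply: le_trans hloc; rewrite ler_norm.
have l4 : j%:R / N%:R <= (\sum_(1 <= k < N.+1) Num.sg (down_point - Y k)) / (2 * N%:R) + 1 / 2.
  rewrite (_ : j%:R / N%:R = (2 * j%:R - N%:R) / (2 * N%:R) + 1 / 2); last by field; rewrite gt_eqF.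
  by rewrite lerD2r ler_wpM2r ?invr_ge0 ?mulr_ge0 ?(ltW Nr) // -natrM.
move=> /(le_trans (ler_norm _)) l3.
have g2 : 16 * (G ^+ 8 + 1) / N%:R < G ^+ 58 / N%:R by rewrite ltr_pM2r ?invr_gt0 // G_gap.
have e1 : dl / 8 * (Num.sqrt X / G) = dl * (Num.sqrt X / G) / 8 by rewrite mulrAC.
have e2 : 16 * (G ^+ 8 + 1) / N%:R = 16 * (G ^+ 8 / N%:R) + 16 * (1 / N%:R) by ring.
have p8 : 0 <= G ^+ 8 / N%:R by rewrite divr_ge0 ?exprn_ge0 ?(ltW Gp) ?(ltW Nr).
have p1 : 0 < 1 / N%:R :> R by rewrite divr_gt0.
move: nb l3 l4 g2 gap l2; rewrite e1 e2; move: p1 p8; set q := dl * _; lra.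
Qed.

End Rigidity.

(** * Spectral bounds and Weyl's inequality *)

Section SpectralBounds.
Variable R : realType.
Local Notation C := R[i].
Local Open Scope complex_scope.

(** Sylvester's determinant identity: one block matrix is triangularized by multiplication on the
    right in two ways. *)
Lemma char_poly_mulC (F : fieldType) m n (A : 'M[F]_(m, n)) (B : 'M[F]_(n, m)) :
  char_poly (A *m B) * 'X^n = 'X^m * char_poly (B *m A).
Proof.
pose A' := map_mx polyC A; pose B' := map_mx polyC B.
have e1 : block_mx 'X%:M A' B' 1%:M *m block_mx 1%:M 0 (- B') 1%:M =
    block_mx (char_poly_mx (A *m B)) A' 0 1%:M.
  rewrite mulmx_block !mulmx1 !mulmx0 !mul1mx !add0r mulmxN /char_poly_mx map_mxM.
  by rewrite /= -/A' -/B' subrr.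
have e2 : block_mx 'X%:M A' B' 1%:M *m block_mx 1%:M (- A') 0 'X%:M =
    block_mx 'X%:M 0 B' (char_poly_mx (B *m A)).
  rewrite mulmx_block !mulmx1 !mulmx0 !addr0 mul1mx !mulmxN /char_poly_mx map_mxM /= -/A' -/B'.
  by rewrite mul_scalar_mx mul_mx_scalar addNr [- _ + _]addrC.
have := congr1 (@determinant _ _) e1; rewrite det_mulmx det_lblock !det1 mulr1 mulr1 det_ublock det1 mulr1 => d1.
have := congr1 (@determinant _ _) e2; rewrite det_mulmx det_ublock det1 mul1r det_lblock !det_scalar d1.
by rewrite /char_poly.
Qed.

Lemma dot_sqr_le n (x y : 'cV[C]_n) : nrm ((adjm x *m y) 0 0) ^+ 2 <= frob2 x * frob2 y.
Proof.
set v := (adjm x *m y) 0 0; have [v0|v0] := eqVneq (nrm v) 0.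
  by rewrite v0 expr0n mulr_ge0 ?frob2_ge0.
have vp : 0 < nrm v by rewrite lt_neqAle eq_sym v0 nrm_ge0.
have x0 := frob2_ge0 x; have y0 := frob2_ge0 y.
have [xz|xz] := eqVneq (frob2 x) 0.
  have := nrm_dot_le x y (_ : 0 < (frob2 y + 1) / nrm v); rewrite divr_gt0 ?xz ?mulr0 ?add0r; try lra.
  move=> /(_ isT); rewrite -/v invf_div => h.
  have : nrm v / (frob2 y + 1) * frob2 y <= nrm v.
    by rewrite mulrAC ler_pdivrMr ?ler_wpM2l; lra.
  lra.
have xp : 0 < frob2 x by rewrite lt_neqAle eq_sym xz.
have := nrm_dot_le x y (_ : 0 < nrm v / frob2 x); rewrite divr_gt0 // => /(_ isT).
rewrite -/v invf_div mulfVK // => h.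
have : nrm v * nrm v <= frob2 x * frob2 y; last by rewrite -expr2.
have h2 : nrm v <= frob2 x / nrm v * frob2 y by lra.
by have := ler_wpM2r (ltW vp) h2; rewrite [frob2 x / _ * _]mulrAC divfK.
Qed.

Lemma frob2_mul_cv m n (A : 'M[C]_(m, n)) (x : 'cV[C]_n) : frob2 (A *m x) <= frob2 A * frob2 x.
Proof.
rewrite {1 2}/frob2 mulr_suml; apply: ler_sum => i _; rewrite big_ord1.
have h := dot_sqr_le (adjm (row i A)) x; rewrite frob2_adj adjmK in h.
have -> : (A *m x) i ord0 = (row i A *m x) 0 0 by rewrite -row_mul [RHS]mxE.
apply: (le_trans h); rewrite ler_wpM2r ?frob2_ge0 // /frob2 big_ord1.
by apply: ler_sum => j _; rewrite mxE.
Qed.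

Lemma frob2_gt0 m n (A : 'M[C]_(m, n)) : A != 0 -> 0 < frob2 A.
Proof.
apply: contraNT; rewrite -leNgt => h; apply/eqP/matrixP => i j; rewrite [RHS]mxE.
apply/eqP; rewrite -nrm_eq0 -sqrf_eq0 eq_le sqr_ge0 andbT; apply: le_trans h.
rewrite /frob2 (bigD1 i) //= (bigD1 j) //= -addrA lerDl addr_ge0 ?sumr_ge0 // => k _; first by rewrite sqr_ge0.
by rewrite sumr_ge0 // => l _; rewrite sqr_ge0.
Qed.

Lemma spectrum_bound M N (A : 'M[C]_(M, N)) lam k : nontrivial_spectrum N (gram A) lam ->
  (1 <= k <= N)%N -> 0 <= lam k <= frob2 A.
Proof.
move=> [hc _] hk.
have : eigenvalue (gram A) ((lam k)%:C).
  rewrite eigenvalue_root_char hc subnn expr0 mul1r.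
  rewrite (big_rem k) /=; last by rewrite mem_index_iota ltnS.
  by rewrite rootM root_XsubC eqxx.
move=> /eigenvalueP [v hv v0]; pose x := adjm v.
have xv : adjm x = v by rewrite /x adjmK.
have x0 : 0 < frob2 x by rewrite frob2_adj; exact: frob2_gt0.
have e : frob2 (A *m x) = lam k * frob2 x.
  have : (frob2 (A *m x))%:C = (lam k * frob2 x)%:C.
    rewrite frob2_cv adjmM xv mulmxA -(mulmxA v) -[adjm A *m A]/(gram A) hv -scalemxAl scalemxE.
    by rewrite rmorphM /= frob2_cv xv.
  by case.
have h := frob2_mul_cv A x; rewrite e ler_pM2r // in h.
by rewrite h andbT -(pmulr_lge0 _ x0) -e frob2_ge0.
Qed.

Lemma hermitian_diagonalization n (A : 'M[C]_n) : hermit A -> exists P (d : 'I_n -> C),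
  [/\ char_poly A = \prod_i ('X - (d i)%:P), (forall x : 'cV[C]_n, frob2 (P *m x) = frob2 x)
    & forall x : 'cV[C]_n, qf A x x = \sum_i d i * (nrm ((P *m x) i 0) ^+ 2)%:C].
Proof.
move=> hA; have /spectral.orthomx_spectralP eA := hermit_normal hA.
set P := spectral.spectralmx A in eA; pose d := spectral.spectral_diag A.
have uP : P \is spectral.unitarymx by exact: spectral.spectral_unitarymx.
have iP : invmx P = adjm P.
  by rewrite (spectral.invmx_unitary uP); apply/matrixP => i j; rewrite !mxE.
have PP : adjm P *m P = 1%:M by rewrite -iP mulVmx // spectral.spectral_unit.
exists P, (fun i => d 0 i); split.
- rewrite {1}eA char_poly_simil ?spectral.spectral_unit // char_poly_trig; last exact: diag_mx_is_trig.
  by apply: eq_bigr => i _; rewrite mxE eqxx mulr1n.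
- move=> x; have : (frob2 (P *m x))%:C = (frob2 x)%:C; last by case.
  by rewrite !frob2_cv adjmM mulmxA -(mulmxA _ _ P) PP mulmx1.
- move=> x; rewrite /qf {1}eA iP !mulmxA -adjmM -!mulmxA mxE.
  apply: eq_bigr => i _; rewrite mul_diag_mx [X in _ * X]mxE adjmE mulrCA mulJ //.
Qed.

Lemma qf_entries_le n (D : 'M[C]_n) (x : 'cV[C]_n) e : (forall i j, nrm (D i j) <= e) ->
  nrm (qf D x x) <= n%:R * e * frob2 x.
Proof.
move=> hD; rewrite qfE.
have fx : frob2 x = \sum_i nrm (x i 0) ^+ 2 by rewrite /frob2; apply: eq_bigr => i _; rewrite big_ord1.
apply: (@le_trans _ _ (\sum_i \sum_j e * ((nrm (x i 0) ^+ 2 + nrm (x j 0) ^+ 2) / 2))).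
  apply: (le_trans (nrm_sum _ _ _)); apply: ler_sum => i _; apply: (le_trans (nrm_sum _ _ _)); apply: ler_sum => j _.
  rewrite !nrmM nrmJ mulrAC mulrC; apply: ler_pM; rewrite ?mulr_ge0 ?nrm_ge0 //.
  have := sqr_ge0 (nrm (x i 0) - nrm (x j 0)); rewrite sqrrB; move: (nrm _) (nrm _) => a b; lra.
rewrite le_eqVlt; apply/orP; left; apply/eqP.
under eq_bigr do rewrite -mulr_sumr -mulr_suml big_split /= sumr_const card_ord -fx.
rewrite -mulr_sumr -mulr_suml big_split /= sumr_const card_ord.
under eq_bigr do rewrite -mulr_natl.
by rewrite -mulr_sumr -fx -mulr_natl; field.
Qed.

(** A dimension count: the linear conditions number n - |I| + |J|, which is less than n. *)
Lemma common_null_vector n (P Q : 'M[C]_n) (I J : {set 'I_n}) : (#|J| < #|I|)%N ->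
  exists2 x : 'cV[C]_n, x != 0 & (forall i, i \notin I -> (P *m x) i 0 = 0) /\ (forall i, i \in J -> (Q *m x) i 0 = 0).
Proof.
move=> JI; pose Z := col_mx (rowsub (fun a : 'I_#|~: I| => enum_val a) P) (rowsub (fun a : 'I_#|J| => enum_val a) Q).
have rZ : (\rank Z < n)%N.
  apply: (leq_ltn_trans (rank_leq_row Z)); rewrite cardsCs finset.setCK card_ord.
  by have := max_card I; rewrite card_ord; lia.
have : kermx Z^T != 0 by rewrite -mxrank_eq0 mxrank_ker mxrank_tr subn_eq0 -ltnNge.
move=> /rowV0Pn [v /sub_kermxP hv v0]; exists v^T.
  by apply: contraNneq v0 => h; rewrite -[v]trmxK h trmx0.
have hz : Z *m v^T = 0 by rewrite -[Z]trmxK -trmx_mul hv trmx0.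
rewrite /Z mul_col_mx in hz.
have : (rowsub (fun a : 'I_#|~: I| => enum_val a) P *m v^T = 0) /\ (rowsub (fun a : 'I_#|J| => enum_val a) Q *m v^T = 0).
  by apply: eq_col_mx; rewrite hz col_mx0.
have rs k (f : 'I_k -> 'I_n) (S : 'M[C]_n) a : (rowsub f S *m v^T) a 0 = (S *m v^T) (f a) 0.
  by rewrite !mxE; apply: eq_bigr => l _; rewrite !mxE.
case=> h1 h2; split => i hi.
  have iI : i \in ~: I by rewrite inE.
  by have := rs _ (fun a : 'I_#|~: I| => enum_val a) P (enum_rank_in iI i); rewrite h1 mxE enum_rankK_in.
by have := rs _ (fun a : 'I_#|J| => enum_val a) Q (enum_rank_in hi i); rewrite h2 mxE enum_rankK_in.
Qed.

Lemma count_spectrum n (A : 'M[C]_n) lam (d : 'I_n -> C) x : nontrivial_spectrum n A lam ->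
  char_poly A = \prod_i ('X - (d i)%:P) ->
  #|[set i : 'I_n | x <= complex.Re (d i)]%SET| = count (fun k => x <= lam k) (index_iota 1 n.+1).
Proof.
move=> [hc _] hd; rewrite subnn expr0 mul1r in hc.
have hp : perm_eq [seq d i | i <- index_enum 'I_n] [seq (lam k)%:C | k <- index_iota 1 n.+1].
  by apply: prod_XsubC_eq; rewrite !big_map -hc hd.
have /permP/(_ (fun w => x <= complex.Re w)) := hp; rewrite !count_map => <-.
by rewrite cardsE cardE /enum_mem size_filter /index_enum; apply: eq_count => i; rewrite !inE.
Qed.

(** The Courant-Fischer argument: if the bound failed, a vector in the span of eigenvectors of A
    with eigenvalue at least [lam k], without component along the fewer than k eigenvectors of B
    above y, would give A - B too large a form. *)
Lemma weyl_le n (A B : 'M[C]_n) lam mu e k : hermit A -> hermit B ->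
  nontrivial_spectrum n A lam -> nontrivial_spectrum n B mu ->
  (forall i j, nrm ((A - B) i j) <= e) -> (1 <= k <= n)%N -> lam k <= mu k + n%:R * e.
Proof.
move=> hA hB sA sB hD /andP[k1 kn]; rewrite leNgt; apply/negP => hlt.
have [P [d [cA nP qA]]] := hermitian_diagonalization hA.
have [Q [f [cB nQ qB]]] := hermitian_diagonalization hB.
pose y := (lam k - n%:R * e + mu k) / 2.
have y1 : mu k < y by rewrite /y; lra.
have y2 : y + n%:R * e < lam k by rewrite /y; lra.
have cI : (k <= #|[set i : 'I_n | (lam k <= complex.Re (d i))%R]%SET|)%N.
  rewrite (count_spectrum _ sA cA) /index_iota subn1 /= -(subnKC kn) iotaD count_cat.
  rewrite (_ : count _ (iota 1 k) = k) ?leq_addr // -[RHS](size_iota 1 k); apply/eqP; rewrite -all_count.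
  by apply/allP => a; rewrite mem_iota add1n ltnS => /andP[a1 ak]; case: sA => _; apply.
have cJ : (#|[set i : 'I_n | (y <= complex.Re (f i))%R]%SET| < k)%N.
  have en : n = (k.-1 + (n - k.-1))%N by lia.
  rewrite (count_spectrum _ sB cB) /index_iota subn1 /= [X in iota 1 X]en iotaD count_cat.
  rewrite [X in (_ + X)%N](_ : _ = 0%N) ?addn0.
    by rewrite -[ltnRHS](prednK k1) ltnS -{2}(size_iota 1 k.-1) count_size.
  apply/eqP; rewrite -leqn0 leqNgt -has_count; apply/hasPn => a; rewrite mem_iota add1n prednK // => /andP[a1 ak].
  rewrite -ltNge; apply: le_lt_trans y1; case: sB => _; apply => //.
  by move: ak k1 kn; clear; lia.
have [x x0 [x1 x2]] := common_null_vector P Q (leq_trans cJ cI).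
have fx : 0 < frob2 x by exact: frob2_gt0.
have lowA : lam k * frob2 x <= complex.Re (qf A x x).
  rewrite qA cRe_sum -nP /frob2 mulr_sumr; apply: ler_sum => i _; rewrite big_ord1 [in leRHS]mulrC cReZ.
  have [hi|hi] := boolP (i \in [set i : 'I_n | lam k <= complex.Re (d i)]%SET); last by rewrite x1 // nrm0 expr0n /= mulr0 mul0r.
  by rewrite mulrC ler_wpM2l ?sqr_ge0 //; move: hi; rewrite inE.
have upB : complex.Re (qf B x x) <= y * frob2 x.
  rewrite qB cRe_sum -nQ /frob2 mulr_sumr; apply: ler_sum => i _; rewrite big_ord1 [in leLHS]mulrC cReZ.
  have [hi|hi] := boolP (i \in [set i : 'I_n | y <= complex.Re (f i)]%SET); first by rewrite x2 // nrm0 expr0n mulr0 mul0r.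
  by rewrite mulrC ler_wpM2r ?sqr_ge0 //; move: hi; rewrite inE -ltNge => /ltW.
have qD : complex.Re (qf A x x) = complex.Re (qf B x x) + complex.Re (qf (A - B) x x).
  by rewrite -cReD /qf mulmxBr mulmxBl submxE addrC subrK.
have := qf_entries_le x hD; have := Re_le_nrm (qf (A - B) x x).
have : (y + n%:R * e) * frob2 x < lam k * frob2 x by rewrite ltr_pM2r.
rewrite mulrDl; move: lowA upB; rewrite qD; lra.
Qed.

Lemma weyl n (A B : 'M[C]_n) lam mu e k : hermit A -> hermit B ->
  nontrivial_spectrum n A lam -> nontrivial_spectrum n B mu ->
  (forall i j, nrm ((A - B) i j) <= e) -> (1 <= k <= n)%N -> `|lam k - mu k| <= n%:R * e.
Proof.
move=> hA hB sA sB hD hk; have h1 := weyl_le hA hB sA sB hD hk.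
have h2 : mu k <= lam k + n%:R * e.
  by apply: (weyl_le hB hA sB sA) => // i j; rewrite -opprB mxE nrmN.
by rewrite ler_norml; apply/andP; split; lra.
Qed.
End SpectralBounds.

(** With b and d in the role of 1 / tt and 1 / tt^2, one threshold implies every largeness condition
    on G, by linear arithmetic. *)
Lemma large_threshold (R : realType) (a b d G : R) : 4000 * d + 24 + 2 * a <= G -> 1 <= b -> b <= d -> 0 <= a ->
  [/\ 400 <= G, 1024 * b <= G, 4 * d <= G, 480 * d <= G & 584 * d + 24 + 2 * a <= G] /\
  128 + 12 * b + 8 * d + 6 * (36 * d + 1) <= G.
Proof. by move=> *; split; [split; lra | lra]. Qed.

(** * Deterministic rigidity on the good event *)

Section GoodOutcome.
Variable R : realType.
Local Notation C := R[i].
Local Open Scope complex_scope.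
Variables (tt : R) (B e M N j : nat) (s G z t xi dl sg : R).

(* Distance of the eigenvalues to the spectral edge at which sg points, in increasing order. *)
Definition edge_gap (lam : nat -> R) (k : nat) : R :=
  2 - sg * ycen s lam (if sg == 1 then k else (N.+1 - k)%N).

(** A grid of distances outside the spectrum. Its mesh z^2 does not exceed the exclusion radius z^2
    (1 + kap), so the excluded intervals leave no gap. *)
Definition excl_kap (i : nat) : R := G ^+ 30 * z ^+ 2 + i%:R * z ^+ 2.

Definition cnt_badray (x : R) (A : 'M[C]_(M, N)) : bool :=
  badray B s G (sg * (2 - x)) (G ^+ 7 / (N%:R * Num.sqrt (Num.min x (4 - x)))) A.

Definition excl_badray (A : 'M[C]_(M, N)) (i : nat) : bool :=
  (2 + excl_kap i <= N%:R ^+ B) && badray B s G (sg * (2 + excl_kap i)) (z ^+ 2 * (1 + excl_kap i)) A.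

Definition bad_outcome (A : 'M[C]_(M, N)) : bool :=
  [|| N%:R ^+ B < frob2 A, has (excl_badray A) (iota 0 (N ^ B.+1).+1),
      cnt_badray (xi + dl) A | (dl / 2 < xi) && cnt_badray (down_point xi dl) A].

Hypotheses (tt0 : 0 < tt) (tt1 : tt <= 1) (N0 : (0 < N)%N) (NM : (N <= M)%N) (s0 : 0 < s) (s1 : s <= 1).
Hypotheses (z0 : 0 < z) (zN : z ^+ 3 * N%:R = 1).
Hypothesis regime : sg = 1 \/ (sg = -1 /\ s <= 1 - tt / 2).
Hypothesis GK : 4000 / tt ^+ 2 + 24 + 2 * (e * (B + 2))%:R <= G.
Hypotheses (nG : N%:R <= G ^+ e) (B1 : (0 < B)%N) (GN : G ^+ 60 <= N%:R) (sB : s^-1 + s <= N%:R ^+ B).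
Hypotheses (t1 : 1 <= t) (tj : t ^+ 3 = j%:R) (hj : (1 <= j <= N)%N).
Hypotheses (dlE : dl = G ^+ 60 * z ^+ 2 / t) (xi4 : xi + dl <= 4 - tt) (xi0 : 0 <= xi).
Hypothesis xiloc : (xi = 0 /\ j = 1%N) \/ (0 < xi /\ `|nu s sg xi - j%:R / N%:R| <= 1 / N%:R).

Lemma tt2_inv : 1 <= tt^-1 /\ tt^-1 <= (tt ^+ 2)^-1.
Proof.
have h : 1 <= tt^-1 by rewrite invf_ge1.
by split=> //; rewrite -exprVn expr2 ler_peMl // (le_trans _ h).
Qed.

Lemma out_G : [/\ 400 <= G, 1024 / tt <= G, 4 / tt ^+ 2 <= G, 480 / tt ^+ 2 <= G &
  584 / tt ^+ 2 + 24 + 2 * (e * (B + 2))%:R <= G].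
Proof. by have [h1 h2] := tt2_inv; have [] := large_threshold GK h1 h2 (ler0n _ _). Qed.

Lemma out_G2 : 128 + 12 / tt + 8 / tt ^+ 2 + 6 * (36 / tt ^+ 2 + 1) <= G.
Proof. by have [h1 h2] := tt2_inv; have [] := large_threshold GK h1 h2 (ler0n _ _). Qed.

Let Gp : 0 < G. Proof. by have [h _ _ _ _] := out_G; lra. Qed.
Let G1 : 1 <= G. Proof. by have [h _ _ _ _] := out_G; lra. Qed.
Let Nr : 0 < N%:R :> R. Proof. by rewrite ltr0n. Qed.

Lemma out_sg : sg = 1 \/ sg = -1.
Proof. by case: regime => [->|[-> _]]; [left | right]. Qed.

Lemma out_N4 : 4 <= N%:R :> R.
Proof.
apply: le_trans GN; have [h _ _ _ _] := out_G.
apply: (@le_trans _ _ G); [lra | by rewrite exprS ler_peMr ?(ltW Gp) // exprn_ege1].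
Qed.

Lemma out_Gz : G ^+ 20 * z <= 1.
Proof.
rewrite -(expr_le1 (n := 3)) //; last by rewrite mulr_ge0 ?exprn_ge0 // ltW.
rewrite exprMn -exprM -zN mulrC ler_wpM2l // ?exprn_ge0 // ltW //.
Qed.

Lemma out_ztt : G ^+ 6 * z ^+ 2 <= tt.
Proof.
have [_ h _ _ _] := out_G; have t0 := tt0.
have it : 1 / G <= tt.
  rewrite ler_pdivrMr //; have := h; rewrite ler_pdivrMr //; lra.
apply: le_trans it; rewrite ler_pdivlMr //.
have h2 : (G ^+ 20 * z) ^+ 2 <= 1 by rewrite expr_le1 ?out_Gz // mulr_ge0 ?exprn_ge0 // ltW.
apply: le_trans h2; rewrite (_ : (G ^+ 20 * z) ^+ 2 = G ^+ 40 * z ^+ 2); last by ring.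
rewrite mulrAC -exprSr ler_wpM2r ?sqr_ge0 // ler_weXn2l //.
Qed.

Lemma out_dom_cnt x : x <= 4 - tt -> (- 2 + tt <= sg * (2 - x)) || (s <= 1 - tt / 2).
Proof. by move=> hx; case: regime => [->|[_ ->]]; rewrite ?orbT //; apply/orP; left; lra. Qed.

Lemma out_kap i : G ^+ 30 * z ^+ 2 <= excl_kap i.
Proof. by rewrite /excl_kap lerDl mulr_ge0 ?sqr_ge0. Qed.

Lemma out_dom_excl i : (- 2 + tt <= sg * (2 + excl_kap i)) || (s <= 1 - tt / 2).
Proof.
case: regime => [->|[_ ->]]; rewrite ?orbT //; apply/orP; left; rewrite mul1r.
have := out_kap i; have : 0 <= G ^+ 30 * z ^+ 2 by rewrite mulr_ge0 ?sqr_ge0 ?exprn_ge0 // ltW.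
by have := tt1; lra.
Qed.

Lemma out_soft : soft tt s sg xi.
Proof.
rewrite /soft; case: regime => [->|[_ h]]; [left | by right]; split=> //.
have : 0 < dl by rewrite dlE divr_gt0 ?mulr_gt0 ?exprn_gt0 //; have := t1; lra.
by have := xi4; lra.
Qed.

Lemma out_dl : 0 < dl.
Proof. by rewrite dlE divr_gt0 ?mulr_gt0 ?exprn_gt0 //; have := t1; lra. Qed.

Lemma out_excl_ray i : 2 + excl_kap i <= N%:R ^+ B ->
  raycond tt N B s G (sg * (2 + excl_kap i)) (z ^+ 2 * (1 + excl_kap i)).
Proof.
have [h _ _ _ _] := out_G.
exact: (excl_ray N0 z0 zN out_sg h out_Gz (out_kap i) (out_dom_excl i)).
Qed.

Lemma out_cnt_ray x : x <= 4 - tt -> countable_at G z x ->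
  raycond tt N B s G (sg * (2 - x)) (G ^+ 7 / (N%:R * Num.sqrt (Num.min x (4 - x)))).
Proof.
have [h _ _ _ h5] := out_G => hx ct; have z2 : 0 < G ^+ 6 * z ^+ 2 by rewrite mulr_gt0 ?exprn_gt0.
have := lt_le_trans z2 ct; rewrite lt_min subr_gt0 => /andP[x0 x4].
exact: (cnt_ray N0 z0 zN out_sg h B1 out_N4 x0 x4 ct (out_dom_cnt hx)).
Qed.

Lemma out_up : countable_at G z (xi + dl).
Proof.
have [h h1 h2 _ _] := out_G.
exact: (up_countable tt0 tt1 N0 s0 s1 z0 zN out_sg h h2 t1 tj hj dlE xi4 xi0 out_soft out_ztt xiloc).
Qed.

Lemma out_down : dl / 2 < xi -> countable_at G z (down_point xi dl).
Proof.
have [h h1 h2 _ _] := out_G.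
exact: (down_countable tt0 tt1 N0 s0 s1 z0 zN out_sg h h2 t1 tj hj dlE xi4 xi0 out_soft out_ztt xiloc).
Qed.

Lemma out_down_le : dl / 2 < xi -> down_point xi dl <= 4 - tt.
Proof.
have d0 := out_dl; move=> hx; rewrite /down_point; have := xi4.
have : 0 < Num.min dl (xi / 2) by rewrite lt_min d0; lra.
lra.
Qed.

Variables (A : 'M[C]_(M, N)) (lam : nat -> R).
Hypotheses (specA : nontrivial_spectrum N (gram A) lam) (good : ~~ bad_outcome A).

Lemma out_yB k : (1 <= k <= N)%N -> `|ycen s lam k| <= N%:R ^+ B.
Proof.
move=> hk; have /andP[l0 l1] := spectrum_bound specA hk.
case/norP: good => fA _; rewrite -leNgt in fA.
have := sB; have := s0; have : 0 < s^-1 by rewrite invr_gt0.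
by rewrite ler_norml /ycen => a b c; apply/andP; split; lra.
Qed.

Lemma edge_gap_mono a b : (1 <= a)%N -> (a <= b)%N -> (b <= N)%N -> edge_gap lam a <= edge_gap lam b.
Proof.
move=> a1 ab bN; have [_ mono] := specA; rewrite /edge_gap /ycen.
case: out_sg => ->; rewrite ?eqxx.
  by have := mono a b a1 ab bN; lra.
have -> : ((-1 : R) == 1) = false by apply/eqP; lra.
have h : lam (N.+1 - a)%N <= lam (N.+1 - b)%N.
  by apply: mono; [rewrite subn_gt0 ltnS | exact: leq_sub2l | move: a1; clear; lia].
move: h; set u := lam _; set v := lam _; lra.
Qed.

Lemma edge_gap_sum x : \sum_(1 <= k < N.+1) Num.sg (x - edge_gap lam k) =
  \sum_(1 <= k < N.+1) Num.sg (x - (2 - sg * ycen s lam k)).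
Proof.
rewrite /edge_gap; case: out_sg => ->; rewrite ?eqxx //.
have -> : ((-1 : R) == 1) = false by apply/eqP; lra.
rewrite [RHS]big_nat_rev /=; apply: eq_big_nat => k _.
by rewrite add1n subSS.
Qed.

Lemma out_counted x : x <= 4 - tt -> countable_at G z x -> ~~ cnt_badray x A ->
  counted s sg G N (edge_gap lam) x.
Proof.
have [h h1 h2 _ h5] := out_G => hx ct gd; have z2 : 0 < G ^+ 6 * z ^+ 2 by rewrite mulr_gt0 ?exprn_gt0.
have := lt_le_trans z2 ct; rewrite lt_min subr_gt0 => /andP[x0 x4].
have [ry _] := badray_good tt0 tt1 N0 NM s0 s1 out_G2 (out_cnt_ray hx ct) gd specA out_yB.
have sB' : s^-1 <= N%:R ^+ B by have := sB; have := s0; lra.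
rewrite /counted edge_gap_sum.
exact: (count_nu tt0 tt1 N0 s0 s1 z0 zN out_sg h h5 nG B1 out_N4 x0 x4 ct (out_dom_cnt hx) out_yB sB' ry).
Qed.

Lemma out_excl k : (1 <= k <= N)%N -> sg * ycen s lam k <= 2 + 2 * (G ^+ 30 * z ^+ 2).
Proof.
move=> hk; rewrite leNgt; apply/negP => big; have [h _ _ h4 _] := out_G.
have z20 : 0 < z ^+ 2 by rewrite exprn_gt0.
pose y := sg * ycen s lam k - 2; have K0 : 0 < G ^+ 30 * z ^+ 2 by rewrite mulr_gt0 ?exprn_gt0.
have yb : 2 * (G ^+ 30 * z ^+ 2) < y by rewrite /y; lra.
(* The grid point just below y; the eigenvalue lies within its exclusion radius. *)
pose i := Num.truncn ((y - G ^+ 30 * z ^+ 2) / z ^+ 2).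
have q0 : 0 <= (y - G ^+ 30 * z ^+ 2) / z ^+ 2 by rewrite divr_ge0 // ?(ltW z20) //; lra.
have /andP[i1 i2] := truncn_itv q0; rewrite -/i in i1 i2.
rewrite ler_pdivlMr // in i1; rewrite ltr_pdivrMr // -natr1 mulrDl mul1r in i2.
have yB' : 2 + y <= N%:R ^+ B.
  rewrite (_ : 2 + y = sg * ycen s lam k); last by rewrite /y; ring.
  by apply: le_trans (out_yB hk); rewrite -(sg_norm out_sg) ler_norm.
have kapy : excl_kap i <= y by rewrite /excl_kap; lra.
have kB : 2 + excl_kap i <= N%:R ^+ B by lra.
have iN : (i <= N ^ B.+1)%N.
  rewrite -(ler_nat R) natrX exprS.
  have zN1 : 1 <= z ^+ 2 * N%:R.
    apply: (@le_trans _ _ (z * (z ^+ 2 * N%:R))); first by rewrite mulrA -exprS zN.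
    rewrite ler_piMl ?(ltW z0) //; first by apply: mulr_ge0; rewrite ?sqr_ge0 ?(ltW Nr).
    by apply: le_trans out_Gz; rewrite ler_peMl ?(ltW z0) // exprn_ege1.
  have : i%:R * z ^+ 2 <= N%:R ^+ B by lra.
  move=> hi; have := ler_wpM2r (ltW Nr) hi; rewrite -mulrA [X in _ <= X]mulrC; apply: le_trans.
  by rewrite ler_peMr.
have gd : ~~ badray B s G (sg * (2 + excl_kap i)) (z ^+ 2 * (1 + excl_kap i)) A.
  case/norP: good => _ /norP[hh _]; move: hh => /hasPn/(_ i); rewrite mem_iota add0n ltnS iN => /(_ isT).
  by rewrite /excl_badray kB.
have rc := out_excl_ray kB.
have [_ sharp] := badray_good tt0 tt1 N0 NM s0 s1 out_G2 rc gd specA out_yB.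
have := excluded tt0 tt1 N0 s0 s1 z0 zN out_sg h h4 out_Gz (out_kap i) (out_dom_excl i) sharp rc hk.
rewrite (_ : ycen s lam k - sg * (2 + excl_kap i) = sg * (y - excl_kap i)); last first.
  rewrite /y (_ : sg * (sg * ycen s lam k - 2 - excl_kap i) = sg * sg * ycen s lam k - sg * (2 + excl_kap i)); last by ring.
  by rewrite (sg_sqr out_sg) mul1r.
rewrite (sg_norm out_sg) ger0_norm ?subr_ge0 // ltNge => /negP; apply.
have : z ^+ 2 * 1 <= z ^+ 2 * (1 + excl_kap i).
  by rewrite ler_wpM2l ?(ltW z20) // lerDl (le_trans (ltW K0)) // out_kap.
by rewrite /excl_kap; lra.
Qed.

Lemma good_rigid : `|edge_gap lam j - xi| <= dl.
Proof.
have [h h1 h2 _ h5] := out_G; have ss := out_soft; have mono := edge_gap_mono; have gg := good.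
case/norP: good => _ /norP[_ /norP[gu gd]].
have up := rigid_up tt0 tt1 N0 s0 s1 z0 zN out_sg h h1 h2 t1 tj hj dlE mono xi4 xi0 ss xiloc (out_counted xi4 out_up gu).
have ex : - (2 * (G ^+ 30 * z ^+ 2)) <= edge_gap lam j.
  rewrite /edge_gap; set k := if _ then _ else _.
  have hk : (1 <= k <= N)%N by move: hj; rewrite /k; case: ifP => // _ /andP[j1 jN]; rewrite subn_gt0 ltnS jN leq_subLR -add1n leq_add2r.
  by have := out_excl hk; lra.
have dn := rigid_down tt0 tt1 N0 s0 s1 z0 zN out_sg h h1 h2 t1 tj hj dlE mono xi4 xi0 ss xiloc ex.
have dn' : xi - dl <= edge_gap lam j.
  apply: dn => hx; apply: out_counted; [exact: out_down_le | exact: out_down | by move: gd; rewrite hx].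
by rewrite ler_norml; move: up dn'; set Y := edge_gap _ _; move=> a b; apply/andP; split; lra.
Qed.
End GoodOutcome.

Section FiniteRigidity.
Variable R : realType.
Local Notation C := R[i].
Local Open Scope complex_scope.

Lemma expect_frob2 M N (s : R) (V : finType) (p : 'I_M -> 'I_N -> V -> R) (xv : 'I_M -> 'I_N -> V -> C) c :
  fmodel c s p xv -> fE (wt p) (fun o => frob2 (Xmat xv o)) = N%:R / s.
Proof.
move=> fm; have cm := fm_cm fm; have s0 := fm_s fm; have N0 := fm_N fm.
have Nr : 0 < N%:R :> R by rewrite ltr0n.
rewrite /frob2 fE_sum; under eq_bigr do rewrite fE_sum.
have e i mu : fE (wt p) (fun o => nrm (Xmat xv o i mu) ^+ 2) = spar N s.
  rewrite (fE_col cm _ mu) -(fE_const (spar N s) (wt_sum1 cm)).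
  apply: eq_bigr => o _; congr (_ * _).
  transitivity (fE (pw (p^~ mu)) (fun sg => nrm (xv i mu (sg i)) ^+ 2)).
    by apply: eq_bigr => sg _; rewrite mxE upd_eq.
  rewrite (fE_fubini (p := p^~ mu) (cm_sum1 (cm mu)) i) -(fE_const (spar N s) (pcol_sum1 cm mu)).
  apply: eq_bigr => sg _; congr (_ * _); rewrite -(cm_var (cm mu) i).
  by apply: eq_bigr => v _; rewrite upd_eq.
under eq_bigr do under eq_bigr do rewrite e.
under eq_bigr do rewrite sumr_const card_ord.
rewrite sumr_const card_ord -[_ *+ M]mulr_natl -[_ *+ N]mulr_natl /spar -(fm_sMN fm).
have M0 : 0 < M%:R :> R.
  by have := Nr; rewrite -(fm_sMN fm) pmulr_rgt0 // exprn_gt0.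
by field; rewrite !gt_eqF // ?exprn_gt0.
Qed.

Variables (tt : R) (c : nat -> R).
Hypotheses (tt0 : 0 < tt) (tt1 : tt <= 1).

Lemma finite_rigidity (B e D : nat) : exists G0 : R, 1 <= G0 /\
  forall (G : R) (M N : nat) (s : R) (V : finType) (p : 'I_M -> 'I_N -> V -> R)
    (xv : 'I_M -> 'I_N -> V -> C), fmodel c s p xv -> G0 <= G -> N%:R <= G ^+ e -> G ^+ 60 <= N%:R ->
  s^-1 <= N%:R ^+ B ->
  forall (sg z t xi dl : R) (j : nat), sg = 1 \/ (sg = -1 /\ s <= 1 - tt / 2) ->
  0 < z -> z ^+ 3 * N%:R = 1 -> 1 <= t -> t ^+ 3 = j%:R -> (1 <= j <= N)%N ->
  dl = G ^+ 60 * z ^+ 2 / t -> xi + dl <= 4 - tt -> 0 <= xi ->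
  (xi = 0 /\ j = 1%N) \/ (0 < xi /\ `|nu s sg xi - j%:R / N%:R| <= 1 / N%:R) ->
  forall lam : {ffun 'I_N -> {ffun 'I_M -> V}} -> nat -> R,
  (forall o, nontrivial_spectrum N (gram (Xmat xv o)) (lam o)) ->
  fP (wt p) (fun o => dl < `|edge_gap N s sg (lam o) j - xi|) <= (N%:R ^+ D)^-1.
Proof.
(* B' lets Markov's inequality for the Frobenius norm gain the factor N^(-D); D' pays for the union
   over N^(B'+1) + 1 exclusion energies. *)
pose B' := (B + D + 4)%N; pose D' := (B'.+1 + (D + 2))%N.
have [G0 [G01 PL]] := badray_prob c tt0 tt1 B' e D'.
pose K := 4000 / tt ^+ 2 + 24 + 2 * (e * (B' + 2))%:R.
have K0 : 0 <= K.
  have h : 0 <= (tt ^+ 2)^-1 by rewrite invr_ge0 sqr_ge0.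
  have h2 : 0 <= (e * (B' + 2))%:R :> R by rewrite ler0n.
  by rewrite /K; move: h h2; set a := _^-1; set b := _%:R; clear -R; lra.
have G00 : 0 <= G0 by apply: le_trans G01.
exists (G0 + K); split; first by apply: (@le_trans _ _ G0); rewrite ?lerDl // (le_trans _ G01) // (ler_nat R 1 128).
have eD' : D' = (D + (B'.+1 + 1).+1)%N by rewrite /D' addnCA addn1 addn2.
have hB : (B.+1 <= B')%N by rewrite /B' addn4 ltnS -addnS -addnS -addnS leq_addr.
move=> G M N s V p xv fm GG nG GN sB sg z t xi dl j regime z0 zN t1 tj hj dlE xi4 xi0 loc lam slam.
have N0 := fm_N fm; have NM := fm_NM fm; have s0 := fm_s fm; have cm := fm_cm fm.
have s1 : s <= 1 := s_le1 N0 (fm_NM fm) s0 (fm_sMN fm).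
have GK : 4000 / tt ^+ 2 + 24 + 2 * (e * (B' + 2))%:R <= G by apply: le_trans GG; rewrite lerDr.
have GG0 : G0 <= G by apply: le_trans GG; rewrite lerDl.
have {PL} PL := PL G M N s V p xv fm GG0 nG.
have Nr : 0 < N%:R :> R by rewrite ltr0n.
have N4 : 4 <= N%:R :> R := out_N4 tt0 tt1 GK GN.
have N1 : 1 <= N%:R :> R by rewrite ler1n.
have B1 : (0 < B')%N by rewrite /B' addn4.
have sB1 : s^-1 <= N%:R ^+ B' by apply: (le_trans sB); rewrite ler_weXn2l // /B' -addnA leq_addr.
have sB2 : s^-1 + s <= N%:R ^+ B'.
  have i1 : 1 <= s^-1 by rewrite invf_ge1.
  apply: (@le_trans _ _ (N%:R ^+ B * N%:R)); last by rewrite -exprSr ler_weXn2l.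
  apply: (@le_trans _ _ (N%:R ^+ B * 4)); last by rewrite ler_wpM2l // exprn_ge0 // ltW.
  move: sB i1 s1; set a := _ ^+ B; set b := s^-1; clear -R; lra.
have {PL} PL := PL sB1.
pose bad o := bad_outcome B' s G z xi dl sg (Xmat xv o).
have cover o : dl < `|edge_gap N s sg (lam o) j - xi| -> bad o.
  apply: contraTT => gd; rewrite -leNgt.
  exact: (good_rigid tt0 tt1 N0 NM s0 s1 z0 zN regime GK nG B1 GN sB2 t1 tj hj dlE xi4 xi0 loc (slam o) gd).
apply: (le_trans (fP_le (wt_ge0 cm) cover)).
pose y : R := (N%:R ^+ D)^-1.
have y0 : 0 < y by rewrite invr_gt0 exprn_gt0.
have i4 : N%:R^-1 <= 4^-1 :> R by rewrite lef_pV2 ?posrE.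
have yk k : (N%:R ^+ (D + k.+1))^-1 <= y / 4.
  rewrite exprD invfM ler_wpM2l ?(ltW y0) // -exprVn; apply: (le_trans _ i4).
  by rewrite exprS ler_piMr ?invr_ge0 ?(ltW Nr) // exprn_ile1 ?invr_ge0 ?(ltW Nr) // invf_le1.
have pz (A : pred {ffun 'I_N -> {ffun 'I_M -> V}}) (b : bool) q : 0 <= q -> (b -> fP (wt p) A <= q) -> fP (wt p) (fun o => b && A o) <= q.
  move=> q0; case: b => [/(_ isT) //|_] /=.
  by rewrite /fP /fE big1 // => o _; rewrite mulr0.
have p1 : fP (wt p) (fun o => N%:R ^+ B' < frob2 (Xmat xv o)) <= y / 4.
  apply: (le_trans (markov_fin (wt_ge0 cm) _ (fun o => frob2_ge0 _))); first by rewrite exprn_gt0.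
  rewrite (expect_frob2 fm); apply: (@le_trans _ _ (N%:R * N%:R ^+ B / N%:R ^+ B')).
    by rewrite ler_wpM2r ?invr_ge0 ?exprn_ge0 ?(ltW Nr) // ler_wpM2l // ltW.
  apply: (le_trans _ (yk 2)).
  rewrite /B' !exprD (_ : N%:R * N%:R ^+ B / (N%:R ^+ B * N%:R ^+ D * N%:R ^+ 4) = (N%:R ^+ D * N%:R ^+ 3)^-1) //.
  by field; rewrite !gt_eqF // exprn_gt0.
have q1 : (N%:R ^+ D')^-1 <= y / 4 by rewrite eD'.
have D0 : 0 <= (N%:R ^+ D')^-1 :> R by rewrite invr_ge0 exprn_ge0 // ltW.
have p2 : fP (wt p) (fun o => has (excl_badray B' s G z sg (Xmat xv o)) (iota 0 (N ^ B'.+1).+1)) <= y / 4.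
  apply: (le_trans (fP_has (wt_ge0 cm) _ (fun i o => excl_badray B' s G z sg (Xmat xv o) i))).
  apply: (@le_trans _ _ (\sum_(i <- iota 0 (N ^ B'.+1).+1) (N%:R ^+ D')^-1)).
    apply: ler_sum => i _; apply: pz => // hB2; apply: PL.
    exact: (out_excl_ray tt0 tt1 N0 z0 zN regime GK GN hB2).
  rewrite big_const_seq count_predT size_iota iter_addr addr0 -[_ *+ _]mulr_natl -natr1 natrX.
  rewrite /D' [in X in _ * X]exprD invfM mulrA.
  have a1 : 1 <= N%:R ^+ B'.+1 :> R by rewrite exprn_ege1.
  apply: (@le_trans _ _ (2 * (N%:R ^+ (D + 2))^-1)).
    rewrite ler_wpM2r ?invr_ge0 ?exprn_ge0 ?(ltW Nr) // ler_pdivrMr ?exprn_gt0 //.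
    by move: a1; set a := _ ^+ _; clear -R; lra.
  apply: (@le_trans _ _ (N%:R * (N%:R ^+ (D + 2))^-1)).
    by rewrite ler_wpM2r ?invr_ge0 ?exprn_ge0 ?(ltW Nr) // (le_trans _ N4) // (ler_nat R 2 4).
  rewrite (_ : N%:R * (N%:R ^+ (D + 2))^-1 = (N%:R ^+ (D + 1))^-1) ?yk //.
  by rewrite !exprD; field; rewrite !gt_eqF // exprn_gt0.
have p3 : fP (wt p) (fun o => cnt_badray B' s G sg (xi + dl) (Xmat xv o)) <= y / 4.
  apply: (le_trans _ q1); apply: PL.
  exact: (out_cnt_ray tt0 tt1 N0 z0 zN regime GK B1 GN xi4
    (out_up tt0 tt1 N0 s0 s1 z0 zN regime GK GN t1 tj hj dlE xi4 xi0 loc)).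
have p4 : fP (wt p) (fun o => (dl / 2 < xi) && cnt_badray B' s G sg (down_point xi dl) (Xmat xv o)) <= y / 4.
  apply: (le_trans _ q1); apply: pz => // hx; apply: PL.
  exact: (out_cnt_ray tt0 tt1 N0 z0 zN regime GK B1 GN (out_down_le tt0 tt1 z0 GK t1 dlE xi4 hx)
    (out_down tt0 tt1 N0 s0 s1 z0 zN regime GK GN t1 tj hj dlE xi4 xi0 loc hx)).
(* Each of the four bad events receives a quarter of the allowed probability. *)
rewrite -/y; have -> : y = y / 4 + (y / 4 + (y / 4 + y / 4)) by field.
apply: (le_trans (fPU (wt_ge0 cm) _ _)); apply: lerD => //.
apply: (le_trans (fPU (wt_ge0 cm) _ _)); apply: lerD => //.
by apply: (le_trans (fPU (wt_ge0 cm) _ _)); apply: lerD.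
Qed.
End FiniteRigidity.

(** * The Marchenko-Pastur distribution function *)

Section MarchenkoPasturTail.
Variable R : realType.
Variables (s : R).
Hypotheses (s0 : 0 < s) (s1 : s <= 1).
Local Notation c := (s^-1 + s).

Lemma center_ge2 : 2 <= c.
Proof.
rewrite -(ler_pM2r s0) [leRHS]mulrDl mulVf ?gt_eqF // -expr2.
have : 0 <= (1 - s) ^+ 2 by rewrite sqr_ge0.
by rewrite sqrrB expr1n mul1r; lra.
Qed.

Lemma center_gt2 : s < 1 -> 2 < c.
Proof.
move=> h; rewrite -(ltr_pM2r s0) [ltRHS]mulrDl mulVf ?gt_eqF // -expr2.
have : 0 < (1 - s) ^+ 2 by rewrite exprn_gt0 // subr_gt0.
by rewrite sqrrB expr1n mul1r; lra.
Qed.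

Lemma nE_nu E : nE s E = nu s 1 (2 - E).
Proof. by rewrite /nu (_ : 1 * (2 - (2 - E)) = E); ring. Qed.

Lemma nE_nuN E : nE s E = 1 - nu s (-1) (E + 2).
Proof. by rewrite /nu (_ : -1 * (2 - (E + 2)) = E); [field | ring]. Qed.

Lemma nu_flip sg x : nu s (- sg) (4 - x) = 1 - nu s sg x.
Proof. by rewrite /nu (_ : - sg * (2 - (4 - x)) = sg * (2 - x)); [field | ring]. Qed.

Lemma nE_decr a b : - 2 < a -> a < b -> b < 2 -> nE s b < nE s a.
Proof.
move=> a2 ab b2; rewrite !nE_nu -subr_gt0.
have sg1 : 1 = 1 :> R \/ 1 = -1 :> R by left.
pose tt := a + 2; have tt0 : 0 < tt by rewrite /tt; lra.
have h1 : 0 < 2 - b by lra.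
have h2 : 2 - b <= 2 - a by lra.
have h3 : 2 - a <= 4 - tt by rewrite /tt; lra.
apply: lt_le_trans (nu_lower tt0 s0 s1 sg1 h1 h2 h3).
have h4 : 0 < 2 - a by lra.
by apply: mulr_gt0; [lra | rewrite divr_gt0 // sqrtr_gt0 divr_gt0 // mulr_gt0].
Qed.

Lemma nu_gt0 sg x : sg = 1 \/ sg = -1 -> 0 < x -> x < 4 -> 0 < nu s sg x.
Proof.
move=> sgP x0 x4; pose tt := 4 - x; have tt0 : 0 < tt by rewrite /tt; lra.
have h : x <= 4 - tt by rewrite /tt; lra.
apply: lt_le_trans (nu_ge tt0 s0 s1 sgP x0 h).
by apply: mulr_gt0; [lra | rewrite divr_gt0 // sqrtr_gt0 divr_gt0 // mulr_gt0].
Qed.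

Lemma nE_bounds E : `|E| < 2 -> 0 < nE s E < 1.
Proof.
rewrite ltr_norml => /andP[h1 h2].
have p1 : 0 < nu s 1 (2 - E) by apply: nu_gt0; [left | lra | lra].
have p2 : 0 < nu s (-1) (E + 2) by apply: nu_gt0; [right | lra | lra].
by rewrite {1}nE_nu p1 /= nE_nuN; lra.
Qed.

Lemma nE_surj a : 0 < a < 1 -> exists2 E, `|E| < 2 & nE s E = a.
Proof.
move=> /andP[a0 a1].
have [x1 x10 h1] := nu_small s0 s1 (or_introl erefl : 1 = 1 :> R \/ 1 = -1 :> R) a0.
have a1' : 0 < 1 - a by lra.
have [x2 x20 h2] := nu_small s0 s1 (or_intror erefl : -1 = 1 :> R \/ -1 = -1 :> R) a1'.
pose y1 := Num.min x1 1; pose y2 := Num.min x2 1.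
have y10 : 0 < y1 by rewrite lt_min x10 ltr01.
have y20 : 0 < y2 by rewrite lt_min x20 ltr01.
have y11 : y1 <= 1 by rewrite ge_min lexx orbT.
have y21 : y2 <= 1 by rewrite ge_min lexx orbT.
have f1 : nE s (2 - y1) <= a.
  rewrite nE_nu (_ : 2 - (2 - y1) = y1); last by ring.
  by apply: le_trans (h1 y1 y10 _); rewrite ?ler_norm // ge_min lexx.
have f2 : a <= nE s (y2 - 2).
  rewrite nE_nuN subrK; have := h2 y2 y20; rewrite ge_min lexx => /(_ isT).
  by move/(le_trans (ler_norm _)); lra.
have [|||E hE eE] := @IVT R (nE s) (y2 - 2) (2 - y1) a.
- by lra.
- apply: continuous_in_subspaceT => x /[!inE]/= /[!in_itv]/= /andP[b1 b2].
  by apply: (drv_cont (nE_drv s0 s1 _)); rewrite ltr_norml; apply/andP; split; lra.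
- by rewrite ge_min le_max f1 f2 !orbT.
by move: hE; rewrite in_itv /= => /andP[e1 e2]; exists E => //; rewrite ltr_norml; apply/andP; split; lra.
Qed.

(** The ratio phi may lie on either side of 1 while s <= 1: w is the mass of the absolutely
    continuous part, 1 for phi >= 1 and phi otherwise. *)
Lemma mp_density_dens phi w x : 0 <= phi -> Num.sqrt phi = w / s ->
  Num.sqrt phi + (Num.sqrt phi)^-1 = c -> mp_density phi x = w * dens s (x - c).
Proof.
move=> p0 hw hc; rewrite /mp_density /mp_gamma_plus /mp_gamma_minus hc hw /dens /rr.
have -> : Num.sqrt (Num.max 0 ((x - (c - 2)) * (c + 2 - x))) = Num.sqrt (4 - (x - c) ^+ 2).
  rewrite (_ : (x - (c - 2)) * (c + 2 - x) = 4 - (x - c) ^+ 2); last by ring.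
  have [h|h] := leP 0 (4 - (x - c) ^+ 2); rewrite ?(max_r h) //.
  by rewrite sqrtr0 ler0_sqrtr // ltW.
have -> : mpden s (x - c) = s * x by rewrite /mpden; field; rewrite gt_eqF.
move: (@pi R) (pi_gt0 R) => p pp; set r := Num.sqrt _.
have [->|x0] := eqVneq x 0; first by rewrite !(mulr0, invr0).
by field; rewrite x0 !gt_eqF.
Qed.

(** A continuous primitive of the normalized density. It is constant beyond the edges, the closed
    formula giving the mass only between them. *)
Definition mp_cdf (x : R) : R := if c + 2 <= x then 0 else if x <= c - 2 then -1 else - nE s (x - c).

Lemma mp_cdf_in x : c - 2 < x -> x < c + 2 -> mp_cdf x = - nE s (x - c).
Proof. by move=> h1 h2; rewrite /mp_cdf !leNgt h1 h2. Qed.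

Lemma nE_shift_drv (x : R) : c - 2 < x -> x < c + 2 -> is_derive x 1 (fun y : R => - nE s (y - c)) (dens s (x - c)).
Proof.
move=> h1 h2; have hE : `|x - c| < 2 by rewrite ltr_norml; apply/andP; split; lra.
have d := @drv_comp R (nE s) (fun y => y - c) x _ _ (nE_drv s0 s1 hE) (drvB (drv_id x) (drv_c c x)).
by apply: (drv_eq (drvN d)); rewrite subr0 ?mulr1 ?mul1r opprK.
Qed.

Lemma mp_cdf_drv (x : R) : c - 2 < x -> x < c + 2 -> is_derive x 1 mp_cdf (dens s (x - c)).
Proof.
move=> h1 h2; apply: near_eq_is_derive (nE_shift_drv h1 h2).
near=> y; apply/esym/mp_cdf_in; near: y; [exact: lt_nbhsr | exact: lt_nbhsl].
Unshelve. all: by end_near. Qed.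

Lemma mp_cdf_top : mp_cdf x @[x --> (c + 2)^'-] --> mp_cdf (c + 2).
Proof.
rewrite {2}/mp_cdf lexx; apply/cvgrPdist_le => e e0.
have [a a0 ha] := nu_small s0 s1 (or_introl erefl : 1 = 1 :> R \/ 1 = -1 :> R) e0.
near=> x; have x2 : x < c + 2 by near: x; exact: nbhs_left_lt.
have xa : c + 2 - Num.min a 1 < x by near: x; apply: nbhs_left_gt; rewrite ltrBlDr ltrDl lt_min a0 ltr01.
have m1 : Num.min a 1 <= 1 by rewrite ge_min lexx orbT.
have m2 : Num.min a 1 <= a by rewrite ge_min lexx.
rewrite mp_cdf_in // ?sub0r ?opprK; last by lra.
by rewrite nE_nu; apply: ha; lra.
Unshelve. all: by end_near. Qed.

Lemma mp_cdf_bot : mp_cdf x @[x --> (c - 2)^'+] --> mp_cdf (c - 2).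
Proof.
have -> : mp_cdf (c - 2) = -1 by rewrite /mp_cdf lexx ifF //; apply/negbTE; rewrite -ltNge; lra.
apply/cvgrPdist_le => e e0.
have [a a0 ha] := nu_small s0 s1 (or_intror erefl : -1 = 1 :> R \/ -1 = -1 :> R) e0.
near=> x; have x2 : c - 2 < x by near: x; exact: nbhs_right_gt.
have xa : x < c - 2 + Num.min a 1 by near: x; apply: nbhs_right_lt; rewrite ltrDl lt_min a0 ltr01.
have m1 : Num.min a 1 <= 1 by rewrite ge_min lexx orbT.
have m2 : Num.min a 1 <= a by rewrite ge_min lexx.
rewrite mp_cdf_in //; last by lra.
rewrite nE_nuN (_ : -1 - - (1 - nu s (-1) (x - c + 2)) = - nu s (-1) (x - c + 2)); last by ring.
by rewrite normrN; apply: ha; lra.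
Unshelve. all: by end_near. Qed.

Lemma dens_cont (x : R) : 0 < x -> {for x, continuous (fun y : R => dens s (y - c))}.
Proof.
move=> x0; have m0 : 0 < mpden s (x - c).
  by rewrite (_ : mpden s (x - c) = s * x) ?mulr_gt0 // /mpden; field; rewrite gt_eqF.
have ne : 2 * pi * mpden s (x - c) != 0 by rewrite gt_eqF // !mulr_gt0 // pi_gt0.
rewrite /dens; apply: cvgM; last apply: cvgV => //.
  rewrite /rr; apply: (@continuous_comp _ _ _ (fun y : R => 4 - (y - c) ^+ 2) Num.sqrt); last exact: sqrt_continuous.
  have d := drvB (drv_id x) (drv_c c x).
  exact: (drv_cont (drvB (drv_c 4 x) (drvM d d))).
apply: (@drv_cont _ (fun y : R => 2 * pi * mpden s (y - c)) x (2 * pi * s)).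
rewrite /mpden; apply: (drv_eq (drvM (drv_c (2 * pi) x) (drvD (drvD (drv_c 1 x) (drvM (drv_c s x) (drvB (drv_id x) (drv_c c x)))) (drv_c (s ^+ 2) x)))).
ring.
Qed.

(** 0 < t keeps the atom at 0 out of the tail. Above the upper edge the integrand vanishes because
    the square root of a negative number is 0, so the integral reduces to a bounded interval. *)
Lemma mp_tail_cdf phi w t : 0 <= phi -> Num.sqrt phi = w / s ->
  Num.sqrt phi + (Num.sqrt phi)^-1 = c -> 0 < t -> c - 2 <= t -> mp_tail phi t = - (w * mp_cdf t).
Proof.
move=> p0 hw hc t0 tl; rewrite /mp_tail leNgt t0 /= addr0.
have dE : mp_density phi = (fun x => w * dens s (x - c)) by apply/funext => x; exact: mp_density_dens.
rewrite dE /Rintegral integral_mkcond.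
have z x : c + 2 <= x -> w * dens s (x - c) = 0.
  move=> h; rewrite /dens /rr ler0_sqrtr ?mul0r ?mulr0 //.
  have : 2 ^+ 2 <= (x - c) ^+ 2 by apply: lerXn2r; rewrite ?nnegrE; lra.
  by lra.
have [tc|tc] := leP (c + 2) t.
  rewrite /mp_cdf tc mulr0 oppr0 (_ : _ \_ _ = cst 0%E) ?integral_cst ?mul0e //.
  by apply/funext => x; rewrite patchE; case: ifPn => //; rewrite inE /= in_itv /= andbT => h; rewrite z // (le_trans tc).
rewrite (_ : _ \_ _ = (fun x => (w * dens s (x - c))%:E) \_ `[t, c + 2]); last first.
  apply/funext => x.
  have m1 : (x \in `[t, +oo[%classic) = (t <= x) by rewrite mem_setE in_itv /= andbT.
  have m2 : (x \in `[t, c + 2]%classic) = (t <= x <= c + 2) by rewrite mem_setE in_itv.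
  rewrite !patchE m1 m2; case: (leP t x) => //= h; case: (leP x (c + 2)) => // h2.
  by rewrite z // ltW.
rewrite -integral_mkcond (@continuous_FTC2 _ _ (fun x => w * mp_cdf x)) //.
- by rewrite /= {1}/mp_cdf lexx mulr0 sub0r.
- apply: continuous_in_subspaceT => x /[!inE]/= /[!in_itv]/= /andP[b1 b2].
  by apply: cvgM; [exact: cvg_cst | apply: dens_cont; lra].
- split.
  + move=> x /[!in_itv]/= /andP[b1 b2]; apply: derivableM; first exact: derivable_cst.
    by have [] := mp_cdf_drv (le_lt_trans tl b1) b2.
  + apply: cvgM; first exact: cvg_cst.
    move: tl; rewrite le_eqVlt => /predU1P[<-|h]; first exact: mp_cdf_bot.
    by apply: cvg_at_right_filter; exact: (drv_cont (mp_cdf_drv h tc)).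
  + by apply: cvgM; [exact: cvg_cst | exact: mp_cdf_top].
- move=> x /[!in_itv]/= /andP[b1 b2]; have d := mp_cdf_drv (le_lt_trans tl b1) b2.
  have d2 := drvM (drv_c w x) d; rewrite derive1E (@derive_val _ _ _ _ _ _ _ d2); ring.
Qed.

Lemma sup_max (A : set R) x : A x -> ubound A x -> sup A = x.
Proof.
move=> Ax ub; apply/eqP; rewrite eq_le ge_sup //=; last by exists x.
by apply: ub_le_sup => //; exists x.
Qed.

Lemma classical_location_in N phi w alpha E : 0 <= phi -> Num.sqrt phi = w / s ->
  Num.sqrt phi + (Num.sqrt phi)^-1 = c -> 0 < w -> `|E| < 2 -> alpha%:R / N%:R = w * nE s E ->
  classical_location N phi alpha = c + E.
Proof.
move=> p0 hw hc w0 hE ha; have /andP[n0 n1] := nE_bounds hE.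
have hE' := hE; rewrite ltr_norml in hE'; case/andP: hE' => e1 e2; have c2 := center_ge2.
apply: sup_max => /=.
  rewrite (mp_tail_cdf p0 hw hc) ?mp_cdf_in; try lra.
  by rewrite mulrN opprK ha (_ : c + E - c = E) //; ring.
move=> t /= h; rewrite leNgt; apply/negP => ht; move: h; apply/negP; rewrite -ltNge.
rewrite (mp_tail_cdf p0 hw hc) ?ha -?mulrN ?ltr_pM2l //; try lra.
rewrite /mp_cdf; case: ifPn => [_|]; first by rewrite oppr0.
rewrite -ltNge => h1; rewrite ifF; last by apply/negbTE; rewrite -ltNge; lra.
by rewrite opprK; apply: nE_decr; lra.
Qed.

(** At the last index the continuous mass is exhausted and every point between 0 and the lower edge
    solves the defining equation; the supremum selects the edge, which is positive because s < 1. *)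
Lemma classical_location_bot N phi w alpha : 0 <= phi -> Num.sqrt phi = w / s ->
  Num.sqrt phi + (Num.sqrt phi)^-1 = c -> 0 < w -> s < 1 -> alpha%:R / N%:R = w ->
  classical_location N phi alpha = c - 2.
Proof.
move=> p0 hw hc w0 hs ha; have c2 := center_gt2 hs.
apply: sup_max => /=.
  rewrite (mp_tail_cdf p0 hw hc) ?lexx //; try lra.
  have -> : mp_cdf (c - 2) = -1 by rewrite /mp_cdf lexx ifF //; apply/negbTE; rewrite -ltNge; lra.
  by rewrite mulrN opprK mulr1 ha.
move=> t /= h; rewrite leNgt; apply/negP => ht; move: h; apply/negP; rewrite -ltNge.
rewrite (mp_tail_cdf p0 hw hc) ?ha -?mulrN; try lra.
rewrite -[ltRHS]mulr1 ltr_pM2l // /mp_cdf; case: ifPn => [_|]; first by rewrite oppr0.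
rewrite -ltNge => h1; rewrite ifF; last by apply/negbTE; rewrite -ltNge.
rewrite opprK; have : `|t - c| < 2 by rewrite ltr_norml; apply/andP; split; lra.
by move/nE_bounds => /andP[].
Qed.

(** Seen from the opposite edge the mass is at least a, while the mass near any edge is at most 4
    times the square root of the distance. No constant depends on s, so the hard edge is
    included. *)
Lemma edge_far sg x a : sg = 1 \/ sg = -1 -> 0 < x -> x < 4 -> 0 < a -> a <= 1 ->
  nu s sg x <= 1 - a -> a ^+ 2 / 16 <= 4 - x.
Proof.
move=> sgP x0 x4 a0 a1 h; have sgN : - sg = 1 \/ - sg = -1 by case: sgP => ->; rewrite ?opprK; [right|left].
have := nu_flip sg x; have [y1|y1 _] := leP (4 - x) 1; last first.
  have : a ^+ 2 <= 1 by rewrite expr_le1 // ltW.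
  by lra.
have y0 : 0 < 4 - x by lra.
have := nu_le_sqrt s0 s1 sgN y0 y1 => hn e.
have ha : a / 4 <= Num.sqrt (4 - x) by lra.
have : (a / 4) ^+ 2 <= Num.sqrt (4 - x) ^+ 2 by apply: lerXn2r; rewrite ?nnegrE ?sqrtr_ge0 //; lra.
by rewrite sqr_sqrtr ?(ltW y0) // expr_div_n (_ : 4 ^+ 2 = 16 :> R) //; ring.
Qed.
End MarchenkoPasturTail.

(** * Discretization *)

Section Rounding.
Variable R : realType.

Definition rcode_type n : finType := (bool * 'I_(n.+1 ^ 2).+1)%type.
(* Rounding towards zero never increases an absolute moment. *)
Definition rcode n (a : R) : rcode_type n := (a < 0, inord (minn (Num.truncn (`|a| * n.+1%:R)) (n.+1 ^ 2))).
Definition rval n (v : rcode_type n) : R := (-1) ^+ v.1 * (v.2%:R / n.+1%:R).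

Lemma rcode_rval n (a : R) : rval (rcode n a) = (-1) ^+ (a < 0)%R * ((minn (Num.truncn (`|a| * n.+1%:R)) (n.+1 ^ 2))%:R / n.+1%:R).
Proof. by rewrite /rval /= inordK // ltnS geq_minr. Qed.

Lemma rval_norm_le n a : `|rval (rcode n a)| <= `|a|.
Proof.
rewrite rcode_rval normrM normrX normrN1 expr1n mul1r ger0_norm ?divr_ge0 //.
have h0 : 0 <= `|a| * n.+1%:R by rewrite mulr_ge0.
rewrite ler_pdivrMr ?ltr0n //; have /andP[h _] := truncn_itv h0.
by apply: (le_trans _ h); rewrite ler_nat geq_minl.
Qed.

Lemma rval_close n a : `|a| <= n.+1%:R -> `|a - rval (rcode n a)| <= n.+1%:R^-1.
Proof.
move=> ha; have n0 : 0 < n.+1%:R :> R by rewrite ltr0n.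
have h0 : 0 <= `|a| * n.+1%:R by rewrite mulr_ge0.
have /andP[h1 h2] := truncn_itv h0.
have m : (Num.truncn (`|a| * n.+1%:R) <= n.+1 ^ 2)%N.
  rewrite -(ler_nat R); apply: (le_trans h1); rewrite natrX expr2.
  by rewrite ler_wpM2r // ltW.
rewrite rcode_rval (minn_idPl m); set k := Num.truncn _ in h1 h2 *.
have e : a = (-1) ^+ (a < 0)%R * `|a|.
  by case: ltrP => h; [rewrite expr1 mulN1r ltr0_norm // opprK | rewrite expr0 mul1r ger0_norm].
rewrite {1}e -mulrBr normrM normrX normrN1 expr1n mul1r.
have k1 : k%:R / n.+1%:R <= `|a| by rewrite ler_pdivrMr.
rewrite ger0_norm ?subr_ge0 // -(ler_pM2r n0) mulrBl mulfVK ?gt_eqF // mulVf ?gt_eqF //.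
by move: h2; rewrite -natr1; lra.
Qed.

Lemma rval_cvg a : rval (rcode n a) @[n --> \oo] --> a.
Proof.
apply/cvgrPdist_le => e e0; near=> n.
have n0 : 0 < n.+1%:R :> R by rewrite ltr0n.
apply: (@le_trans _ _ n.+1%:R^-1).
  apply: rval_close; near: n; exists (Num.truncn `|a|).+1 => // n /= hn.
  have /andP[_ h] := truncn_itv (normr_ge0 a); apply: (le_trans (ltW h)); rewrite ler_nat.
  by rewrite (leq_trans hn).
near: n; exists (Num.truncn e^-1).+1 => // n /= hn.
have ei : 0 <= e^-1 by rewrite invr_ge0 ltW.
have /andP[_ h] := truncn_itv ei.
rewrite -[leRHS]invrK lef_pV2 ?posrE ?invr_gt0 // ?ltr0n //.
by apply: (le_trans (ltW h)); rewrite ler_nat (leq_trans hn).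
Unshelve. all: by end_near. Qed.

Lemma measurable_boolT d (T : measurableType d) (f : T -> bool) : measurable_fun setT f -> measurable [set x | f x].
Proof. by move=> mf; have := mf measurableT [set true] I; rewrite setTI. Qed.

Lemma rcode_measurable n v : measurable [set a : R | rcode n a == v].
Proof.
have mt : measurable_fun [set: R] (fun a : R => `|a| * n.+1%:R).
  by apply: measurable_funM => //; exact: (measurableT_comp (@normr_measurable R setT) (measurable_id _)).
have mk k : measurable [set a : R | (Num.truncn (`|a| * n.+1%:R) == k)%N].
  rewrite (_ : [set a | _] = [set a : R | (k%:R <= `|a| * n.+1%:R)%R] `&` [set a : R | (`|a| * n.+1%:R < k.+1%:R)%R]).
    by apply: measurableI; apply: measurable_boolT; [exact: measurable_fun_ler | exact: measurable_fun_ltr].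
  apply/seteqP; split => a /=; rewrite truncn_eq ?mulr_ge0 //; first by move/andP.
  by move=> [-> ->].
have ms b : measurable [set a : R | (a < 0)%R == b].
  have h : measurable [set a : R | (a < 0)%R].
    by rewrite (_ : [set a : R | _] = `]-oo, 0[%classic) //; apply/seteqP; split => a; rewrite /= in_itv.
  case: b; first by rewrite (_ : [set a | _] = [set a : R | (a < 0)%R]) //; apply/seteqP; split => a /=; [move/eqP | move=> ->].
  rewrite (_ : [set a | _] = ~` [set a : R | (a < 0)%R]); first exact: measurableC.
  by apply/seteqP; split => a /=; [move/eqP => -> | move/negP/negbTE => ->].
have -> : [set a : R | rcode n a == v] = [set a : R | (a < 0)%R == v.1] `&`
    \bigcup_(k in [set k | (minn k (n.+1 ^ 2))%N = v.2]) [set a : R | (Num.truncn (`|a| * n.+1%:R) == k)%N].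
  apply/seteqP; split => a /=.
    move=> /eqP <- /=; split => //; exists (Num.truncn (`|a| * n.+1%:R)) => //=.
    by rewrite inordK // ltnS geq_minr.
  case=> /eqP h1 [k /= h2 /eqP h3]; rewrite /rcode h1 h3 h2 inord_val.
  by case: (v).
apply: measurableI => //; exact: bigcup_measurable.
Qed.
End Rounding.

(** * Integrals of functions with finitely many values *)

Section CodeIntegral.
Variables (R : realType) (d : measure_display) (T : measurableType d) (P : probability T R).

Lemma integral_code (V : finType) (code : T -> V) (f : V -> R) :
  (forall v, measurable [set x | code x == v]) ->
  (\int[P]_x (f (code x))%:E = (\sum_v fine (P [set x | code x == v]) * f v)%:E)%E.
Proof.
move=> mc; have e x : (f (code x))%:E = \sum_(v : V) ((f v)%:E * (\1_[set x | code x == v] x)%:E)%E.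
  rewrite (bigD1 (code x)) //= big1 => [|v hv].
    by rewrite indicE mem_set /= ?eqxx // mule1 addr0.
  by rewrite indicE memNset ?mule0 //= => /eqP h; rewrite h eqxx in hv.
under eq_integral do rewrite e.
have ii v : P.-integrable setT (fun x => ((\1_[set x | code x == v] x)%:E : \bar R)).
  exact: integrable_indic.
rewrite integral_sum //; last by move=> v; exact: integrableZl.
rewrite -sumEFin; apply: eq_bigr => v _.
rewrite integralZl // integral_indic // setIT EFinM fineK ?fin_num_measure //.
by rewrite muleC.
Qed.

Lemma prob_code (V : finType) (code : T -> V) (A : pred V) :
  (forall v, measurable [set x | code x == v]) ->
  P [set x | A (code x)] = (\sum_v fine (P [set x | code x == v]) * (A v)%:R)%:E.
Proof.
move=> mc; rewrite -(integral_code (fun v => (A v)%:R) mc).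
have mA : measurable [set x | A (code x)].
  rewrite (_ : [set x | _] = \big[setU/set0]_(v | A v) [set x | code x == v]).
    by apply: bigsetU_measurable => v _.
  rewrite -bigcup_seq_cond; apply/seteqP; split => x /=.
    by move=> h; exists (code x) => //=; rewrite mem_index_enum h.
  by move=> [v /= /andP[_ h] /eqP ->].
rewrite -{1}[[set x | A (code x)]]setIT -integral_indic //; apply: eq_integral => x _; rewrite indicE.
by rewrite (_ : (x \in [set x | A (code x)]) = A (code x)) //; apply/idP/idP; rewrite inE.
Qed.

Lemma integral_bounded_cvg (f : nat -> T -> R) (g h : T -> R) :
  (forall n, measurable_fun setT (f n)) -> measurable_fun setT g ->
  (forall x, f n x @[n --> \oo] --> g x) -> P.-integrable setT (EFin \o h) ->
  (forall n x, `|f n x| <= h x) ->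
  (\int[P]_x (f n x)%:E @[n --> \oo] --> \int[P]_x (g x)%:E)%E.
Proof.
move=> mf mg fg ih fh.
have [] := @dominated_convergence _ _ R P setT measurableT (fun n x => (f n x)%:E) (fun x => (g x)%:E) (fun x => (h x)%:E).
- by move=> n; exact/measurable_EFinP.
- exact/measurable_EFinP.
- by apply: aeW => x _; apply: cvg_EFin; [exact: nearW | exact: fg].
- exact: ih.
- by apply: aeW => x n _; rewrite lee_fin.
- by [].
Qed.
End CodeIntegral.

(** * Rounded entries and passage to the limit *)

Section DiscretizedModel.
Variables (R : realType) (d : measure_display) (T : measurableType d) (P : probability T R).
Variables (M N : nat) (Xre Xim : 'I_M -> 'I_N -> T -> R) (v : R) (c : nat -> R).
Local Open Scope complex_scope.
Hypothesis mX : forall i j, measurable_fun setT (Xre i j) /\ measurable_fun setT (Xim i j).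
Hypothesis indX : mutually_independent P (fun ij : 'I_M * 'I_N => fun x => (Xre ij.1 ij.2 x, Xim ij.1 ij.2 x)).
Hypothesis meanX : forall i j, (\int[P]_x (Xre i j x)%:E = 0)%E /\ (\int[P]_x (Xim i j x)%:E = 0)%E.
Hypothesis varX : forall i j, (\int[P]_x ((Xre i j x) ^+ 2 + (Xim i j x) ^+ 2)%:E = v%:E)%E.
Hypothesis momX : forall k i j, (\int[P]_x (((Xre i j x) ^+ 2 + (Xim i j x) ^+ 2) ^+ k)%:E <= (c k * v ^+ k)%:E)%E.
Hypothesis v0 : 0 < v.

Local Notation V n := (rcode_type n * rcode_type n)%type.
Definition code n i j x : V n := (rcode n (Xre i j x), rcode n (Xim i j x)).
Definition codes n x : {ffun 'I_N -> {ffun 'I_M -> V n}} := [ffun j => [ffun i => code n i j x]].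
Definition pcode n i j (w : V n) : R := fine (P [set x | code n i j x == w]).

Lemma code_measurable n i j (w : V n) : measurable [set x | code n i j x == w].
Proof.
rewrite (_ : [set x | _] = Xre i j @^-1` [set a | rcode n a == w.1] `&` Xim i j @^-1` [set a | rcode n a == w.2]).
  have [m1 m2] := mX i j; apply: measurableI.
    by have := m1 measurableT _ (rcode_measurable w.1); rewrite setTI.
  by have := m2 measurableT _ (rcode_measurable w.2); rewrite setTI.
by apply/seteqP; split => x /=; rewrite /code -pair_eqE /=; [move/andP | move/andP].
Qed.

Lemma codes_set n (o : {ffun 'I_N -> {ffun 'I_M -> V n}}) : [set x | codes n x == o] =
  \bigcap_(ij in [set ij : 'I_M * 'I_N | ij \in [set: 'I_M * 'I_N]%SET]) (fun x => (Xre ij.1 ij.2 x, Xim ij.1 ij.2 x)) @^-1`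
    [set ab : R * R | (rcode n ab.1, rcode n ab.2) == o ij.2 ij.1].
Proof.
apply/seteqP; split => x /=.
  by move=> /eqP <- [i j] _ /=; rewrite !ffunE.
move=> h; apply/eqP/ffunP => j; apply/ffunP => i; rewrite !ffunE.
by apply/eqP; exact: (h (i, j) (finset.in_setT _)).
Qed.

Lemma codes_measurable n o : measurable [set x | codes n x == o].
Proof.
rewrite codes_set; apply: fin_bigcap_measurable => [|[i j] _]; first exact: finite_finset.
exact: (@code_measurable n i j (o j i)).
Qed.

(** Independence, applied to the preimages of single codes, makes the law of the rounded matrix a
    product weight as in the finite model. *)
Lemma codes_prob n o : fine (P [set x | codes n x == o]) = wt (@pcode n) o.
Proof.
rewrite codes_set indX => [|[i j]]; last first.
  rewrite (_ : [set ab : R * R | _] = fst @^-1` [set a | rcode n a == (o j i).1] `&` snd @^-1` [set a | rcode n a == (o j i).2]).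
    have m1 := (measurable_fst : measurable_fun setT (fst : R * R -> R)) measurableT _ (rcode_measurable (o j i).1).
    have m2 := (measurable_snd : measurable_fun setT (snd : R * R -> R)) measurableT _ (rcode_measurable (o j i).2).
    by rewrite !setTI in m1 m2; exact: measurableI.
  by apply/seteqP; split => x /=; rewrite -pair_eqE /=; [move/andP | move/andP].
rewrite (eq_bigr (fun ij => (pcode ij.1 ij.2 (o ij.2 ij.1))%:E)) => [|[i j] _]; last first.
  by rewrite /pcode fineK //; apply: fin_num_measure; exact: code_measurable.
rewrite prodEFin /= /wt /pw exchange_big /= pair_big_dep /=.
by apply: eq_bigl => x; rewrite finset.in_setT.
Qed.

Lemma codes_fP n (A : pred {ffun 'I_N -> {ffun 'I_M -> V n}}) : P [set x | A (codes n x)] = (fP (wt (@pcode n)) A)%:E.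
Proof.
rewrite prob_code; last exact: codes_measurable.
by congr (_%:E); apply: eq_bigr => o _; rewrite codes_prob.
Qed.

Lemma pcode_ge0 n i j w : 0 <= @pcode n i j w.
Proof. by rewrite fine_ge0. Qed.

Lemma pcode_sum n i j (f : V n -> R) : (\sum_w pcode i j w * f w)%:E = (\int[P]_x (f (code n i j x))%:E)%E.
Proof. by rewrite integral_code //; exact: code_measurable. Qed.

Lemma pcode_sum1 n i j : \sum_w @pcode n i j w = 1.
Proof.
have : (\sum_w @pcode n i j w * 1)%:E = 1%:E.
  by rewrite (pcode_sum i j (fun=> 1)) integral_cst //= mul1e probability_setT.
by case=> <-; apply: eq_bigr => w _; rewrite mulr1.
Qed.

Lemma sqr_measurable i j : measurable_fun setT (fun x => Xre i j x ^+ 2 + Xim i j x ^+ 2).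
Proof. by have [m1 m2] := mX i j; apply: measurable_funD; exact: measurable_funX. Qed.

Lemma sqr_integrable i j : P.-integrable setT (fun x => (Xre i j x ^+ 2 + Xim i j x ^+ 2)%:E).
Proof.
apply/integrableP; split; first exact/measurable_EFinP/sqr_measurable.
under eq_integral do rewrite gee0_abs ?lee_fin ?addr_ge0 ?sqr_ge0 //.
by rewrite varX ltry.
Qed.

Definition csize n (w : V n) : R := rval R w.1 ^+ 2 + rval R w.2 ^+ 2.

Lemma csize_le n i j x : csize (code n i j x) <= Xre i j x ^+ 2 + Xim i j x ^+ 2.
Proof.
by apply: lerD; rewrite -[X in X <= _]real_normK ?num_real // -[X in _ <= X]real_normK ?num_real //;
  apply: lerXn2r; rewrite ?nnegrE // rval_norm_le.
Qed.

Lemma csize_ge0 n w : 0 <= @csize n w. Proof. by rewrite addr_ge0 ?sqr_ge0. Qed.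

Lemma code_fun_measurable n i j (f : V n -> R) : measurable_fun setT (fun x => f (code n i j x)).
Proof.
move=> _ B mB; rewrite setTI.
rewrite (_ : _ @^-1` _ = \big[setU/set0]_(w | f w \in B) [set x | code n i j x == w]).
  by apply: bigsetU_measurable => w _; exact: code_measurable.
rewrite -bigcup_seq_cond; apply/seteqP; split => x /=.
  by move=> h; exists (code n i j x) => //=; rewrite mem_index_enum inE.
by move=> [w /= /andP[_ h] /eqP ->]; rewrite inE in h.
Qed.

Lemma csize_mom n i j k : \sum_w @pcode n i j w * csize w ^+ k <= c k * v ^+ k.
Proof.
rewrite -lee_fin (pcode_sum i j (fun w => csize w ^+ k)); apply: le_trans (momX k i j).
apply: ge0_le_integral => //.
- by move=> x _; rewrite lee_fin exprn_ge0 // csize_ge0.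
- by apply/measurable_EFinP; exact: (code_fun_measurable i j (fun w => csize w ^+ k)).
- by apply/measurable_EFinP/measurable_funX; exact: sqr_measurable.
- by move=> x _; rewrite lee_fin; apply: lerXn2r; rewrite ?nnegrE ?csize_ge0 ?addr_ge0 ?sqr_ge0 // csize_le.
Qed.

Definition mre n i j : R := \sum_w @pcode n i j w * rval R w.1.
Definition mim n i j : R := \sum_w @pcode n i j w * rval R w.2.
Definition msq n i j : R := \sum_w @pcode n i j w * csize w.
Definition mvar n i j : R := msq n i j - mre n i j ^+ 2 - mim n i j ^+ 2.

Lemma msq_le n i j : msq n i j <= v.
Proof.
rewrite -lee_fin (pcode_sum i j (@csize n)) -(varX i j); apply: ge0_le_integral => //.
- by move=> x _; rewrite lee_fin csize_ge0.
- by apply/measurable_EFinP; exact: (code_fun_measurable i j (@csize n)).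
- by apply/measurable_EFinP; exact: sqr_measurable.
- by move=> x _; rewrite lee_fin csize_le.
Qed.

Lemma dom_integrable i j : P.-integrable setT (EFin \o (fun x => 1 + (Xre i j x ^+ 2 + Xim i j x ^+ 2))).
Proof.
rewrite (_ : EFin \o _ = (fun x => (cst 1%:E x + (Xre i j x ^+ 2 + Xim i j x ^+ 2)%:E)%E)) //.
by apply: integrableD => //; [exact: finite_measure_integrable_cst | exact: sqr_integrable].
Qed.

Lemma cvg_real_of_int (f : nat -> T -> R) (g : T -> R) (a : nat -> R) b :
  (forall n, (a n)%:E = (\int[P]_x (f n x)%:E)%E) -> (b%:E = \int[P]_x (g x)%:E)%E ->
  (\int[P]_x (f n x)%:E @[n --> \oo] --> \int[P]_x (g x)%:E)%E -> a n @[n --> \oo] --> b.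
Proof.
move=> ha hb; rewrite -hb; under eq_fun do rewrite -ha.
exact: fine_cvg.
Qed.

Lemma mre_cvg i j : mre n i j @[n --> \oo] --> 0.
Proof.
apply: (@cvg_real_of_int (fun n x => rval R (code n i j x).1) (Xre i j)).
- by move=> n; exact: (pcode_sum i j (fun w : V n => rval R w.1)).
- by have [-> _] := meanX i j.
apply: (integral_bounded_cvg _ _ _ (dom_integrable i j)).
- by move=> n; exact: (code_fun_measurable i j (fun w : V n => rval R w.1)).
- by have [] := mX i j.
- by move=> x; exact: rval_cvg.
move=> n x; apply: (le_trans (rval_norm_le _ _)).
have := sqr_ge0 (`|Xre i j x| - 1); rewrite -(real_normK (num_real (Xre i j x))).
by have := sqr_ge0 (Xim i j x); rewrite sqrrB; have := normr_ge0 (Xre i j x); nra.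
Qed.

Lemma mim_cvg i j : mim n i j @[n --> \oo] --> 0.
Proof.
apply: (@cvg_real_of_int (fun n x => rval R (code n i j x).2) (Xim i j)).
- by move=> n; exact: (pcode_sum i j (fun w : V n => rval R w.2)).
- by have [_ ->] := meanX i j.
apply: (integral_bounded_cvg _ _ _ (dom_integrable i j)).
- by move=> n; exact: (code_fun_measurable i j (fun w : V n => rval R w.2)).
- by have [] := mX i j.
- by move=> x; exact: rval_cvg.
move=> n x; apply: (le_trans (rval_norm_le _ _)).
have := sqr_ge0 (`|Xim i j x| - 1); rewrite -(real_normK (num_real (Xim i j x))).
by have := sqr_ge0 (Xre i j x); rewrite sqrrB; have := normr_ge0 (Xim i j x); nra.
Qed.

Lemma msq_cvg i j : msq n i j @[n --> \oo] --> v.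
Proof.
apply: (@cvg_real_of_int (fun n x => csize (code n i j x)) (fun x => Xre i j x ^+ 2 + Xim i j x ^+ 2)).
- by move=> n; exact: (pcode_sum i j (@csize n)).
- by rewrite varX.
apply: (integral_bounded_cvg _ _ _ (dom_integrable i j)).
- by move=> n; exact: (code_fun_measurable i j (@csize n)).
- exact: sqr_measurable.
- by move=> x; apply: cvgD; rewrite expr2; under eq_fun do rewrite expr2; apply: cvgM; exact: rval_cvg.
- by move=> n x; rewrite ger0_norm ?csize_ge0 // (le_trans (csize_le _ _ _ _)) // lerDr.
Qed.

Lemma mvar_cvg i j : mvar n i j @[n --> \oo] --> v.
Proof.
rewrite -[X in _ --> X](_ : v - 0 * 0 - 0 * 0 = v); last by ring.
rewrite /mvar; under eq_fun do rewrite !expr2.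
by apply: cvgB; [apply: cvgB; [exact: msq_cvg | apply: cvgM; exact: mre_cvg] | apply: cvgM; exact: mim_cvg].
Qed.

(** Rounding spoils mean and variance. Subtracting the mean of the code and rescaling by this factor
    restores both exactly, as [column_model] demands, and both corrections disappear in the
    limit. *)
Definition xscale n i j : R := Num.sqrt (v / mvar n i j).
Definition xcode n i j (w : V n) : R[i] :=
  (xscale n i j * (rval R w.1 - mre n i j)) +i* (xscale n i j * (rval R w.2 - mim n i j)).

Lemma xscale_cvg i j : xscale n i j @[n --> \oo] --> (1 : R).
Proof.
rewrite -[X in _ --> X](_ : Num.sqrt (v / v) = 1); last by rewrite divff ?gt_eqF // sqrtr1.
apply: (@continuous_cvg _ _ _ _ _ _ Num.sqrt); first exact: sqrt_continuous.
by apply: cvgM; [exact: cvg_cst | apply: cvgV; [rewrite gt_eqF | exact: mvar_cvg]].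
Qed.

(** Per power of |x|^2: 4 from the squared scale, 2 from removing the mean, 2 from the power of a
    sum. The constant does not depend on the rounding, so it serves all approximations. *)
Definition ckap k : R := 16 ^+ k * (`|c k| + 1).

Lemma discretized_column n : (forall i j, v / 4 <= mvar n i j) ->
  forall j, column_model (fun i => @pcode n i j) (fun i => @xcode n i j) v ckap.
Proof.
move=> hv j; have vr0 i : 0 < mvar n i j by apply: lt_le_trans (hv i j); rewrite divr_gt0.
have sc2 i : xscale n i j ^+ 2 = v / mvar n i j by rewrite sqr_sqrtr // divr_ge0 // ltW.
have nx i w : nrm (@xcode n i j w) ^+ 2 = xscale n i j ^+ 2 * (csize w - 2 * mre n i j * rval R w.1 - 2 * mim n i j * rval R w.2
   + (mre n i j ^+ 2 + mim n i j ^+ 2)).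
  by rewrite nrm_sqr /= /csize; ring.
split=> //.
- by move=> i w; exact: pcode_ge0.
- by move=> i; exact: pcode_sum1.
- by move=> k; rewrite /ckap mulr_ge0 ?exprn_ge0 // addr_ge0.
- move=> i; apply: cplx_eq; rewrite ?cRe_sum ?cIm_sum /=.
    under eq_bigr do rewrite mul0r subr0 mulrCA mulrBr.
    by rewrite -mulr_sumr sumrB -mulr_suml pcode_sum1 mul1r subrr mulr0.
  under eq_bigr do rewrite mul0r addr0 mulrCA mulrBr.
  by rewrite -mulr_sumr sumrB -mulr_suml pcode_sum1 mul1r subrr mulr0.
- move=> i; transitivity (\sum_w (xscale n i j ^+ 2 * (@pcode n i j w * csize w) - xscale n i j ^+ 2 * (2 * mre n i j) * (pcode i j w * rval R w.1)
      - xscale n i j ^+ 2 * (2 * mim n i j) * (pcode i j w * rval R w.2) + xscale n i j ^+ 2 * (mre n i j ^+ 2 + mim n i j ^+ 2) * pcode i j w)).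
    by apply: eq_bigr => w _; rewrite nx; ring.
  rewrite big_split !sumrB -!mulr_sumr pcode_sum1 -/(mre n i j) -/(mim n i j) -/(msq n i j).
  transitivity (xscale n i j ^+ 2 * mvar n i j); first by rewrite /mvar /=; ring.
  by rewrite sc2 divfK // gt_eqF.
move=> i k; have s4 : xscale n i j ^+ 2 <= 4.
  by rewrite sc2 ler_pdivrMr //; have := hv i j; lra.
have mm : mre n i j ^+ 2 + mim n i j ^+ 2 <= v by have := vr0 i; have := msq_le n i j; rewrite /mvar; lra.
apply: (@le_trans _ _ (\sum_w @pcode n i j w * (16 ^+ k * (csize w ^+ k + v ^+ k)))).
  apply: ler_sum => w _; rewrite ler_wpM2l ?pcode_ge0 //.
  apply: (@le_trans _ _ ((8 * (csize w + v)) ^+ k)).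
    apply: lerXn2r; rewrite ?nnegrE ?sqr_ge0 //; first by rewrite mulr_ge0 // addr_ge0 ?csize_ge0 // ltW.
    rewrite nx; set Q := (X in _ * X <= _).
    have Q0 : 0 <= Q.
      by rewrite (_ : Q = (rval R w.1 - mre n i j) ^+ 2 + (rval R w.2 - mim n i j) ^+ 2) ?addr_ge0 ?sqr_ge0 // /Q /csize; ring.
    have Q2 : Q <= 2 * (csize w + v).
      apply: (@le_trans _ _ (2 * (csize w + (mre n i j ^+ 2 + mim n i j ^+ 2)))); last by rewrite ler_wpM2l // lerD2l.
      rewrite -subr_ge0 (_ : _ - Q = (rval R w.1 + mre n i j) ^+ 2 + (rval R w.2 + mim n i j) ^+ 2) ?addr_ge0 ?sqr_ge0 //.
      by rewrite /Q /csize; ring.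
    apply: (@le_trans _ _ (4 * (2 * (csize w + v)))); last by lra.
    by apply: ler_pM => //; rewrite sqr_ge0.
  rewrite exprMn (_ : 16 ^+ k = 8 ^+ k * 2 ^+ k :> R); last by rewrite -exprMn; congr (_ ^+ k); ring.
  rewrite -[leRHS]mulrA ler_wpM2l ?exprn_ge0 //.
  by apply: pow_sum_le; [exact: csize_ge0 | exact: ltW].
under eq_bigr do rewrite mulrCA mulrDr.
rewrite -mulr_sumr big_split /= -mulr_suml pcode_sum1 mul1r /ckap -[leRHS]mulrA ler_wpM2l ?exprn_ge0 //.
rewrite mulrDl mul1r lerD2r; apply: (le_trans (csize_mom n i j k)).
by rewrite ler_wpM2r ?exprn_ge0 ?(ltW v0) // ler_norm.
Qed.

Lemma mvar_near : exists n0, forall n, (n0 <= n)%N -> forall i j, v / 4 <= mvar n i j.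
Proof.
have h (ij : 'I_M * 'I_N) : exists n0, forall n, (n0 <= n)%N -> v / 4 <= mvar n ij.1 ij.2.
  have v4 : 0 < v / 2 by rewrite divr_gt0.
  have /cvgrPdist_lt/(_ _ v4) [n0 _ hn] := mvar_cvg ij.1 ij.2.
  exists n0 => n hh; have := hn n hh; move/(le_lt_trans (ler_norm _)); lra.
have [f hf] := boolp.choice h.
exists (\max_ij f ij) => n hn i j; apply: (hf (i, j)); apply: leq_trans hn; exact: leq_bigmax.
Qed.

Definition outcome_matrix n x : 'M[R[i]]_(M, N) := Xmat (fun i j => @xcode n i j) (codes n x).

Lemma outcome_entry_cvg i j x :
  (xscale n i j * (rval R (code n i j x).1 - mre n i j) @[n --> \oo] --> Xre i j x) /\
  (xscale n i j * (rval R (code n i j x).2 - mim n i j) @[n --> \oo] --> Xim i j x).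
Proof.
have h1 := xscale_cvg i j; split.
  have e : Xre i j x = 1 * (Xre i j x - 0) by rewrite subr0 mul1r.
  rewrite e; apply: cvgM => //.
  by apply: cvgB; [exact: rval_cvg | exact: mre_cvg].
have e : Xim i j x = 1 * (Xim i j x - 0) by rewrite subr0 mul1r.
rewrite e; apply: cvgM => //.
by apply: cvgB; [exact: rval_cvg | exact: mim_cvg].
Qed.

Lemma gram_entry (A : 'M[R[i]]_(M, N)) a b : gram A a b =
  (\sum_i (complex.Re (A i a) * complex.Re (A i b) + complex.Im (A i a) * complex.Im (A i b))) +i*
  (\sum_i (complex.Re (A i a) * complex.Im (A i b) - complex.Im (A i a) * complex.Re (A i b))).
Proof.
rewrite /gram mxE; apply: cplx_eq; rewrite ?cRe_sum ?cIm_sum /=; apply: eq_bigr => i _; rewrite !mxE.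
  by rewrite cReM cReJ cImJ mulNr opprK.
by rewrite cImM cReJ cImJ mulNr.
Qed.

Lemma gram_outcome_cvg x e : 0 < e -> exists n0, forall n, (n0 <= n)%N ->
  forall a b, nrm ((gram (outcome_matrix n x) - gram (cmatrix Xre Xim x)) a b) <= e.
Proof.
move=> e0; have e2 : 0 < e / 2 by rewrite divr_gt0.
have h (ab : 'I_N * 'I_N) : exists n0, forall n, (n0 <= n)%N ->
    nrm ((gram (outcome_matrix n x) - gram (cmatrix Xre Xim x)) ab.1 ab.2) <= e.
  case: ab => a b /=.
  have cR : complex.Re (gram (outcome_matrix n x) a b) @[n --> \oo] --> complex.Re (gram (cmatrix Xre Xim x) a b).
    under eq_fun do rewrite gram_entry /=; rewrite gram_entry /=; apply: cvg_big => [|i _]; first exact: add_continuous.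
    under eq_fun do rewrite !mxE !ffunE; rewrite !mxE /=.
    have [r1 i1] := outcome_entry_cvg i a x; have [r2 i2] := outcome_entry_cvg i b x.
    by apply: cvgD; apply: cvgM.
  have cI : complex.Im (gram (outcome_matrix n x) a b) @[n --> \oo] --> complex.Im (gram (cmatrix Xre Xim x) a b).
    under eq_fun do rewrite gram_entry /=; rewrite gram_entry /=; apply: cvg_big => [|i _]; first exact: add_continuous.
    under eq_fun do rewrite !mxE !ffunE; rewrite !mxE /=.
    have [r1 i1] := outcome_entry_cvg i a x; have [r2 i2] := outcome_entry_cvg i b x.
    by apply: cvgB; apply: cvgM.
  have /cvgrPdist_le/(_ _ e2) [n1 _ h1] := cR; have /cvgrPdist_le/(_ _ e2) [n2 _ h2] := cI.
  exists (maxn n1 n2) => n; rewrite geq_max => /andP[/h1 /= d1 /h2 /= d2].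
  rewrite submxE; apply: (le_trans (nrm_le_ReIm _)); rewrite cReB cImB.
  by rewrite distrC [X in _ + X]distrC; lra.
have [f hf] := boolp.choice h; exists (\max_ab f ab) => n hn a b.
by apply: (hf (a, b)); apply: leq_trans hn; exact: leq_bigmax.
Qed.

(** The inequality in the event is strict, so by convergence of the eigenvalues the event lies in
    the limes inferior of the approximating events, each of probability at most q. The eigenvalue is
    measurable as a pointwise limit of functions of finitely many codes. *)
Lemma limit_law (lam : T -> nat -> R) k (q gam thr : R) : (1 <= k <= N)%N ->
  (forall x, nontrivial_spectrum N (gram (cmatrix Xre Xim x)) (lam x)) ->
  (forall (W : finType) (p : 'I_M -> 'I_N -> W -> R) (xv : 'I_M -> 'I_N -> W -> R[i]),
    (forall j, column_model (fun i => p i j) (fun i => xv i j) v ckap) ->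
    forall lam' : {ffun 'I_N -> {ffun 'I_M -> W}} -> nat -> R,
    (forall o, nontrivial_spectrum N (gram (Xmat xv o)) (lam' o)) ->
    fP (wt p) (fun o => thr < `|lam' o k - gam|) <= q) ->
  (P [set x | (thr < `|lam x k - gam|)%R] <= q%:E)%E.
Proof.
move=> hk slam fin; have [n0 hn0] := mvar_near.
have hl (no : {n : nat & {ffun 'I_N -> {ffun 'I_M -> V n}}}) : exists mu : nat -> R,
    nontrivial_spectrum N (gram (Xmat (fun i j => @xcode (projT1 no) i j) (projT2 no))) mu.
  exact: (hermit_real_spectrum (hermit_gram _)).
have [L hL] := boolp.choice hl.
pose ell n x := L (existT _ n (codes n x)) k.
have mell n : measurable_fun setT (ell n).
  move=> _ B mB; rewrite setTI.
  rewrite (_ : _ @^-1` _ = \big[setU/set0]_(o : {ffun 'I_N -> {ffun 'I_M -> V n}} | L (existT _ n o) k \in B) [set x | codes n x == o]).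
    by apply: bigsetU_measurable => o _; exact: codes_measurable.
  rewrite -bigcup_seq_cond; apply/seteqP; split => x /=.
    by move=> h; exists (codes n x) => //=; rewrite mem_index_enum inE.
  by case=> w /= /andP[_ h] /eqP e; rewrite /ell e; rewrite inE in h.
have cell x : ell n x @[n --> \oo] --> lam x k.
  have Nr : 0 < N%:R :> R by rewrite ltr0n; case/andP: hk => a b; exact: leq_trans b.
  apply/cvgrPdist_le => e e0; have e1 : 0 < e / N%:R by rewrite divr_gt0.
  have [n1 h1] := gram_outcome_cvg x e1; exists n1 => // n /= hn; rewrite distrC.
  have := weyl (hermit_gram _) (hermit_gram _) (hL (existT _ n (codes n x))) (slam x) (h1 n hn) hk.
  by rewrite [_ * (_ / _)]mulrC divfK ?gt_eqF.
have mlam : measurable_fun setT (fun x => lam x k).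
  apply/measurable_EFinP; apply: (emeasurable_fun_cvg (fun n x => (ell n x)%:E)).
    by move=> n; exact/measurable_EFinP.
  by move=> x _; apply: cvg_EFin; [exact: nearW | exact: cell].
have mdist (f : T -> R) : measurable_fun setT f -> measurable [set x | (thr < `|f x - gam|)%R].
  move=> mf; apply: measurable_boolT; apply: measurable_fun_ltr => //.
  by apply: (measurableT_comp (@normr_measurable R setT)); exact: measurable_funB.
pose E n := [set x | (thr < `|ell n x - gam|)%R].
pose F m := \bigcap_(n in [set n | (m + n0 <= n)%N]) E n.
have mE n : measurable (E n) by exact: mdist.
have mF m : measurable (F m) by rewrite /F -[X in measurable X]setCK setC_bigcap; apply: measurableC; apply: bigcup_measurable => n _; exact: measurableC.
have mU : measurable (\bigcup_m F m) by exact: bigcup_measurable.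
have PF m : (P (F m) <= q%:E)%E.
  apply: (@le_trans _ _ (P (E (m + n0)%N))).
    by apply: le_measure; rewrite ?inE // => x /(_ (m + n0)%N); apply => /=.
  rewrite /E (codes_fP (fun o => thr < `|L (existT _ (m + n0)%N o) k - gam|)) lee_fin.
  apply: (fin _ (@pcode (m + n0)) (fun i j => @xcode (m + n0) i j) _ (fun o => L (existT _ (m + n0)%N o))).
    by apply: discretized_column => i j; apply: hn0; rewrite leq_addl.
  by move=> o; exact: (hL (existT _ (m + n0)%N o)).
apply: (@le_trans _ _ (P (\bigcup_m F m))).
  apply: le_measure; rewrite ?inE //; first exact: mdist.
  move=> x /= hx; pose g := `|lam x k - gam| - thr; have g0 : 0 < g by rewrite subr_gt0.
  have /cvgrPdist_lt/(_ _ g0) [n1 _ h1] := cell x.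
  exists n1 => // n /= hn; have := h1 n (leq_trans (leq_addr _ _) hn) => /= hh; rewrite /E /=.
  have := ler_normD (lam x k - ell n x) (ell n x - gam); rewrite addrA subrK; move: hh; rewrite /g; lra.
have cv := nondecreasing_cvg_mu mF mU (_ : {homo F : n m / (n <= m)%N >-> (n <= m)%O}).
have {cv} cv : (P \o F) x @[x --> \oo] --> P (\bigcup_m F m).
  apply: cv => a b ab; apply/subsetPset => x h n /= hn; apply: h => /=.
  by apply: leq_trans hn; rewrite leq_add2r.
rewrite -(cvg_lim _ cv) //; apply: lime_le; first by apply/cvg_ex; exists (P (\bigcup_m F m)).
by apply: nearW => m; exact: PF.
Qed.
End DiscretizedModel.

(** * Both edges *)

Section EdgeLaw.
Variable R : realType.

Record tall_entries (c : nat -> R) (M N : nat) d (T : measurableType d) (P : probability T R)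
    (Xre Xim : 'I_M -> 'I_N -> T -> R) (lam : T -> nat -> R) : Prop := TallEntries {
  te_N : (0 < N)%N;
  te_NM : (N <= M)%N;
  te_meas : forall i j, measurable_fun setT (Xre i j) /\ measurable_fun setT (Xim i j);
  te_ind : mutually_independent P (fun ij : 'I_M * 'I_N => fun x => (Xre ij.1 ij.2 x, Xim ij.1 ij.2 x));
  te_mean : forall i j, (\int[P]_x (Xre i j x)%:E = 0)%E /\ (\int[P]_x (Xim i j x)%:E = 0)%E;
  te_var : forall i j, (\int[P]_x ((Xre i j x) ^+ 2 + (Xim i j x) ^+ 2)%:E = (spar N (Num.sqrt (N%:R / M%:R)))%:E)%E;
  te_mom : forall k i j, (\int[P]_x (((Xre i j x) ^+ 2 + (Xim i j x) ^+ 2) ^+ k)%:E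
     <= (c k * spar N (Num.sqrt (N%:R / M%:R)) ^+ k)%:E)%E;
  te_spec : forall x, nontrivial_spectrum N (gram (cmatrix Xre Xim x)) (lam x) }.

Lemma aspect_sqrt (M N : nat) (s : R) : (0 < N)%N -> (N <= M)%N -> s = Num.sqrt (N%:R / M%:R) ->
  [/\ 0 < s, s <= 1, s ^+ 2 * M%:R = N%:R & s ^+ 2 = N%:R / M%:R].
Proof.
move=> N0 NM ->; have Nr : 0 < N%:R :> R by rewrite ltr0n.
have Mr : 0 < M%:R :> R by rewrite ltr0n (leq_trans N0).
have q0 : 0 < N%:R / M%:R :> R by rewrite divr_gt0.
rewrite sqr_sqrtr ?(ltW q0) // sqrtr_gt0 q0 divfK ?gt_eqF //; split=> //.
have q1 : N%:R / M%:R <= 1 :> R by rewrite ler_pdivrMr // mul1r ler_nat.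
by apply: (le_trans (ler_wsqrtr q1)); rewrite sqrtr1.
Qed.

(** Here xi is the distance of the classical location to the edge. The powers with exponents -1/3
    and -2/3 become cube roots t of j and z of 1/N, and G^100 <= N makes dl at most tt, so that xi +
    dl stays away from the opposite edge. *)
Lemma edge_law (tt : R) (c : nat -> R) (B e D : nat) : 0 < tt -> tt <= 1 -> exists G0 : R, 1 <= G0 /\
  forall (G : R) (M N : nat) d (T : measurableType d) (P : probability T R)
    (Xre Xim : 'I_M -> 'I_N -> T -> R) (lam : T -> nat -> R) (s : R),
  tall_entries c P Xre Xim lam -> s = Num.sqrt (N%:R / M%:R) ->
  G0 <= G -> N%:R <= G ^+ e -> G ^+ 100 <= N%:R -> s^-1 <= N%:R ^+ B ->
  forall (sg xi thr : R) (j : nat), sg = 1 \/ (sg = -1 /\ s <= 1 - tt / 2) -> (1 <= j <= N)%N ->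
  0 <= xi -> xi <= 4 - 2 * tt ->
  (xi = 0 /\ j = 1%N) \/ (0 < xi /\ `|nu s sg xi - j%:R / N%:R| <= 1 / N%:R) ->
  G ^+ 60 * (j%:R `^ (- (1 / 3)) * N%:R `^ (- (2 / 3))) <= thr ->
  (P [set x | (thr < `|lam x (if sg == 1 then j else (N.+1 - j)%N) - (s^-1 + s + sg * (2 - xi))|)%R]
    <= ((N%:R ^+ D)^-1)%:E)%E.
Proof.
move=> tt0 tt1; have [G0 [G01 FR]] := finite_rigidity (ckap c) tt0 tt1 B e D.
exists (G0 + tt^-1); split.
  by apply: (le_trans G01); rewrite lerDl invr_ge0 ltW.
move=> G M N d T P Xre Xim lam s te sE GG nG GN sB sg xi thr j regime hj xi0 xi4 loc hthr.
have N0 := te_N te; have NM := te_NM te; have [s0 s1 sMN s2] := aspect_sqrt N0 NM sE.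
have GG0 : G0 <= G by apply: le_trans GG; rewrite lerDl invr_ge0 ltW.
have Gtt : tt^-1 <= G by apply: le_trans GG; rewrite lerDr (le_trans _ G01).
have G1 : 1 <= G by apply: le_trans GG0.
have Gp : 0 < G by apply: lt_le_trans G1.
have GN60 : G ^+ 60 <= N%:R by apply: le_trans GN; rewrite ler_weXn2l.
have Nr : 0 < N%:R :> R by rewrite ltr0n.
have jr : 0 < j%:R :> R by rewrite ltr0n; case/andP: hj.
pose z : R := N%:R `^ (- (1 / 3)); pose t : R := j%:R `^ (1 / 3).
have z0 : 0 < z by rewrite powR_gt0.
have zX k : z ^+ k = N%:R `^ (- (1 / 3) * k%:R) by rewrite powRrM powR_mulrn // powR_ge0.
have zN : z ^+ 3 * N%:R = 1.
  rewrite zX (_ : - (1 / 3) * 3%:R = - 1 :> R); last by field.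
  by rewrite powRN powRr1 // mulVf // gt_eqF.
have z2 : z ^+ 2 = N%:R `^ (- (2 / 3)).
  by rewrite zX; congr (_ `^ _); field.
have t0 : 0 < t by rewrite powR_gt0.
have tj : t ^+ 3 = j%:R.
  rewrite -powR_mulrn ?powR_ge0 // -powRrM (_ : 1 / 3 * 3%:R = 1 :> R); last by field.
  by rewrite powRr1 // ltW.
have t1 : 1 <= t.
  by apply: cube_le; rewrite ?(ltW t0) // expr1n tj ler1n; case/andP: hj.
have ti : t^-1 = j%:R `^ (- (1 / 3)) by rewrite powRN.
pose dl := G ^+ 60 * z ^+ 2 / t.
have dlthr : dl <= thr by apply: le_trans hthr; rewrite /dl ti -z2 mulrAC -mulrA.
have dltt : dl <= tt.
  apply: (@le_trans _ _ (G ^+ 60 * z ^+ 2)).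
    by rewrite /dl ler_pdivrMr // ler_peMr // mulr_ge0 ?exprn_ge0 // ltW.
  apply: (@le_trans _ _ G^-1); last by rewrite -[leRHS]invrK lef_pV2 ?posrE ?invr_gt0.
  apply: cube_le; first by rewrite invr_ge0 ltW.
  rewrite exprVn -[leRHS]mul1r ler_pdivlMr ?exprn_gt0 //.
  have e1 : (z ^+ 3 * G ^+ 100) ^+ 2 <= 1.
    rewrite expr_le1 ?mulr_ge0 ?exprn_ge0 ?(ltW z0) ?(ltW Gp) // -zN ler_wpM2l ?exprn_ge0 ?(ltW z0) //.
  apply: le_trans e1; rewrite (_ : (G ^+ 60 * z ^+ 2) ^+ 3 * G ^+ 3 = z ^+ 6 * G ^+ 183); last by ring.
  rewrite (_ : (z ^+ 3 * G ^+ 100) ^+ 2 = z ^+ 6 * G ^+ 200); last by ring.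
  by rewrite ler_wpM2l ?exprn_ge0 ?(ltW z0) // ler_weXn2l.
have xd : xi + dl <= 4 - tt by move: xi4 dltt; clear; lra.
set k := if sg == 1 then j else (N.+1 - j)%N.
have hk : (1 <= k <= N)%N.
  by rewrite /k; case: ifP => // _; move: hj => /andP[j1 jN]; rewrite subn_gt0 ltnS jN leq_subLR -add1n leq_add2r.
have sgP : sg = 1 \/ sg = -1 by case: regime => [->|[-> _]]; [left | right].
have v0 : 0 < spar N (Num.sqrt (N%:R / M%:R : R)) by rewrite -sE /spar divr_gt0.
apply: (limit_law (te_meas te) (te_ind te) (te_mean te) (te_var te) (te_mom te) v0 hk (te_spec te)).
move=> W p xv hc lam' sp.
have fm : fmodel (ckap c) s p xv.
  by split=> // mu; rewrite sE; exact: hc.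
have cm : forall mu, column_model (p^~ mu) (xv^~ mu) (spar N s) (ckap c) := fm_cm fm.
apply: le_trans (FR G M N s W p xv fm GG0 nG GN60 sB sg z t xi dl j regime z0 zN t1 tj hj erefl xd xi0 loc lam' sp).
apply: fP_le; first exact: (wt_ge0 cm).
move=> o h; apply: (le_lt_trans dlthr); apply: (lt_le_trans h).
rewrite /edge_gap /ycen -/k (_ : 2 - sg * (lam' o k - (s^-1 + s)) - xi = - (sg * (lam' o k - (s^-1 + s + sg * (2 - xi))))).
  by rewrite normrN (sg_norm sgP).
rewrite (_ : sg * (lam' o k - (s^-1 + s + sg * (2 - xi))) = sg * (lam' o k - (s^-1 + s)) - sg * sg * (2 - xi)); last by ring.
by rewrite (sg_sqr sgP); ring.
Qed.

Definition same_law (N K : nat) (phi w s : R) : Prop :=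
  [/\ 0 <= phi, Num.sqrt phi = w / s, Num.sqrt phi + (Num.sqrt phi)^-1 = s^-1 + s, 0 < w & N%:R^-1 = w * K%:R^-1].

Lemma upper_law (omega : R) (c : nat -> R) (B e D : nat) : 0 < omega < 1 -> exists G0 : R, 1 <= G0 /\
  forall (G : R) (M N : nat) d (T : measurableType d) (P : probability T R)
    (Xre Xim : 'I_M -> 'I_N -> T -> R) (lam : T -> nat -> R) (s : R),
  tall_entries c P Xre Xim lam -> s = Num.sqrt (N%:R / M%:R) ->
  G0 <= G -> N%:R <= G ^+ e -> G ^+ 100 <= N%:R -> s^-1 <= N%:R ^+ B ->
  forall (n : nat) (phi w thr : R) (alpha : nat), same_law n N phi w s -> (1 <= alpha)%N ->
  alpha%:R <= (1 - omega) * N%:R ->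
  G ^+ 60 * (alpha%:R `^ (- (1 / 3)) * N%:R `^ (- (2 / 3))) <= thr ->
  (P [set x | (thr < `|lam x alpha - classical_location n phi alpha|)%R] <= ((N%:R ^+ D)^-1)%:E)%E.
Proof.
(* [edge_far] leaves the distance omega^2 / 16 = 2 tt to the lower edge. *)
move=> /andP[om0 om1]; pose tt := omega ^+ 2 / 32.
have o2 : 0 < omega ^+ 2 by rewrite exprn_gt0.
have o3 : omega ^+ 2 <= 1 by rewrite expr_le1 // ltW.
have tt0 : 0 < tt by rewrite /tt; lra.
have tt1 : tt <= 1 by rewrite /tt; lra.
have [G0 [G01 EL]] := edge_law c B e D tt0 tt1; exists G0; split=> //.
move=> G M N d T P Xre Xim lam s te sE GG nG GN sB n phi w thr alpha [p0 hw hc w0 hn] a1 aN hthr.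
have N0 := te_N te; have NM := te_NM te; have [s0 s1 sMN s2] := aspect_sqrt N0 NM sE.
have Nr : 0 < N%:R :> R by rewrite ltr0n.
have aw : alpha%:R / N%:R <= 1 - omega by rewrite ler_pdivrMr.
have [|E hE eE] := nE_surj s0 s1 (a := alpha%:R / N%:R).
  by rewrite divr_gt0 ?ltr0n //=; lra.
have hE' := hE; rewrite ltr_norml in hE'; case/andP: hE' => E1 E2.
have sgP : 1 = 1 :> R \/ 1 = -1 :> R by left.
have nuE : nu s 1 (2 - E) = alpha%:R / N%:R by rewrite -nE_nu.
have x0 : 0 < 2 - E by lra.
have x4 : 2 - E < 4 by lra.
have far := edge_far s0 s1 sgP x0 x4 om0 (ltW om1) (_ : nu s 1 (2 - E) <= 1 - omega).
rewrite nuE in far; have {}far := far aw.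
have aN' : (alpha <= N)%N.
  by rewrite -(ler_nat R) (le_trans aN) // ler_piMl ?(ltW Nr) //; lra.
have loc : classical_location n phi alpha = s^-1 + s + E.
  by apply: (classical_location_in s0 s1 p0 hw hc w0 hE); rewrite eE hn mulrCA.
have := EL G M N d T P Xre Xim lam s te sE GG nG GN sB 1 (2 - E) thr alpha (or_introl erefl) _ (ltW x0).
rewrite eqxx a1 aN' => /(_ isT); rewrite (_ : 1 * (2 - (2 - E)) = E); last by ring.
rewrite loc; apply => //; first by rewrite /tt; lra.
by right; split=> //; rewrite nuE subrr normr0 divr_ge0.
Qed.

(** Rounding in [n./2] prevents a >= n / 2; a quarter survives because a >= 1. *)
Lemma half_quarter a n : (1 <= a)%N -> (n./2 <= a)%N -> (n <= a * 4)%N.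
Proof.
move=> a1 h; rewrite -(odd_double_half n); apply: (@leq_trans (1 + a.*2)).
  by apply: leq_add; [exact: leq_b1 | rewrite leq_double].
by rewrite -muln2; move: a1; clear; lia.
Qed.

Lemma lower_law (c0 : R) (c : nat -> R) (B e D : nat) : 0 < c0 -> c0 <= 1 -> exists G0 : R, 1 <= G0 /\
  forall (G : R) (M N : nat) d (T : measurableType d) (P : probability T R)
    (Xre Xim : 'I_M -> 'I_N -> T -> R) (lam : T -> nat -> R) (s : R),
  tall_entries c P Xre Xim lam -> s = Num.sqrt (N%:R / M%:R) ->
  G0 <= G -> N%:R <= G ^+ e -> G ^+ 100 <= N%:R -> s^-1 <= N%:R ^+ B -> s <= 1 - c0 / 4 ->
  forall (n : nat) (phi w thr : R) (alpha : nat), same_law n N phi w s -> (1 <= alpha <= N)%N ->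
  (N./2 <= alpha)%N ->
  G ^+ 60 * ((N.+1 - alpha)%:R `^ (- (1 / 3)) * N%:R `^ (- (2 / 3))) <= thr ->
  (P [set x | (thr < `|lam x alpha - classical_location n phi alpha|)%R] <= ((N%:R ^+ D)^-1)%:E)%E.
Proof.
(* alpha >= N / 4 and [edge_far] leave the distance 1/256 >= 2 tt to the upper edge. *)
move=> c00 c01; pose tt := c0 / 512.
have tt0 : 0 < tt by rewrite /tt; lra.
have tt1 : tt <= 1 by rewrite /tt; lra.
have [G0 [G01 EL]] := edge_law c B e D tt0 tt1; exists G0; split=> //.
move=> G M N d T P Xre Xim lam s te sE GG nG GN sB sc n phi w thr alpha [p0 hw hc w0 hn] /andP[a1 aN] a2 hthr.
have N0 := te_N te; have NM := te_NM te; have [s0 s1 sMN s2] := aspect_sqrt N0 NM sE.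
have Nr : 0 < N%:R :> R by rewrite ltr0n.
have regime : (-1 : R) = 1 \/ ((-1 : R) = -1 /\ s <= 1 - tt / 2) by right; split=> //; rewrite /tt; lra.
have j1 : (1 <= N.+1 - alpha <= N)%N by rewrite subn_gt0 ltnS aN leq_subLR -add1n leq_add2r.
have {}EL := EL G M N d T P Xre Xim lam s te sE GG nG GN sB (-1) _ thr (N.+1 - alpha)%N regime j1.
have ne : ((-1 : R) == 1) = false by apply/eqP; lra.
have idx : (N.+1 - (N.+1 - alpha))%N = alpha by rewrite subKn // ltnW.
move: EL; rewrite ne idx => EL.
(* The last eigenvalue has its classical location on the edge itself: xi = 0 and j = 1. *)
have [aK|aK] := eqVneq alpha N.
  have slt : s < 1 by lra.
  have loc : classical_location n phi alpha = s^-1 + s - 2.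
    by apply: (classical_location_bot s0 s1 p0 hw hc w0 slt); rewrite hn aK mulrCA mulfV ?mulr1 // gt_eqF.
  have := EL 0; rewrite subr0 mulN1r loc; apply => //; first by rewrite /tt; lra.
  by left; split=> //; rewrite aK subSnn.
have aN' : (alpha < N)%N by rewrite ltn_neqAle aK.
have aw : 4^-1 <= alpha%:R / N%:R :> R.
  rewrite ler_pdivlMr // mulrC ler_pdivrMr // -natrM ler_nat.
  exact: half_quarter.
have aw1 : alpha%:R / N%:R < 1 :> R by rewrite ltr_pdivrMr // mul1r ltr_nat.
have [|E hE eE] := nE_surj s0 s1 (a := alpha%:R / N%:R).
  by rewrite divr_gt0 ?ltr0n.
have hE' := hE; rewrite ltr_norml in hE'; case/andP: hE' => E1 E2.
have sgP : -1 = 1 :> R \/ -1 = -1 :> R by right.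
have nuE : nu s (-1) (E + 2) = 1 - alpha%:R / N%:R by rewrite -eE nE_nuN; ring.
have x0 : 0 < E + 2 by lra.
have x4 : E + 2 < 4 by lra.
have far := edge_far s0 s1 sgP x0 x4 (_ : 0 < 4^-1) (_ : 4^-1 <= 1) (_ : nu s (-1) (E + 2) <= 1 - 4^-1).
have {}far : 4^-1 ^+ 2 / 16 <= 4 - (E + 2) by apply: far; rewrite ?nuE; lra.
have loc : classical_location n phi alpha = s^-1 + s + E.
  by apply: (classical_location_in s0 s1 p0 hw hc w0 hE); rewrite eE hn mulrCA.
have := EL (E + 2); rewrite mulN1r (_ : - (2 - (E + 2)) = E); last by ring.
rewrite loc; apply => //; first exact: ltW.
  by move: far; rewrite /tt exprVn; lra.
(* Counted from below, alpha has index j = N + 1 - alpha, while nu at its classical location is (j -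
   1) / N. The tolerance 1/N is exactly this shift. *)
right; split=> //; rewrite nuE natrB; last by rewrite ltnW.
rewrite -natr1 (_ : 1 - alpha%:R / N%:R - (N%:R + 1 - alpha%:R) / N%:R = - (1 / N%:R)); last by field; rewrite gt_eqF.
by rewrite normrN ger0_norm // divr_ge0.
Qed.
End EdgeLaw.

(** * Reduction to tall matrices and choice of exponents *)

Section Reduction.
Variable R : realType.

Lemma char_poly_tr (F : fieldType) n (A : 'M[F]_n) : char_poly A^T = char_poly A.
Proof. by rewrite /char_poly -det_tr; congr (\det _); rewrite /char_poly_mx linearB /= tr_scalar_mx map_trmx trmxK. Qed.

(** By [char_poly_mulC] the two Gram matrices have the same characteristic polynomial up to a power
    of the variable, which accounts for the N - M trivial eigenvalues. *)
Lemma gram_tr_spectrum M N (A : 'M[R[i]]_(M, N)) lam : (M <= N)%N ->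
  nontrivial_spectrum M (gram A) lam -> nontrivial_spectrum M (gram A^T) lam.
Proof.
move=> MN [hc mono]; split=> //; rewrite subnn expr0 mul1r.
have e : gram A^T = (A *m (map_mx (@conjc R) A)^T)^T by rewrite trmx_mul trmxK /gram -map_trmx trmxK.
rewrite e char_poly_tr; have := char_poly_mulC A (map_mx (@conjc R) A)^T.
rewrite -[_ *m A]/(gram A) hc mulrA -exprD subnKC // mulrC => /mulfI; apply.
by rewrite monic_neq0 // monicXn.
Qed.

Section Entries.
Variables (Cp : nat -> R) (M N : nat) (d : measure_display) (T : measurableType d) (P : probability T R).
Variables (Xre Xim : 'I_M -> 'I_N -> T -> R).

Lemma entry_swap : entry_hypotheses Cp P Xre Xim ->
  entry_hypotheses Cp P (fun i j => Xre j i) (fun i j => Xim j i).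
Proof.
case=> mX ind mean var mom; split.
- by move=> i j; exact: mX.
- move=> J B mB; pose sw (ij : 'I_M * 'I_N) := (ij.2, ij.1).
  have := ind [set ij : 'I_M * 'I_N | sw ij \in J]%SET (fun ij => B (sw ij)) (fun ij => mB (sw ij)).
  rewrite (_ : \bigcap_(i in _) _ = \bigcap_(ij in [set j | j \in J]) (fun x => (Xre ij.2 ij.1 x, Xim ij.2 ij.1 x)) @^-1` B ij); last first.
    apply/seteqP; split => x h [i j] /= hij; first by apply: (h (j, i)); rewrite /= finset.inE.
    by rewrite /= finset.inE in hij; exact: (h (j, i) hij).
  move=> ->; rewrite [RHS](reindex sw) /=; last first.
    by exists (fun ij => (ij.2, ij.1)) => [[i j] _|[i j] _].
  by apply: eq_bigl => ij; rewrite finset.inE.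
- by move=> i j; exact: mean.
- by move=> i j; rewrite [M%:R * _]mulrC.
- by move=> p i j; rewrite [M%:R * _]mulrC; exact: mom.
Qed.

Lemma spar_sqrt : (0 < N)%N -> (0 < M)%N -> (Num.sqrt (N%:R * M%:R))^-1 = spar N (Num.sqrt (N%:R / M%:R : R)).
Proof.
move=> N0 M0; have Nr : 0 < N%:R :> R by rewrite ltr0n.
have Mr : 0 < M%:R :> R by rewrite ltr0n.
have q0 : 0 < Num.sqrt (N%:R * M%:R : R) by rewrite sqrtr_gt0 mulr_gt0.
have e : Num.sqrt (N%:R / M%:R) * Num.sqrt (N%:R * M%:R) = N%:R :> R.
  rewrite -sqrtrM ?divr_ge0 // (_ : N%:R / M%:R * (N%:R * M%:R) = N%:R ^+ 2); last by field; rewrite gt_eqF.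
  by rewrite sqrtr_sqr ger0_norm.
have b0 : 0 < Num.sqrt (N%:R / M%:R : R) by rewrite sqrtr_gt0 divr_gt0.
rewrite /spar; move: (Num.sqrt (N%:R / M%:R)) (Num.sqrt (N%:R * M%:R)) e q0 b0 => b a e a0 b0.
by rewrite -e; field; rewrite !gt_eqF.
Qed.

Lemma tall_of_entries lam : (0 < N)%N -> (N <= M)%N -> entry_hypotheses Cp P Xre Xim ->
  (forall x, nontrivial_spectrum N (gram (cmatrix Xre Xim x)) (lam x)) ->
  tall_entries (fun k => Cp (2 * k)%N) P Xre Xim lam.
Proof.
move=> N0 NM [mX ind mean var mom] sp; have M0 : (0 < M)%N by exact: leq_trans NM.
have q0 : 0 < Num.sqrt (N%:R * M%:R : R) by rewrite sqrtr_gt0 mulr_gt0 // ltr0n.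
split=> //; first by move=> i j; rewrite var spar_sqrt.
move=> k i j; rewrite -spar_sqrt //; have := mom (2 * k)%N i j.
under eq_integral do rewrite exprM [(_ * _) ^+ 2]exprMn !sqr_sqrtr ?sqrtr_ge0 ?addr_ge0 ?sqr_ge0 // exprMn EFinM.
rewrite ge0_integralZl_EFin ?exprn_ge0 ?(ltW q0) //; first last.
- apply/measurable_EFinP/measurable_funX; have [m1 m2] := mX i j.
  by apply: measurable_funD; exact: measurable_funX.
- by move=> x _; rewrite lee_fin exprn_ge0 // addr_ge0 ?sqr_ge0.
move=> h; rewrite exprVn EFinM muleC lee_pdivlMl ?exprn_gt0 //.
Qed.
End Entries.

(** For M < N the transposed matrix is tall with s = sqrt(M / N), and w = M / N, the remaining mass
    of the limit law being the atom at 0. *)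
Lemma tall_reduction (Cp : nat -> R) M N d (T : measurableType d) (P : probability T R)
    (Xre Xim : 'I_M -> 'I_N -> T -> R) lam : (0 < M)%N -> (0 < N)%N -> entry_hypotheses Cp P Xre Xim ->
  (forall x, nontrivial_spectrum (minn M N) (gram (cmatrix Xre Xim x)) (lam x)) ->
  exists Xre' Xim' : 'I_(maxn M N) -> 'I_(minn M N) -> T -> R,
    tall_entries (fun k => Cp (2 * k)%N) P Xre' Xim' lam /\
    exists w : R, same_law N (minn M N) (M%:R / N%:R) w (Num.sqrt ((minn M N)%:R / (maxn M N)%:R)).
Proof.
move=> M0 N0 eh sp; have Nr : 0 < N%:R :> R by rewrite ltr0n.
have Mr : 0 < M%:R :> R by rewrite ltr0n.
have phi0 : 0 <= M%:R / N%:R :> R by rewrite divr_ge0.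
have [NM|MN] := leqP N M.
  rewrite (minn_idPr NM) in sp; exists Xre, Xim; split; first exact: tall_of_entries.
  exists 1; have q : 0 < Num.sqrt (N%:R / M%:R : R) by rewrite sqrtr_gt0 divr_gt0.
  have e : Num.sqrt (M%:R / N%:R : R) = (Num.sqrt (N%:R / M%:R))^-1.
    by rewrite -sqrtrV ?divr_ge0 // invf_div.
  by split=> //; rewrite ?e ?invrK ?mul1r.
rewrite (minn_idPl (ltnW MN)) in sp.
exists (fun i j => Xre j i), (fun i j => Xim j i); split.
  apply: tall_of_entries => //; [exact: ltnW | exact: entry_swap |] => x.
  have -> : cmatrix (fun i j => Xre j i) (fun i j => Xim j i) x = (cmatrix Xre Xim x)^T by apply/matrixP => i j; rewrite !mxE.
  exact: gram_tr_spectrum (ltnW MN) (sp x).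
have q : 0 < Num.sqrt (M%:R / N%:R : R) by rewrite sqrtr_gt0 divr_gt0.
exists (Num.sqrt (M%:R / N%:R) ^+ 2); split=> //.
- by rewrite expr2 mulfK // gt_eqF.
- by rewrite addrC.
- by rewrite exprn_gt0.
- by rewrite sqr_sqrtr //; field; rewrite !gt_eqF.
Qed.

Lemma aspect_gap (c : R) M N : (0 < M)%N -> (0 < N)%N -> 0 < c -> c <= 1 -> c <= `|M%:R / N%:R - 1| ->
  Num.sqrt ((minn M N)%:R / (maxn M N)%:R) <= 1 - c / 4.
Proof.
move=> M0 N0 c0 c1 h; have Nr : 0 < N%:R :> R by rewrite ltr0n.
have Mr : 0 < M%:R :> R by rewrite ltr0n.
suff hs : (minn M N)%:R / (maxn M N)%:R <= 1 - c / 2.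
  apply: sqr_le_le; first by lra.
  rewrite sqr_sqrtr ?divr_ge0 //; apply: (le_trans hs).
  by have : 0 <= (c / 4) ^+ 2 by [rewrite sqr_ge0]; move=> h2; rewrite -subr_ge0 (_ : (1 - c / 4) ^+ 2 - (1 - c / 2) = (c / 4) ^+ 2) //; field.
have [NM|MN] := leqP N M.
  rewrite ler_pdivrMr //.
  move: h; rewrite ger0_norm ?subr_ge0 ?ler_pdivlMr ?mul1r ?ler_nat // lerBrDr ler_pdivlMr // => h.
  apply: (@le_trans _ _ ((1 - c / 2) * ((c + 1) * N%:R))); last by rewrite ler_wpM2l //; lra.
  rewrite mulrA ler_peMl ?(ltW Nr) //; have : 0 <= c * (1 - c) by rewrite mulr_ge0 // ?subr_ge0 // ltW.
  by lra.
move: h; rewrite ler0_norm; last by rewrite subr_le0 ler_pdivrMr // mul1r ler_nat ltnW.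
by lra.
Qed.

(** G is a power of N so small that G^60 <= N^eps and G^100 <= K; in return N is at most a fixed
    integer power of G and of K, which puts the remaining comparisons in terms of integer powers. *)
Lemma size_facts (C eps D : R) : 0 < C -> 0 < eps -> 0 < D ->
  exists (de : R) (e B D' : nat), 0 < de /\ forall N M : nat, (1 <= N)%N ->
    N%:R `^ C^-1 <= M%:R <= N%:R `^ C -> let K := minn M N in let G : R := N%:R `^ de in
    [/\ (0 < M)%N, K%:R <= G ^+ e /\ G ^+ 100 <= K%:R, (Num.sqrt (K%:R / (maxn M N)%:R : R))^-1 <= K%:R ^+ B,
      G ^+ 60 <= N%:R `^ eps & (K%:R ^+ D')^-1 <= N%:R `^ (- D)].
Proof.
move=> C0 eps0 D0; pose ka := Num.min 1 C^-1; pose mu := Num.max 1 C.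
have ka0 : 0 < ka by rewrite lt_min ltr01 invr_gt0.
have ka1 : ka <= 1 by rewrite ge_min lexx.
have ka2 : ka <= C^-1 by rewrite ge_min lexx orbT.
have mu1 : 1 <= mu by rewrite le_max lexx.
have mu2 : C <= mu by rewrite le_max lexx orbT.
pose de := Num.min (eps / 60) (ka / 100).
have de0 : 0 < de by rewrite lt_min !divr_gt0.
have de1 : de * 60 <= eps by rewrite -ler_pdivlMr // ge_min lexx.
have de2 : de * 100 <= ka by rewrite -ler_pdivlMr // ge_min lexx orbT.
have up (x : R) : 0 <= x -> x <= (Num.truncn x).+1%:R by move=> x0; have /andP[_ /ltW] := truncn_itv x0.
exists de, (Num.truncn de^-1).+1, (Num.truncn (mu / ka)).+1, (Num.truncn (D / ka)).+1; split=> // N M N1 /andP[h1 h2] K G.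
have Nr : 1 <= N%:R :> R by rewrite ler1n.
have N0 : 0 <= N%:R :> R by [].
have pw1 (x : R) : 0 <= x -> 1 <= N%:R `^ x by move=> x0; rewrite -[X in X <= _](powRr0 N%:R) ler_powR.
have M1 : 1 <= M%:R :> R by apply: le_trans h1; apply: pw1; rewrite invr_ge0 ltW.
have M0 : (0 < M)%N by rewrite -(ler_nat R).
have Kka : N%:R `^ ka <= K%:R.
  rewrite /K; case: (leqP M N) => _; first by apply: le_trans h1; exact: ler_powR.
  by rewrite -[leRHS]powRr1 //; exact: ler_powR.
have KN : K%:R <= N%:R :> R by rewrite ler_nat geq_minr.
have K1 : 1 <= K%:R :> R by apply: le_trans Kka; apply: pw1; exact: ltW.
have GX k : G ^+ k = N%:R `^ (de * k%:R) by rewrite powRrM powR_mulrn // powR_ge0.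
have KX (x : R) : 0 <= x -> N%:R `^ x <= K%:R ^+ (Num.truncn (x / ka)).+1.
  move=> x0; apply: (@le_trans _ _ ((N%:R `^ ka) ^+ (Num.truncn (x / ka)).+1)); last first.
    by apply: lerXn2r; rewrite ?nnegrE ?powR_ge0.
  rewrite -powR_mulrn ?powR_ge0 // -powRrM; apply: ler_powR => //.
  by rewrite mulrC -ler_pdivrMr // up // divr_ge0 // ltW.
split=> //.
- split; last by rewrite GX; apply: le_trans Kka; exact: ler_powR.
  apply: (le_trans KN); rewrite GX -[leLHS]powRr1 //; apply: ler_powR => //.
  by rewrite mulrC -ler_pdivrMr // div1r up // invr_ge0 ltW.
- have L1 : 1 <= (maxn M N)%:R :> R by rewrite ler1n leq_max M0.
  have LN : (maxn M N)%:R <= N%:R `^ mu.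
    case: (leqP M N) => _; last by apply: (le_trans h2); exact: ler_powR.
    by rewrite -[leLHS]powRr1 //; exact: ler_powR.
  apply: le_trans (KX mu _); last by apply: le_trans mu1.
  apply: le_trans LN; set L := (maxn M N)%:R in L1 *.
  have K0 : 0 < K%:R :> R by apply: lt_le_trans K1.
  have L0 : 0 < L by apply: lt_le_trans L1.
  rewrite -sqrtrV ?divr_ge0 ?(ltW K0) ?(ltW L0) // invf_div.
  apply: sqr_le_le; first exact: ltW.
  rewrite sqr_sqrtr ?divr_ge0 ?(ltW K0) ?(ltW L0) // ler_pdivrMr //.
  apply: (@le_trans _ _ (L ^+ 2)); last by rewrite ler_peMr ?sqr_ge0.
  by rewrite expr2 ler_peMr // ltW.
- by rewrite GX; exact: ler_powR.
rewrite powRN lef_pV2 ?posrE ?exprn_gt0 ?powR_gt0 ?(lt_le_trans _ K1) ?(lt_le_trans _ Nr) //.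
by apply: KX; exact: ltW.
Qed.

Lemma power_eventually (de G0 : R) : 0 < de -> 0 <= G0 -> exists N0, (1 <= N0)%N /\
  forall N, (N0 <= N)%N -> G0 <= N%:R `^ de.
Proof.
move=> de0 G00; exists (Num.truncn (G0 `^ de^-1)).+1; split=> // N hN.
have /andP[_ h] := truncn_itv (powR_ge0 G0 de^-1).
have : G0 `^ de^-1 <= N%:R by apply: (le_trans (ltW h)); rewrite ler_nat.
move=> h2; have := ge0_ler_powR (ltW de0) (_ : G0 `^ de^-1 \is Num.nneg) (_ : N%:R \is Num.nneg) h2.
by rewrite !nnegrE powR_ge0 ler0n -powRrM mulVf ?gt_eqF // powRr1 //; apply.
Qed.
End Reduction.

Theorem mainTheorem4 (R : realType) (C : R) (Cp : nat -> R) (omega : R) :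
  0 < C -> 0 < omega < 1 ->
  (* bulk and upper edge: alpha in {1, ..., floor((1 - omega) K)} *)
  (forall eps D : R, 0 < eps -> 0 < D ->
   exists N0 : nat, forall N M : nat, (N0 <= N)%N ->
   N%:R `^ C^-1 <= M%:R <= N%:R `^ C ->
   forall (d : measure_display) (T : measurableType d) (P : probability T R)
     (Xre Xim : 'I_M -> 'I_N -> T -> R) (lam : T -> nat -> R),
   entry_hypotheses Cp P Xre Xim ->
   (forall x, nontrivial_spectrum (minn M N) (gram (cmatrix Xre Xim x)) (lam x)) ->
   forall alpha : nat, (1 <= alpha)%N ->
   alpha%:R <= (1 - omega) * (minn M N)%:R ->
   (P [set x | (N%:R `^ eps * (alpha%:R `^ (- (1/3)) * (minn M N)%:R `^ (- (2/3)))
               < `|lam x alpha - classical_location N (M%:R / N%:R) alpha|)%R ]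
      <= (N%:R `^ (- D))%:E)%E)
  /\
  (* lower edge, when |phi - 1| >= c: alpha in {floor(K/2), ..., K} *)
  (forall c eps D : R, 0 < c -> 0 < eps -> 0 < D ->
   exists N0 : nat, forall N M : nat, (N0 <= N)%N ->
   N%:R `^ C^-1 <= M%:R <= N%:R `^ C ->
   c <= `|M%:R / N%:R - 1| ->
   forall (d : measure_display) (T : measurableType d) (P : probability T R)
     (Xre Xim : 'I_M -> 'I_N -> T -> R) (lam : T -> nat -> R),
   entry_hypotheses Cp P Xre Xim ->
   (forall x, nontrivial_spectrum (minn M N) (gram (cmatrix Xre Xim x)) (lam x)) ->
   forall alpha : nat, (1 <= alpha)%N -> ((minn M N)./2 <= alpha)%N ->
   (alpha <= minn M N)%N ->
   (P [set x | (N%:R `^ eps * (((minn M N).+1 - alpha)%:R `^ (- (1/3))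
                              * (minn M N)%:R `^ (- (2/3)))
               < `|lam x alpha - classical_location N (M%:R / N%:R) alpha|)%R ]
      <= (N%:R `^ (- D))%:E)%E).
Proof.
move=> C0 om; split.
  move=> eps D eps0 D0; have [de [e [B [D' [de0 facts]]]]] := size_facts C0 eps0 D0.
  have [G0 [G01 UL]] := upper_law (fun k => Cp (2 * k)%N) B e D' om.
  have [N0 [N01 big]] := power_eventually de0 (le_trans ler01 G01).
  exists N0 => N M hN hM d T P Xre Xim lam eh sp alpha a1 aN.
  have N1 : (1 <= N)%N := leq_trans N01 hN.
  have [M0 [nG GN] sB Ge Kd] := facts N M N1 hM.
  have [Yre [Yim [te [w sl]]]] := tall_reduction M0 N1 eh sp.
  have h := UL _ _ _ _ _ _ _ _ _ _ te erefl (big N hN) nG GN sB _ _ _ (N%:R `^ eps * (alpha%:R `^ (- (1 / 3)) * (minn M N)%:R `^ (- (2 / 3)))) _ sl a1 aN.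
  by apply: le_trans (h _) _; rewrite ?lee_fin // ler_wpM2r // mulr_ge0 // powR_ge0.
move=> c eps D c0 eps0 D0; have [de [e [B [D' [de0 facts]]]]] := size_facts C0 eps0 D0.
(* [lower_law] is stated for a gap at most 1; a larger c is a stronger hypothesis. *)
pose c1 := Num.min c 1; have c10 : 0 < c1 by rewrite lt_min c0 ltr01.
have c11 : c1 <= 1 by rewrite ge_min lexx orbT.
have [G0 [G01 LL]] := lower_law (fun k => Cp (2 * k)%N) B e D' c10 c11.
have [N0 [N01 big]] := power_eventually de0 (le_trans ler01 G01).
exists N0 => N M hN hM hc d T P Xre Xim lam eh sp alpha a1 a2 aN.
have N1 : (1 <= N)%N := leq_trans N01 hN.
have [M0 [nG GN] sB Ge Kd] := facts N M N1 hM.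
have hc1 : c1 <= `|M%:R / N%:R - 1| by apply: le_trans hc; rewrite ge_min lexx.
have gap := aspect_gap M0 N1 c10 c11 hc1.
have [Yre [Yim [te [w sl]]]] := tall_reduction M0 N1 eh sp.
have a12 : (1 <= alpha <= minn M N)%N by rewrite a1.
have h := LL _ _ _ _ _ _ _ _ _ _ te erefl (big N hN) nG GN sB gap _ _ _ (N%:R `^ eps * (((minn M N).+1 - alpha)%:R `^ (- (1 / 3)) * (minn M N)%:R `^ (- (2 / 3)))) _ sl a12 a2.
by apply: le_trans (h _) _; rewrite ?lee_fin // ler_wpM2r // mulr_ge0 // powR_ge0.
Qed.
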